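(* There exists a constant $\epsilon>0$ such that it is NP-hard to approximate the Euclidean $k$-means problem to within a factor better than $(1+\epsilon)$.
   Context: Euclidean $k$-means problem: the input is a finite set $S$ of $n$ points in $\mathbb{R}^d$ and an integer $k$ (both $k$ and $d$ are part of the input); the goal is to choose $k$ centers $c_1,\dots,c_k\in\mathbb{R}^d$ (arbitrary points of $\mathbb{R}^d$) minimizing $\Phi=\sum_{x\in S}\min_{i}\|x-c_i\|^2$. Approximating within factor $\alpha$ means outputting a solution whose cost is at most $\alpha$ times the optimum. *)

(* Defs.v *)
From Stdlib Require Import PArith NArith.
From HB Require Import structures.
From mathcomp Require Import all_boot all_order all_algebra.
From mathcomp Require Import reals.

Set Implicit Arguments.
Unset Strict Implicit.
Unset Printing Implicit Defensive.

Import Order.TTheory GRing.Theory Num.Theory.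

Local Open Scope ring_scope.

Definition word := seq bool.

(** * Polynomial time: deterministic one-tape Turing machines *)

Variant direction := MoveLeft | Stay | MoveRight.

(* [None] is the blank and [Some (inl b)] the input/output bit [b];
   a transition to [None] halts the machine. *)
Definition symbol (A : finType) := option (bool + A).

Record turing_machine := TuringMachine {
  tm_state : finType;
  tm_aux : finType;
  tm_start : tm_state;
  tm_trans : tm_state -> symbol tm_aux ->
             option (tm_state * symbol tm_aux * direction)
}.

(* Two-way infinite tape: the cells to the left of the head (nearest first),
   the scanned cell, the cells to its right; all other cells are blank. *)
Definition tape (A : finType) : Type :=
  (seq (symbol A) * symbol A * seq (symbol A))%type.

Definition config (M : turing_machine) : Type :=
  (tm_state M * tape (tm_aux M))%type.

Definition move_head (A : finType) (d : direction) (t : tape A) : tape A :=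
  let: (l, a, r) := t in
  match d with
  | MoveLeft => (behead l, head None l, a :: r)
  | Stay => (l, a, r)
  | MoveRight => (a :: l, head None r, behead r)
  end.

Definition halted (M : turing_machine) (c : config M) : Prop :=
  let: (q, (_, a, _)) := c in tm_trans q a = None.

Definition step (M : turing_machine) (c : config M) : config M :=
  let: (q, (l, a, r)) := c in
  if tm_trans q a is Some (q', a', d) then (q', move_head d (l, a', r)) else c.

Definition initial (M : turing_machine) (w : word) : config M :=
  let s : seq (symbol (tm_aux M)) := [seq Some (inl b) | b <- w] in
  (tm_start M, ([::], head None s, behead s)).

Fixpoint leading_bits (A : finType) (s : seq (symbol A)) : word :=
  if s is Some (inl b) :: s' then b :: leading_bits s' else [::].

(* The output is the maximal block of bits starting at the head. *)
Definition output (M : turing_machine) (c : config M) : word :=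
  let: (_, (_, a, r)) := c in leading_bits (a :: r).

(* A halted configuration is a fixpoint of [step], so running for exactly
   [p.[size w]] steps tests halting within that many steps. *)
Definition poly_time (f : word -> word) : Prop :=
  exists (M : turing_machine) (p : {poly nat}), forall w : word,
    let c := iter p.[size w] (@step M) (initial M w) in
    halted c /\ output c = f w.

(** * Encodings as words; all of them are prefix-free *)

Definition enc_unary (n : nat) : word := rcons (nseq n true) false.

Definition enc_seq (T : Type) (enc : T -> word) (s : seq T) : word :=
  foldr (fun x w => true :: enc x ++ w) [:: false] s.

Definition enc_word : word -> word := enc_seq (fun b => [:: b]).

Definition enc_pair (x y : word) : word := enc_word x ++ y.

Fixpoint pos_bits (p : positive) : word :=
  match p with
  | xH => [:: true]
  | xO p' => false :: pos_bits p'
  | xI p' => true :: pos_bits p'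
  end.

Definition enc_nat (n : nat) : word :=
  enc_word (if bin_of_nat n is Npos p then pos_bits p else [::]).

Definition enc_int (z : int) : word := (z < 0) :: enc_nat `|z|%N.

Definition enc_rat (q : rat) : word := enc_int (numq q) ++ enc_int (denq q).

Definition enc_point (d : nat) (v : 'rV[rat]_d) : word :=
  enc_seq enc_rat [seq v 0 i | i <- enum 'I_d].

(** * NP and NP-hardness *)

Definition poly_time_decidable (L : word -> Prop) : Prop :=
  exists2 f : word -> word, poly_time f & forall w, L w <-> f w = [:: true].

Definition in_NP (L : word -> Prop) : Prop :=
  exists (V : word -> Prop) (p : {poly nat}), poly_time_decidable V /\
    forall x, L x <-> exists2 y : word, (size y <= p.[size x])%N & V (enc_pair x y).

Record search_problem := SearchProblem {
  valid_input : word -> Prop;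
  valid_output : word -> word -> Prop
}.

(* [f] maps [x] to an instance of the search problem, and membership of [x]
   is decided in polynomial time from [x] and any solution of [f x].
   This is only meaningful for problems all of whose instances have a solution
   of length polynomial in that of the instance. *)
Definition reduces_to (L : word -> Prop) (A : search_problem) : Prop :=
  exists (f : word -> word) (D : word -> Prop),
    [/\ poly_time f, poly_time_decidable D &
      forall x, valid_input A (f x) /\
        forall z, valid_output A (f x) z -> (L x <-> D (enc_pair x z))].

Definition NP_hard (A : search_problem) : Prop :=
  forall L : word -> Prop, in_NP L -> reduces_to L A.

(** * Euclidean k-means *)

(* The library's norm on row vectors is the sup norm. *)
Definition sqdist (R : realDomainType) (d : nat) (x y : 'rV[R]_d) : R :=
  \sum_(i < d) (x 0 i - y 0 i) ^+ 2.

(* There are [k.+1] centers, so that the minimum is over a nonempty set. *)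
Definition kmeans_cost (R : realDomainType) (d k : nat) (S : seq 'rV[R]_d)
    (c : 'I_k.+1 -> 'rV[R]_d) : R :=
  \sum_(x <- S)
    \big[Order.min/sqdist x (c ord0)]_(i < k.+1) sqdist x (c i).

Definition real_point (R : realType) (d : nat) (v : 'rV[rat]_d) : 'rV[R]_d :=
  map_mx ratr v.

(* The number of centers and the dimension are in unary: otherwise an instance
   with few points could have exponentially long solutions only. *)
Definition enc_instance (d k : nat) (S : seq 'rV[rat]_d) : word :=
  enc_unary d ++ enc_unary k ++ enc_seq (@enc_point d) S.

Definition enc_centers (d k : nat) (c : 'I_k -> 'rV[rat]_d) : word :=
  enc_seq (@enc_point d) [seq c i | i <- enum 'I_k].

(* Points of the instance and output centers are rational, as they are written
   down as words; the optimum is over all real centers. *)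
Definition kmeans_approximation (R : realType) (alpha : R) : search_problem :=
  {| valid_input w :=
       exists (d k : nat) (S : seq 'rV[rat]_d),
         uniq S /\ w = enc_instance k.+1 S;
     valid_output w z :=
       exists (d k : nat) (S : seq 'rV[rat]_d) (c : 'I_k.+1 -> 'rV[rat]_d),
         [/\ uniq S, w = enc_instance k.+1 S, z = enc_centers c &
           forall c' : 'I_k.+1 -> 'rV[R]_d,
             kmeans_cost [seq real_point R x | x <- S]
                         (fun i => real_point R (c i))
             <= alpha * kmeans_cost [seq real_point R x | x <- S] c'] |}.

(** * Injectivity of the encodings *)

Definition prefix_code (T : Type) (enc : T -> word) : Prop :=
  forall x y s t, enc x ++ s = enc y ++ t -> x = y /\ s = t.

Lemma enc_unary_prefix : prefix_code enc_unary.
Proof.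
rewrite /enc_unary; elim=> [|n IHn] [|m] s t //=; first by case.
by case=> /IHn [-> ->].
Qed.

Lemma enc_seq_prefix (T : Type) (enc : T -> word) :
  prefix_code enc -> prefix_code (enc_seq enc).
Proof.
move=> encP; elim=> [|x u IHu] [|y v] s t //=; first by case.
by case; rewrite -!catA => /encP [-> /IHu [-> ->]].
Qed.

Lemma enc_word_prefix : prefix_code enc_word.
Proof. by apply: enc_seq_prefix => x y s t /= []. Qed.

Lemma pos_bits_inj : injective pos_bits.
Proof.
have nz p : pos_bits p != [::] by case: p.
elim=> [p IHp|p IHp|] [q|q|] //=.
- by case=> /IHp ->.
- by case=> /eqP; rewrite (negPf (nz _)).
- by case=> /IHp ->.
- by case=> /esym/eqP; rewrite (negPf (nz _)).
Qed.

Lemma enc_nat_prefix : prefix_code enc_nat.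
Proof.
move=> n m s t /enc_word_prefix [eq_bits ->]; split=> //.
apply: (can_inj bin_of_natK); move: eq_bits.
have nz p : pos_bits p <> [::] by case: p.
case: (bin_of_nat n) => [|p]; case: (bin_of_nat m) => [|q] //.
- by move/esym/nz.
- by move/nz.
- by move/pos_bits_inj ->.
Qed.

Lemma enc_int_prefix : prefix_code enc_int.
Proof.
move=> x y s t [eq_sg /enc_nat_prefix [eq_abs ->]]; split=> //.
by case: x y eq_sg eq_abs => [n|n] [m|m] //= _; [move-> | case=> ->].
Qed.

Lemma enc_rat_prefix : prefix_code enc_rat.
Proof.
move=> x y s t; rewrite /enc_rat -!catA.
move=> /enc_int_prefix [eq_n /enc_int_prefix [eq_d ->]]; split=> //.
by rewrite -(divq_num_den x) -(divq_num_den y) eq_n eq_d.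
Qed.

Lemma enc_point_prefix (d : nat) : prefix_code (@enc_point d).
Proof.
move=> x y s t /(enc_seq_prefix enc_rat_prefix) [eq_xy ->]; split=> //.
apply/rowP=> i; move/eq_in_map: eq_xy; apply; exact: mem_enum.
Qed.

Lemma enc_instance_inj (d k d' k' : nat) (S : seq 'rV[rat]_d)
    (S' : seq 'rV[rat]_d') :
  enc_instance k S = enc_instance k' S' ->
  k = k' /\ existT (fun n => seq 'rV[rat]_n) d S = existT _ d' S'.
Proof.
move=> /enc_unary_prefix [eq_d]; rewrite -{d'}eq_d in S' *.
move=> /enc_unary_prefix [-> eqS]; split=> //; congr existT.
have := enc_seq_prefix (@enc_point_prefix d) (x := S) (y := S') (s := [::]) (t := [::]).
by rewrite !cats0 => /(_ eqS) [].
Qed.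

Lemma enc_centers_inj (d k : nat) (c c' : 'I_k -> 'rV[rat]_d) :
  enc_centers c = enc_centers c' -> c =1 c'.
Proof.
move=> eq_c i.
have := enc_seq_prefix (@enc_point_prefix d)
  (x := [seq c i | i <- enum 'I_k]) (y := [seq c' i | i <- enum 'I_k])
  (s := [::]) (t := [::]).
rewrite !cats0 => /(_ eq_c) [/eq_in_map eq_cc' _].
by apply: eq_cc'; exact: mem_enum.
Qed.

(* Main.v *)
(* A language in NP is reduced to a constraint graph on the cells of a computation
   tableau, placed on an explicit expander (shears acting on pairs of polynomials
   over F_2). As in Dinur's proof of the PCP theorem, each amplification step powers
   the constraints along random walks, which multiplies the fraction of violated
   constraints, and then composes with a long-code test to return to a fixed
   alphabet; logarithmically many steps give a constant gap. The conflict graph of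
   the final constraint graph has a small vertex cover exactly when the constraints
   are satisfiable. Subdividing each of its edges twice removes triangles, and the
   points e_u + e_v over the edges of the subdivision form the k-means instance: a
   cluster of t edges costs t - 1 if it is a star and more otherwise, so the optimum
   measures the vertex cover number. A solution within 1 + eps of the optimum
   therefore tells the two cases apart, by comparing its cost, computed exactly on
   binary fractions, with a threshold. *)
Require Import Defs.
From HB Require Import structures.
From mathcomp Require Import all_boot all_order all_algebra.
From mathcomp Require Import reals boolp ring lra zify.

Set Implicit Arguments.
Unset Strict Implicit.
Unset Printing Implicit Defensive.

(** Rounds of amplification can follow each other without preprocessing because the composed graph
    is itself an expander: it has the fixed alphabet [Sg1], the fixed label set [Lb1] and the
    Poincare constant [300 * 300], whatever constant its input had. Inside a cloud the edges of
    cubes expand; between clouds the long walks queried by the consistency test do. Composition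
    loses a constant factor and powering gains one proportional to [t], so a large constant [t]
    doubles the gap. The constants of the loop must be chosen before the language, whose verifier
    fixes the alphabet of the tableau; a separate first step absorbs that dependence, so that [eps]
    is universal. On the computational side everything must end as a one-tape machine. The class
    [pt] of functions between tree-encoded types is closed under composition, case distinction and
    folds; what is left to prove for a fold is a polynomial bound on its intermediate values. An
    amplification step is local: each vertex becomes constantly many, and neighbours are found along
    walks of constant length. Hence logarithmically many steps keep the table polynomial. *)

Module RegisterMachine.

(** * A register language and its compilation to Turing machines *)

Definition store := nat -> word.

Definition upd (s : store) (i : nat) (w : word) : store :=
  fun j => if j == i then w else s j.

(* [Case] and [While] pop the top of a register and branch on the result. *)
Inductive cmd :=
| Skip
| Push of nat & bool
| Seq of cmd & cmd
| Case of nat & cmd & cmd & cmd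
| While of nat & cmd & cmd.

(** The count is in sweeps of the tape rather than in machine steps: [compile_runs] charges
    [4 * B + 9] machine steps per unit, and the same count bounds the growth of the store. *)
Inductive exec : cmd -> store -> nat -> store -> Prop :=
| ESkip s : exec Skip s 1 s
| EPush s i b : exec (Push i b) s 1 (upd s i (b :: s i))
| ESeq c1 c2 s n1 s1 n2 s2 :
    exec c1 s n1 s1 -> exec c2 s1 n2 s2 -> exec (Seq c1 c2) s (n1 + n2).+1 s2
| ECaseN i cN c0 c1 s n s' :
    s i = [::] -> exec cN s n s' -> exec (Case i cN c0 c1) s n.+2 s'
| ECaseB i cN c0 c1 s b w n s' :
    s i = b :: w -> exec (if b then c1 else c0) (upd s i w) n s' ->
    exec (Case i cN c0 c1) s n.+2 s'
| EWhileN i c0 c1 s : s i = [::] -> exec (While i c0 c1) s 2 s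
| EWhileB i c0 c1 s b w n s1 m s' :
    s i = b :: w -> exec (if b then c1 else c0) (upd s i w) n s1 ->
    exec (While i c0 c1) s1 m s' -> exec (While i c0 c1) s (n + m).+3 s'.

Fixpoint regs_below (r : nat) (c : cmd) : bool :=
  match c with
  | Skip => true
  | Push i _ => i < r
  | Seq c1 c2 => regs_below r c1 && regs_below r c2
  | Case i cN c0 c1 =>
      [&& i < r, regs_below r cN, regs_below r c0 & regs_below r c1]
  | While i c0 c1 => [&& i < r, regs_below r c0 & regs_below r c1]
  end.

(** [Dol] marks the left end of the tape, [Hash] ends each register, and [Hole] holds the place of a
    removed bit until the tape has closed up. *)
Definition marks : finType := option bool.
Definition sym : finType := option (bool + marks).

Definition Bit (b : bool) : sym := Some (inl b).
Definition Hash : sym := Some (inr (Some false)).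
Definition Dol : sym := Some (inr (Some true)).
Definition Hole : sym := Some (inr None).

Definition marker (a : sym) := (a == Hash) || (a == Dol).

Record frag := Frag {
  fst_ : finType;
  fstart : fst_;
  ftrans : fst_ -> sym -> option (fst_ * sym * direction)
}.

Definition stape : Type := (seq sym * sym * seq sym)%type.

Inductive steps (Q : Type) (tr : Q -> sym -> option (Q * sym * direction)) :
  nat -> Q * stape -> Q * stape -> Prop :=
| steps0 c : steps tr 0 c c
| stepsS n q l a r q' a' d c :
    tr q a = Some (q', a', d) ->
    steps tr n (q', move_head d ((l, a', r) : tape marks)) c ->
    steps tr n.+1 (q, (l, a, r)) c.

Lemma steps_trans Q tr n m c1 c2 c3 :
  @steps Q tr n c1 c2 -> steps tr m c2 c3 -> steps tr (n + m) c1 c3.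
Proof. by elim=> // n' q l a r q' a' d c e _ IH /IH; apply: stepsS. Qed.

Lemma steps_map Q Q' tr tr' (f : Q -> Q') :
  (forall q a q1 a1 d, tr q a = Some (q1, a1, d) ->
     tr' (f q) a = Some (f q1, a1, d)) ->
  forall n c c', steps tr n c c' ->
  steps tr' n (f c.1, c.2) (f c'.1, c'.2).
Proof.
move=> H n c c'; elim=> {n c c'} [c|n q l a r q' a' d c /H e _ IH /=].
  exact: steps0.
exact: stepsS e IH.
Qed.

Definition mst (i : nat) : finType :=
  ('I_i.+2 + (bool + (option bool * sym + bool * option bool)))%type.

Section Micro.

Variables (i : nat) (kind : option bool).

Definition Find (n : nat) : mst i := inl (inord n).
Definition Run (b : bool) : mst i := inr (inl b).
Definition Shift (o : option bool) (s : sym) : mst i := inr (inr (inl (o, s))).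
Definition Home (o : option bool) : mst i := inr (inr (inr (false, o))).
Definition Done (o : option bool) : mst i := inr (inr (inr (true, o))).

(* [kind = Some b] inserts [b] on top of register [i], shifting the tape to the
   right; [kind = None] removes the top of register [i], shifting the tape to
   the left on the way back. *)
Definition mtrans (q : mst i) (a : sym) : option (mst i * sym * direction) :=
  match q with
  | inl n =>
    if nat_of_ord n is n'.+1 then
      Some (Find (if marker a then n' else n'.+1), a, MoveRight)
    else if kind is Some b then Some (Shift None a, Bit b, MoveRight)
    else match a with
         | Some (inl b) => Some (Run b, Hole, MoveRight)
         | _ => Some (Home None, a, MoveLeft)
         end
  | inr (inl b) =>
    if a is None then Some (Shift (Some b) None, None, MoveLeft)
    else Some (Run b, a, MoveRight)
  | inr (inr (inl (None, s))) =>
    if a is None then Some (Home None, s, MoveLeft)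
    else Some (Shift None a, s, MoveRight)
  | inr (inr (inl (Some b, s))) =>
    if a == Hole then Some (Home (Some b), s, MoveLeft)
    else Some (Shift (Some b) a, s, MoveLeft)
  | inr (inr (inr (false, o))) =>
    if a == Dol then Some (Done o, a, Stay) else Some (Home o, a, MoveLeft)
  | inr (inr (inr (true, o))) => None
  end.

Definition mk (l s : seq sym) : stape := (l, head None s, behead s).

Notation msteps := (steps mtrans).

Definition lay (ws : seq word) : seq sym :=
  flatten [seq rcons [seq Bit b | b <- w] Hash | w <- ws].

Lemma find_word n w l r : n < i.+1 ->
  msteps (size w).+1 (Find n.+1, mk l (rcons [seq Bit b | b <- w] Hash ++ r))
    (Find n, mk (rev (rcons [seq Bit b | b <- w] Hash) ++ l) r).
Proof.
move=> lt_n; elim: w l => [|b w IHw] l /=.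
  apply: stepsS; first by rewrite /= inordK.
  by apply: steps0.
apply: stepsS; first by rewrite /= inordK.
by rewrite /= -/(mk _ _) rev_cons (cat_rcons (Bit b)); apply: IHw.
Qed.

Lemma find_lay n ws l r : n + size ws < i.+2 ->
  msteps (size (lay ws)) (Find (n + size ws), mk l (lay ws ++ r))
    (Find n, mk (rev (lay ws) ++ l) r).
Proof.
elim: ws l => [|w ws IHws] l /=; first by rewrite addn0 => _; apply: steps0.
rewrite addnS => lt_n; rewrite /lay /= -/(lay ws) size_cat size_rcons size_map.
rewrite -catA rev_cat -catA; apply: steps_trans; first by apply: find_word; lia.
by apply: IHws; lia.
Qed.

Lemma home_steps o l0 a s : all (predC1 Dol) l0 ->
  msteps (size l0).+1
    (Home o, move_head MoveLeft ((rcons l0 Dol, a, s) : tape marks))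
    (Done o, ([::], Dol, rev l0 ++ a :: s)).
Proof.
elim: l0 a s => [|x l0 IHl] a s /=.
  move=> _; apply: stepsS; first by rewrite /= ?eqxx.
  exact: steps0.
case/andP=> xD lD; apply: stepsS; first by rewrite /= (negbTE xD).
by rewrite rev_cons cat_rcons; apply: IHl.
Qed.

Lemma head_nseq j : head None (nseq j (None : sym)) = None. Proof. by case: j. Qed.
Lemma behead_nseq j : behead (nseq j (None : sym)) = nseq j.-1 None.
Proof. by case: j. Qed.

Lemma carry_steps s c l j : all (predC1 None) s ->
  msteps (size s).+1 (Shift None c, mk l (s ++ nseq j None))
   (Home None, move_head MoveLeft
     ((rev (belast c s) ++ l, last c s, nseq j.-1 None) : tape marks)).
Proof.
elim: s c l => [|x s IHs] c l /=.
  move=> _; rewrite /mk head_nseq behead_nseq.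
  by apply: stepsS => //; apply: steps0.
case/andP=> xN sN; rewrite rev_cons cat_rcons.
apply: (@stepsS _ _ _ _ _ _ _ (Shift None x) c MoveRight).
  by case: x xN.
exact: IHs.
Qed.

Lemma run_steps b s l j : all (predC1 None) s ->
  msteps (size s).+1 (Run b, mk l (s ++ nseq j None))
   (Shift (Some b) None, move_head MoveLeft
     ((rev s ++ l, None, nseq j.-1 None) : tape marks)).
Proof.
elim: s l => [|x s IHs] l /=.
  move=> _; rewrite /mk head_nseq behead_nseq.
  by apply: stepsS => //; apply: steps0.
case/andP=> xN sN; rewrite rev_cons cat_rcons.
apply: (@stepsS _ _ _ _ _ _ _ (Run b) x MoveRight).
  by case: x xN.
exact: IHs.
Qed.

Lemma shift_steps b sl c l a r : all (predC1 Hole) sl ->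
  msteps (size sl).+1
   (Shift (Some b) c, move_head MoveLeft ((sl ++ Hole :: l, a, r) : tape marks))
   (Home (Some b), move_head MoveLeft
     ((l, last c sl, rev (belast c sl) ++ a :: r) : tape marks)).
Proof.
elim: sl c a r => [|x sl IHs] c a r /=.
  move=> _; apply: stepsS; first by rewrite /= ?eqxx.
  exact: steps0.
case/andP=> xH sH; rewrite rev_cons cat_rcons.
apply: stepsS; first by rewrite /= (negbTE xH).
exact: IHs.
Qed.

End Micro.

Lemma lay_all (P : pred sym) ws : (forall b, P (Bit b)) -> P Hash ->
  all P (lay ws).
Proof.
move=> PB PH; apply/allP => x /flattenP[y /mapP[w _ ->]].
by rewrite mem_rcons inE => /orP[/eqP-> // | /mapP[b _ ->]].
Qed.

Section Tapes.

Variable r : nat.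

Definition slay (s : store) := lay (mkseq s r).

Definition lsize (s : store) : nat := size (slay s).

(** The number [j] of explicit trailing blanks belongs to the representation of the tape, not to the
    store. It changes during a run, hence the quantification over it in all the specifications. *)
Definition home (s : store) (j : nat) : stape :=
  ([::], Dol, slay s ++ nseq j None).

Lemma slay_split s i : i < r ->
  slay s = lay (mkseq s i) ++ [seq Bit b | b <- s i] ++
           Hash :: lay [seq s j | j <- iota i.+1 (r - i.+1)].
Proof.
move=> lt_i; rewrite /slay /mkseq -{1}(subnKC (ltnW lt_i)) iotaD map_cat /lay.
have ->: r - i = (r - i.+1).+1 by lia.
by rewrite map_cat flatten_cat /= add0n cat_rcons.
Qed.

Lemma slay_upd s i w : i < r ->
  slay (upd s i w) = lay (mkseq s i) ++ [seq Bit b | b <- w] ++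
           Hash :: lay [seq s j | j <- iota i.+1 (r - i.+1)].
Proof.
move=> lt_i; rewrite (slay_split _ lt_i) {2}/upd eqxx; congr (_ ++ (_ ++ _ :: _)).
  congr lay; apply/eq_in_map => j; rewrite mem_iota /upd.
  by case: eqP => // ->; lia.
congr lay; apply/eq_in_map => j; rewrite mem_iota /upd.
by case: eqP => // ->; lia.
Qed.

(** The left end [Dol] counts as a marker too, so [i.+1] markers precede register [i]. *)
Lemma find_reg kind s i t : i < r ->
  steps (@mtrans i kind) (size (lay (mkseq s i))).+1
    (Find i i.+1, ([::], Dol, lay (mkseq s i) ++ t))
    (Find i 0, mk (rev (lay (mkseq s i)) ++ [:: Dol]) t).
Proof.
move=> lt_i; apply: stepsS; first by rewrite /= inordK.
have := @find_lay i kind 0 (mkseq s i) [:: Dol] t.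
by rewrite size_mkseq; apply.
Qed.

Lemma push_steps s i b j : i < r ->
  exists j' m, steps (@mtrans i (Some b)) m (Find i i.+1, home s j)
                 (Done i None, home (upd s i (b :: s i)) j') /\
               m <= 4 * lsize s + 8.
Proof.
move=> lt_i; exists j.-1.
set pre := lay (mkseq s i).
set post := [seq Bit b | b <- s i] ++
           Hash :: lay [seq s j | j <- iota i.+1 (r - i.+1)].
have def_s : slay s = pre ++ post by exact: slay_split.
have [c [post' def_post]] : exists c post', post = c :: post'.
  by rewrite /post; case: (s i) => [|c w] /=; do 2 eexists.
have postN : all (predC1 None) post.
  by rewrite all_cat /= lay_all // all_map (eq_all (a2 := predT)) ?all_predT.
eexists; split.
  rewrite /home def_s -catA; apply: steps_trans; first exact: find_reg.
  apply: (steps_trans (n := 1)).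
    rewrite def_post; apply: stepsS; first by rewrite /= inordK.
    exact: steps0.
  rewrite /= -/(mk _ _); apply: steps_trans.
    by apply: carry_steps; move: postN; rewrite def_post => /andP[].
  set L := (X in (X, _, _)).
  have ->: L = rcons (rev (belast c post') ++ Bit b :: rev pre) Dol.
    by rewrite /L rcons_cat -cats1 /=.
  set F := Done _ _.
  have ->: slay (upd s i (b :: s i)) = pre ++ Bit b :: post.
    by rewrite slay_upd.
  have := @home_steps i (Some b) None (rev (belast c post') ++ Bit b :: rev pre)
    (last c post') (nseq j.-1 None).
  have -> : rev (rev (belast c post') ++ Bit b :: rev pre) ++
     last c post' :: nseq j.-1 None = (pre ++ Bit b :: post) ++ nseq j.-1 None.
    rewrite rev_cat rev_cons !revK cat_rcons -!catA /=; congr (_ ++ _ :: _).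
    by rewrite def_post -cat_rcons -lastI.
  apply; rewrite all_cat /= !all_rev lay_all // andbT.
  apply/allP => x /mem_belast; rewrite -def_post mem_cat inE.
  case/or3P=> [/mapP[b' _ ->] // | /eqP-> // |].
  by move: x; apply/allP; apply: lay_all.
rewrite /lsize def_s def_post !size_cat /= !size_rev size_belast -/pre; lia.
Qed.

Lemma popN_steps s i j : i < r -> s i = [::] ->
  exists m, steps (@mtrans i None) m (Find i i.+1, home s j)
                 (Done i None, home s j) /\ m <= 4 * lsize s + 8.
Proof.
move=> lt_i si0.
set pre := lay (mkseq s i); set post := lay [seq s j | j <- iota i.+1 (r - i.+1)].
have def_s : slay s = pre ++ Hash :: post by rewrite (slay_split _ lt_i) si0.
eexists; split.
  rewrite /home def_s -catA; apply: steps_trans; first exact: find_reg.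
  apply: (steps_trans (n := 1)).
    apply: stepsS; first by rewrite /= inordK.
    exact: steps0.
  rewrite cats1 [X in (X, _)]/(Home i None).
  have := @home_steps i None None (rev pre) Hash (post ++ nseq j None).
  by rewrite revK; apply; rewrite all_rev lay_all.
rewrite /lsize def_s size_cat /= size_rev -/pre; lia.
Qed.

Lemma popB_steps s i j b w : i < r -> s i = b :: w ->
  exists j' m, steps (@mtrans i None) m (Find i i.+1, home s j)
                 (Done i (Some b), home (upd s i w) j') /\
               m <= 4 * lsize s + 8.
Proof.
move=> lt_i si.
set pre := lay (mkseq s i).
set post := [seq Bit b | b <- w] ++
           Hash :: lay [seq s j | j <- iota i.+1 (r - i.+1)].
have def_s : slay s = pre ++ Bit b :: post by rewrite (slay_split _ lt_i) si.
have postP (P : pred sym) : (forall b, P (Bit b)) -> P Hash -> all P post.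
  move=> PB PH; rewrite all_cat /= lay_all // PH !andbT all_map.
  by apply/allP => x _; apply: PB.
(* One new blank is the cell where the run to the right turned back, the other is the cell vacated
   by the shift. *)
exists j.-1.+2; eexists; split.
  rewrite /home def_s -catA; apply: steps_trans; first exact: find_reg.
  apply: (steps_trans (n := 1)).
    apply: stepsS; first by rewrite /= inordK.
    exact: steps0.
  rewrite /= -/(mk _ _) -/(Run i b); apply: steps_trans.
    by apply: run_steps; apply: postP.
  apply: steps_trans.
    by apply: shift_steps; rewrite all_rev; apply: postP.
  rewrite slay_upd // -/pre -/post cats1.
  set X := last None _; set Y := rev (belast _ _).
  have XY : X :: Y = rcons post None.
    by rewrite /X /Y -rev_rcons -lastI rev_cons revK.
  have := @home_steps i None (Some b) (rev pre) X (Y ++ None :: nseq j.-1 None).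
  rewrite revK -cat_cons XY cat_rcons -[(pre ++ post) ++ _]catA.
  by apply; rewrite all_rev lay_all.
rewrite /lsize def_s size_cat /= !size_rev -/pre; lia.
Qed.

End Tapes.

Definition micro_frag (i : nat) (kind : option bool) : frag :=
  {| fst_ := mst i; fstart := Find i i.+1; ftrans := @mtrans i kind |}.

Definition lift_trans (Q Q' : Type) (f : Q -> Q')
    (x : option (Q * sym * direction)) : option (Q' * sym * direction) :=
  omap (fun y : Q * sym * direction => (f y.1.1, y.1.2, y.2)) x.

Definition seq_frag (F G : frag) : frag :=
  @Frag (fst_ F + fst_ G)%type (inl (fstart F)) (fun q a =>
    match q with
    | inl q => if ftrans q a is Some x then lift_trans inl (Some x)
               else Some (inr (fstart G), a, Stay)
    | inr q => lift_trans inr (ftrans q a)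
    end).

Definition case_frag (i : nat) (FN F0 F1 : frag) : frag :=
  @Frag (mst i + (fst_ FN + (fst_ F0 + fst_ F1)))%type (inl (Find i i.+1))
   (fun q a =>
    match q with
    | inl q => if mtrans None q a is Some x then lift_trans inl (Some x) else
               match q with
               | inr (inr (inr (_, Some true))) =>
                 Some (inr (inr (inr (fstart F1))), a, Stay)
               | inr (inr (inr (_, Some false))) =>
                 Some (inr (inr (inl (fstart F0))), a, Stay)
               | _ => Some (inr (inl (fstart FN)), a, Stay)
               end
    | inr (inl q) => lift_trans (inr \o inl) (ftrans q a)
    | inr (inr (inl q)) => lift_trans (inr \o inr \o inl) (ftrans q a)
    | inr (inr (inr q)) => lift_trans (inr \o inr \o inr) (ftrans q a)
    end).

Definition while_frag (i : nat) (F0 F1 : frag) : frag :=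
  @Frag (mst i + (fst_ F0 + fst_ F1))%type (inl (Find i i.+1)) (fun q a =>
    match q with
    | inl q => if mtrans None q a is Some x then lift_trans inl (Some x) else
               match q with
               | inr (inr (inr (_, Some true))) =>
                 Some (inr (inr (fstart F1)), a, Stay)
               | inr (inr (inr (_, Some false))) =>
                 Some (inr (inl (fstart F0)), a, Stay)
               | _ => None
               end
    | inr (inl q) => if ftrans q a is Some x then lift_trans (inr \o inl) (Some x)
               else Some (inl (Find i i.+1), a, Stay)
    | inr (inr q) => if ftrans q a is Some x then lift_trans (inr \o inr) (Some x)
               else Some (inl (Find i i.+1), a, Stay)
    end).

Fixpoint compile (c : cmd) : frag :=
  match c with
  | Skip => @Frag unit tt (fun _ _ => None)
  | Push i b => micro_frag i (Some b)
  | Seq c1 c2 => seq_frag (compile c1) (compile c2)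
  | Case i cN c0 c1 => case_frag i (compile cN) (compile c0) (compile c1)
  | While i c0 c1 => while_frag i (compile c0) (compile c1)
  end.

Lemma steps_stay Q tr q l a r q' :
  tr q a = Some (q', a, Stay) -> @steps Q tr 1 (q, (l, a, r)) (q', (l, a, r)).
Proof. by move=> e; apply: stepsS e _; apply: steps0. Qed.

(** A fragment starts and halts on [Dol]; this is what lets fragments be glued by a single
    stationary move. *)
Definition runs (r : nat) (F : frag) (s : store) (n : nat) (s' : store) :=
  forall j, exists j' q m,
    [/\ steps (@ftrans F) m (fstart F, home r s j) (q, home r s' j'),
        ftrans q Dol = None & m <= n].

Lemma size_slay_upd r s i w : i < r ->
  lsize r (upd s i w) + size (s i) = lsize r s + size w.
Proof.
move=> lt_i; rewrite /lsize slay_upd // (slay_split s lt_i) !size_cat /= !size_map; lia.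
Qed.

(** The tape bound [B] is fixed for the whole run, so that every elementary operation costs at most
    one sweep of a tape of that length and the costs of subprograms simply add up. *)
Lemma compile_runs r c s n s' : exec c s n s' -> regs_below r c ->
  lsize r s' <= lsize r s + n /\
  forall B, lsize r s + n <= B ->
  runs r (compile c) s (n * (4 * B + 9)) s'.
Proof.
elim=> {c s n s'}.
- move=> s _; split=> [|B _ j]; first by lia.
  by exists j, tt, 0; split=> //; apply: steps0.
- move=> s i b /= lt_i; split; first by have := size_slay_upd s (b :: s i) lt_i => /=; lia.
  move=> B leB j; have [j' [m [st le_m]]] := push_steps s b j lt_i.
  by exists j', (Done i None), m; split; [exact: st| |lia].
- move=> c1 c2 s n1 s1 n2 s2 _ IH1 _ IH2 /= /andP[r1 r2].
  have [sz1 {}IH1] := IH1 r1; have [sz2 {}IH2] := IH2 r2.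
  split; first by lia.
  move=> B leB j.
  have [|j1 [q1 [m1 [st1 h1 le1]]]] := IH1 B _ j; first by lia.
  have [|j2 [q2 [m2 [st2 h2 le2]]]] := IH2 B _ j1; first by lia.
  exists j2, (inr q2), (m1 + (1 + m2)); split; last by nia.
    apply: steps_trans.
      apply: (@steps_map _ _ _ (@ftrans (seq_frag _ _)) inl) st1.
      by move=> q a q' a' d /= ->.
    apply: steps_trans; first by apply: steps_stay; rewrite /= h1.
    apply: (@steps_map _ _ _ (@ftrans (seq_frag _ _)) inr) st2.
    by move=> q a q' a' d /= ->.
  by rewrite /= h2.
- move=> i cN c0 c1 s n s' si _ IH /= /and4P[lt_i rN _ _].
  have [sz {}IH] := IH rN; split; first by lia.
  move=> B leB j.
  have [m1 [st1 le1]] := popN_steps j lt_i si.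
  have [|j2 [q2 [m2 [st2 h2 le2]]]] := IH B _ j; first by lia.
  exists j2, (inr (inl q2)), (m1 + (1 + m2)); split; last by nia.
    apply: steps_trans.
      apply: (@steps_map _ _ _ (@ftrans (case_frag i _ _ _)) inl) st1.
      by move=> q a q' a' d /= ->.
    apply: steps_trans; first by apply: steps_stay.
    apply: (@steps_map _ _ _ (@ftrans (case_frag i _ _ _)) (inr \o inl)) st2.
    by move=> q a q' a' d /= ->.
  by rewrite /= h2.
- move=> i cN c0 c1 s b w n s' si _ IH /= /and4P[lt_i _ r0 r1].
  have [sz {}IH] := IH (if b as b0 return regs_below r (if b0 then c1 else c0) then r1 else r0).
  have szu := size_slay_upd s w lt_i; rewrite si /= in szu.
  split; first by lia.
  move=> B leB j.
  have [j1 [m1 [st1 le1]]] := popB_steps j lt_i si.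
  have [|j2 [q2 [m2 [st2 h2 le2]]]] := IH B _ j1; first by lia.
  case: b {si IH} st1 q2 st2 h2 => st1 q2 st2 h2.
    exists j2, (inr (inr (inr q2))), (m1 + (1 + m2)); split; last by nia.
      apply: steps_trans.
        apply: (@steps_map _ _ _ (@ftrans (case_frag i _ _ _)) inl) st1.
        by move=> q a q' a' d /= ->.
      apply: steps_trans; first by apply: steps_stay.
      apply: (@steps_map _ _ _ (@ftrans (case_frag i _ _ _)) (inr \o inr \o inr)) st2.
      by move=> q a q' a' d /= ->.
    by rewrite /= h2.
  exists j2, (inr (inr (inl q2))), (m1 + (1 + m2)); split; last by nia.
    apply: steps_trans.
      apply: (@steps_map _ _ _ (@ftrans (case_frag i _ _ _)) inl) st1.
      by move=> q a q' a' d /= ->.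
    apply: steps_trans; first by apply: steps_stay.
    apply: (@steps_map _ _ _ (@ftrans (case_frag i _ _ _)) (inr \o inr \o inl)) st2.
    by move=> q a q' a' d /= ->.
  by rewrite /= h2.
- move=> i c0 c1 s si /= /and3P[lt_i _ _]; split; first by lia.
  move=> B leB j; have [m [st le_m]] := popN_steps j lt_i si.
  exists j, (inl (Done i None)), m; split=> //; last by lia.
  apply: (@steps_map _ _ _ (@ftrans (while_frag i _ _)) inl) st.
  by move=> q a q' a' d /= ->.
- move=> i c0 c1 s b w n s1 m s' si _ IH1 _ IH2 /= rr.
  have [sz2 {}IH2] := IH2 rr; case/and3P: rr => lt_i r0 r1.
  have [sz1 {}IH1] := IH1 (if b as b0 return regs_below r (if b0 then c1 else c0) then r1 else r0).
  have szu := size_slay_upd s w lt_i; rewrite si /= in szu.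
  split; first by lia.
  move=> B leB j.
  have [j1 [m1 [st1 le1]]] := popB_steps j lt_i si.
  have [|j2 [q2 [m2 [st2 h2 le2]]]] := IH1 B _ j1; first by lia.
  have [|j3 [q3 [m3 [st3 h3 le3]]]] := IH2 B _ j2; first by lia.
  exists j3, q3, (m1 + (1 + (m2 + (1 + m3)))); split=> //; last by nia.
  set W := while_frag i (compile c0) (compile c1).
  apply: steps_trans.
    apply: (@steps_map _ _ _ (@ftrans W) inl) st1.
    by move=> q a q' a' d /= ->.
  case: b {si IH1 st1} q2 st2 h2 => q2 st2 h2.
    apply: steps_trans; first exact: steps_stay.
    apply: steps_trans.
      apply: (@steps_map _ _ _ (@ftrans W) (inr \o inr)) st2.
      by move=> q a q' a' d /= ->.
    by apply: steps_trans st3; apply: steps_stay; rewrite /= h2.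
  apply: steps_trans; first exact: steps_stay.
  apply: steps_trans.
    apply: (@steps_map _ _ _ (@ftrans W) (inr \o inl)) st2.
    by move=> q a q' a' d /= ->.
  by apply: steps_trans st3; apply: steps_stay; rewrite /= h2.
Qed.

(** * Reading the input and presenting the output *)

Section Wrap.

Variable r : nat.

(** Turns the raw input into a home tape: [Dol] is written to its left and [r.+1] marks [Hash] to
    its right, so that the input is register 0 and the other registers are empty. *)
Definition prelude : frag :=
  @Frag (mst 0 + ('I_3 + 'I_r.+2))%type (inr (inl (inord 0))) (fun q a =>
    match q with
    | inl q => lift_trans inl (mtrans None q a)
    | inr (inl q) =>
      match nat_of_ord q with
      | 0 => Some (inr (inl (inord 1)), a, MoveLeft)
      | 1 => Some (inr (inl (inord 2)), Dol, MoveRight)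
      | _ => if a is None then Some (inr (inr (inord r)), Hash, MoveRight)
             else Some (inr (inl (inord 2)), a, MoveRight)
      end
    | inr (inr q) =>
      if nat_of_ord q is n.+1 then Some (inr (inr (inord n)), Hash, MoveRight)
      else Some (inl (Home 0 None), a, MoveLeft)
    end).

Lemma prelude_end w l j :
  steps (@ftrans prelude) (size w).+1
    (inr (inl (inord 2)), mk l ([seq Bit b | b <- w] ++ nseq j None))
    (inr (inr (inord r)), mk (Hash :: rev [seq Bit b | b <- w] ++ l) (nseq j.-1 None)).
Proof.
elim: w l => [|b w IHw] l /=.
  rewrite /mk head_nseq behead_nseq; apply: stepsS; first by rewrite /= inordK.
  exact: steps0.
apply: stepsS; first by rewrite /= inordK.
by rewrite rev_cons (cat_rcons (Bit b)); apply: IHw.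
Qed.

Lemma prelude_hash n l j : n < r.+2 ->
  steps (@ftrans prelude) n.+1 (inr (inr (inord n)), mk l (nseq j None))
    (inl (Home 0 None), move_head MoveLeft
       ((nseq n Hash ++ l, None, nseq (j - n.+1) None) : tape marks)).
Proof.
elim: n l j => [|n IHn] l j lt_n.
  rewrite /mk head_nseq behead_nseq -subn1.
  by apply: stepsS; [rewrite /= inordK | exact: steps0].
rewrite /mk head_nseq behead_nseq; apply: stepsS; first by rewrite /= inordK.
rewrite [move_head _ _]/(mk (Hash :: l) (nseq j.-1 None)).
have := IHn (Hash :: l) j.-1 (ltnW lt_n).
have ->: j.-1 - n.+1 = j - n.+2 by lia.
have -> // : nseq n Hash ++ Hash :: l = nseq n.+1 Hash ++ l.
by rewrite /=; elim: (n) => //= k ->.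
Qed.

Definition input_store (w : word) : store := fun i => if i == 0 then w else [::].

Lemma slay_input w : slay r.+1 (input_store w) =
  [seq Bit b | b <- w] ++ nseq r.+1 Hash.
Proof.
rewrite (@slay_split _ _ 0) //= subn1 /=; congr (_ ++ _ :: _).
by elim: (r) (0) => //= n IHn i; rewrite -[in RHS](IHn i.+1).
Qed.

(** Steps off [Dol], so that the output block starts at register 0; the mark [Hash] after that
    register ends the block. *)
Definition finish : frag :=
  @Frag bool false (fun q a => if q then None else Some (true, a, MoveRight)).

Definition machine (c : cmd) : turing_machine :=
  let F := seq_frag prelude (seq_frag (compile c) finish) in
  @TuringMachine (fst_ F) marks (fstart F) (@ftrans F).

Lemma machine_runs c w n s' : exec c (input_store w) n s' ->
  regs_below r.+1 c ->
  exists j m, steps (@ftrans (seq_frag prelude (seq_frag (compile c) finish)))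
      m (fstart (seq_frag prelude (seq_frag (compile c) finish)),
         mk [::] [seq Bit b | b <- w])
      (inr (inr true), mk [:: Dol] (slay r.+1 s' ++ nseq j None)) /\
      m <= n * (4 * (size w + r.+1 + n) + 9) + 2 * size w + 2 * r + 20.
Proof.
move=> ex rb; have [_ /(_ (size w + r.+1 + n))] := compile_runs ex rb.
rewrite /lsize slay_input size_cat size_map size_nseq leqnn => /(_ isT) run.
set G := seq_frag (compile c) finish; set F := seq_frag prelude G.
have st1 : steps (@ftrans prelude) (2 * size w + 2 * r + 6)
   (fstart prelude, mk [::] [seq Bit b | b <- w])
   (inl (Done 0 None), home r.+1 (input_store w) 1).
  have ->: 2 * size w + 2 * r + 6 =
           1 + (1 + ((size w).+1 + (r.+1 + (size w + r.+1).+1))) by lia.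
  apply: steps_trans.
    by apply: stepsS; [rewrite /= inordK | exact: steps0].
  apply: steps_trans.
    by apply: stepsS; [rewrite /= inordK | exact: steps0].
  set s := (X in (_, X)).
  have ->: s = mk [:: Dol] ([seq Bit b | b <- w] ++ nseq (w == [::]) None).
    by rewrite /s; case: (w) => //= b v; rewrite cats0.
  apply: steps_trans; first exact: prelude_end.
  apply: steps_trans; first exact: prelude_hash.
  have -> : (w == [::]).-1 - r.+1 = 0 by case: (w == _).
  have /= := @home_steps 0 None None (nseq r Hash ++ Hash :: rev [seq Bit b | b <- w]) None [::].
  rewrite rcons_cat /= -cats1 size_cat /= size_nseq size_rev size_map addnS.
  rewrite all_cat /= all_nseq orbT all_rev => /(_ _)/wrap[].
    by rewrite all_map; apply/allP.
  move=> st; rewrite addnC in st; rewrite addnS.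
  have := @steps_map _ _ _ (@ftrans prelude) inl _ _ _ _ st => /=.
  rewrite /home slay_input rev_cat rev_cons revK rev_nseq cat_rcons -catA /=.
  apply; by move=> p a p' a' d /= ->.
have [j [q [m [st2 h2 le2]]]] := run 1.
exists j; eexists; split.
  apply: steps_trans.
    by apply: (@steps_map _ _ _ (@ftrans F) inl) st1 => p a p' a' d /= ->.
  apply: steps_trans; first exact: steps_stay.
  apply: (steps_trans (n := m)).
    apply: (@steps_map _ _ _ (@ftrans F) (inr \o inl)) st2 => p a p' a' d /= ->.
    by [].
  apply: (steps_trans (n := 1)); first by apply: steps_stay; rewrite /= h2.
  apply: stepsS; first by [].
  exact: steps0.
lia.
Qed.

End Wrap.

Lemma leq_expl m n e : m <= n -> m ^ e <= n ^ e.
Proof. by case: e => // e; rewrite leq_exp2r. Qed.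

Lemma horner_bound C e : exists p : {poly nat}, forall n, p.[n]%R = (n + C) ^ e.
Proof.
exists (('X + C%:P) ^+ e)%R => n.
by elim: e => [|e IHe]; rewrite ?expr0 ?hornerE // exprS hornerM IHe !hornerE expnS.
Qed.

Lemma leading_bits_word w (s : seq sym) :
  leading_bits ([seq Bit b | b <- w] ++ Hash :: s) = w.
Proof. by elim: w => //= b w ->. Qed.

Lemma machine_iter r c n c1 c2 : 
  steps (@tm_trans (machine r c)) n c1 c2 ->
  iter n (@step (machine r c)) c1 = c2.
Proof.
elim=> // {}n q l a s q' a' d c' e _ <-.
by rewrite iterSr; congr (iter _ _ _); rewrite /step e.
Qed.

(** In [n] units of cost the tape grows by at most [n] cells and each unit is a sweep, so the
    machine time is quadratic in [n]. The exponent [2 * e + 3] and the shift [r + 30] leave room for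
    the lower terms. *)
Theorem poly_time_exec (f : word -> word) (c : cmd) (r e : nat) :
  regs_below r.+1 c ->
  (forall w, exists n s', [/\ exec c (input_store w) n s', s' 0 = f w &
     n <= (size w + 2) ^ e]) ->
  poly_time f.
Proof.
move=> rb ex; exists (machine r c).
have [p def_p] := horner_bound (r + 30) (2 * e + 3).
exists p => w; have [n [s' [exw s'0 le_n]]] := ex w.
have [j [m [st le_m]]] := machine_runs exw rb.
rewrite def_p -s'0; set N := _ ^ _.
have le_mN : m <= N.
  apply: leq_trans le_m _; rewrite /N.
  set y := size w + (r + 30); have y30 : 30 <= y by rewrite /y; lia.
  have le_ny : n <= y ^ e by apply: leq_trans le_n _; apply: leq_expl; rewrite /y; lia.
  have ye : 0 < y ^ e by rewrite expn_gt0; lia.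
  have ->: 2 * e + 3 = e + e + 1 + 1 + 1 by lia.
  rewrite !expnD !expn1; set Y := y ^ e in le_ny ye *.
  have: n * (4 * (size w + r.+1 + n) + 9) <= Y * (4 * (y + Y) + 9).
    by apply: leq_mul => //; rewrite /y; lia.
  have : 2 * size w + 2 * r + 20 <= 2 * y by rewrite /y; lia.
  have ny : 0 < y by lia.
  have h1 : Y * y <= Y * Y * y by rewrite leq_mul // leq_pmulr.
  have h2 : Y * Y <= Y * Y * y by rewrite leq_pmulr.
  have h3 : Y <= Y * Y by rewrite leq_pmulr.
  have h4 : y <= Y * Y * y by rewrite leq_pmull // muln_gt0 ye.
  have h5 : Y * Y * y * 30 <= Y * Y * y * (y * y) by rewrite leq_mul //; nia.
  rewrite -[_ * y * y]mulnA; lia.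
have -> : iter N (step (M:=machine r c)) (initial (machine r c) w) =
  (inr (inr true), mk [:: Dol] (slay r.+1 s' ++ nseq j None)).
  rewrite -(subnK le_mN) iterD.
  have -> : initial (machine r c) w =
    (fstart (seq_frag (prelude r) (seq_frag (compile c) finish)),
     mk [::] [seq Bit b | b <- w]) by [].
  rewrite (@machine_iter r c _ _ _ st).
  (* The machine has halted after [m] steps, so the remaining ones change nothing. *)
  by elim: (N - m) => //= k ->.
split; first by [].
rewrite (@slay_split _ _ 0) //= -catA cat_cons.
case: (s' 0) => //= b v; by rewrite leading_bits_word.
Qed.

End RegisterMachine.
Import RegisterMachine.

Module TreeFunctions.

(** * Polynomial-time functions on binary trees *)

Inductive tree := Lf | Nd of tree & tree.

(** Preorder traversal. It is prefix-free, so the code of a node needs no separator between its two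
    subtrees. *)
Fixpoint code (t : tree) : word :=
  if t is Nd l r then true :: code l ++ code r else [:: false].

Definition tsize (t : tree) : nat := size (code t).

Lemma tsize_Nd l r : tsize (Nd l r) = (tsize l + tsize r).+1.
Proof. by rewrite /tsize /= size_cat. Qed.

Lemma tsize_gt0 t : 0 < tsize t. Proof. by case: t. Qed.

Class Enc (T : Type) := enc : T -> tree.

#[export] Instance Enc_tree : Enc tree := id.
#[export] Instance Enc_prod {X Y : Type} {eX : Enc X} {eY : Enc Y} : Enc (X * Y) :=
  fun p => Nd (enc p.1) (enc p.2).

Definition esize {X : Type} {eX : Enc X} (x : X) : nat := tsize (enc x).

Definition runsto c s s' N := exists2 n, exec c s n s' & n <= N.

Lemma exec_size c s n s' i : exec c s n s' -> size (s' i) <= size (s i) + n.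
Proof.
elim=> {c s n s'}; rewrite /upd.
- by move=> s; lia.
- by move=> s j b; case: eqP => [->|] /=; lia.
- by move=> *; lia.
- by move=> *; lia.
- move=> j cN c0 c1 s b w n s' sj _; case: eqP => [->|]; rewrite ?sj /=; lia.
- by move=> *; lia.
- move=> j c0 c1 s b w n s1 m s' sj _; case: eqP => [->|]; rewrite ?sj /=; lia.
Qed.

Lemma runsto_seq c1 c2 s s1 s2 n1 n2 : runsto c1 s s1 n1 -> runsto c2 s1 s2 n2 ->
  runsto (Seq c1 c2) s s2 (n1 + n2).+1.
Proof.
case=> m1 e1 l1 [m2 e2 l2]; exists (m1 + m2).+1; [exact: ESeq e1 e2 | lia].
Qed.

Lemma runsto_le c s s' n m : runsto c s s' n -> n <= m -> runsto c s s' m.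
Proof. by case=> k ex le1 le2; exists k => //; lia. Qed.

Ltac st_eq := apply: funext => ?; rewrite /upd;
  do ?[case: eqP => ?]; subst => //; try lia.

Definition mv i j := While i (Push j false) (Push j true).

Lemma mv_runs i j s : i != j ->
  runsto (mv i j) s (upd (upd s i [::]) j (rev (s i) ++ s j)) (4 * size (s i) + 2).
Proof.
move=> ne; move Ew: (s i) => w; elim: w s Ew => [|b w IHw] s si.
  exists 2 => //.
  have -> : upd (upd s i [::]) j (rev [::] ++ s j) = s by st_eq.
  exact: EWhileN.
pose s1 := upd (upd s i w) j (b :: s j).
have [|n ex le_n] := IHw s1; first by rewrite /s1 /upd (negPf ne) eqxx.
exists (1 + n).+3; last by rewrite /=; lia.
apply: (EWhileB si (s1 := s1)).
  have -> : s1 = upd (upd s i w) j (b :: upd s i w j).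
    by rewrite /s1 /upd [j == i]eq_sym (negPf ne).
  by case: b {si s1 ex}; apply: EPush.
have -> // : upd (upd s i [::]) j (rev (b :: w) ++ s j) =
             upd (upd s1 i [::]) j (rev w ++ s1 j).
rewrite /s1 /upd eqxx rev_cons cat_rcons.
by apply: funext => k; case: eqP => // _; case: eqP.
Qed.

Definition clear i := While i Skip Skip.

Lemma clear_runs i s : runsto (clear i) s (upd s i [::]) (4 * size (s i) + 2).
Proof.
move Ew: (s i) => w; elim: w s Ew => [|b w IHw] s si.
  exists 2 => //; have -> : upd s i [::] = s by st_eq.
  exact: EWhileN.
have [|n ex le_n] := IHw (upd s i w); first by rewrite /upd eqxx.
exists (1 + n).+3; last by rewrite /=; lia.
apply: (EWhileB si); first by case: b {si}; apply: ESkip.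
by have -> : upd s i [::] = upd (upd s i w) i [::] by st_eq.
Qed.

Definition cp k i j :=
  While k (Seq (Push i false) (Push j false)) (Seq (Push i true) (Push j true)).

Lemma cp_runs k i j s : [&& k != i, k != j & i != j] ->
  runsto (cp k i j) s
    (upd (upd (upd s k [::]) i (rev (s k) ++ s i)) j (rev (s k) ++ s j))
    (6 * size (s k) + 2).
Proof.
case/and3P=> nki nkj nij.
move Ew: (s k) => w; elim: w s Ew => [|b w IHw] s sk.
  exists 2 => //.
  have -> : upd (upd (upd s k [::]) i (rev [::] ++ s i)) j (rev [::] ++ s j) = s.
    by st_eq.
  exact: EWhileN.
pose s1 := upd (upd (upd s k w) i (b :: s i)) j (b :: s j).
have [|n ex le_n] := IHw s1.
  by rewrite /s1 /upd (negPf nki) (negPf nkj) eqxx.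
exists (3 + n).+3; last by rewrite /=; lia.
apply: (EWhileB sk (s1 := s1)).
  set sw := upd s k w.
  have -> : s1 = upd (upd sw i (b :: sw i)) j (b :: upd sw i (b :: sw i) j).
    by rewrite /s1 /sw /upd [j == i]eq_sym (negPf nij) ![_ == k]eq_sym (negPf nki) (negPf nkj).
  by case: b {sk ex s1}; apply: (@ESeq _ _ _ 1 _ 1); apply: EPush.
have -> // : upd (upd (upd s k [::]) i (rev (b :: w) ++ s i)) j (rev (b :: w) ++ s j) =
  upd (upd (upd s1 k [::]) i (rev w ++ s1 i)) j (rev w ++ s1 j).
rewrite /s1 /upd !eqxx (negPf nij) rev_cons !cat_rcons.
apply: funext => l; case: eqP => // _; case: eqP => // _.
by case: eqP.
Qed.

Definition empty_above (b : nat) (s : store) := forall j, b < j -> s j = [::].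

Definition copy b := Seq (mv b b.+2) (cp b.+2 b b.+1).

Lemma copy_runs b s : empty_above b s ->
  runsto (copy b) s (upd s b.+1 (s b)) (10 * size (s b) + 5).
Proof.
move=> em; have := @mv_runs b b.+2 s; rewrite (em b.+2) // cats0.
have -> : (b != b.+2) by lia.
set s1 := upd _ _ _ => /(_ isT) r1.
have s1b : s1 b.+2 = rev (s b) by rewrite /s1 /upd eqxx.
have := @cp_runs b.+2 b b.+1 s1.
have -> : [&& b.+2 != b, b.+2 != b.+1 & b != b.+1] by lia.
move/(_ isT); rewrite s1b revK size_rev; set s2 := upd _ _ _ => r2.
have -> : upd s b.+1 (s b) = s2.
  rewrite /s2 /s1; apply: funext => j; rewrite /upd.
  do ?[case: eqP => ?]; subst; rewrite ?cats0 ?(em b.+1) ?(em b.+2) ?cats0 //; lia.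
by apply: runsto_le (runsto_seq r1 r2) _; lia.
Qed.

(* Moves register [b.+1] to [b], through [b.+2]. *)
Definition back b := Seq (mv b.+1 b.+2) (mv b.+2 b).

Lemma back_runs b s : s b = [::] -> s b.+2 = [::] ->
  runsto (back b) s (upd (upd s b.+1 [::]) b (s b.+1)) (8 * size (s b.+1) + 5).
Proof.
move=> sb sb2; have := @mv_runs b.+1 b.+2 s; rewrite sb2 cats0.
have -> : (b.+1 != b.+2) by lia.
set s1 := upd _ _ _ => /(_ isT) r1.
have := @mv_runs b.+2 b s1.
have -> : b.+2 != b by lia.
have -> : s1 b.+2 = rev (s b.+1) by rewrite /s1 /upd eqxx.
move/(_ isT); rewrite revK size_rev; set s2 := upd _ _ _ => r2.
have -> : upd (upd s b.+1 [::]) b (s b.+1) = s2.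
  rewrite /s2 /s1; apply: funext => j; rewrite /upd.
  do ?[case: eqP => ?]; subst; rewrite ?sb ?cats0 //; lia.
by apply: runsto_le (runsto_seq r1 r2) _; lia.
Qed.

Definition poly_bd (N : nat -> nat) := exists e, forall n, N n <= (n + 2) ^ e.

Lemma pb_const k : poly_bd (fun=> k).
Proof.
exists k => n; apply: leq_trans (_ : 2 ^ k <= _); first exact/ltnW/ltn_expl.
by apply: leq_expl; lia.
Qed.

Lemma pb_id : poly_bd id.
Proof. by exists 1 => n; rewrite expn1; lia. Qed.

Lemma pb_mul N M : poly_bd N -> poly_bd M -> poly_bd (fun n => N n * M n).
Proof.
by case=> e1 h1 [e2 h2]; exists (e1 + e2) => n; rewrite expnD leq_mul.
Qed.

Lemma pb_add N M : poly_bd N -> poly_bd M -> poly_bd (fun n => N n + M n).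
Proof.
case=> e1 h1 [e2 h2]; exists (maxn e1 e2).+1 => n.
have le e : e <= maxn e1 e2 -> (n + 2) ^ e <= (n + 2) ^ (maxn e1 e2).
  by apply: leq_pexp2l; lia.
have := h1 n; have := h2 n; have := le e1 (leq_maxl _ _).
have := le e2 (leq_maxr _ _); rewrite expnS.
have : 2 * (n + 2) ^ maxn e1 e2 <= (n + 2) * (n + 2) ^ maxn e1 e2.
  by rewrite leq_mul2r; lia.
lia.
Qed.

Lemma pb_exp N e : poly_bd N -> poly_bd (fun n => N n ^ e).
Proof.
move=> pN; elim: e => [|e IHe]; first exact: (pb_const 1).
have [e' h] := pb_mul pN IHe.
by exists e' => n; rewrite expnS.
Qed.

Ltac pb := repeat first [ exact: pb_id | apply: pb_add | apply: pb_mul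
  | apply: pb_exp | eassumption | exact: pb_const ].

(** One program for every base register [b], with the registers above [b] as scratch space that is
    empty before and after. A value can thus rest in [b] while another is computed from [b.+1]
    upwards. *)
Definition computes {X Y : Type} {eX : Enc X} {eY : Enc Y} (f : X -> Y)
    (c : nat -> cmd) (N : nat -> nat) :=
  forall b s x, s b = code (enc x) -> empty_above b s ->
    runsto (c b) s (upd s b (code (enc (f x)))) (N (esize x)).

Definition pt {X Y : Type} {eX : Enc X} {eY : Enc Y} (f : X -> Y) :=
  exists c e, computes f c (fun n => (n + 2) ^ e).

Section Closure.

Context {X Y Z : Type} {eX : Enc X} {eY : Enc Y} {eZ : Enc Z}.

Lemma pt_intro (f : X -> Y) c N : poly_bd N -> computes f c N -> pt f.
Proof.
case=> e h comp; exists c, e => b s x sb em.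
exact: runsto_le (comp b s x sb em) (h _).
Qed.

Lemma computes_size (f : X -> Y) c N x :
  computes f c N -> esize (f x) <= esize x + N (esize x).
Proof.
move=> comp; have [||n ex le_n] := comp 0 (input_store (code (enc x))) x.
- by [].
- by case.
have := exec_size 0 ex; rewrite /upd /input_store /= -!/(tsize _) -!/(esize _); lia.
Qed.

Lemma pt_esize (f : X -> Y) : pt f ->
  exists e, forall x, esize (f x) <= (esize x + 2) ^ e.
Proof.
case=> c [e comp].
have [e' h] : poly_bd (fun n => n + (n + 2) ^ e) by pb.
by exists e' => x; apply: leq_trans (computes_size x comp) (h _).
Qed.

Lemma pt_ext (f g : X -> Y) : pt f -> f =1 g -> pt g.
Proof. by move=> ptf /funext <-. Qed.

Lemma pt_comp (g : Y -> Z) (f : X -> Y) : pt g -> pt f -> pt (fun x => g (f x)).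
Proof.
case=> cg [eg hg] [cf [ef hf]].
have [e he] : poly_bd (fun n => ((n + 2) ^ ef + (n + (n + 2) ^ ef + 2) ^ eg) + 1) by pb.
exists (fun b => Seq (cf b) (cg b)), e.
move=> b s x sb em; apply: runsto_le _ (he _); rewrite addn1.
apply: runsto_seq (hf b s x sb em) _.
have -> : upd s b (code (enc (g (f x)))) =
   upd (upd s b (code (enc (f x)))) b (code (enc (g (f x)))).
  by st_eq.
apply: runsto_le (hg _ _ _ _ _) _.
- by rewrite /upd eqxx.
- by move=> j lt_j; rewrite /upd; case: eqP lt_j => [->|_ /em //]; lia.
by apply: leq_expl; have := computes_size x hf; lia.
Qed.

End Closure.

Lemma pt_retype X Y {eX : Enc X} {eY : Enc Y} (g : tree -> tree) (f : X -> Y) :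
  pt g -> (forall x, g (enc x) = enc (f x)) -> pt f.
Proof.
case=> c [e h] gf; exists c, e => b s x sb em; rewrite -gf.
exact: h.
Qed.

Lemma pt_id X {eX : Enc X} : pt (fun x : X => x).
Proof.
apply: (@pt_intro _ _ _ _ _ (fun=> Skip) (fun=> 1)); first by pb.
move=> b s x <- _; exists 1 => //.
have -> : upd s b (s b) = s by st_eq.
exact: ESkip.
Qed.

Fixpoint pushes (b : nat) (w : word) :=
  if w is x :: w' then Seq (pushes b w') (Push b x) else Skip.

Lemma pushes_runs b w s :
  runsto (pushes b w) s (upd s b (w ++ s b)) (2 * size w + 1).
Proof.
elim: w => [|x w IHw] /=.
  exists 1 => //; have -> : upd s b (s b) = s by st_eq.
  exact: ESkip.
apply: runsto_le (runsto_seq IHw _) (_ : (2 * size w + 1 + 1).+1 <= _); last by lia.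
exists 1 => //; set s1 := upd s b _.
have -> : upd s b (x :: w ++ s b) = upd s1 b (x :: s1 b).
  by rewrite /s1 /upd eqxx; st_eq.
exact: EPush.
Qed.

Lemma pt_cst X Y {eX : Enc X} {eY : Enc Y} (y : Y) : pt (fun _ : X => y).
Proof.
apply: (@pt_intro _ _ _ _ _ (fun b => Seq (clear b) (pushes b (code (enc y))))
  (fun n => (4 * n + 2) + (2 * esize y + 1) + 1)); first by pb.
move=> b s x sb em; rewrite addn1.
apply: runsto_seq; first by rewrite /esize /tsize -sb; exact: clear_runs.
have -> : upd s b (code (enc y)) = upd (upd s b [::]) b (code (enc y) ++ upd s b [::] b).
  by rewrite /upd eqxx cats0; st_eq.
exact: pushes_runs.
Qed.

Definition st4 (s : store) (b : nat) (u v w t : word) : store := fun j =>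
  if j == b then u else if j == b.+1 then v else if j == b.+2 then w
  else if j == b.+3 then t else s j.

Lemma st4E s b u v w t :
  (st4 s b u v w t b = u) * (st4 s b u v w t b.+1 = v) *
  (st4 s b u v w t b.+2 = w) * (st4 s b u v w t b.+3 = t).
Proof.
rewrite /st4 !eqxx.
have -> : (b.+1 == b) = false by lia.
have -> : (b.+2 == b) = false by lia.
have -> : (b.+3 == b) = false by lia.
have -> : (b.+2 == b.+1) = false by lia.
have -> : (b.+3 == b.+1) = false by lia.
by have -> : (b.+3 == b.+2) = false by lia.
Qed.

Lemma st4_id s b x : s b = x -> empty_above b s -> s = st4 s b x [::] [::] [::].
Proof.
move=> <- em; apply: funext => j; rewrite /st4.
by do ?[case: eqP => ?]; subst => //; rewrite em //; lia.
Qed.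

Lemma upd_st4 s b x : empty_above b s -> upd s b x = st4 s b x [::] [::] [::].
Proof.
move=> em; apply: funext => j; rewrite /upd /st4.
by do ?[case: eqP => ?]; subst => //; rewrite em //; lia.
Qed.

Lemma st4_empty1 s b u v : empty_above b s -> empty_above b.+1 (st4 s b u v [::] [::]).
Proof.
by move=> em j lt_j; rewrite /st4; do ?[case: eqP => ?] => //; try lia; apply: em; lia.
Qed.

Ltac st4_eq := apply: funext => ?; rewrite /upd /st4; do ?[case: eqP => ?];
  subst; rewrite ?revK ?cats0 //; try lia.

Lemma upd_st4E s b u v w t x :
  (upd (st4 s b u v w t) b x = st4 s b x v w t) *
  (upd (st4 s b u v w t) b.+1 x = st4 s b u x w t) *
  (upd (st4 s b u v w t) b.+2 x = st4 s b u v x t).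
Proof. by split; [split|]; st4_eq. Qed.

Lemma runsto_mv i j s s' n : i != j ->
  s' = upd (upd s i [::]) j (rev (s i) ++ s j) -> 4 * size (s i) + 2 <= n ->
  runsto (mv i j) s s' n.
Proof. by move=> ne ->; apply: runsto_le; apply: mv_runs. Qed.

Lemma runsto_at X Y {eX : Enc X} {eY : Enc Y} b s c (f : X -> Y) N x u v :
  computes f c N -> empty_above b s -> v = code (enc x) ->
  runsto (c b.+1) (st4 s b u v [::] [::]) (st4 s b u (code (enc (f x))) [::] [::])
    (N (esize x)).
Proof.
move=> comp em vx.
have -> : st4 s b u (code (enc (f x))) [::] [::] =
   upd (st4 s b u v [::] [::]) b.+1 (code (enc (f x))).
  by st4_eq.
by apply: comp; [rewrite st4E | exact: st4_empty1].
Qed.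

Lemma copy_st4 b s x : empty_above b s ->
  runsto (copy b) (st4 s b x [::] [::] [::]) (st4 s b x x [::] [::]) (10 * size x + 5).
Proof.
move=> em; have := @copy_runs b (st4 s b x [::] [::] [::]); rewrite st4E.
have -> : upd (st4 s b x [::] [::] [::]) b.+1 x = st4 s b x x [::] [::] by st4_eq.
by apply=> j lt_j; rewrite /st4; do ?[case: eqP => ?] => //; try lia; apply: em.
Qed.

Lemma back_st4 b s x : runsto (back b) (st4 s b [::] x [::] [::])
  (st4 s b x [::] [::] [::]) (8 * size x + 5).
Proof.
have := @back_runs b (st4 s b [::] x [::] [::]); rewrite !st4E => /(_ erefl erefl).
by have -> : upd (upd (st4 s b [::] x [::] [::]) b.+1 [::]) b x = st4 s b x [::] [::] [::] by st4_eq.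
Qed.

Definition swap b := Seq (mv b b.+2) (Seq (mv b.+1 b.+3) (Seq (mv b.+3 b) (mv b.+2 b.+1))).

Lemma swap_st4 b s x y : runsto (swap b) (st4 s b x y [::] [::])
  (st4 s b y x [::] [::]) (8 * size x + 8 * size y + 20).
Proof.
apply: (@runsto_le _ _ _ ((4 * size x + 2) + ((4 * size y + 2) + ((4 * size y + 2) +
  (4 * size x + 2)).+1).+1).+1); last by lia.
apply: (runsto_seq (s1 := st4 s b [::] y (rev x) [::])).
  by apply: runsto_mv; rewrite ?st4E //; [lia | st4_eq].
apply: (runsto_seq (s1 := st4 s b [::] [::] (rev x) (rev y))).
  by apply: runsto_mv; rewrite ?st4E //; [lia | st4_eq].
apply: (runsto_seq (s1 := st4 s b y [::] (rev x) [::])).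
  by apply: runsto_mv; rewrite ?st4E ?size_rev //; [lia | st4_eq].
by apply: runsto_mv; rewrite ?st4E ?size_rev //; [lia | st4_eq].
Qed.

Definition merge b := Seq (mv b b.+2) (Seq (mv b.+2 b.+1) (Seq (Push b.+1 true) (back b))).

Lemma merge_st4 b s x y : runsto (merge b) (st4 s b x y [::] [::])
  (st4 s b (true :: x ++ y) [::] [::] [::]) (20 * size x + 20 * size y + 30).
Proof.
apply: (@runsto_le _ _ _ ((4 * size x + 2) + ((4 * size x + 2) + (1 +
  (8 * size (true :: x ++ y) + 5)).+1).+1).+1); last by rewrite /= size_cat; lia.
apply: (runsto_seq (s1 := st4 s b [::] y (rev x) [::])).
  by apply: runsto_mv; rewrite ?st4E //; [lia | st4_eq].
apply: (runsto_seq (s1 := st4 s b [::] (x ++ y) [::] [::])).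
  by apply: runsto_mv; rewrite ?st4E ?size_rev //; [lia | st4_eq].
apply: runsto_seq (back_st4 _ _ _).
exists 1 => //.
have -> : st4 s b [::] (true :: x ++ y) [::] [::] =
   upd (st4 s b [::] (x ++ y) [::] [::]) b.+1
     (true :: st4 s b [::] (x ++ y) [::] [::] b.+1) by rewrite st4E; st4_eq.
exact: EPush.
Qed.

(** [f] is applied to a copy of the input in [b.+1]; the swap then parks [f x] in [b] and brings the
    input to [b.+1] for [g]. *)
Lemma pt_pair X Y Z {eX : Enc X} {eY : Enc Y} {eZ : Enc Z} (f : X -> Y) (g : X -> Z) :
  pt f -> pt g -> pt (fun x => (f x, g x)).
Proof.
case=> cf [ef hf] [cg [eg hg]].
pose F n := n + (n + 2) ^ ef; pose G n := n + (n + 2) ^ eg.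
apply: (@pt_intro _ _ _ _ _
  (fun b => Seq (copy b) (Seq (cf b.+1) (Seq (swap b) (Seq (cg b.+1) (merge b)))))
  (fun n => (10 * n + 5) + ((n + 2) ^ ef + ((8 * n + 8 * F n + 20) + ((n + 2) ^ eg +
     (20 * F n + 20 * G n + 30) + 1) + 1) + 1) + 1)); first by rewrite /F /G; pb.
move=> b s x sb em; rewrite (upd_st4 _ em) {1}(st4_id sb em) !addn1.
have szF := computes_size x hf; have szG := computes_size x hg.
apply: runsto_seq; first exact: copy_st4.
apply: runsto_seq; first exact: runsto_at hf em _.
apply: runsto_seq.
  apply: runsto_le (swap_st4 _ _ _ _) _.
  rewrite -!/(tsize _) -!/(esize _) /F; lia.
apply: runsto_seq; first exact: runsto_at hg em _.
apply: runsto_le (merge_st4 _ _ _ _) _.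
rewrite -!/(tsize _) -!/(esize _) /F /G; lia.
Qed.

(** Register [b.+2] counts in unary the subtrees still to be read: a leaf settles one, a node
    replaces one by two. *)
Definition parse_body b := Case b Skip (Push b.+1 false)
  (Seq (Push b.+1 true) (Seq (Push b.+2 true) (Push b.+2 true))).

Lemma parse_runs b s ts rest acc :
  runsto (While b.+2 (parse_body b) (parse_body b))
    (st4 s b (flatten (map code ts) ++ rest) acc (nseq (size ts) true) [::])
    (st4 s b rest (rev (flatten (map code ts)) ++ acc) [::] [::])
    (20 * size (flatten (map code ts)) + 2).
Proof.
have [n le_n] := ubnP (size (flatten (map code ts))).
elim: n ts acc le_n => // n IHn [|t ts] acc /= le_n.
  by exists 2 => //; apply: EWhileN; rewrite st4E.
case: t le_n => [|l r] /= le_n.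
  have [|m ex le_m] := IHn ts (false :: acc); first by lia.
  exists (3 + m).+3; last by lia.
  apply: (EWhileB (b := true) (w := nseq (size ts) true)) (_ : exec _ _ m _).
  - by rewrite st4E.
  - rewrite upd_st4E.
    apply: (ECaseB _ (b := false) (w := flatten [seq code i | i <- ts] ++ rest)).
      by rewrite st4E.
    by rewrite upd_st4E; exact: EPush.
  by rewrite st4E upd_st4E rev_cons cat_rcons.
have [|m ex le_m] := IHn [:: l, r & ts] (true :: acc).
  by rewrite /= !size_cat in le_n *; lia.
rewrite /= !size_cat in ex le_m; exists (7 + m).+3; last by rewrite !size_cat; lia.
apply: (EWhileB (b := true) (w := nseq (size ts) true)) (_ : exec _ _ m _).
- by rewrite st4E.
- rewrite upd_st4E.
  apply: (ECaseB _ (b := true) (w := ((code l ++ code r) ++ flatten [seq code i | i <- ts]) ++ rest)).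
    by rewrite st4E.
  rewrite upd_st4E.
  by apply: (@ESeq _ _ _ 1 _ 3); [exact: EPush | apply: (@ESeq _ _ _ 1 _ 1); exact: EPush].
by move: ex; rewrite !(st4E, upd_st4E) rev_cons cat_rcons -!catA.
Qed.

Definition car t := if t is Nd l _ then l else Lf.
Definition cdr t := if t is Nd _ r then r else Lf.

(** For a node, [fin] finds the right subtree in [b] and the reversed code of the left one in
    [b.+1]; a leaf is put back as it was. *)
Definition split b fin := Case b Skip (Push b false)
  (Seq (Push b.+2 true) (Seq (While b.+2 (parse_body b) (parse_body b)) fin)).

Lemma split_runs b s x f fin n : s b = code x -> empty_above b s ->
  f Lf = Lf ->
  (forall l r, x = Nd l r -> runsto fin (st4 s b (code r) (rev (code l)) [::] [::])
     (st4 s b (code (f x)) [::] [::] [::]) n) ->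
  runsto (split b fin) s (upd s b (code (f x))) (20 * tsize x + n + 10).
Proof.
move=> sb em fL fN; rewrite (upd_st4 _ em) {1}(st4_id sb em).
case: x sb fN => [|l r] sb fN.
  rewrite fL; exists 3; last by lia.
  apply: (ECaseB _ (b := false) (w := [::])); first by rewrite st4E.
  set s1 := upd _ _ _; have -> : st4 s b (code Lf) [::] [::] [::] = upd s1 b (false :: s1 b).
    by rewrite /s1 /upd eqxx; st4_eq.
  exact: EPush.
have [m1 ex1 le1] := @parse_runs b s [:: l] (code r) [::].
have [m2 ex2 le2] := fN l r erefl.
rewrite /= cats0 in ex1 le1; rewrite cats0 in ex1; rewrite tsize_Nd.
exists (1 + (m1 + m2).+1).+3; last by rewrite /tsize; lia.
apply: (ECaseB _ (b := true) (w := code l ++ code r)); first by rewrite st4E.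
apply: ESeq; first exact: EPush.
set s1 := upd _ _ _.
have -> : s1 = st4 s b (code l ++ code r) [::] [:: true] [::].
  by rewrite /s1; st4_eq.
by apply: ESeq ex1 ex2.
Qed.

Lemma pt_cdr : pt cdr.
Proof.
apply: (@pt_intro _ _ _ _ _ (fun b => split b (clear b.+1)) (fun n => 20 * n + (4 * n + 2) + 10)).
  by pb.
move=> b s x sb em; rewrite /esize /enc /Enc_tree in sb *.
apply: split_runs => // l r ->.
have := clear_runs b.+1 (st4 s b (code r) (rev (code l)) [::] [::]).
rewrite st4E size_rev => run.
have -> : st4 s b (code (cdr (Nd l r))) [::] [::] [::] =
   upd (st4 s b (code r) (rev (code l)) [::] [::]) b.+1 [::] by st4_eq.
by apply: runsto_le run _; rewrite tsize_Nd /tsize; lia.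
Qed.

Lemma pt_car : pt car.
Proof.
apply: (@pt_intro _ _ _ _ _ (fun b => split b (Seq (clear b) (mv b.+1 b)))
  (fun n => 20 * n + (8 * n + 5) + 10)); first by pb.
move=> b s x sb em; rewrite /esize /enc /Enc_tree in sb *.
apply: split_runs => // l r ->.
have := clear_runs b (st4 s b (code r) (rev (code l)) [::] [::]).
rewrite st4E => run; apply: runsto_le (runsto_seq run (_ : runsto _ _ _ (4 * tsize l + 2))) _.
  by apply: runsto_mv; [lia | rewrite /=; st4_eq | rewrite /upd /st4; do ?[case: eqP => ?] => //; try lia; rewrite size_rev].
rewrite tsize_Nd /tsize; lia.
Qed.

Definition truthy t := if t is Nd _ _ then true else false.

Lemma pt_if_enc X Y C {eX : Enc X} {eY : Enc Y} {eC : Enc C} (c : X -> C) (f g : X -> Y) :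
  pt c -> pt f -> pt g -> pt (fun x => if truthy (enc (c x)) then f x else g x).
Proof.
case=> cc [ec hc] [cf [ef hf]] [cg [eg hg]].
pose Cn n := n + (n + 2) ^ ec.
apply: (@pt_intro _ _ _ _ _ (fun b => Seq (copy b) (Seq (cc b.+1)
   (Case b.+1 Skip (Seq (clear b.+1) (cg b)) (Seq (clear b.+1) (cf b)))))
  (fun n => (10 * n + 5) + ((n + 2) ^ ec + ((4 * Cn n + 2) + ((n + 2) ^ ef + (n + 2) ^ eg) + 3) + 1) + 1)).
  by rewrite /Cn; pb.
move=> b s x sb em; rewrite {1}(st4_id sb em) [_ + 1]addn1 [_ + _ + 1]addn1.
have szC := computes_size x hc.
apply: runsto_seq; first exact: copy_st4.
apply: runsto_seq; first exact: runsto_at hc em _.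
set s1 := st4 _ _ _ _ _ _.
have s1b : s1 b.+1 = code (enc (c x)) by rewrite /s1 st4E.
have fin (h : X -> Y) ch N w : computes h ch N -> size w <= esize (c x) ->
  runsto (Seq (clear b.+1) (ch b)) (upd s1 b.+1 w) (upd s b (code (enc (h x))))
    ((4 * esize (c x) + 2) + N (esize x)).+1.
  move=> hh le_w; apply: (runsto_seq (s1 := s)); last exact: hh.
  have := clear_runs b.+1 (upd s1 b.+1 w).
  have -> : upd (upd s1 b.+1 w) b.+1 [::] = s.
    by rewrite [RHS](st4_id sb em) /s1 !upd_st4E.
  have -> : upd s1 b.+1 w b.+1 = w by rewrite /upd eqxx.
  by move=> run; apply: runsto_le run _; lia.
rewrite /esize in fin szC *.
case: (enc (c x)) s1b fin szC => [|l r] s1b fin szC /=.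
  have [//|m ex le_m] := fin g cg _ [::] hg.
  exists m.+2; last by rewrite /Cn /=; lia.
  exact: (ECaseB _ s1b).
have [|m ex le_m] := fin f cf _ (code l ++ code r) hf.
  by rewrite /tsize /=.
exists m.+2; last by rewrite /Cn /=; lia.
exact: (ECaseB _ s1b).
Qed.

(** One copy of the code of [x] is consumed bit by bit as the loop counter, whence exactly [esize x]
    rounds. The bound on all iterates excludes repeated squaring of the size. *)
Lemma pt_iter_enc X {eX : Enc X} (f : X -> X) N : pt f -> poly_bd N ->
  (forall x i, i <= esize x -> esize (iter i f x) <= N (esize x)) ->
  pt (fun x => iter (esize x) f x).
Proof.
case=> cf [ef hf] pN le_N.
apply: (@pt_intro _ _ _ _ _ (fun b => Seq (copy b) (Seq (While b (cf b.+1) (cf b.+1)) (back b)))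
  (fun n => (10 * n + 5) + ((n * ((N n + 2) ^ ef + 3) + 2) + (8 * N n + 5) + 1) + 1)).
  by pb.
move=> b s x sb em; rewrite (upd_st4 _ em) {1}(st4_id sb em) !addn1.
apply: runsto_seq; first exact: copy_st4.
apply: (runsto_seq (s1 := st4 s b [::] (code (enc (iter (esize x) f x))) [::] [::])); last first.
  by apply: runsto_le (back_st4 _ _ _) _; rewrite -/(tsize _) -/(esize _); have := le_N x _ (leqnn _); lia.
have loop : forall i w, size w + i = esize x ->
  runsto (While b (cf b.+1) (cf b.+1)) (st4 s b w (code (enc (iter i f x))) [::] [::])
    (st4 s b [::] (code (enc (iter (esize x) f x))) [::] [::])
    (size w * ((N (esize x) + 2) ^ ef + 3) + 2); last first.
  by apply: (loop 0 (code (enc x))); rewrite addn0.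
move=> i w; elim: w i => [|a w IHw] i /=.
  by rewrite add0n => ->; exists 2 => //; apply: EWhileN; rewrite st4E.
rewrite addSnnS => szw; have [m2 ex2 le2] := IHw _ szw.
have [m1 ex1 le1] := @runsto_at _ _ _ _ b s cf f _ (iter i f x) w _ hf em erefl.
exists (m1 + m2).+3.
  apply: (EWhileB (b := a) (w := w)) ex2; first by rewrite st4E.
  have -> : upd (st4 s b (a :: w) (code (enc (iter i f x))) [::] [::]) b w =
    st4 s b w (code (enc (iter i f x))) [::] [::] by st4_eq.
  by case: (a).
have : (esize (iter i f x) + 2) ^ ef <= (N (esize x) + 2) ^ ef.
  by apply: leq_expl; rewrite leq_add2r; apply: le_N; lia.
lia.
Qed.

End TreeFunctions.
Import TreeFunctions.

(** * Encodings of data types, and folds over lists *)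

Module TreeEncodings.

#[export] Instance Enc_bool : Enc bool := fun b => if b then Nd Lf Lf else Lf.
#[export] Instance Enc_nat : Enc nat := fun n => iter n (Nd Lf) Lf.
#[export] Instance Enc_seq {X : Type} {eX : Enc X} : Enc (seq X) :=
  foldr (fun x t => Nd (enc x) t) Lf.
(** The low priority lets [bool] and products keep their structural encodings. *)
#[export] Instance Enc_fin (T : finType) : Enc T | 100 :=
  fun x => enc (nat_of_ord (enum_rank x)).

Lemma esize_pair X Y {eX : Enc X} {eY : Enc Y} (x : X) (y : Y) :
  esize (x, y) = (esize x + esize y).+1.
Proof. exact: tsize_Nd. Qed.

Lemma esize_cons X {eX : Enc X} (x : X) (s : seq X) :
  esize (x :: s) = (esize x + esize s).+1.
Proof. exact: tsize_Nd. Qed.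

Lemma esize_nat (n : nat) : esize n = 2 * n + 1.
Proof.
elim: n => // n IHn; have -> : esize n.+1 = (1 + esize n).+1 by exact: tsize_Nd.
lia.
Qed.

Lemma esize_bool (b : bool) : esize b <= 3. Proof. by case: b. Qed.

Lemma size_esize X {eX : Enc X} (s : seq X) : size s < esize s.
Proof. by elim: s => // x s IHs; rewrite esize_cons /=; lia. Qed.

Lemma esize_cat X {eX : Enc X} (s t : seq X) : esize (s ++ t) <= esize s + esize t.
Proof. by elim: s => [|x s IHs] /=; rewrite ?esize_cons; lia. Qed.

Lemma esize_drop X {eX : Enc X} (s : seq X) i : esize (drop i s) <= esize s.
Proof. by elim: s i => [|x s IHs] [|i] //=; rewrite esize_cons; have := IHs i; lia. Qed.

Lemma esize_gt0 X {eX : Enc X} (x : X) : 0 < esize x.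
Proof. exact: tsize_gt0. Qed.

Lemma esize_seq_le X {eX : Enc X} (s : seq X) M : (forall i, i < size s -> forall x0,
  esize (nth x0 s i) <= M) -> esize s <= size s * M.+1 + 1.
Proof.
elim: s => // x s IHs le_M; rewrite esize_cons /=.
have := le_M 0 isT x; have /= := IHs (fun i lt_i => le_M i.+1 lt_i); lia.
Qed.

Section Context.

Context {X : Type} {eX : Enc X}.

Lemma pt_fst {Y Z : Type} {eY : Enc Y} {eZ : Enc Z} (f : X -> Y * Z) :
  pt f -> pt (fun x => (f x).1).
Proof.
move=> ptf; apply: (pt_comp (g := fst)) ptf.
by apply: pt_retype pt_car _ => -[].
Qed.

Lemma pt_snd {Y Z : Type} {eY : Enc Y} {eZ : Enc Z} (f : X -> Y * Z) :
  pt f -> pt (fun x => (f x).2).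
Proof.
move=> ptf; apply: (pt_comp (g := snd)) ptf.
by apply: pt_retype pt_cdr _ => -[].
Qed.

Lemma pt_if {Y : Type} {eY : Enc Y} (c : X -> bool) (f g : X -> Y) :
  pt c -> pt f -> pt g -> pt (fun x => if c x then f x else g x).
Proof.
move=> ptc ptf ptg; apply: pt_ext (pt_if_enc ptc ptf ptg) _ => x.
by case: (c x).
Qed.

Lemma pt_cons {Y : Type} {eY : Enc Y} (f : X -> Y) (g : X -> seq Y) :
  pt f -> pt g -> pt (fun x => f x :: g x).
Proof.
move=> ptf ptg; apply: (pt_comp (g := fun p : Y * seq Y => p.1 :: p.2)) (pt_pair ptf ptg).
by apply: pt_retype (pt_id (X := tree)) _ => -[].
Qed.

Lemma pt_behead {Y : Type} {eY : Enc Y} (f : X -> seq Y) : pt f -> pt (fun x => behead (f x)).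
Proof.
move=> ptf; apply: (pt_comp (g := behead)) ptf.
by apply: pt_retype pt_cdr _ => -[].
Qed.

Lemma pt_nilp {Y : Type} {eY : Enc Y} (f : X -> seq Y) : pt f -> pt (fun x => nilp (f x)).
Proof.
move=> ptf; apply: pt_ext (pt_if_enc ptf (pt_cst false) (pt_cst true)) _ => x.
by case: (f x).
Qed.

Lemma pt_head {Y : Type} {eY : Enc Y} (y : Y) (f : X -> seq Y) :
  pt f -> pt (fun x => head y (f x)).
Proof.
move=> ptf; apply: (pt_comp (g := head y)) ptf.
have ptg := pt_if_enc (@pt_id tree Enc_tree) pt_car (pt_cst (enc y)).
by apply: pt_retype (ptg eY) _ => -[].
Qed.

Lemma pt_S (f : X -> nat) : pt f -> pt (fun x => (f x).+1).
Proof.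
move=> ptf; apply: (pt_comp (g := S)) ptf.
by apply: (pt_retype (pt_pair (pt_cst Lf) (pt_id (X := tree)))).
Qed.

Lemma pt_P (f : X -> nat) : pt f -> pt (fun x => (f x).-1).
Proof.
move=> ptf; apply: (pt_comp (g := predn)) ptf.
by apply: pt_retype pt_cdr _ => -[].
Qed.

Lemma pt_eq0 (f : X -> nat) : pt f -> pt (fun x => f x == 0).
Proof.
move=> ptf; apply: pt_ext (pt_if_enc ptf (pt_cst false) (pt_cst true)) _ => x.
by case: (f x).
Qed.

Lemma pt_neg (f : X -> bool) : pt f -> pt (fun x => ~~ f x).
Proof.
move=> ptf; apply: pt_ext (pt_if ptf (pt_cst false) (pt_cst true)) _ => x.
by case: (f x).
Qed.

Lemma pt_and (f g : X -> bool) : pt f -> pt g -> pt (fun x => f x && g x).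
Proof. by move=> ptf ptg; apply: pt_ext (pt_if ptf ptg (pt_cst false)) _ => x. Qed.

Lemma pt_or (f g : X -> bool) : pt f -> pt g -> pt (fun x => f x || g x).
Proof. by move=> ptf ptg; apply: pt_ext (pt_if ptf (pt_cst true) ptg) _ => x. Qed.

Lemma pt_eqb (f g : X -> bool) : pt f -> pt g -> pt (fun x => f x == g x).
Proof.
move=> ptf ptg; apply: pt_ext (pt_if ptf ptg (pt_neg ptg)) _ => x.
by case: (f x); case: (g x).
Qed.

Lemma pt_xor (f g : X -> bool) : pt f -> pt g -> pt (fun x => f x (+) g x).
Proof.
move=> ptf ptg; apply: pt_ext (pt_if ptf (pt_neg ptg) ptg) _ => x.
by case: (f x).
Qed.

End Context.

Section Fold.

Context {X A B : Type} {eX : Enc X} {eA : Enc A} {eB : Enc B}.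

(** The fold is an iteration on triples of input, accumulator and remaining list that is idle once
    the list is empty. As many rounds are run as the initial triple has code bits, which exceeds the
    length of the list. *)
Lemma pt_foldl (a0 : A) (step : X -> B -> A -> B) (init : X -> B) (l : X -> seq A) N :
  pt (fun p : X * (B * A) => step p.1 p.2.1 p.2.2) -> pt init -> pt l ->
  poly_bd N ->
  (forall x i, esize (foldl (step x) (init x) (take i (l x))) <= N (esize x)) ->
  pt (fun x => foldl (step x) (init x) (l x)).
Proof.
move=> pts pti ptl [e pN] le_N.
pose T := (X * (B * seq A))%type.
pose G0 (p : T) : T := if nilp p.2.2 then p else
  (p.1, (step p.1 p.2.1 (head a0 p.2.2), behead p.2.2)).
pose I0 x : T := (x, (init x, l x)).
have valG x i : iter i G0 (I0 x) =
   (x, (foldl (step x) (init x) (take i (l x)), drop i (l x))).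
  elim: i => [|i IHi]; first by rewrite take0 drop0.
  rewrite iterS IHi /G0 /=.
  have [le_i|lt_i] := leqP (size (l x)) i.
    by rewrite drop_oversize //= !take_oversize ?drop_oversize //; lia.
  by rewrite (drop_nth a0) //= (take_nth a0) // -cats1 foldl_cat.
(* Only the reachable states need to stay small. *)
pose S := {p : T | exists x i, p = iter i G0 (I0 x)}.
pose eT : Enc T := @Enc_prod X _ eX (@Enc_prod B _ eB (@Enc_seq A eA)).
(* The subtype inherits the encoding of the triple, so the program for [G0] also serves for its
   restriction [G]. *)
pose eS : Enc S := fun s => @enc T eT (sval s).
have GP (s : S) : exists x i, G0 (sval s) = iter i G0 (I0 x).
  by case: s => p /= [x [i ep]]; exists x, i.+1; rewrite ep.
pose G (s : S) : S := exist _ (G0 (sval s)) (GP s).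
have ptG0 : pt G0.
  have p22 : pt (fun p : T => p.2.2) by exact: pt_snd (pt_snd pt_id).
  apply: pt_if (pt_nilp p22) pt_id _; apply: pt_pair; first exact: pt_fst pt_id.
  apply: pt_pair (pt_behead p22).
  apply: (pt_comp (g := fun p : X * (B * A) => step p.1 p.2.1 p.2.2)
    (f := fun p : T => (p.1, (p.2.1, head a0 p.2.2)))) => //.
  apply: pt_pair; first exact: pt_fst pt_id.
  apply: pt_pair (pt_head _ p22); exact: pt_fst (pt_snd pt_id).
have ptG : pt G by case: ptG0 => c [e' h]; exists c, e' => b s x; apply: h.
pose I (x : X) : S := exist _ (I0 x) (ex_intro _ x (ex_intro _ 0 erefl)).
have ptI : pt I.
  have [c [e' h]] := pt_pair (pt_id (X := X)) (pt_pair pti ptl).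
  by exists c, e'.
have iterG s i : sval (iter i G s) = iter i G0 (sval s) by elim: i => //= i ->.
have [el lel] := pt_esize ptl.
have ptit := @pt_iter_enc S eS G (fun n => 2 * n + 3 + (n + 2) ^ e + (n + 2) ^ el) ptG.
have {ptit} ptit : pt (fun s : S => iter (esize s) G s).
  apply: ptit; first by pb.
  move=> s i _; have szS (s0 : S) : esize s0 =
      (esize (sval s0).1 + (esize (sval s0).2.1 + esize (sval s0).2.2).+1).+1.
    by case: s0 => -[x [b s']] p; rewrite /esize /enc /eS /eT /enc /Enc_prod /= !tsize_Nd.
  rewrite !szS iterG; case: s => p [x [j ej]] /=; rewrite ej -iterD !valG /=.
  set E := (X in _ <= 2 * X + _ + _ + _).
  have xE : esize x <= E by rewrite /E; lia.
  rewrite -/E; have h1 := leq_expl e (leq_add xE (leqnn 2)).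
  have h2 := leq_expl el (leq_add xE (leqnn 2)).
  have h3 := le_N x (i + j); have h4 := lel x.
  pose proof (pN (esize x)) as h5; pose proof (esize_drop (l x) (i + j)) as h6.
  by lia.
have ptv : pt (fun s : S => (sval s).2.1).
  by case: (pt_fst (pt_snd (pt_id (X := T)))) => c [e' h]; exists c, e' => b s x; apply: h.
apply: pt_ext (pt_comp ptv (pt_comp ptit ptI)) _ => x.
rewrite iterG valG /= take_oversize //.
have -> : esize (I x) = esize (x, (init x, l x)) by [].
by rewrite !esize_pair; pose proof (size_esize (l x)); lia.
Qed.

End Fold.

End TreeEncodings.
Import TreeEncodings.

(** * Lists, unary arithmetic and finite case analysis *)

Module ListFunctions.

Lemma enc_nseq_Lf n : enc (nseq n Lf) = enc n :> tree.
Proof. by elim: n => //= n IHn; rewrite /enc /= in IHn *; rewrite IHn. Qed.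

Lemma foldl_const (A B : Type) (g : B -> B) b (s : seq A) :
  foldl (fun b _ => g b) b s = iter (size s) g b.
Proof. by elim: s b => //= a s IHs b; rewrite IHs -iterS iterSr. Qed.

Lemma esize_catrev X {eX : Enc X} (s t : seq X) : esize (catrev s t) + 1 = esize s + esize t.
Proof.
elim: s t => [|x s IHs] t /=; first by rewrite addnC.
by rewrite IHs !esize_cons; lia.
Qed.

Lemma esize_rev X {eX : Enc X} (s : seq X) : esize (rev s) = esize s.
Proof.
pose proof (esize_catrev s [::]) as h.
rewrite /rev; move: h; have -> : esize (@nil X) = 1 by []; lia.
Qed.

Lemma esize_take X {eX : Enc X} (s : seq X) i : esize (take i s) <= esize s.
Proof.
elim: s i => [|x s IHs] [|i] //=; last by rewrite !esize_cons; have := IHs i; lia.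
Qed.

Lemma esize_flatten X {eX : Enc X} (s : seq (seq X)) : esize (flatten s) <= esize s.
Proof.
elim: s => //= u s IHs; rewrite esize_cons.
pose proof (esize_cat u (flatten s)); lia.
Qed.

Lemma esize_map_le X Y {eX : Enc X} {eY : Enc Y} (f : X -> Y) s m M :
  (forall a, esize a <= m -> esize (f a) <= M) -> esize s <= m ->
  esize (map f s) <= size s * M.+1 + 1.
Proof.
move=> fM; elim: s => // x s IHs; rewrite esize_cons => le_m /=; rewrite esize_cons.
have h1 : esize (f x) <= M by apply: fM; lia.
have h2 : esize (map f s) <= size s * M.+1 + 1 by apply: IHs; lia.
lia.
Qed.

Section Context.

Context {X : Type} {eX : Enc X}.

(** A fold over a list of [n x] leaves, whose encoding is that of the number [n x] itself. *)
Lemma pt_iter {B : Type} {eB : Enc B} (step : X -> B -> B) init (n : X -> nat) N :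
  pt (fun p : X * B => step p.1 p.2) -> pt init -> pt n -> poly_bd N ->
  (forall x i, i <= n x -> esize (iter i (step x) (init x)) <= N (esize x)) ->
  pt (fun x => iter (n x) (step x) (init x)).
Proof.
move=> pts pti ptn pN le_N.
have ptl : pt (fun x => nseq (n x) Lf).
  apply: (pt_comp (g := fun k : nat => nseq k Lf)) ptn.
  by apply: pt_retype (pt_id (X := tree)) _ => k; rewrite enc_nseq_Lf.
have ptf : pt (fun x => foldl (fun b (_ : tree) => step x b) (init x) (nseq (n x) Lf)).
  apply: (pt_foldl (N := N) (step := fun x b (_ : tree) => step x b) Lf) => //.
    apply: (pt_comp (g := fun p : X * B => step p.1 p.2)
      (f := fun p : X * (B * tree) => (p.1, p.2.1))) => //.
    apply: pt_pair; first exact: pt_fst pt_id.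
    exact: pt_fst (pt_snd pt_id).
  move=> x i; rewrite foldl_const size_take size_nseq; apply: le_N.
  by case: ifP; lia.
by apply: pt_ext ptf _ => x; rewrite foldl_const size_nseq.
Qed.

Lemma pt_nth {Y : Type} {eY : Enc Y} d (f : X -> seq Y) (n : X -> nat) :
  pt f -> pt n -> pt (fun x => nth d (f x) (n x)).
Proof.
move=> ptf ptn; have [e le_e] := pt_esize ptf.
have itE i (s : seq Y) : iter i behead s = drop i s.
  by elim: i => [|i IHi]; rewrite ?drop0 // iterS IHi -addn1 addnC -drop_drop; case: (drop i s) => //= ? ?; rewrite drop0.
have pti : pt (fun x => iter (n x) behead (f x)).
  apply: (pt_iter (N := fun m => (m + 2) ^ e) (step := fun _ => behead)) => //.
  - by apply: pt_behead; apply: pt_snd pt_id.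
  - by exists e.
  by move=> x i _; rewrite itE; apply: leq_trans (esize_drop _ _) (le_e x).
apply: pt_ext (pt_head d pti) _ => x; rewrite itE.
by rewrite -nth0 nth_drop addn0.
Qed.

Lemma pt_add (f g : X -> nat) : pt f -> pt g -> pt (fun x => f x + g x).
Proof.
move=> ptf ptg; have [e le_e] := pt_esize ptf; have [e' le_e'] := pt_esize ptg.
have pti : pt (fun x => iter (f x) succn (g x)).
  apply: (pt_iter (N := fun m => (m + 2) ^ e + (m + 2) ^ e') (step := fun _ => succn)) => //.
  - by apply: pt_S; apply: pt_snd pt_id.
  - by pb.
  move=> x i le; rewrite iter_succn esize_nat.
  have := le_e x; have := le_e' x; rewrite !esize_nat; lia.
by apply: pt_ext pti _ => x; rewrite iter_succn addnC.
Qed.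

Lemma pt_sub (f g : X -> nat) : pt f -> pt g -> pt (fun x => f x - g x).
Proof.
move=> ptf ptg; have [e le_e] := pt_esize ptf.
have itE i n : iter i predn n = n - i by elim: i => [|i IHi]; rewrite ?subn0 // iterS IHi subnS.
have pti : pt (fun x => iter (g x) predn (f x)).
  apply: (pt_iter (N := fun m => (m + 2) ^ e) (step := fun _ => predn)) => //.
  - by apply: pt_P; apply: pt_snd pt_id.
  - by exists e.
  move=> x i le; rewrite itE esize_nat.
  have := le_e x; rewrite !esize_nat; lia.
by apply: pt_ext pti _ => x; rewrite itE.
Qed.

Lemma pt_leq (f g : X -> nat) : pt f -> pt g -> pt (fun x => f x <= g x).
Proof. by move=> ptf ptg; exact: pt_eq0 (pt_sub ptf ptg). Qed.

Lemma pt_eqn (f g : X -> nat) : pt f -> pt g -> pt (fun x => f x == g x).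
Proof.
move=> ptf ptg; apply: pt_ext (pt_and (pt_leq ptf ptg) (pt_leq ptg ptf)) _ => x.
by rewrite -eqn_leq.
Qed.

End Context.

Section Lists.

Context {X A : Type} {eX : Enc X} {eA : Enc A}.

Lemma pt_size (l : X -> seq A) : pt l -> pt (fun x => size (l x)).
Proof.
move=> ptl; have [e le_e] := pt_esize ptl.
(* [pt_foldl] asks for an element of [A]; without one, every list over [A] is empty. *)
case: (pselect (exists a : A, True)) => [[a0 _]|no]; last first.
  by apply: pt_ext (pt_cst 0) _ => x; case: (l x) => // a; case: no; exists a.
have ptf : pt (fun x => foldl (fun n (_ : A) => n.+1) 0 (l x)).
  apply: (pt_foldl (N := fun m => 2 * (m + 2) ^ e + 1) (step := fun (_ : X) n (_ : A) => n.+1) a0) => //.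
  - by apply: pt_S; exact: pt_fst (pt_snd pt_id).
  - exact: pt_cst.
  - by pb.
  move=> x i; rewrite foldl_const iter_succn esize_nat size_take.
  pose proof (size_esize (l x)); have := le_e x; case: ifP; lia.
by apply: pt_ext ptf _ => x; rewrite foldl_const iter_succn.
Qed.

Lemma foldl_consE (B : Type) (f : A -> B) acc s :
  foldl (fun r a => f a :: r) acc s = catrev (map f s) acc.
Proof. by elim: s acc => //= a s IHs acc; rewrite IHs. Qed.

Lemma pt_catrev (l m : X -> seq A) : pt l -> pt m -> pt (fun x => catrev (l x) (m x)).
Proof.
move=> ptl ptm; have [e le_e] := pt_esize ptl; have [e' le_e'] := pt_esize ptm.
case: (pselect (exists a : A, True)) => [[a0 _]|no]; last first.
  by apply: pt_ext ptm _ => x; case: (l x) => // a; case: no; exists a.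
have ptf : pt (fun x => foldl (fun r (a : A) => a :: r) (m x) (l x)).
  apply: (pt_foldl (N := fun m => (m + 2) ^ e + (m + 2) ^ e') (step := fun (_ : X) r (a : A) => a :: r) a0) => //.
  - by apply: pt_cons; [exact: pt_snd (pt_snd pt_id) | exact: pt_fst (pt_snd pt_id)].
  - by pb.
  move=> x i; rewrite (foldl_consE id) map_id.
  pose proof (esize_catrev (take i (l x)) (m x)); pose proof (esize_take (l x) i).
  have := le_e x; have := le_e' x; lia.
by apply: pt_ext ptf _ => x; rewrite (foldl_consE id) map_id.
Qed.

Lemma pt_rev (l : X -> seq A) : pt l -> pt (fun x => rev (l x)).
Proof. by move=> ptl; exact: pt_catrev ptl (pt_cst _). Qed.

Lemma pt_cat (l m : X -> seq A) : pt l -> pt m -> pt (fun x => l x ++ m x).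
Proof.
move=> ptl ptm; apply: pt_ext (pt_catrev (pt_rev ptl) ptm) _ => x.
by rewrite catrevE revK.
Qed.

End Lists.

Section More.

Context {X A : Type} {eX : Enc X} {eA : Enc A}.

Lemma pt_flatten (l : X -> seq (seq A)) : pt l -> pt (fun x => flatten (l x)).
Proof.
move=> ptl; have [e le_e] := pt_esize ptl.
have fE acc (s : seq (seq A)) : foldl cat acc s = acc ++ flatten s.
  by elim: s acc => [|a s IHs] acc /=; rewrite ?cats0 // IHs catA.
have ptf : pt (fun x => foldl cat [::] (l x)).
  apply: (pt_foldl (N := fun m => (m + 2) ^ e) (step := fun (_ : X) => cat) [::]) => //.
  - by apply: pt_cat; [exact: pt_fst (pt_snd pt_id) | exact: pt_snd (pt_snd pt_id)].
  - exact: pt_cst.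
  - by exists e.
  move=> x i; rewrite fE; apply: leq_trans (esize_flatten _) (leq_trans (esize_take _ _) (le_e x)).
by apply: pt_ext ptf _ => x; rewrite fE.
Qed.

Lemma pt_map {Y : Type} {eY : Enc Y} (f : X -> A -> Y) (l : X -> seq A) :
  pt (fun p : X * A => f p.1 p.2) -> pt l -> pt (fun x => [seq f x a | a <- l x]).
Proof.
move=> ptf ptl; have [e le_e] := pt_esize ptl; have [e' le_e'] := pt_esize ptf.
case: (pselect (exists a : A, True)) => [[a0 _]|no]; last first.
  by apply: pt_ext (pt_cst [::]) _ => x; case: (l x) => // a; case: no; exists a.
have ptg : pt (fun x => foldl (fun r (a : A) => f x a :: r) [::] (l x)).
  apply: (pt_foldl (N := fun m => (m + 2) ^ e * ((m + (m + 2) ^ e + 1 + 2) ^ e' + 1) + 1)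
     (step := fun x r (a : A) => f x a :: r) a0) => //.
  - apply: pt_cons; last exact: pt_fst (pt_snd pt_id).
    apply: (pt_comp (g := fun p : X * A => f p.1 p.2) (f := fun p : X * (seq Y * A) => (p.1, p.2.2))) => //.
    by apply: pt_pair; [exact: pt_fst pt_id | exact: pt_snd (pt_snd pt_id)].
  - exact: pt_cst.
  - by pb.
  move=> x i; rewrite foldl_consE esize_rev.
  set m := esize x; set s := take i (l x).
  have s1 : esize s <= (m + 2) ^ e by apply: leq_trans (esize_take _ _) (le_e x).
  have s2 : size s <= (m + 2) ^ e by pose proof (size_esize s); lia.
  apply: leq_trans (esize_map_le (m := (m + 2) ^ e) (M := (m + (m + 2) ^ e + 1 + 2) ^ e') _ s1) _.
    move=> a le_a; apply: leq_trans (le_e' (x, a)) _; apply: leq_expl; rewrite esize_pair -/m; lia.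
  by rewrite leq_add2r; apply: leq_mul => //; rewrite -[X in X <= _]addn1.
by apply: pt_ext (pt_rev ptg) _ => x; rewrite foldl_consE revK.
Qed.

Lemma pt_has (f : X -> A -> bool) (l : X -> seq A) :
  pt (fun p : X * A => f p.1 p.2) -> pt l -> pt (fun x => has (f x) (l x)).
Proof.
move=> ptf ptl.
case: (pselect (exists a : A, True)) => [[a0 _]|no]; last first.
  by apply: pt_ext (pt_cst false) _ => x; case: (l x) => // a; case: no; exists a.
have fE b x s : foldl (fun r (a : A) => r || f x a) b s = b || has (f x) s.
  by elim: s b => [|a s IHs] b /=; rewrite ?orbF // IHs orbA.
have ptg : pt (fun x => foldl (fun r (a : A) => r || f x a) false (l x)).
  apply: (pt_foldl (N := fun m => 3) (step := fun x r (a : A) => r || f x a) a0) => //.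
  - apply: pt_or; first exact: pt_fst (pt_snd pt_id).
    apply: (pt_comp (g := fun p : X * A => f p.1 p.2) (f := fun p : X * (bool * A) => (p.1, p.2.2))) => //.
    by apply: pt_pair; [exact: pt_fst pt_id | exact: pt_snd (pt_snd pt_id)].
  - exact: pt_cst.
  - by pb.
  by move=> x i; exact: esize_bool.
by apply: pt_ext ptg _ => x; rewrite fE.
Qed.

Lemma pt_cmap {C Y : Type} {eY : Enc Y} (f : C -> X -> Y) (cs : seq C) :
  (forall c, pt (f c)) -> pt (fun x => [seq f c x | c <- cs]).
Proof.
move=> ptf; elim: cs => [|c cs IHcs]; first exact: pt_cst.
exact: pt_cons (ptf c) IHcs.
Qed.

End More.

Section Filter.

Context {X A : Type} {eX : Enc X} {eA : Enc A}.

Lemma pt_iota (n : X -> nat) : pt n -> pt (fun x => iota 0 (n x)).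
Proof.
move=> ptn; have [e le_e] := pt_esize ptn.
have itE i : iter i (fun s : seq nat => size s :: s) [::] = rev (iota 0 i).
  elim: i => // i IHi; rewrite iterS IHi size_rev size_iota.
  by rewrite -(addn1 i) iotaD /= rev_cat.
have pti : pt (fun x => iter (n x) (fun s : seq nat => size s :: s) [::]).
  apply: (pt_iter (N := fun m => (m + 2) ^ e * (2 * (m + 2) ^ e + 2) + 1) (step := fun _ (s : seq nat) => size s :: s)) => //.
  - by apply: pt_cons; [apply: pt_size|]; exact: pt_snd pt_id.
  - exact: pt_cst.
  - by pb.
  move=> x i le_i; rewrite itE esize_rev.
  have n_le : n x <= (esize x + 2) ^ e by have := le_e x; rewrite esize_nat; lia.
  have := @esize_seq_le nat _ (iota 0 i) (2 * i + 1); rewrite size_iota => h.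
  have {h} h : esize (iota 0 i) <= i * (2 * i + 1).+1 + 1.
    by apply: h => j lt_j x0; rewrite nth_iota // esize_nat; lia.
  apply: leq_trans h _; rewrite leq_add2r; apply: leq_mul; lia.
by apply: pt_ext (pt_rev pti) _ => x; rewrite itE revK.
Qed.

Lemma pt_mul (f g : X -> nat) : pt f -> pt g -> pt (fun x => f x * g x).
Proof.
move=> ptf ptg; have [e le_e] := pt_esize ptf; have [e' le_e'] := pt_esize ptg.
have itE n i : iter i (addn n) 0 = i * n by elim: i => //= i ->; lia.
have pti : pt (fun x => iter (f x) (addn (g x)) 0).
  apply: (pt_iter (N := fun m => 2 * ((m + 2) ^ e * (m + 2) ^ e') + 1) (step := fun x => addn (g x))) => //.
  - apply: pt_add; last exact: pt_snd pt_id.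
    by apply: (pt_comp (g := g)) => //; exact: pt_fst pt_id.
  - exact: pt_cst.
  - by pb.
  move=> x i le; rewrite itE esize_nat leq_add2r leq_mul2l /=; apply: leq_mul.
    by have := le_e x; rewrite esize_nat; lia.
  by have := le_e' x; rewrite esize_nat; lia.
by apply: pt_ext pti _ => x; rewrite itE.
Qed.

End Filter.

Section Case.

Context {X Y : Type} {eX : Enc X} {eY : Enc Y}.

Lemma pt_rank (T : finType) (g : X -> T) : pt g -> pt (fun x => nat_of_ord (enum_rank (g x))).
Proof.
move=> ptg; apply: (pt_comp (g := fun t : T => nat_of_ord (enum_rank t))) ptg.
exact: (pt_retype (pt_id (X := tree))).
Qed.

(** The dependence of [f] on its finite argument may be arbitrary, since it is wired into the
    program as a chain of comparisons of ranks. This is how the gadgets of constant size get into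
    the machine. *)
Lemma pt_case (T : finType) (y0 : T) (f : T -> X -> Y) (g : X -> T) :
  (forall a, pt (f a)) -> pt g -> pt (fun x => f (g x) x).
Proof.
move=> ptf ptg.
have h (l : seq T) : pt (fun x => if g x \in l then f (g x) x else f y0 x).
  elim: l => [|a l IHl]; first by apply: pt_ext (ptf y0) _.
  apply: pt_ext (pt_if (pt_eqn (pt_rank ptg) (pt_cst (nat_of_ord (enum_rank a)))) (ptf a) IHl) _ => x.
  by rewrite inE (inj_eq val_inj) (inj_eq enum_rank_inj); case: eqP => [->|].
by apply: pt_ext (h (enum T)) _ => x; rewrite mem_enum.
Qed.

End Case.

(** At most [n] letters of a finite alphabet are read by nested case distinctions, so [F] may again
    be arbitrary. *)
Lemma pt_finseq {X Y : Type} {eX : Enc X} {eY : Enc Y} (T : finType) (y0 : T) n (F : seq T -> Y)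
  (g : X -> seq T) : pt g -> pt (fun x => F (take n (g x))).
Proof.
elim: n F g => [|n IHn] F g ptg.
  by apply: pt_ext (pt_cst (F [::])) _ => x; rewrite take0.
have h : pt (fun x => F (head y0 (g x) :: take n (behead (g x)))).
  apply: (pt_case (f := fun a x => F (a :: take n (behead (g x)))) y0) (pt_head y0 ptg) => a.
  exact: (IHn (fun s => F (a :: s))) (pt_behead ptg).
by apply: pt_ext (pt_if (pt_nilp ptg) (pt_cst (F [::])) h) _ => x; case: (g x).
Qed.

End ListFunctions.
Import ListFunctions.

Module GraphTables.

(** * Tables of labelled graphs and local transformations *)

Definition table (D : Type) := seq (D * seq nat).

(** The vertices stay abstract and [ix] numbers them by the rows of the table. It is quantified
    existentially because every transformation of the graph brings its own numbering. *)
Definition rep (V Lb D : finType) (d0 : D) (nb : V -> Lb -> V) (dat : V -> D) (T : table D) :=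
  exists ix : V -> nat, [/\ injective ix, forall v, ix v < size T, size T = #|V| &
    forall v, nth (d0, [::]) T (ix v) = (dat v, [seq ix (nb v l) | l <- enum Lb])].

Lemma nth_flatten_const (A B : Type) (a0 : A) (d : B) (F : A -> seq B) q s i j :
  (forall a, size (F a) = q) -> i < size s -> j < q ->
  nth d (flatten [seq F a | a <- s]) (i * q + j) = nth d (F (nth a0 s i)) j.
Proof.
move=> Fq; elim: s i => //= a s IHs [|i] lt_i lt_j; rewrite nth_cat Fq.
  by rewrite mul0n add0n lt_j.
by rewrite ifF; [rewrite -IHs //; congr nth; lia | lia].
Qed.

Lemma size_flatten_const (A B : Type) (F : A -> seq B) q s :
  (forall a, size (F a) = q) -> size (flatten [seq F a | a <- s]) = size s * q.
Proof. by move=> Fq; elim: s => //= a s IHs; rewrite size_cat IHs Fq mulSn. Qed.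

Section Local.

Variables (Lb D Lb' D' K : finType) (d0 : D) (d0' : D').
Variables (om : K -> Lb' -> seq Lb) (kp : K -> Lb' -> K).
Variables (W : K -> seq (seq Lb)) (Dl : K -> seq D -> D').

Definition walkT (T : table D) (i : nat) (w : seq Lb) : nat :=
  foldl (fun i l => nth 0 (nth (d0, [::]) T i).2 (enum_rank l)) i w.

(** The row of the new vertex [(v, k)]: its data is computed by [Dl k] from the old data at the ends
    of the walks [W k] from [v], and the label [l] leads to the end of the walk [om k l], with new
    second component [kp k l]. *)
Definition entryT (T : table D) (i : nat) (k : K) : D' * seq nat :=
  (Dl k [seq (nth (d0, [::]) T (walkT T i w)).1 | w <- W k],
   [seq walkT T i (om k l) * #|K| + enum_rank (kp k l) | l <- enum Lb']).

Definition stepT (T : table D) : table D' :=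
  flatten [seq [seq entryT T i k | k <- enum K] | i <- iota 0 (size T)].

Section Run.

Context {X : Type} {eX : Enc X}.

Lemma pt_walkT (f : X -> table D) (i : X -> nat) w : pt f -> pt i ->
  pt (fun x => walkT (f x) (i x) w).
Proof.
move=> ptf; elim: w i => //= l w IHw i pti; apply: IHw.
by apply: pt_nth; [apply: pt_snd; apply: pt_nth | exact: pt_cst].
Qed.

End Run.

Section Run2.

Context {X : Type} {eX : Enc X}.

(** [Lb], [Lb'], [K] and the walks do not depend on the input, so the entries made from one old row
    come from a fixed program, and only the old rows need a loop. *)
Lemma pt_stepT (f : X -> table D) : pt f -> pt (fun x => stepT (f x)).
Proof.
move=> ptf; apply: pt_flatten.
apply: (pt_map (f := fun x i => [seq entryT (f x) i k | k <- enum K])); last first.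
  by apply: pt_iota; apply: pt_size.
have p1 : pt (fun p : X * nat => f p.1) by apply: (pt_comp (g := f)) => //; exact: pt_fst pt_id.
have p2 : pt (fun p : X * nat => p.2) by exact: pt_snd pt_id.
apply: (pt_cmap (f := fun k (p : X * nat) => entryT (f p.1) p.2 k)) => k.
apply: pt_pair.
  have ptw : pt (fun p : X * nat => [seq (nth (d0, [::]) (f p.1) (walkT (f p.1) p.2 w)).1 | w <- W k]).
    apply: (pt_cmap (f := fun w (p : X * nat) => (nth (d0, [::]) (f p.1) (walkT (f p.1) p.2 w)).1)) => w.
    by apply: pt_fst; apply: pt_nth => //; exact: (pt_walkT (f := fun p : X * nat => f p.1) (i := snd)).
  apply: pt_ext (pt_finseq d0 (size (W k)) (Dl k) ptw) _ => p.
  by rewrite take_oversize // size_map.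
apply: (pt_cmap (f := fun l (p : X * nat) => walkT (f p.1) p.2 (om k l) * #|K| + enum_rank (kp k l))) => l.
by apply: pt_add; [apply: pt_mul; [exact: (pt_walkT (f := fun p : X * nat => f p.1) (i := snd)) | exact: pt_cst] | exact: pt_cst].
Qed.

End Run2.

Section Correct.

Variables (V : finType) (nb : V -> Lb -> V) (dat : V -> D).
Variables (nb' : V * K -> Lb' -> V * K) (dat' : V * K -> D').
Hypothesis nbE : forall v k l, nb' (v, k) l = (foldl nb v (om k l), kp k l).
Hypothesis datE : forall v k, dat' (v, k) = Dl k [seq dat (foldl nb v w) | w <- W k].

Lemma rep_stepT T : rep d0 nb dat T -> rep d0' nb' dat' (stepT T).
Proof.
case=> ix [ixI ix_lt szT nthT].
have wE v w : walkT T (ix v) w = ix (foldl nb v w).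
  elim: w v => //= l w IHw v; rewrite /walkT /= nthT /= -IHw; congr foldl.
  by rewrite (nth_map l) -?cardE // nth_enum_rank.
have szE i : size [seq entryT T i k | k <- enum K] = #|K| by rewrite size_map -cardE.
have szS : size (stepT T) = (#|V| * #|K|)%N.
  by rewrite /stepT (size_flatten_const (q := #|K|)) // size_iota szT.
exists (fun p => ix p.1 * #|K| + enum_rank p.2); split=> [[v k] [v' k'] /= e|[v k] /=||[v k] /=].
- have K0 : 0 < #|K| by apply/card_gt0P; exists k.
  have := congr1 (fun n => n %/ #|K|) e; rewrite /= !divnMDl // !divn_small // !addn0 => /ixI ->.
  have := congr1 (fun n => n %% #|K|) e; rewrite /= !modnMDl !modn_small // => /val_inj/enum_rank_inj ->.
  by [].
- rewrite szS; have := ix_lt v; rewrite szT => lt_v.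
  apply: leq_trans (_ : (ix v).+1 * #|K| <= _); last by rewrite leq_mul2r lt_v orbT.
  by rewrite mulSn addnC ltn_add2r ltn_ord.
- by rewrite szS card_prod.
rewrite /stepT (nth_flatten_const 0) ?size_iota //.
rewrite nth_iota // add0n (nth_map k) -?cardE // nth_enum_rank /entryT datE.
congr (_, _); first by congr Dl; apply: eq_map => w; rewrite wE nthT.
by apply: eq_map => l; rewrite nbE wE.
Qed.

End Correct.

End Local.

End GraphTables.
Import GraphTables.

(** * From functions on encoded words to Turing machines *)

Module WordFunctions.

Lemma regs_below_le r r' c : r <= r' -> regs_below r c -> regs_below r' c.
Proof.
move=> le; elim: c => //= [i _|c1 I1 c2 I2|i c1 I1 c2 I2 c3 I3|i c1 I1 c2 I2].
- by move=> lt; exact: leq_trans lt le.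
- by case/andP=> /I1-> /I2->.
- by case/and4P=> lt /I1-> /I2-> /I3->; rewrite (leq_trans lt le).
- by case/and3P=> lt /I1-> /I2->; rewrite (leq_trans lt le).
Qed.

Lemma regs_below_ex c : exists r, regs_below r.+1 c.
Proof.
elim: c => [|i b|c1 [r1 I1] c2 [r2 I2]|i c1 [r1 I1] c2 [r2 I2] c3 [r3 I3]|i c1 [r1 I1] c2 [r2 I2]].
- by exists 0.
- by exists i => /=.
- by exists (r1 + r2) => /=; rewrite (regs_below_le _ I1) ?(regs_below_le _ I2) //; lia.
- exists (i + r1 + r2 + r3) => /=.
  by rewrite (regs_below_le _ I1) ?(regs_below_le _ I2) ?(regs_below_le _ I3) ?andbT; lia.
- exists (i + r1 + r2) => /=.
  by rewrite (regs_below_le _ I1) ?(regs_below_le _ I2) ?andbT; lia.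
Qed.

Definition st2 (a b : word) : store := fun i => if i == 0 then a else if i == 1 then b else [::].

Lemma upd_st2_0 a b c : upd (st2 a b) 0 c = st2 c b.
Proof. by apply: funext => -[|[|i]]. Qed.

Lemma upd_st2_1 a b c : upd (st2 a b) 1 c = st2 a c.
Proof. by apply: funext => -[|[|i]]. Qed.

Lemma push0 a b x : runsto (Push 0 x) (st2 a b) (st2 (x :: a) b) 1.
Proof. by exists 1 => //; rewrite -[st2 (x :: a) b](upd_st2_0 a); exact: EPush. Qed.

Lemma push1 a b x : runsto (Push 1 x) (st2 a b) (st2 a (x :: b)) 1.
Proof. by exists 1 => //; rewrite -[st2 a (x :: b)](upd_st2_1 a b); exact: EPush. Qed.

Lemma runs_while i c0 c1 s b w s1 s' n m : s i = b :: w ->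
  runsto (if b then c1 else c0) (upd s i w) s1 n -> runsto (While i c0 c1) s1 s' m ->
  runsto (While i c0 c1) s s' (n + m).+3.
Proof.
by move=> si [k e1 l1] [k' e2 l2]; exists (k + k').+3; [exact: EWhileB si e1 e2 | lia].
Qed.

Lemma runs_case i cN c0 c1 s b w s' n : s i = b :: w ->
  runsto (if b then c1 else c0) (upd s i w) s' n -> runsto (Case i cN c0 c1) s s' n.+2.
Proof. by move=> si [k e1 l1]; exists k.+2; [exact: ECaseB si e1 | lia]. Qed.

(** Before the code of the tail, a list cell holding [true] contributes the bits [1100] and one
    holding [false] the bits [10]; a stack receives them last bit first. *)
Definition load_body (b : bool) : cmd :=
  if b then Seq (Push 0 false) (Seq (Push 0 false) (Seq (Push 0 true) (Push 0 true)))
  else Seq (Push 0 false) (Push 0 true).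

Definition load : cmd :=
  Seq (mv 0 1) (Seq (Push 0 false) (While 1 (load_body false) (load_body true))).

Lemma load_loop w (u : seq bool) :
  runsto (While 1 (load_body false) (load_body true)) (st2 (code (enc u)) w)
    (st2 (code (enc (catrev w u))) [::]) (12 * size w + 2).
Proof.
elim: w u => [|b w IHw] u /=; first by exists 2 => //; exact: EWhileN.
apply: runsto_le (runs_while (b := b) (w := w) (n := 8) _ _ (IHw (b :: u))) _; [by []| |lia].
rewrite upd_st2_1; case: b; rewrite /load_body.
  apply: runsto_le (runsto_seq (push0 _ _ _) (runsto_seq (push0 _ _ _) (runsto_seq (push0 _ _ _) (push0 _ _ _)))) _.
  by [].
by apply: runsto_le (runsto_seq (push0 _ _ _) (push0 _ _ _)) _.
Qed.

Lemma load_runs w : runsto load (input_store w) (st2 (code (enc w)) [::]) (16 * size w + 10).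
Proof.
have r1 := @mv_runs 0 1 (input_store w) isT.
have e1 : upd (upd (input_store w) 0 [::]) 1 (rev (input_store w 0) ++ input_store w 1) = st2 [::] (rev w).
  by apply: funext => -[|[|i]] //=; rewrite /upd /= cats0.
rewrite e1 in r1; have r2 := load_loop (rev w) [::]; rewrite size_rev in r2.
have e2 : catrev (rev w) [::] = w by rewrite catrevE revK cats0.
rewrite e2 in r2.
apply: runsto_le (runsto_seq r1 (runsto_seq (push0 _ _ _) r2)) _.
by rewrite /input_store /=; lia.
Qed.

Definition unload_loop : cmd :=
  While 0 Skip (Case 0 Skip (Push 1 false)
    (Seq (Case 0 Skip Skip Skip) (Seq (Case 0 Skip Skip Skip) (Push 1 true)))).

Lemma skip_runs s : runsto Skip s s 1. Proof. by exists 1 => //; exact: ESkip. Qed.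

Lemma pop0 b w acc : runsto (Case 0 Skip Skip Skip) (st2 (b :: w) acc) (st2 w acc) 3.
Proof.
apply: (@runs_case _ _ _ _ _ b w) => //; rewrite upd_st2_0.
by case: b; exact: skip_runs.
Qed.

Lemma unload_runs (u : seq bool) acc :
  runsto unload_loop (st2 (code (enc u)) acc) (st2 [::] (catrev u acc)) (20 * size u + 10).
Proof.
elim: u acc => [|b u IHu] acc /=.
  apply: runsto_le (runs_while (b := false) (w := [::]) (n := 1) (m := 2) _ _ _) _ => //.
    by rewrite upd_st2_0; exact: skip_runs.
  by exists 2 => //; exact: EWhileN.
apply: runsto_le (runs_while (b := true) (n := 12) _ _ (IHu (b :: acc))) _; [by []| |lia].
rewrite upd_st2_0; case: b.
  apply: (@runsto_le _ _ _ 11) => //.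
  apply: (@runs_case _ _ _ _ _ true ([:: false; false] ++ code (enc u)) _ 9) => //; rewrite upd_st2_0.
  by apply: runsto_le (runsto_seq (pop0 _ _ _) (runsto_seq (pop0 _ _ _) (push1 _ _ _))) _.
apply: (@runsto_le _ _ _ 3) => //.
apply: (@runs_case _ _ _ _ _ false (code (enc u)) _ 1) => //; rewrite upd_st2_0.
exact: push1.
Qed.

Lemma esize_word (w : seq bool) : esize w <= 4 * size w + 1.
Proof.
elim: w => // b w IHw; rewrite esize_cons /=.
by pose proof (esize_bool b); lia.
Qed.

(** The program for [f] runs at base register 0 between a conversion of the raw word to its tree
    code and one back; both are linear in the length of the word concerned. *)
Theorem pt_poly_time (f : word -> word) :
  pt (fun w : seq bool => f w : seq bool) -> poly_time f.
Proof.
move=> ptf; have [e' le_e'] := pt_esize ptf; case: (ptf) => c [e comp].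
pose cm := Seq load (Seq (c 0) (Seq unload_loop (mv 1 0))).
have [r rb] := regs_below_ex cm.
have [d dP] : poly_bd (fun n => 16 * n + 20 + (4 * n + 3) ^ e + 24 * (4 * n + 3) ^ e').
  pose M n := 16 * n + 20 + (4 * n + 3) ^ e + 24 * (4 * n + 3) ^ e'.
  have : poly_bd M by rewrite /M; pb.
  by [].
apply: (poly_time_exec (c := cm) (e := d) rb) => w.
have r1 := load_runs w.
have em : empty_above 0 (st2 (code (enc w)) [::]) by case=> [|[|j]].
have := comp 0 (st2 (code (enc w)) [::]) w (erefl _) em; rewrite upd_st2_0 => r2.
have r3 := unload_runs (f w) [::].
have r4 := @mv_runs 1 0 (st2 [::] (catrev (f w) [::])) isT.
have e4 : upd (upd (st2 [::] (catrev (f w) [::])) 1 [::]) 0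
   (rev (st2 [::] (catrev (f w) [::]) 1) ++ st2 [::] (catrev (f w) [::]) 0) = st2 (f w) [::].
  apply: funext => -[|[|i]] //=; rewrite /upd /= cats0 /st2 /=.
  by rewrite -[catrev _ _]/(rev (f w)) revK.
rewrite e4 in r4.
have [n ex le_n] := runsto_seq r1 (runsto_seq r2 (runsto_seq r3 r4)).
exists n, (st2 (f w) [::]); split=> //; apply: leq_trans le_n _; apply: leq_trans (dP _).
have h1 := esize_word w; have h2 : size (f w) < esize (f w : seq bool) by exact: size_esize.
have h3 : esize (f w : seq bool) <= (esize w + 2) ^ e' by exact: le_e'.
have h4 : (esize w + 2) ^ e <= (4 * size w + 3) ^ e by apply: leq_expl; rewrite -[3]/(1 + 2) addnA leq_add2r; exact: esize_word.
have h5 : (esize w + 2) ^ e' <= (4 * size w + 3) ^ e' by apply: leq_expl; rewrite -[3]/(1 + 2) addnA leq_add2r; exact: esize_word.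
have -> : size (st2 [::] (catrev (f w) [::]) 1) = size (f w) by exact: size_rev.
have fin (A A' X X' F E S : nat) : F < E -> E <= X -> X <= X' -> A <= A' ->
  16 * S + 10 + (A + (20 * F + 10 + (4 * F + 2)).+1).+1 < 16 * S + 20 + A' + 24 * X' by lia.
exact: fin h2 h3 h5 h4.
Qed.

End WordFunctions.
Import WordFunctions.

Module BinaryArithmetic.

(** * Binary arithmetic *)

Definition val2 (w : seq bool) : nat := foldr (fun (b : bool) n => b + 2 * n) 0 w.

Lemma val2_rcons s (b : bool) : val2 (rcons s b) = val2 s + b * 2 ^ size s.
Proof.
elim: s => [|a s IHs] /=; first by rewrite expn0; lia.
by rewrite -/(val2 (rcons s b)) IHs -/(val2 s) expnS; lia.
Qed.

Lemma val2_take s i : val2 (take i.+1 s) = val2 (take i s) + nth false s i * 2 ^ i.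
Proof.
have [lt|ge] := ltnP i (size s).
  by rewrite (take_nth false) // val2_rcons size_takel // ltnW.
by rewrite nth_default // !take_oversize ?addn0 // ltnW.
Qed.

Lemma val2_take_lt s i : val2 (take i s) < 2 ^ i.
Proof.
elim: i => [|i IHi]; first by rewrite take0.
rewrite val2_take expnS; case: (nth false s i); lia.
Qed.

Lemma iota_rcons n : iota 0 n.+1 = rcons (iota 0 n) n.
Proof. by rewrite -addn1 iotaD /= cats1. Qed.

Definition add_step (u v : seq bool) (p : bool * seq bool) (i : nat) : bool * seq bool :=
  let a := nth false u i in let b := nth false v i in
  (if a == b then a else p.1, (a (+) b (+) p.1) :: p.2).

Definition addw (u v : seq bool) : seq bool :=
  let r := foldl (add_step u v) (false, [::]) (iota 0 (maxn (size u) (size v))) in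
  rev (r.1 :: r.2).

Lemma add_inv u v n : let r := foldl (add_step u v) (false, [::]) (iota 0 n) in
  size r.2 = n /\ val2 (rev r.2) + r.1 * 2 ^ n = val2 (take n u) + val2 (take n v).
Proof.
elim: n => [|n]; first by rewrite /= !take0.
cbv zeta; rewrite iota_rcons foldl_rcons.
case: (foldl (add_step u v) (false, [::]) (iota 0 n)) => c acc /= [sz IH].
rewrite sz; split=> //; rewrite rev_cons val2_rcons size_rev sz !val2_take expnS.
by move: IH; case: (nth false u n); case: (nth false v n); case: c => /=; lia.
Qed.

Lemma val_addw u v : val2 (addw u v) = val2 u + val2 v.
Proof.
rewrite /addw; set n := maxn _ _; have [sz] := add_inv u v n.
rewrite !take_oversize ?leq_maxl ?leq_maxr // => <-.
by rewrite rev_cons val2_rcons size_rev sz.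
Qed.

Lemma size_addw u v : size (addw u v) = (maxn (size u) (size v)).+1.
Proof. by rewrite /addw size_rev /=; have [->] := add_inv u v (maxn (size u) (size v)). Qed.

(** Horner's rule from the most significant bit of [u]; words are read with the least significant
    bit first. *)
Definition mulw (u v : seq bool) : seq bool :=
  foldl (fun acc (b : bool) => addw (if b then v else [::]) (false :: acc)) [::] (rev u).

Lemma val_mulw u v : val2 (mulw u v) = val2 u * val2 v.
Proof.
rewrite /mulw foldl_rev; elim: u => //= b u IHu.
by rewrite val_addw /= IHu -/(val2 u); case: b => /=; lia.
Qed.

(** The coefficient 1 of [size v] matters: with the accumulator as second factor, as in [fadd], a
    long sum of fractions grows additively ([fsz_fadd]) instead of doubling at each term. *)
Lemma size_mulw_take u v i :
  size (foldl (fun acc (b : bool) => addw (if b then v else [::]) (false :: acc)) [::] (take i (rev u)))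
  <= size v + 2 * size u.
Proof.
have h (s : seq bool) : size (foldl (fun acc (b : bool) => addw (if b then v else [::]) (false :: acc)) [::] s) <= size v + 2 * size s.
  elim/last_ind: s => //= s b IHs; rewrite foldl_rcons size_addw size_rcons /=.
  by case: b => /=; lia.
apply: leq_trans (h _) _; have : size (take i (rev u)) <= size u by rewrite size_take_min size_rev geq_minr.
by lia.
Qed.

Lemma size_mulw u v : size (mulw u v) <= size v + 2 * size u.
Proof. by have := size_mulw_take u v (size u); rewrite take_oversize ?size_rev. Qed.

(** The bits are scanned upwards, so the highest place of difference has the last word. *)
Definition leq_step (u v : seq bool) (r : bool) (i : nat) : bool :=
  if nth false u i == nth false v i then r else nth false v i.

Definition leqw (u v : seq bool) : bool :=
  foldl (leq_step u v) true (iota 0 (maxn (size u) (size v))).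

Lemma leqwE u v : leqw u v = (val2 u <= val2 v).
Proof.
have h n : foldl (leq_step u v) true (iota 0 n) = (val2 (take n u) <= val2 (take n v)).
  elim: n => [|n IHn]; first by rewrite !take0.
  rewrite iota_rcons foldl_rcons IHn /leq_step !val2_take.
  have h1 := val2_take_lt u n; have h2 := val2_take_lt v n.
  by case: (nth false u n); case: (nth false v n) => /=; lia.
by rewrite /leqw h !take_oversize ?leq_maxl ?leq_maxr.
Qed.

Lemma esize_size (w : seq bool) : size w <= esize w.
Proof. by apply: ltnW; exact: size_esize. Qed.

(* Growth is additive in the measure [mu] but not in [esize], whose ratio to
   [mu] is only bounded. *)
Lemma pt_foldl_mu {X A S : Type} {eX : Enc X} {eA : Enc A} {eS : Enc S} (mu : S -> nat) c N
    (a0 : A) (step : X -> S -> A -> S) (init : X -> S) (l : X -> seq A) :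
  pt (fun p : X * (S * A) => step p.1 p.2.1 p.2.2) -> pt init -> pt l -> poly_bd N ->
  (forall b, esize b <= c * mu b + c) ->
  (forall x b a, esize a <= esize (l x) -> mu (step x b a) <= mu b + N (esize x)) ->
  (forall x, mu (init x) <= N (esize x)) ->
  pt (fun x => foldl (step x) (init x) (l x)).
Proof.
move=> pts pti ptl pN mu_e mu_step mu_init; have [e le_e] := pt_esize ptl.
apply: (pt_foldl (N := fun m => c * (N m + (m + 2) ^ e * N m) + c) a0 pts pti ptl); first by pb.
move=> x i; have h s m : esize s <= esize (l x) -> forall b, mu b <= m ->
    mu (foldl (step x) b s) <= m + size s * N (esize x).
  elim: s m => [|a s IHs] m /=; first by move=> _ b; rewrite addn0.
  rewrite esize_cons => le b le_b.
  have le1 : esize a <= esize (l x) by lia.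
  have le2 : esize s <= esize (l x) by lia.
  have := IHs (m + N (esize x)) le2 (step x b a); rewrite mulSn addnA; apply.
  by have := mu_step x b a le1; lia.
apply: leq_trans (mu_e _) _; rewrite leq_add2r leq_mul2l; apply/orP; right.
have := h (take i (l x)) _ (esize_take _ _) _ (mu_init x); move/leq_trans; apply.
rewrite leq_add2l leq_mul2r; apply/orP; right.
pose proof (size_esize (l x)) as h1; have h2 := le_e x.
have h3 : size (take i (l x)) <= size (l x) by rewrite size_take_min geq_minr.
exact: leq_trans h3 (leq_trans (ltnW h1) h2).
Qed.

Section Ops.

Context {X : Type} {eX : Enc X}.

Lemma pt_max (f g : X -> nat) : pt f -> pt g -> pt (fun x => maxn (f x) (g x)).
Proof. by move=> ptf ptg; apply: pt_ext (pt_add ptf (pt_sub ptg ptf)) _ => x; rewrite maxnE. Qed.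

Lemma pt_addw (u v : X -> seq bool) : pt u -> pt v -> pt (fun x => addw (u x) (v x)).
Proof.
move=> ptu ptv.
have ptn : pt (fun x => iota 0 (maxn (size (u x)) (size (v x)))) by apply: pt_iota; apply: pt_max; exact: pt_size.
have ptf : pt (fun x => foldl (add_step (u x) (v x)) (false, [::]) (iota 0 (maxn (size (u x)) (size (v x))))).
  apply: (pt_foldl_mu (mu := fun p : bool * seq bool => size p.2) (c := 10) (N := fun=> 1) 0 (step := fun x => add_step (u x) (v x))) => //.
  - have p1 : pt (fun p : X * ((bool * seq bool) * nat) => p.1) by exact: pt_fst pt_id.
    have p21 : pt (fun p : X * ((bool * seq bool) * nat) => p.2.1) by exact: pt_fst (pt_snd pt_id).
    have p22 : pt (fun p : X * ((bool * seq bool) * nat) => p.2.2) by exact: pt_snd (pt_snd pt_id).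
    have pu : pt (fun p : X * ((bool * seq bool) * nat) => nth false (u p.1) p.2.2) by apply: pt_nth => //; exact: (pt_comp ptu p1).
    have pv : pt (fun p : X * ((bool * seq bool) * nat) => nth false (v p.1) p.2.2) by apply: pt_nth => //; exact: (pt_comp ptv p1).
    apply: pt_pair; first by apply: pt_if; [exact: pt_eqb | by [] | exact: pt_fst p21].
    by apply: pt_cons; [apply: pt_xor; [exact: pt_xor | exact: pt_fst p21] | exact: pt_snd p21].
  - exact: pt_cst.
  - by pb.
  - case=> c w; rewrite esize_pair /=; pose proof (esize_bool c); pose proof (esize_word w); lia.
  - by move=> x b a _; rewrite /add_step /= addn1.
exact: pt_rev (pt_cons (pt_fst ptf) (pt_snd ptf)).
Qed.

Lemma pt_leqw (u v : X -> seq bool) : pt u -> pt v -> pt (fun x => leqw (u x) (v x)).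
Proof.
move=> ptu ptv.
apply: (pt_foldl (N := fun=> 3) 0 (step := fun x => leq_step (u x) (v x))).
- have p1 : pt (fun p : X * (bool * nat) => p.1) by exact: pt_fst pt_id.
  have p21 : pt (fun p : X * (bool * nat) => p.2.1) by exact: pt_fst (pt_snd pt_id).
  have p22 : pt (fun p : X * (bool * nat) => p.2.2) by exact: pt_snd (pt_snd pt_id).
  have pu : pt (fun p : X * (bool * nat) => nth false (u p.1) p.2.2) by apply: pt_nth => //; exact: (pt_comp ptu p1).
  have pv : pt (fun p : X * (bool * nat) => nth false (v p.1) p.2.2) by apply: pt_nth => //; exact: (pt_comp ptv p1).
  by apply: pt_if => //; exact: pt_eqb.
- exact: pt_cst.
- by apply: pt_iota; apply: pt_max; exact: pt_size.
- by pb.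
by move=> x i; exact: esize_bool.
Qed.

End Ops.

Section Ops2.

Context {X : Type} {eX : Enc X}.

Lemma pt_mulw (u v : X -> seq bool) : pt u -> pt v -> pt (fun x => mulw (u x) (v x)).
Proof.
move=> ptu ptv; have [e le_e] := pt_esize ptu; have [e' le_e'] := pt_esize ptv.
apply: (pt_foldl (N := fun m => 4 * ((m + 2) ^ e' + 2 * (m + 2) ^ e) + 1) false
  (step := fun x acc (b : bool) => addw (if b then v x else [::]) (false :: acc))).
- have p1 : pt (fun p : X * (seq bool * bool) => p.1) by exact: pt_fst pt_id.
  have p21 : pt (fun p : X * (seq bool * bool) => p.2.1) by exact: pt_fst (pt_snd pt_id).
  have p22 : pt (fun p : X * (seq bool * bool) => p.2.2) by exact: pt_snd (pt_snd pt_id).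
  apply: pt_addw; first by apply: pt_if => //; [exact: (pt_comp ptv p1) | exact: pt_cst].
  by apply: pt_cons => //; exact: pt_cst.
- exact: pt_cst.
- exact: pt_rev.
- by pb.
move=> x i; apply: leq_trans (esize_word _) _; rewrite leq_add2r leq_mul2l /=.
apply: leq_trans (size_mulw_take _ _ _) _; apply: leq_add; first exact: leq_trans (esize_size _) (le_e' x).
by rewrite leq_mul2l /=; exact: leq_trans (esize_size _) (le_e x).
Qed.

End Ops2.

(** The triple [(a, (b, c))] stands for the fraction [(a - b) / c]; keeping the two parts of the
    numerator apart avoids signed arithmetic. *)
Definition tfrac : Type := (seq bool * (seq bool * seq bool))%type.
Definition fsz (f : tfrac) : nat := maxn (size f.1) (maxn (size f.2.1) (size f.2.2)).

Definition fadd (a t : tfrac) : tfrac :=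
  (addw (mulw t.2.2 a.1) (mulw t.1 a.2.2),
   (addw (mulw t.2.2 a.2.1) (mulw t.2.1 a.2.2), mulw t.2.2 a.2.2)).

Definition fle (a b : tfrac) : bool :=
  leqw (addw (mulw a.1 b.2.2) (mulw b.2.1 a.2.2)) (addw (mulw b.1 a.2.2) (mulw a.2.1 b.2.2)).

Definition fzero : tfrac := ([::], ([::], [:: true])).

Lemma fsz_fadd a t : fsz (fadd a t) <= fsz a + (2 * fsz t + 1).
Proof.
rewrite /fsz /fadd /= !size_addw.
have h1 := size_mulw t.2.2 a.1; have h2 := size_mulw t.1 a.2.2.
have h3 := size_mulw t.2.2 a.2.1; have h4 := size_mulw t.2.1 a.2.2; have h5 := size_mulw t.2.2 a.2.2.
by lia.
Qed.

Lemma fsz_esize (f : tfrac) : fsz f <= esize f.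
Proof.
case: f => a [b c]; rewrite !esize_pair /fsz /=.
have h1 := esize_size a; have h2 := esize_size b; have h3 := esize_size c; lia.
Qed.

Lemma esize_frac (f : tfrac) : esize f <= 20 * fsz f + 20.
Proof.
case: f => a [b c]; rewrite !esize_pair /fsz /=.
have h1 := esize_word a; have h2 := esize_word b; have h3 := esize_word c; lia.
Qed.

Definition zrat : Type := ((bool * seq bool) * (bool * seq bool))%type.

(** The square of the difference between the bit [x] and a signed fraction of absolute value
    [n / d], over the denominator [d ^ 2]. The mixed term [2 x n d] joins the positive part for a
    negative fraction and the negative part otherwise; prefixing [false] doubles. *)
Definition fterm (x : bool) (r : zrat) : tfrac :=
  let n := r.1.2 in let d := r.2.2 in let dd := mulw d d in let nd := false :: mulw n d in
  (addw (if x then dd else [::]) (addw (mulw n n) (if x && r.1.1 then nd else [::])),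
   (if x && ~~ r.1.1 then nd else [::], dd)).

Section Frac.

Context {X : Type} {eX : Enc X}.

Lemma pt_fadd (a t : X -> tfrac) : pt a -> pt t -> pt (fun x => fadd (a x) (t x)).
Proof.
move=> pa ptt; have a1 := pt_fst pa; have a2 := pt_fst (pt_snd pa); have a3 := pt_snd (pt_snd pa).
have t1 := pt_fst ptt; have t2 := pt_fst (pt_snd ptt); have t3 := pt_snd (pt_snd ptt).
apply: pt_pair; first by apply: pt_addw; exact: pt_mulw.
by apply: pt_pair; [apply: pt_addw; exact: pt_mulw | exact: pt_mulw].
Qed.

Lemma pt_fle (a t : X -> tfrac) : pt a -> pt t -> pt (fun x => fle (a x) (t x)).
Proof.
move=> pa ptt; have a1 := pt_fst pa; have a2 := pt_fst (pt_snd pa); have a3 := pt_snd (pt_snd pa).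
have t1 := pt_fst ptt; have t2 := pt_fst (pt_snd ptt); have t3 := pt_snd (pt_snd ptt).
by apply: pt_leqw; apply: pt_addw; exact: pt_mulw.
Qed.

Lemma pt_fterm (b : X -> bool) (r : X -> zrat) : pt b -> pt r -> pt (fun x => fterm (b x) (r x)).
Proof.
move=> pb0 pr; have s1 := pt_fst (pt_fst pr); have n1 := pt_snd (pt_fst pr); have d1 := pt_snd (pt_snd pr).
have dd := pt_mulw d1 d1; have nd := pt_cons (pt_cst false) (pt_mulw n1 d1).
have nil : pt (fun _ : X => [::] : seq bool) by exact: pt_cst.
apply: pt_pair.
  apply: pt_addw; first exact: pt_if.
  apply: pt_addw; first exact: pt_mulw.
  by apply: pt_if => //; exact: pt_and.
apply: pt_pair => //; apply: pt_if => //; apply: pt_and => //; exact: pt_neg.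
Qed.

End Frac.

Definition zdef : zrat := ((false, [::]), (false, [:: true])).

(** The point is an edge: its coordinates are 1 at the two components of [p] and 0 elsewhere. *)
Definition fdist (d : nat) (p : nat * nat) (c : seq zrat) : tfrac :=
  foldl (fun acc j => fadd acc (fterm ((j == p.1) || (j == p.2)) (nth zdef c j))) fzero (iota 0 d).

Definition fmin (a t : tfrac) : tfrac := if fle a t then a else t.

Definition fmindist (d : nat) (p : nat * nat) (cs : seq (seq zrat)) : tfrac :=
  foldl (fun a c => fmin a (fdist d p c)) (fdist d p (head [::] cs)) cs.

Definition fcost (d : nat) (ps : seq (nat * nat)) (cs : seq (seq zrat)) : tfrac :=
  foldl (fun a p => fadd a (fmindist d p cs)) fzero ps.

Section Cost.

Context {X : Type} {eX : Enc X}.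

Lemma pt_fdist (d : X -> nat) (p : X -> nat * nat) (c : X -> seq zrat) :
  pt d -> pt p -> pt c -> pt (fun x => fdist (d x) (p x) (c x)).
Proof.
move=> ptd ptp ptc.
have ptt : pt (fun q : X * nat => fterm ((q.2 == (p q.1).1) || (q.2 == (p q.1).2)) (nth zdef (c q.1) q.2)).
  have q1 : pt (fun q : X * nat => q.1) by exact: pt_fst pt_id.
  have q2 : pt (fun q : X * nat => q.2) by exact: pt_snd pt_id.
  have qp := pt_comp ptp q1; have qc := pt_comp ptc q1.
  apply: pt_fterm; last exact: pt_nth.
  by apply: pt_or; apply: pt_eqn => //; [exact: pt_fst | exact: pt_snd].
have [e le_e] := pt_esize ptt; have [e' le_e'] := pt_esize (pt_iota ptd).
apply: (pt_foldl_mu (mu := fsz) (c := 20) (N := fun m => 2 * (m + (m + 2) ^ e' + 3) ^ e + 1) 0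
  (step := fun x acc j => fadd acc (fterm ((j == (p x).1) || (j == (p x).2)) (nth zdef (c x) j)))).
- apply: pt_fadd; first exact: pt_fst (pt_snd pt_id).
  apply: (pt_comp (f := fun q : X * (tfrac * nat) => (q.1, q.2.2)) ptt).
  by apply: pt_pair; [exact: pt_fst pt_id | exact: pt_snd (pt_snd pt_id)].
- exact: pt_cst.
- exact: pt_iota.
- by pb.
- exact: esize_frac.
- move=> x b a le_a; apply: leq_trans (fsz_fadd _ _) _; rewrite leq_add2l leq_add2r leq_mul2l /=.
  apply: leq_trans (fsz_esize _) _; apply: leq_trans (le_e (x, a)) _; apply: leq_expl.
  by rewrite esize_pair; have := le_e' x; lia.
by move=> x; rewrite /fsz /= addn1.
Qed.

End Cost.

Section Cost2.

Context {X : Type} {eX : Enc X}.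

Lemma pt_fmindist (d : X -> nat) (p : X -> nat * nat) (cs : X -> seq (seq zrat)) :
  pt d -> pt p -> pt cs -> pt (fun x => fmindist (d x) (p x) (cs x)).
Proof.
move=> ptd ptp ptc.
have ptt : pt (fun q : X * seq zrat => fdist (d q.1) (p q.1) q.2).
  have q1 : pt (fun q : X * seq zrat => q.1) by exact: pt_fst pt_id.
  by apply: pt_fdist; [exact: (pt_comp ptd q1) | exact: (pt_comp ptp q1) | exact: pt_snd pt_id].
have pti : pt (fun x => fdist (d x) (p x) (head [::] (cs x))) by apply: pt_fdist => //; exact: pt_head.
have [e le_e] := pt_esize ptt; have [e' le_e'] := pt_esize ptc; have [e2 le_e2] := pt_esize pti.
apply: (pt_foldl_mu (mu := fsz) (c := 20) (N := fun m => (m + (m + 2) ^ e' + 3) ^ e + (m + 2) ^ e2) [::]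
  (step := fun x a c => fmin a (fdist (d x) (p x) c))) => //.
- have ptd2 : pt (fun q : X * (tfrac * seq zrat) => fdist (d q.1) (p q.1) q.2.2).
    apply: (pt_comp (f := fun q : X * (tfrac * seq zrat) => (q.1, q.2.2)) ptt).
    by apply: pt_pair; [exact: pt_fst pt_id | exact: pt_snd (pt_snd pt_id)].
  have pa : pt (fun q : X * (tfrac * seq zrat) => q.2.1) by exact: pt_fst (pt_snd pt_id).
  by apply: pt_if => //; exact: pt_fle.
- by pb.
- exact: esize_frac.
- move=> x b a le_a; rewrite /fmin; case: ifP => _; first exact: leq_addr.
  apply: leq_trans (leq_addl _ _); apply: leq_trans (leq_addr _ _).
  apply: leq_trans (fsz_esize _) _; apply: leq_trans (le_e (x, a)) _; apply: leq_expl.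
  by rewrite esize_pair; have := le_e' x; lia.
by move=> x; apply: leq_trans (leq_addl _ _); exact: leq_trans (fsz_esize _) (le_e2 x).
Qed.

End Cost2.

Section Cost3.

Context {X : Type} {eX : Enc X}.

Lemma pt_fcost (d : X -> nat) (ps : X -> seq (nat * nat)) (cs : X -> seq (seq zrat)) :
  pt d -> pt ps -> pt cs -> pt (fun x => fcost (d x) (ps x) (cs x)).
Proof.
move=> ptd ptp ptc.
have ptt : pt (fun q : X * (nat * nat) => fmindist (d q.1) q.2 (cs q.1)).
  have q1 : pt (fun q : X * (nat * nat) => q.1) by exact: pt_fst pt_id.
  by apply: pt_fmindist; [exact: (pt_comp ptd q1) | exact: pt_snd pt_id | exact: (pt_comp ptc q1)].
have [e le_e] := pt_esize ptt; have [e' le_e'] := pt_esize ptp.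
apply: (pt_foldl_mu (mu := fsz) (c := 20) (N := fun m => 2 * (m + (m + 2) ^ e' + 3) ^ e + 1) (0, 0)
  (step := fun x a p => fadd a (fmindist (d x) p (cs x)))) => //.
- apply: pt_fadd; first exact: pt_fst (pt_snd pt_id).
  apply: (pt_comp (f := fun q : X * (tfrac * (nat * nat)) => (q.1, q.2.2)) ptt).
  by apply: pt_pair; [exact: pt_fst pt_id | exact: pt_snd (pt_snd pt_id)].
- exact: pt_cst.
- by pb.
- exact: esize_frac.
- move=> x b a le_a; apply: leq_trans (fsz_fadd _ _) _; rewrite leq_add2l leq_add2r leq_mul2l /=.
  apply: leq_trans (fsz_esize _) _; apply: leq_trans (le_e (x, a)) _; apply: leq_expl.
  by rewrite esize_pair; have := le_e' x; lia.
by move=> x; rewrite /fsz /= addn1.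
Qed.

End Cost3.

End BinaryArithmetic.
Import BinaryArithmetic.

Module EdgeClusters.

Import Order.TTheory GRing.Theory Num.Theory.
Local Open Scope ring_scope.

(** * Clusters of edges *)

Section Clusters.

Variables (R : realFieldType) (N M : finType) (A : M -> {set N}).
Hypothesis cardA : forall m, #|A m| = 2.
Hypothesis simpleA : forall m m', m != m' -> (#|A m :&: A m'| <= 1)%N.
Hypothesis trifree : forall w m, w \notin A m ->
  (#|[set m' | (w \in A m') && (A m :&: A m' != set0)]| <= 1)%N.

Definition pnt (m : M) (n : N) : R := (n \in A m)%:R.
Definition sd (x c : N -> R) : R := \sum_n (x n - c n) ^+ 2.

Lemma sum_mem (B : {set N}) : \sum_n (n \in B)%:R = #|B|%:R :> R.
Proof.
by rewrite -natr_sum -sum1_card [in RHS]big_mkcond.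
Qed.

Lemma sd_pnt m m' : sd (pnt m) (pnt m') = 4 - 2 * #|A m :&: A m'|%:R.
Proof.
transitivity (\sum_n ((n \in A m)%:R + (n \in A m')%:R - 2 * (n \in A m :&: A m')%:R : R)).
  apply: eq_bigr => n _; rewrite /pnt inE.
  by case: (n \in A m); case: (n \in A m'); rewrite /= ?mulr1n ?mulr0n; ring.
rewrite sumrB big_split /= -mulr_sumr !sum_mem !cardA; ring.
Qed.

Lemma pair_sum (S : {set M}) (b : M -> R) :
  \sum_(m in S) \sum_(m' in S) (b m - b m') ^+ 2 =
  2 * #|S|%:R * \sum_(m in S) b m ^+ 2 - 2 * (\sum_(m in S) b m) ^+ 2.
Proof.
have e1 : \sum_(m in S) \sum_(m' in S) b m ^+ 2 = #|S|%:R * \sum_(m in S) b m ^+ 2.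
  by rewrite mulr_sumr; apply: eq_bigr => m _; rewrite sumr_const mulr_natl.
have e2 : \sum_(m in S) \sum_(m' in S) b m' ^+ 2 = #|S|%:R * \sum_(m in S) b m ^+ 2.
  by rewrite sumr_const mulr_natl.
transitivity (\sum_(m in S) \sum_(m' in S) b m ^+ 2 + \sum_(m in S) \sum_(m' in S) b m' ^+ 2
   - 2 * \sum_(m in S) \sum_(m' in S) b m * b m').
  rewrite mulr_sumr -big_split -sumrB; apply: eq_bigr => m _ /=.
  rewrite mulr_sumr -big_split -sumrB; apply: eq_bigr => m' _ /=; ring.
by rewrite e1 e2 expr2 big_distrlr /=; ring.
Qed.

(** The subtracted squares measure how far [c] is from the centroid. Dropping them gives a lower
    bound for every center, and they vanish at the centroid. *)
Lemma pair_sd (S : {set M}) (c : N -> R) :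
  \sum_(m in S) \sum_(m' in S) sd (pnt m) (pnt m') =
  2 * #|S|%:R * \sum_(m in S) sd (pnt m) c -
  2 * \sum_n (\sum_(m in S) (pnt m n - c n)) ^+ 2.
Proof.
transitivity (\sum_n \sum_(m in S) \sum_(m' in S) (pnt m n - pnt m' n) ^+ 2).
  rewrite [RHS]exchange_big; apply: eq_bigr => m _ /=.
  by rewrite [RHS]exchange_big.
have -> : \sum_(m in S) sd (pnt m) c = \sum_n \sum_(m in S) (pnt m n - c n) ^+ 2.
  by rewrite [RHS]exchange_big.
rewrite !mulr_sumr -sumrB; apply: eq_bigr => n _.
rewrite -(pair_sum S (fun m => pnt m n - c n)).
by apply: eq_bigr => m _; apply: eq_bigr => m' _; congr (_ ^+ 2); ring.
Qed.

Definition dj (m m' : M) : nat := (A m :&: A m' == set0).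
Definition Q (S : {set M}) : nat := (\sum_(m in S) \sum_(m' in S) dj m m')%N.

Lemma cardsD1R (S : {set M}) m : m \in S -> #|S|%:R = 1 + #|S :\ m|%:R :> R.
Proof. by move=> mS; rewrite (cardsD1 m S) mS natrD. Qed.

(** In the pairwise form of the cost, two distinct edges are at squared distance 2 if they meet and
    4 if they are disjoint. After halving, each ordered pair of distinct edges counts 1, with an
    excess of 1 for each of the [Q S] disjoint ones. *)
Lemma cluster_lower (S : {set M}) c : S != set0 ->
  #|S|%:R - 1 + (Q S)%:R / #|S|%:R <= \sum_(m in S) sd (pnt m) c.
Proof.
rewrite -card_gt0 => S0; have s0 : 0 < #|S|%:R :> R by rewrite ltr0n.
have key : #|S|%:R * (#|S|%:R - 1) + (Q S)%:R <= 2^-1 * \sum_(m in S) \sum_(m' in S) sd (pnt m) (pnt m').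
  have -> : #|S|%:R * (#|S|%:R - 1) + (Q S)%:R =
     \sum_(m in S) \sum_(m' in S) ((m != m')%:R + (dj m m')%:R : R).
    rewrite /Q natr_sum.
    have -> : #|S|%:R * (#|S|%:R - 1) = \sum_(m in S) \sum_(m' in S) (m != m')%:R :> R.
      rewrite -[X in X * _ = _]mulr1 -mulrA mul1r.
      transitivity (\sum_(m in S) (#|S|%:R - 1) : R).
        by rewrite sumr_const mulr_natl.
      apply: eq_bigr => m mS; rewrite (bigD1 m) //= eqxx add0r.
      rewrite (eq_bigr (fun=> 1)); last by move=> m' /andP[_ ne]; rewrite eq_sym ne.
      rewrite sumr_const.
      have -> : #|[pred i | i \in S & i != m]| = #|S :\ m|.
        by apply: eq_card => i; rewrite !inE andbC.
      by rewrite (cardsD1R mS); ring.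
    rewrite -big_split; apply: eq_bigr => m _ /=.
    by rewrite natr_sum -big_split.
  rewrite mulr_sumr; apply: ler_sum => m _; rewrite mulr_sumr; apply: ler_sum => m' _.
  rewrite sd_pnt /dj; have [->|ne] := eqVneq m m'.
    rewrite setIid cardA.
    have -> : (A m' == set0) = false by apply/eqP => e; have := cardA m'; rewrite e cards0.
    by rewrite /= ?mulr0n; lra.
  have := simpleA ne; have [->|nz] := eqVneq (A m :&: A m') set0.
    by rewrite cards0 /= ?mulr1n; lra.
  case: (#|_|) => [|[|//]] _ /=; rewrite ?mulr1n ?mulr0n; lra.
have := pair_sd S c.
have : 0 <= \sum_n (\sum_(m in S) (pnt m n - c n)) ^+ 2.
  by apply: sumr_ge0 => n _; exact: sqr_ge0.
set q := \sum_n _; set D := \sum_(m in S) \sum_(m' in S) _ in key *.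
set E := \sum_(m in S) _ => q0 e.
rewrite -(ler_pM2l s0) mulrDr [_ * (_ / _)]mulrCA divff ?gt_eqF // mulr1.
by apply: le_trans key _; rewrite e; lra.
Qed.

Lemma cluster_upper (S : {set M}) : S != set0 ->
  (forall m m', m \in S -> m' \in S -> A m :&: A m' != set0) ->
  \sum_(m in S) sd (pnt m) (fun n => (\sum_(m in S) pnt m n) / #|S|%:R) <= #|S|%:R - 1.
Proof.
rewrite -card_gt0 => S0 sh; have s0 : 0 < #|S|%:R :> R by rewrite ltr0n.
pose c : N -> R := fun n => (\sum_(m in S) pnt m n) / #|S|%:R; rewrite -/c.
have := pair_sd S c; rewrite [X in _ - 2 * X]big1 ?mulr0 ?subr0; last first.
  move=> n _; rewrite sumrB sumr_const -[_ *+ #|S|]mulr_natl /c mulrCA divff ?gt_eqF // mulr1.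
  by rewrite subrr expr0n.
have : \sum_(m in S) \sum_(m' in S) sd (pnt m) (pnt m') <= 2 * #|S|%:R * (#|S|%:R - 1).
  have -> : 2 * #|S|%:R * (#|S|%:R - 1) = \sum_(m in S) (2 * (#|S|%:R - 1)) :> R.
    by rewrite sumr_const -mulr_natl; ring.
  apply: ler_sum => m mS; rewrite (bigD1 m) //= sd_pnt setIid cardA.
  have -> : 2 * (#|S|%:R - 1) = \sum_(m' in S | m' != m) 2 :> R.
    rewrite sumr_const.
    have -> : #|[pred i | i \in S & i != m]| = #|S :\ m|.
      by apply: eq_card => i; rewrite !inE andbC.
    by rewrite (cardsD1R mS) -mulr_natr; ring.
  have -> : 4 - 2 * 2%:R = 0 :> R by lra.
  rewrite add0r; apply: ler_sum => m' /andP[m'S _]; rewrite sd_pnt.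
  have := sh _ _ mS m'S; rewrite -card_gt0; case: #|_| => // k _.
  by rewrite -natr1; have : 0 <= k%:R :> R := ler0n _ _; lra.
move=> le e; rewrite e in le.
by rewrite -(ler_pM2l (_ : 0 < 2 * #|S|%:R)) // mulr_gt0.
Qed.

Section Cover.

Variable S : {set M}.
Hypothesis S0 : S != set0.

Definition starS (n : N) := [set m in S | n \in A m].

(** The cover consists of a vertex [w] of maximal degree [D0] in the cluster and one end of each of
    the [T0] edges that avoid [w]. It has at most [1 + T0] vertices, so [T0] has to be charged to
    the disjoint pairs. *)
Lemma cover_ex : exists Z : {set N}, (forall m, m \in S -> A m :&: Z != set0) /\
  (#|Z| * #|S| <= #|S| + 3 * Q S)%N.
Proof.
have [m0 m0S] := set0Pn _ S0.
have [n0 n0A] : exists n, n \in A m0 by apply/set0Pn; rewrite -card_gt0 cardA.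
pose w := [arg max_(n > n0) #|starS n|].
have wmax n : (#|starS n| <= #|starS w|)%N.
  by rewrite /w; case: arg_maxnP => // i _; apply.
set D := starS w; pose T := S :\: D.
have DS : D \subset S by apply/subsetP => m; rewrite inE => /andP[].
have cT : (#|T| + #|D| = #|S|)%N.
  by rewrite cardsD (setIidPr DS) subnK // subset_leq_card.
have D1 : (0 < #|D|)%N.
  apply: leq_trans (wmax n0); apply/card_gt0P; exists m0; by rewrite inE m0S.
have pick m : exists n, n \in A m by apply/set0Pn; rewrite -card_gt0 cardA.
pose ch m := xchoose (pick m).
exists (w |: [set ch m | m in T]); split=> [m mS|].
  apply/set0Pn; have [wm|wm] := boolP (w \in A m).
    by exists w; rewrite !inE wm eqxx.
  exists (ch m); rewrite !inE (xchooseP (pick m)) /=; apply/orP; right.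
  by apply: imset_f; rewrite !inE mS wm.
have cZ : (#|w |: [set ch m | m in T]| <= 1 + #|T|)%N.
  rewrite cardsU1; apply: leq_add; first by case: (_ \notin _).
  exact: leq_imset_card.
(* Without triangles, an edge avoiding [w] meets at most one edge of the star at [w]; each disjoint
   pair is counted in both orders. *)
have b1 : (2 * (#|T| * (#|D| - 1)) <= Q S)%N.
  have tri m : m \in T -> (#|D| - 1 <= \sum_(m' in D) dj m m')%N.
    rewrite !inE => /andP[nD mS]; have wm : w \notin A m by move: nD; rewrite mS.
    have : (\sum_(m' in D) dj m m' + \sum_(m' in D) (A m :&: A m' != set0) = #|D|)%N.
      rewrite -big_split -sum1_card; apply: eq_bigr => m' _ /=.
      by rewrite /dj; case: eqP.
    have : (\sum_(m' in D) (A m :&: A m' != set0) <= 1)%N.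
      apply: leq_trans (trifree wm); rewrite -sum1dep_card big_mkcond [X in (_ <= X)%N]big_mkcond.
      by apply: leq_sum => m' _; rewrite !inE; case: (m' \in S); case: (w \in _); case: eqP.
    lia.
  have tot : (#|T| * (#|D| - 1) <= \sum_(m in T) \sum_(m' in D) dj m m')%N.
    by rewrite -sum_nat_const; apply: leq_sum.
  have sp (F : M -> nat) : (\sum_(m in S) F m = \sum_(m in T) F m + \sum_(m in D) F m)%N.
    rewrite (bigID (mem D)) /= addnC; congr (_ + _)%N; apply: eq_bigl => m.
      by rewrite !inE andbC; case: (m \in S) => //=; rewrite ?andbT ?andbF.
    by rewrite !inE andbA andbb.
  rewrite /Q sp; apply: leq_trans (_ : \sum_(m in T) \sum_(m' in D) dj m m' +
     \sum_(m in D) \sum_(m' in T) dj m m' <= _)%N.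
    rewrite [X in (_ <= _ + X)%N]exchange_big /=.
    have -> : (\sum_(j in T) \sum_(i in D) dj i j = \sum_(m in T) \sum_(m' in D) dj m m')%N.
      by apply: eq_bigr => j _; apply: eq_bigr => i _; rewrite /dj setIC.
    lia.
  by apply: leq_add; apply: leq_sum => m _; rewrite sp ?leq_addl ?leq_addr.
(* By maximality of [w], an edge meets at most [2 * #|D| - 1] edges of the cluster, itself
   included. *)
have b2 : (#|S| * (#|S| + 1) <= Q S + #|S| * (2 * #|D|))%N.
  rewrite -!sum_nat_const /Q -big_split; apply: leq_sum => m mS /=.
  have [p [q [npq Am]]] : exists p q, p != q /\ A m = [set p; q].
    by have /eqP/cards2P[p [q [npq e]]] := cardA m; exists p, q.
  have : (\sum_(m' in S) dj m m' + #|starS p :|: starS q| >= #|S|)%N.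
    have -> : #|starS p :|: starS q| = (\sum_(i in S) ((p \in A i) || (q \in A i)))%N.
      rewrite -sum1_card big_mkcond [RHS]big_mkcond; apply: eq_bigr => i _.
      by rewrite !inE; case: (i \in S) => //=; case: (_ || _).
    rewrite -sum1_card.
    rewrite -big_split; apply: leq_sum => i _ /=; rewrite /dj Am.
    case: eqP => //= /eqP/set0Pn[n]; rewrite !inE => /andP[/orP[]/eqP-> ->] //.
    by rewrite orbT.
  have : (#|starS p :|: starS q| + 1 <= 2 * #|D|)%N.
    have := cardsUI (starS p) (starS q).
    have : (0 < #|starS p :&: starS q|)%N.
      by apply/card_gt0P; exists m; rewrite !inE mS Am !inE !eqxx orbT.
    have := wmax p; have := wmax q; rewrite -/D; lia.
  lia.
apply: leq_trans (leq_mul cZ (leqnn _)) _.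
move: (Q S) b1 b2 => q b1 b2; rewrite -cT in b1 b2 *.
move: #|T| #|D| D1 b1 b2 => T0 D0 D1 b1 b2.
rewrite mulnDl mul1n leq_add2l.
(* For a matching ([D0 = 1]) the second bound suffices. Otherwise the first one handles clusters of
   at most [3 * D0] edges, where [D0 <= 2 * (D0 - 1)], and the second one the larger clusters. *)
have [D2|D2] := leqP 2 D0; last first.
  have -> : D0 = 1 by lia.
  have D01 : D0 = 1%N by lia.
by subst D0; clear D1 b1 D2; nia.
have [le|gt] := leqP (T0 + D0) (3 * D0).
  have : (D0 <= 2 * (D0 - 1))%N by lia.
  by move=> h; nia.
by nia.
Qed.

End Cover.

Variable k : nat.

Definition kcost (c : 'I_k.+1 -> N -> R) : R :=
  \sum_m \big[Order.min/sd (pnt m) (c ord0)]_(i < k.+1) sd (pnt m) (c i).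

Lemma bigmin_elem (I : eqType) (r : seq I) (F : I -> R) x j : j \in r ->
  \big[Order.min/x]_(i <- r) F i <= F j.
Proof.
elim: r => // i r IHr; rewrite inE big_cons ge_min => /orP[/eqP->|/IHr->].
  by rewrite lexx.
by rewrite orbT.
Qed.

Lemma min_attained m (c : 'I_k.+1 -> N -> R) :
  exists i, \big[Order.min/sd (pnt m) (c ord0)]_(i < k.+1) sd (pnt m) (c i) = sd (pnt m) (c i).
Proof.
apply: (big_ind (fun y => exists i, y = sd (pnt m) (c i))).
- by exists ord0.
- by move=> y z [i ->] [j ->]; case: (leP (sd (pnt m) (c i))) => _; [exists i | exists j].
- by move=> i _; exists i.
Qed.

(** Assign each point to a center nearest to it. The covers of the clusters together cover the
    graph, and a nonempty cluster [S] with cover [Z] costs at least [#|S| - 1 + (#|Z| - 1) / 3]. For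
    an empty cluster this expression is negative, so the sum may run over all centers. *)
Lemma kcost_lower (c : 'I_k.+1 -> N -> R) : exists Z : {set N},
  (forall m, A m :&: Z != set0) /\
  #|M|%:R - k.+1%:R + (#|Z|%:R - k.+1%:R) / 3 <= kcost c.
Proof.
pose nr m := projT1 (cid (min_attained m c)).
have nrP m : \big[Order.min/sd (pnt m) (c ord0)]_(i < k.+1) sd (pnt m) (c i) = sd (pnt m) (c (nr m)).
  by rewrite /nr; case: cid.
pose S i := [set m | nr m == i].
have Zex i : exists Z : {set N}, (forall m, m \in S i -> A m :&: Z != set0) /\
    (S i != set0)%:R * (#|S i|%:R - 1 + (#|Z|%:R - 1) / 3) <= \sum_(m in S i) sd (pnt m) (c i) /\
    (S i == set0 -> Z = set0).
  have [e|ne] := eqVneq (S i) set0.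
    exists set0; rewrite e; split=> [m|]; first by rewrite inE.
    by split=> //; rewrite mul0r big_set0.
  have [Z [cov le]] := cover_ex ne; exists Z; split=> //; split=> //.
  rewrite mul1r; apply: le_trans (cluster_lower _ ne); rewrite lerD2l.
  have s0 : 0 < #|S i|%:R :> R by rewrite ltr0n card_gt0.
  rewrite ler_pdivlMr //; move: le; rewrite -(ler_nat R) natrD !natrM; lra.
pose Z i := projT1 (cid (Zex i)).
have ZP i : _ := projT2 (cid (Zex i)).
exists (\bigcup_i Z i); split=> [m|].
  have [] := ZP (nr m) => /(_ m); rewrite inE eqxx => /(_ isT) /set0Pn[n].
  rewrite inE => /andP[nA nZ] _; apply/set0Pn; exists n; rewrite inE nA /=.
  by apply/bigcupP; exists (nr m).
have -> : kcost c = \sum_i \sum_(m in S i) sd (pnt m) (c i).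
  rewrite /kcost (partition_big nr xpredT) //=; apply: eq_bigr => i _.
  rewrite (eq_bigl (fun m => m \in S i)); last by move=> m; rewrite !inE.
  by apply: eq_bigr => m mS; rewrite nrP; move: mS; rewrite inE => /eqP->.
apply: le_trans (_ : \sum_i (S i != set0)%:R * (#|S i|%:R - 1 + (#|Z i|%:R - 1) / 3) <= _); last first.
  by apply: ler_sum => i _; case: (ZP i) => _ [].
have card_le : #|\bigcup_i Z i|%:R <= \sum_i #|Z i|%:R :> R.
  rewrite -natr_sum ler_nat; elim/big_ind2: _ => // [|a n b m ? ?]; first by rewrite cards0.
  by apply: leq_trans (leq_card_setU _ _) _; apply: leq_add.
have eM : #|M|%:R = \sum_i #|S i|%:R :> R.
  rewrite -natr_sum -sum1_card (partition_big nr xpredT) //=; congr (_%:R).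
  by apply: eq_bigr => i _; rewrite -sum1_card; apply: eq_bigl => m; rewrite !inE.
have le_i i : (#|S i|%:R - 1 + (#|Z i|%:R - 1) / 3) <=
    (S i != set0)%:R * (#|S i|%:R - 1 + (#|Z i|%:R - 1) / 3) :> R.
  have [e|ne] := eqVneq (S i) set0; last by rewrite mul1r.
  have [_ [_ z0]] := ZP i; have -> : Z i = set0 by apply: z0; rewrite e. 
  rewrite e !cards0 mul0r; lra.
apply: le_trans (ler_sum _ (fun i _ => le_i i)); rewrite big_split /= sumrB -mulr_suml sumrB -eM.
by rewrite !sumr_const card_ord; lra.
Qed.

Lemma kcost_upper (I : finType) (sg : M -> I) : #|I| = k.+1 ->
  (forall i, exists m, sg m = i) ->
  (forall m m', sg m = sg m' -> A m :&: A m' != set0) ->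
  exists c : 'I_k.+1 -> N -> R, kcost c <= #|M|%:R - k.+1%:R.
Proof.
move=> cI sur sh; pose S i := [set m | sg m == i].
pose cen i n : R := (\sum_(m in S i) pnt m n) / #|S i|%:R.
exists (fun j => cen (enum_val (cast_ord (esym cI) j))).
apply: le_trans (_ : \sum_m sd (pnt m) (cen (sg m)) <= _).
  apply: ler_sum => m _.
  have -> : cen (sg m) = cen (enum_val (cast_ord (esym cI) (cast_ord cI (enum_rank (sg m))))).
    by rewrite cast_ordK enum_rankK.
  by apply: bigmin_elem; rewrite mem_index_enum.
rewrite (partition_big sg xpredT) //=.
have -> : #|M|%:R - k.+1%:R = \sum_i (#|S i|%:R - 1) :> R.
  rewrite sumrB sumr_const cI -natr_sum -sum1_card (partition_big sg xpredT) //=; congr (_%:R - _).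
  by apply: eq_bigr => i _; rewrite -sum1_card; apply: eq_bigl => m; rewrite !inE.
apply: ler_sum => i _; rewrite (eq_bigl (fun m => m \in S i)); last by move=> m; rewrite !inE.
apply: le_trans (cluster_upper (S := S i) _ _).
- by apply: ler_sum => m; rewrite inE => /eqP->.
- by have [m <-] := sur i; apply/set0Pn; exists m; rewrite inE.
- by move=> m m'; rewrite !inE => /eqP e /eqP e'; apply: sh; rewrite e e'.
Qed.

End Clusters.

End EdgeClusters.
Import EdgeClusters.

Module SubdividedGraphs.

Import Order.TTheory GRing.Theory Num.Theory.
Local Open Scope ring_scope.

(** * Subdivided graphs as k-means instances *)

Lemma sum_pairs (z : nat -> nat) c m :
  (\sum_(x < c + 2 * m) z x = \sum_(x < c) z x + \sum_(j < m) (z (c + 2 * j) + z (c + 2 * j).+1))%N.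
Proof.
elim: m => [|m IHm]; first by rewrite big_ord0 !addn0.
rewrite big_ord_recr /= addnA -IHm.
have -> : (c + 2 * m.+1 = (c + 2 * m).+2)%N by lia.
by rewrite !big_ord_recr /= addnA.
Qed.

Section Subdivision.

Variables (c m : nat) (p q : nat -> nat).
Hypothesis p_lt : forall j, (j < m)%N -> (p j < c)%N.
Hypothesis q_lt : forall j, (j < m)%N -> (q j < c)%N.
Hypothesis pq : forall j, (j < m)%N -> p j <> q j.

Definition ME : finType := ('I_m * 'I_3)%type.

(** The edge [j] becomes the path from [p j] through the new vertices [c + 2 * j] and
    [(c + 2 * j).+1] to [q j]. *)
Definition sub_ends (j i : nat) : nat * nat :=
  match i with
  | 0 => (p j, (c + 2 * j)%N)
  | 1 => ((c + 2 * j)%N, (c + 2 * j).+1)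
  | _ => ((c + 2 * j).+1, q j)
  end.

Definition onE (e : ME) (x : nat) : bool :=
  (x == (sub_ends e.1 e.2).1) || (x == (sub_ends e.1 e.2).2).

Definition EA (e : ME) : {set 'I_(c + 2 * m)} := [set x : 'I_(c + 2 * m) | onE e x].

(** Parallel edges of the original graph do no harm here: every edge of the subdivision contains a
    new vertex, and that vertex belongs to a single [j]. *)
Lemma share_inj e e' x y : onE e x -> onE e y -> onE e' x -> onE e' y -> x <> y -> e = e'.
Proof.
case: e e' => [[j lj] [i li]] [[j' lj'] [i' li']]; rewrite /onE /= => h1 h2 h3 h4 nxy.
suff [ej ei] : j = j' /\ i = i' by subst j' i'; congr (_, _); apply: val_inj.
have e1 : j = j' -> p j = p j' by move->.
have e2 : j = j' -> q j = q j' by move->.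
have := p_lt lj; have := p_lt lj'; have := q_lt lj; have := q_lt lj'; have := pq lj; have := pq lj'.
by case: i i' li li' h1 h2 h3 h4 => [|[|[|//]]] [|[|[|//]]] _ _ /=; lia.
Qed.

Lemma internal_edge e x y : onE e x -> onE e y -> (x < y)%N -> (c <= x)%N ->
  exists2 j, (j < m)%N & x = (c + 2 * j)%N /\ y = (c + 2 * j).+1.
Proof.
case: e => [[j lj] [i li]]; rewrite /onE /= => h1 h2 h3 h4.
have := p_lt lj; have := q_lt lj => h5 h6; exists j => //.
by case: i li h1 h2 => [|[|[|//]]] _ /=; lia.
Qed.

Lemma even_nbr e w j : (j < m)%N -> onE e (c + 2 * j)%N -> onE e w -> w <> (c + 2 * j)%N ->
  w <> (c + 2 * j).+1 -> w = p j.
Proof.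
case: e => [[j' lj'] [i li]] lj; rewrite /onE /= => h1 h2 h3 h4.
have := p_lt lj'; have := q_lt lj' => h5 h6; have e1 : j = j' -> p j = p j' by move->.
by case: i li h1 h2 => [|[|[|//]]] _ /=; lia.
Qed.

Lemma odd_nbr e w j : (j < m)%N -> onE e (c + 2 * j).+1 -> onE e w -> w <> (c + 2 * j)%N ->
  w <> (c + 2 * j).+1 -> w = q j.
Proof.
case: e => [[j' lj'] [i li]] lj; rewrite /onE /= => h1 h2 h3 h4.
have := p_lt lj'; have := q_lt lj' => h5 h6; have e1 : j = j' -> q j = q j' by move->.
by case: i li h1 h2 => [|[|[|//]]] _ /=; lia.
Qed.

(** Adjacent new vertices are the middle of one path, and their other neighbours [p j] and [q j]
    differ. *)
Lemma no_internal_triangle e e1 e2 x y w : onE e x -> onE e y -> onE e1 w -> onE e1 x ->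
  onE e2 w -> onE e2 y -> x <> y -> x <> w -> y <> w -> (c <= x)%N -> (c <= y)%N -> False.
Proof.
wlog lt : e e1 e2 x y / (x < y)%N.
  move=> wl h1 h2 h3 h4 h5 h6 n1 n2 n3 cx cy; case: (ltngtP x y) => [lt|lt|//].
    exact: (wl e e1 e2 x y).
  by apply: (wl e e2 e1 y x) => // e'; case: n1.
move=> h1 h2 h3 h4 h5 h6 n1 n2 n3 cx cy; have [j lj [ex ey]] := internal_edge h1 h2 lt cx.
subst x y; have w1 : w <> (c + 2 * j)%N by move=> e'; case: n2.
have w2 : w <> (c + 2 * j).+1 by move=> e'; case: n3.
by have := pq lj; rewrite -(even_nbr lj h4 h3 w1 w2) -(odd_nbr lj h6 h5 w1 w2).
Qed.

Lemma edge_internal e x y : onE e x -> onE e y -> x <> y -> (c <= x)%N || (c <= y)%N.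
Proof. by case: e => [[j lj] [i li]]; rewrite /onE /= => h1 h2 h3; case: i li h1 h2 => [|[|[|//]]] _ /=; lia. Qed.

(** Each edge has a new end, so two of the three vertices of a triangle would be new. *)
Lemma no_triangle e e1 e2 x y w : onE e x -> onE e y -> onE e1 w -> onE e1 x ->
  onE e2 w -> onE e2 y -> x <> y -> x <> w -> y <> w -> False.
Proof.
move=> h1 h2 h3 h4 h5 h6 n1 n2 n3.
have n1' : y <> x by move/esym. 
have n2' : w <> x by move/esym.
have n3' : w <> y by move/esym.
have i1 := edge_internal h1 h2 n1; have i2 := edge_internal h4 h3 n2; have i3 := edge_internal h6 h5 n3.
have [cx|cx] := boolP (c <= x)%N.
  have [cy|cy] := boolP (c <= y)%N; first exact: (no_internal_triangle h1 h2 h3 h4 h5 h6).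
  have cw : (c <= w)%N by move: i3; rewrite (negPf cy).
  exact: (no_internal_triangle h4 h3 h2 h1 h6 h5).
have cy : (c <= y)%N by move: i1; rewrite (negPf cx).
have cw : (c <= w)%N by move: i2; rewrite (negPf cx).
exact: (no_internal_triangle h6 h5 h1 h2 h4 h3).
Qed.

Lemma ends_lt (e : ME) : ((sub_ends e.1 e.2).1 < c + 2 * m)%N && ((sub_ends e.1 e.2).2 < c + 2 * m)%N.
Proof.
case: e => [[j lj] [i li]] /=; have := p_lt lj; have := q_lt lj.
by case: i li => [|[|[|//]]] _ /=; lia.
Qed.

Lemma ends_neq (e : ME) : (sub_ends e.1 e.2).1 <> (sub_ends e.1 e.2).2.
Proof.
case: e => [[j lj] [i li]] /=; have := p_lt lj; have := q_lt lj.
by case: i li => [|[|[|//]]] _ /=; lia.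
Qed.

Lemma EA_card e : #|EA e| = 2.
Proof.
have /andP[l1 l2] := ends_lt e.
have -> : EA e = [set Ordinal l1; Ordinal l2] by apply/setP => x; rewrite !inE -!val_eqE.
by rewrite cards2 -val_eqE /=; case: eqP => // /(@ends_neq e).
Qed.

Lemma EA_simple e e' : e != e' -> (#|EA e :&: EA e'| <= 1)%N.
Proof.
move=> ne; apply/card_le1_eqP => x y; rewrite !inE => /andP[h1 h2] /andP[h3 h4].
apply/val_inj/eqP; apply: contraNT ne => /eqP nxy; apply/eqP.
exact: (share_inj h1 h3 h2 h4 (fun e => nxy (esym e))).
Qed.

Lemma EA_trifree w e : w \notin EA e ->
  (#|[set e' | (w \in EA e') && (EA e :&: EA e' != set0)]| <= 1)%N.
Proof.
rewrite inE => nw; apply/card_le1_eqP => e1 e2; rewrite !inE.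
case/andP=> w1 /set0Pn[x]; rewrite !inE => /andP[x0 x1].
case/andP=> w2 /set0Pn[y]; rewrite !inE => /andP[y0 y1].
have nx : (x : nat) <> w by move=> e'; rewrite e' (negPf nw) in x0.
have ny : (y : nat) <> w by move=> e'; rewrite e' (negPf nw) in y0.
have [exy|/eqP nxy] := eqVneq (x : nat) (y : nat).
  by rewrite -exy in y1; apply: esym; apply: (share_inj w1 x1 w2 y1) => e'; case: nx.
by case: (no_triangle x0 y0 w1 x1 w2 y1 nxy nx ny).
Qed.

(** The middle edge of each path forces one new vertex into [Z], which accounts for [m]. Where both
    new vertices of a path are chosen, one of them is exchanged for [p j]; where only one is, an end
    edge of the path forces [p j] or [q j]. *)
Lemma EA_cover (Z : {set 'I_(c + 2 * m)}) : (forall e, EA e :&: Z != set0) ->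
  exists cv : nat -> bool, (forall j, (j < m)%N -> cv (p j) || cv (q j)) /\
    (\sum_(x < c) cv x + m <= #|Z|)%N.
Proof.
move=> ZP; pose z (n : nat) : bool := [exists x : 'I_(c + 2 * m), (x \in Z) && (x == n :> nat)].
have zE (x : 'I_(c + 2 * m)) : z x = (x \in Z).
  apply/existsP/idP => [[y /andP[yZ /eqP e]]|xZ]; last by exists x; rewrite xZ eqxx.
  by rewrite -(val_inj e : y = x).
have zc j i : (j < m)%N -> (i < 3)%N -> z (sub_ends j i).1 || z (sub_ends j i).2.
  move=> lj li; have /set0Pn[x] := ZP (Ordinal lj, Ordinal li).
  rewrite !inE /onE /= -zE => /andP[/orP[]/eqP-> ->] //; by rewrite orbT.
pose both (j : nat) := z (c + 2 * j)%N && z (c + 2 * j).+1.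
exists (fun x => z x || [exists j : 'I_m, both j && (p j == x)]); split=> [j lj|].
  have := zc j 0%N lj isT; have := zc j 1%N lj isT; have := zc j 2%N lj isT; rewrite /=.
  case: (z (p j)) => //; case: (z (q j)); first by rewrite !orbT.
  rewrite orbF /= => z2 _ z1; apply/orP; left; apply/existsP; exists (Ordinal lj).
  by rewrite /both z1 z2 /=.
have -> : #|Z| = (\sum_(x < c + 2 * m) z x)%N.
  by rewrite -sum1_card big_mkcond; apply: eq_bigr => x _; rewrite zE; case: (x \in Z).
rewrite (sum_pairs (fun x => z x)).
apply: leq_trans (_ : \sum_(x < c) z x + (\sum_(j < m) both j + m) <= _)%N; last first.
  rewrite leq_add2l -[X in (_ + X <= _)%N](card_ord m) -sum1_card -big_split; apply: leq_sum => j _ /=.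
  by have := zc j 1%N (ltn_ord j) isT; rewrite /= /both; case: (z _); case: (z _).
rewrite addnA leq_add2r.
apply: leq_trans (_ : \sum_(x < c) (z x + \sum_(j < m) (both j && (p j == x))) <= _)%N.
  apply: leq_sum => x _; case: (z x) => //=; case: existsP => [[j h]|_] //=.
  by rewrite (bigD1 j) //= h.
rewrite big_split leq_add2l exchange_big /=; apply: leq_sum => j _.
case: (both j) => /=; last by rewrite big1.
by rewrite (bigD1 (Ordinal (p_lt (ltn_ord j)))) //= eqxx big1 // => x; rewrite -val_eqE eq_sym => /negPf /= ->.
Qed.

Section Clustering.

Variables (R : realFieldType) (k : nat).

Lemma subdivision_lower (cen : 'I_k.+1 -> 'I_(c + 2 * m) -> R) :
  exists cv : nat -> bool, (forall j, (j < m)%N -> cv (p j) || cv (q j)) /\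
    (3 * m)%:R - k.+1%:R + ((\sum_(x < c) cv x + m)%:R - k.+1%:R) / 3 <= kcost EA cen.
Proof.
have [Z [ZP le]] := kcost_lower EA_card EA_simple EA_trifree cen.
have [cv [cvP cvZ]] := EA_cover ZP; exists cv; split=> //.
apply: le_trans le; rewrite card_prod !card_ord [(3 * m)%N]mulnC lerD2l ler_pM2r ?invr_gt0 //.
by rewrite lerD2r ler_nat.
Qed.

Variable cv : nat -> bool.
Hypothesis cvP : forall j, (j < m)%N -> cv (p j) || cv (q j).
Hypothesis cv_onto : forall x, (x < c)%N -> cv x -> exists2 j, (j < m)%N & p j = x.

(** One cluster per cover vertex and one per path. An end edge at a covered end, at [p j] if
    possible, joins the star of that end; the two remaining edges share a new vertex and form the
    cluster of the path. *)
Definition cls (e : ME) : nat + nat :=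
  match nat_of_ord e.2 with
  | 0 => if cv (p e.1) then inl (p e.1) else inr (nat_of_ord e.1)
  | 1 => inr (nat_of_ord e.1)
  | _ => if cv (p e.1) then inr (nat_of_ord e.1) else inl (q e.1)
  end.

Definition tocls (e : ME) : 'I_c.+1 + 'I_m :=
  match cls e with inl x => inl (inord x) | inr _ => inr e.1 end.

Definition ptc (y : 'I_c.+1 + 'I_m) : nat :=
  match y with
  | inl x => x
  | inr j => if cv (p j) then (c + 2 * j).+1 else (c + 2 * j)%N
  end.

Lemma onE_ptc e : onE e (ptc (tocls e)).
Proof.
case: e => j [i li]; rewrite /tocls /cls /onE /=.
have lp := p_lt (ltn_ord j); have lq := q_lt (ltn_ord j).
have h1 : (inord (p j) : 'I_c.+1) = p j :> nat by rewrite inordK //; exact: ltnW.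
have h2 : (inord (q j) : 'I_c.+1) = q j :> nat by rewrite inordK //; exact: ltnW.
by case: i li => [|[|[|//]]] _ /=; case cp: (cv (p j)); rewrite /= ?cp ?h1 ?h2 eqxx ?orbT.
Qed.

(** By [cv_onto] every cover vertex is a first end [p j], so its star is not empty and the number of
    clusters is exactly [k.+1]. *)
Lemma subdivision_upper : (\sum_(x < c) cv x + m = k.+1)%N ->
  exists cen : 'I_k.+1 -> 'I_(c + 2 * m) -> R, kcost EA cen <= (3 * m)%:R - k.+1%:R.
Proof.
move=> card_cv; pose I : finType := {y : 'I_c.+1 + 'I_m | y \in [set tocls e | e : ME]}.
have img (e : ME) : tocls e \in [set tocls e | e : ME] by apply: imset_f.
pose sg (e : ME) : I := exist _ (tocls e) (img e).
have cI : #|I| = k.+1.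
  rewrite card_sig -card_cv.
  have -> : #|[pred y | y \in [set tocls e | e : ME]]| = #|[set tocls e | e : ME]| by apply: eq_card.
  have -> : [set tocls e | e : ME] = [set y : 'I_c.+1 + 'I_m | if y is inl x then (x < c)%N && cv x else true].
    apply/setP => y; rewrite inE; apply/imsetP/idP => [[[j [i li]] _ ->]|].
      rewrite /tocls /cls /=; have lp := p_lt (ltn_ord j); have lq := q_lt (ltn_ord j).
      have h1 : (inord (p j) : 'I_c.+1) = p j :> nat by rewrite inordK //; exact: ltnW.
      have h2 : (inord (q j) : 'I_c.+1) = q j :> nat by rewrite inordK //; exact: ltnW.
      have := cvP (ltn_ord j).
      by case: i li => [|[|[|//]]] _ /=; have [cp|ncp] := boolP (cv (p j)) => //=; rewrite ?h1 ?h2 ?lp ?lq ?cp.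
    case: y => [x /andP[lx cx]|j _].
      have [j lj pj] := cv_onto lx cx; exists (Ordinal lj, ord0) => //.
      by rewrite /tocls /cls /= pj cx inord_val.
    by exists (j, inord 1); rewrite // /tocls /cls /= inordK.
  rewrite -sum1_card big_mkcond big_sumType /= [in RHS]addnC addnC; congr (_ + _)%N.
    by rewrite (eq_bigr (fun=> 1%N)) ?sum1_card ?card_ord // => j _; rewrite inE.
  rewrite big_ord_recr /= inE ltnn addn0; apply: eq_bigr => x _.
  by rewrite inE /= ltn_ord; case: cv.
have [||cen le] := @kcost_upper R _ _ EA EA_card k I sg cI.
- by case=> y yP; have /imsetP[e _ ey] := yP; exists e; apply: val_inj; rewrite /= ey.
- move=> e e' /(congr1 val) /= et; have h := onE_ptc e; have h' := onE_ptc e'; rewrite -et in h'.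
  have /andP[l1 l2] := ends_lt e.
  have lt : (ptc (tocls e) < c + 2 * m)%N by move: h; rewrite /onE => /orP[] /eqP->.
  by apply/set0Pn; exists (Ordinal lt); rewrite !inE h h'.
by exists cen; apply: le_trans le _; rewrite card_prod !card_ord mulnC.
Qed.

End Clustering.

End Subdivision.

End SubdividedGraphs.
Import SubdividedGraphs.

Module FractionValues.

Import Order.TTheory GRing.Theory Num.Theory.
Local Open Scope ring_scope.

(** * Values of fractions *)

Definition fval (f : tfrac) : rat := ((val2 f.1)%:R - (val2 f.2.1)%:R) / (val2 f.2.2)%:R.
Definition fpos (f : tfrac) : bool := (0 < val2 f.2.2)%N.

Lemma fpos_neq0 f : fpos f -> (val2 f.2.2)%:R != 0 :> rat.
Proof. by rewrite pnatr_eq0 -lt0n. Qed.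

Lemma fval_fadd a t : fpos a -> fpos t -> fpos (fadd a t) /\ fval (fadd a t) = fval a + fval t.
Proof.
move=> pa ptt; split; first by move: pa ptt; rewrite /fpos /= val_mulw muln_gt0 => -> ->.
rewrite /fval /= !val_addw !val_mulw !natrD !natrM.
by have := fpos_neq0 pa; have := fpos_neq0 ptt => h1 h2; field; rewrite h1 h2.
Qed.

Lemma fleE a b : fpos a -> fpos b -> fle a b = (fval a <= fval b).
Proof.
move=> pa pb; have da : 0 < (val2 a.2.2)%:R :> rat by rewrite ltr0n.
have db : 0 < (val2 b.2.2)%:R :> rat by rewrite ltr0n.
rewrite /fle leqwE !val_addw !val_mulw /fval ler_pdivrMr // mulrAC ler_pdivlMr //.
rewrite -(ler_nat rat) !natrD !natrM.
by apply/idP/idP; lra.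
Qed.

Lemma fval0 : fval fzero = 0. Proof. by rewrite /fval /= subrr mul0r. Qed.

Definition zval (r : zrat) : rat := (-1) ^+ r.1.1 * (val2 r.1.2)%:R / (val2 r.2.2)%:R.
Definition zpos (r : zrat) : bool := (0 < val2 r.2.2)%N.

Lemma fval_fterm x r : zpos r -> fpos (fterm x r) /\ fval (fterm x r) = (x%:R - zval r) ^+ 2.
Proof.
case: r => [[s n] [s' d]] pr; have d0 : (val2 d)%:R != 0 :> rat by rewrite pnatr_eq0 -lt0n.
split; first by rewrite /fpos /= val_mulw muln_gt0 andbb.
rewrite /fval /zval /fterm /= !val_addw !val_mulw; clear pr.
case: x; case: s => /=; rewrite ?val_mulw ?add0n ?addn0 ?natrD ?natrM ?expr1 ?expr0; by field; rewrite ?d0.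
Qed.

Lemma fval_sum (I : Type) (F : I -> tfrac) s a : (forall i, fpos (F i)) -> fpos a ->
  fpos (foldl (fun acc i => fadd acc (F i)) a s) /\
  fval (foldl (fun acc i => fadd acc (F i)) a s) = fval a + \sum_(i <- s) fval (F i).
Proof.
move=> pF; elim: s a => [|i s IHs] a pa /=; first by rewrite big_nil addr0.
have [p1 e1] := fval_fadd pa (pF i); have [p2 ->] := IHs _ p1.
by rewrite e1 big_cons addrA.
Qed.

Definition pind (p : nat * nat) (j : nat) : bool := (j == p.1) || (j == p.2).

Lemma fval_fdist d p c : all zpos c -> fpos (fdist d p c) /\
  fval (fdist d p c) = \sum_(j < d) ((pind p j)%:R - zval (nth zdef c j)) ^+ 2.
Proof.
move=> pc; have pn j : zpos (nth zdef c j).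
  by have [lt|ge] := ltnP j (size c); [exact: (allP pc) (mem_nth _ lt) | rewrite nth_default].
have pF j : fpos (fterm (pind p j) (nth zdef c j)) by have [] := fval_fterm (pind p j) (pn j).
have [p1 e1] := fval_sum (iota 0 d) pF (isT : fpos fzero); split=> //.
rewrite [LHS]e1 fval0 add0r -(big_mkord xpredT (fun j => ((pind p j)%:R - zval (nth zdef c j)) ^+ 2)) /index_iota subn0.
by apply: eq_bigr => j _; have [_ ->] := fval_fterm (pind p j) (pn j).
Qed.

Lemma bigmin_start (I : Type) (F : I -> rat) s (a b : rat) :
  \big[Order.min/Order.min a b]_(i <- s) F i = Order.min b (\big[Order.min/a]_(i <- s) F i).
Proof.
elim: s => [|i s IHs]; first by rewrite !big_nil minC.
by rewrite !big_cons IHs minCA.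
Qed.

Lemma fval_fmindist d p cs : all (all zpos) cs -> fpos (fmindist d p cs) /\
  fval (fmindist d p cs) =
    \big[Order.min/fval (fdist d p (head [::] cs))]_(c <- cs) fval (fdist d p c).
Proof.
move=> pcs.
have h s a : all (all zpos) s -> fpos a -> fpos (foldl (fun a c => fmin a (fdist d p c)) a s) /\
   fval (foldl (fun a c => fmin a (fdist d p c)) a s) = \big[Order.min/fval a]_(c <- s) fval (fdist d p c).
  elim: s a => [|c s IHs] a /=; first by rewrite big_nil.
  case/andP=> pc ps pa; have [pd _] := fval_fdist d p pc.
  have [pm em] : fpos (fmin a (fdist d p c)) /\ fval (fmin a (fdist d p c)) = Order.min (fval a) (fval (fdist d p c)).
    by rewrite /fmin fleE //; case: lerP.
  have [-> ->] := IHs _ ps pm; by rewrite em bigmin_start big_cons.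
apply: h => //; have : all zpos (head [::] cs) by case: cs pcs => //= c cs /andP[].
by case/(fval_fdist d p).
Qed.

Lemma fval_fcost d ps cs : all (all zpos) cs -> fpos (fcost d ps cs) /\
  fval (fcost d ps cs) = \sum_(p <- ps) fval (fmindist d p cs).
Proof.
move=> pcs; have pF p : fpos (fmindist d p cs) by have [] := fval_fmindist d p pcs.
by have [p1 e1] := fval_sum ps pF (isT : fpos fzero); split=> //; rewrite [LHS]e1 fval0 add0r.
Qed.

(** * Instances *)

Definition prow (d : nat) (p : nat * nat) : 'rV[rat]_d := \row_j (pind p j)%:R.

Definition pairs (c m : nat) (p q : nat -> nat) : seq (nat * nat) :=
  [seq sub_ends c p q j i | j <- iota 0 m, i <- iota 0 3].

Definition enc_rat_bit (b : bool) : word := if b then enc_rat 1 else enc_rat 0.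

Definition inst_word (d k1 : nat) (ps : seq (nat * nat)) : word :=
  enc_unary d ++ enc_unary k1 ++
  enc_seq (fun p => enc_seq enc_rat_bit [seq pind p j | j <- iota 0 d]) ps.

Lemma eq_enc_seq (T S : Type) (e : T -> word) (e' : S -> word) (f : S -> T) s :
  (forall x, e (f x) = e' x) -> enc_seq e (map f s) = enc_seq e' s.
Proof. by move=> h; rewrite /enc_seq; elim: s => //= x s ->; rewrite h. Qed.

Lemma inst_wordE d k1 ps : enc_instance k1 [seq prow d p | p <- ps] = inst_word d k1 ps.
Proof.
congr (_ ++ (_ ++ _)); apply: eq_enc_seq => p; rewrite /enc_point.
have -> : [seq prow d p 0 i | i <- enum 'I_d] = [seq ((nat_of_bool b)%:R : rat) | b : bool <- [seq pind p j | j <- iota 0 d]].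
  rewrite -val_enum_ord -!map_comp; apply: eq_map => i /=; by rewrite mxE.
by apply: eq_enc_seq => -[].
Qed.

Section Subdivided.

Variables (c m : nat) (p q : nat -> nat).
Hypothesis p_lt : forall j, (j < m)%N -> (p j < c)%N.
Hypothesis q_lt : forall j, (j < m)%N -> (q j < c)%N.
Hypothesis pq : forall j, (j < m)%N -> p j <> q j.

Definition meL : seq (ME m) := [seq (j, i) | j <- enum 'I_m, i <- enum 'I_3].

Lemma pairsE : pairs c m p q = [seq sub_ends c p q (nat_of_ord e.1) (nat_of_ord e.2) | e : ME m <- meL].
Proof.
have h3 (f : nat -> nat * nat) : [:: f 0%N; f 1%N; f 2%N] = [seq f (val i) | i <- enum 'I_3].
  by rewrite (map_comp f val) val_enum_ord.
rewrite /pairs /meL -(val_enum_ord m); elim: (enum 'I_m) => //= j s IHs.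
rewrite map_cat -IHs.
have -> : [seq sub_ends c p q (nat_of_ord e.1) (nat_of_ord e.2) | e : ME m <- [seq (j, i) | i <- enum 'I_3]] =
    [:: sub_ends c p q j 0; sub_ends c p q j 1; sub_ends c p q j 2].
  by rewrite -map_comp (h3 (fun i => sub_ends c p q j i)).
by [].
Qed.

Lemma meL_uniq : uniq meL.
Proof. by apply: allpairs_uniq; rewrite ?enum_uniq // => -[? ?] [? ?] _ _ [-> ->]. Qed.

Lemma mem_meL e : e \in meL.
Proof. by case: e => j i; apply: allpairs_f; rewrite mem_enum. Qed.

Notation d := (c + 2 * m)%N.

Lemma prow_onE (e : ME m) (x : 'I_d) : prow d (sub_ends c p q e.1 e.2) 0 x = (onE c p q e x)%:R.
Proof. by rewrite mxE. Qed.

Definition pts : seq 'rV[rat]_d := [seq prow d x | x <- pairs c m p q].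

Lemma pts_uniq : uniq pts.
Proof.
rewrite /pts pairsE -map_comp map_inj_in_uniq ?meL_uniq // => e e' _ _ /= ee.
have on (x : 'I_d) : onE c p q e x = onE c p q e' x.
  have := congr1 (fun v : 'rV[rat]_d => v 0 x) ee; rewrite /= !prow_onE => /eqP.
  by rewrite eqr_nat; case: onE; case: onE.
have /andP[l1 l2] := ends_lt p_lt q_lt e; have ne := @ends_neq c m p q p_lt q_lt e.
have h1 := on (Ordinal l1); have h2 := on (Ordinal l2); rewrite /= in h1 h2.
apply: (share_inj p_lt q_lt pq _ _ _ _ ne); rewrite -?h1 -?h2 /onE eqxx ?orbT //.
Qed.

Lemma pts_cost (R : realType) k (cen : 'I_k.+1 -> 'rV[R]_d) :
  kmeans_cost [seq real_point R x | x <- pts] cen =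
  kcost (@EA c m p q) (fun i n => cen i 0 n).
Proof.
rewrite /kmeans_cost /pts pairsE !big_map big_uniq ?meL_uniq //=.
rewrite (eq_bigl xpredT); last by move=> e; rewrite mem_meL.
have sdE (e : ME m) i : sqdist (real_point R (prow d (sub_ends c p q e.1 e.2))) (cen i) =
   sd (pnt R (@EA c m p q) e) (fun n => cen i 0 n).
  by apply: eq_bigr => n _; rewrite mxE prow_onE ratr_nat /pnt inE.
by apply: eq_bigr => e _; rewrite sdE; apply: eq_bigr => i _; rewrite sdE.
Qed.

End Subdivided.

(** * Parsing *)

Definition bits (n : nat) : word := if bin_of_nat n is BinNums.Npos p then pos_bits p else [::].

Lemma val2_bits n : val2 (bits n) = n.
Proof.
have h p : val2 (pos_bits p) = nat_of_pos p.
  by elim: p => //= p IHp; rewrite -/(val2 (pos_bits p)) IHp NatTrec.doubleE -mul2n.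
by rewrite /bits -[RHS](bin_of_natK n); case: (bin_of_nat n) => //= p; rewrite h.
Qed.

Definition zint (z : int) : bool * seq bool := (z < 0, bits `|z|%N).
Definition zrat_of (r : rat) : zrat := (zint (numq r), zint (denq r)).

Lemma zval_of r : zpos (zrat_of r) /\ zval (zrat_of r) = r.
Proof.
have dp := denq_gt0 r; rewrite /zpos /zval /= !val2_bits; split; first by rewrite absz_gt0 gt_eqF.
rewrite -[RHS]divq_num_den; congr (_ / _); last by rewrite -{2}(gtz0_abs dp).
by case: (numq r) => n; rewrite ?NegzE //= ?expr0 ?expr1 ?mul1r ?mulN1r ?abszN ?absz_nat ?rmorphN.
Qed.

Definition pstate : Type :=
  (nat * (bool * (seq bool * ((bool * seq bool) * (seq zrat * seq (seq zrat))))))%type.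

(** A one-pass automaton on encoded centers. State 0 awaits a point and 1 a coordinate; 2 reads the
    sign of a numerator, 3 and 4 its digits; 5 to 7 do the same for the denominator; 8 is the end.
    Digits are collected in reverse in [cur]. *)
Definition pst (s : pstate) (b : bool) : pstate :=
  let: (st, (sg, (cur, (num, (rats, ptl))))) := s in
  match st with
  | 0 => (if b then 1 else 8, (sg, (cur, (num, (rats, ptl)))))
  | 1 => if b then (2, (sg, (cur, (num, (rats, ptl)))))
         else (0, (sg, (cur, (num, ([::], rev rats :: ptl)))))
  | 2 => (3, (b, (cur, (num, (rats, ptl)))))
  | 3 => if b then (4, (sg, (cur, (num, (rats, ptl)))))
         else (5, (sg, ([::], ((sg, rev cur), (rats, ptl)))))
  | 4 => (3, (sg, (b :: cur, (num, (rats, ptl)))))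
  | 5 => (6, (b, (cur, (num, (rats, ptl)))))
  | 6 => if b then (7, (sg, (cur, (num, (rats, ptl)))))
         else (1, (sg, ([::], ((false, [::]), ((num, (sg, rev cur)) :: rats, ptl)))))
  | 7 => (6, (sg, (b :: cur, (num, (rats, ptl)))))
  | _ => s
  end%N.

Definition pinit : pstate := (0%N, (false, ([::], ((false, [::]), ([::], [::]))))).
Definition parse (z : word) : seq (seq zrat) := rev (foldl pst pinit z).2.2.2.2.2.

Lemma pst_word3 w sg cur num rats ptl t :
  foldl pst (3%N, (sg, (cur, (num, (rats, ptl))))) (enc_word w ++ t) =
  foldl pst (5%N, (sg, ([::], ((sg, rev cur ++ w), (rats, ptl))))) t.
Proof.
elim: w cur => [|b w IHw] cur /=; first by rewrite cats0.
by rewrite IHw rev_cons cat_rcons.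
Qed.

Lemma pst_word6 w sg cur num rats ptl t :
  foldl pst (6%N, (sg, (cur, (num, (rats, ptl))))) (enc_word w ++ t) =
  foldl pst (1%N, (sg, ([::], ((false, [::]), ((num, (sg, rev cur ++ w)) :: rats, ptl))))) t.
Proof.
elim: w cur => [|b w IHw] cur /=; first by rewrite cats0.
by rewrite IHw rev_cons cat_rcons.
Qed.

Lemma pst_point rs sg num rats ptl t : exists sg' num',
  foldl pst (1%N, (sg, ([::], (num, (rats, ptl))))) (enc_seq enc_rat rs ++ t) =
  foldl pst (0%N, (sg', ([::], (num', ([::], (rev rats ++ map zrat_of rs) :: ptl))))) t.
Proof.
elim: rs sg num rats => [|r rs IHrs] sg num rats /=; first by exists sg, num; rewrite cats0.
rewrite /enc_rat /enc_int -!catA /= pst_word3 /= pst_word6.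
have [sg' [num' ->]] := IHrs (denq r < 0) (false, [::]) (zrat_of r :: rats).
by exists sg', num'; rewrite rev_cons cat_rcons.
Qed.

Lemma pst_points (T : Type) (f : T -> seq rat) (ps : seq T) sg num ptl :
  (foldl pst (0%N, (sg, ([::], (num, ([::], ptl))))) (enc_seq (fun x => enc_seq enc_rat (f x)) ps)).2.2.2.2.2 =
  rev [seq map zrat_of (f x) | x <- ps] ++ ptl.
Proof.
elim: ps sg num ptl => [|x ps IHps] sg num ptl //=.
have [sg' [num' ->]] := pst_point (f x) sg num [::] ptl (enc_seq (fun x => enc_seq enc_rat (f x)) ps).
by rewrite IHps rev_cons cat_rcons.
Qed.

Lemma parse_centers d k (cen : 'I_k -> 'rV[rat]_d) :
  parse (enc_centers cen) = [seq [seq zrat_of (cen i 0 j) | j <- enum 'I_d] | i <- enum 'I_k].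
Proof.
rewrite /parse /enc_centers /enc_point (pst_points (fun v : 'rV[rat]_d => [seq v 0 i | i <- enum 'I_d])).
rewrite cats0 revK -map_comp; apply: eq_map => i /=; by rewrite -map_comp.
Qed.

Definition sstate : Type := (nat * (seq bool * seq bool))%type.
(** State 0 awaits a continuation flag of the first component and 1 its next bit; 2 copies the
    rest. *)
Definition sst (s : sstate) (b : bool) : sstate :=
  match s.1 with
  | 0 => (if b then 1 else 2, s.2)
  | 1 => (0, (b :: s.2.1, s.2.2))
  | _ => (2, (s.2.1, b :: s.2.2))
  end%N.
Definition splitp (w : word) : word * word :=
  let r := foldl sst (0%N, ([::], [::])) w in (rev r.2.1, rev r.2.2).

Lemma splitpE x z : splitp (enc_pair x z) = (x, z).
Proof.
have h2 u acc acc2 : foldl sst (2%N, (acc, acc2)) u = (2%N, (acc, catrev u acc2)).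
  by elim: u acc2 => //= b u IHu acc2; rewrite IHu.
have h1 u acc : foldl sst (0%N, (acc, [::])) (enc_word u ++ z) = (2%N, (catrev u acc, rev z)).
  by elim: u acc => [|b u IHu] acc /=; [rewrite h2 | rewrite IHu].
by rewrite /splitp /enc_pair h1 /= revK -[catrev x [::]]/(rev x) revK.
Qed.

Lemma fcost_centers d k ps (cen : 'I_k.+1 -> 'rV[rat]_d) :
  let cs := parse (enc_centers cen) in
  fpos (fcost d ps cs) /\ fval (fcost d ps cs) = kmeans_cost [seq prow d p | p <- ps] cen.
Proof.
rewrite /= parse_centers; set cs := [seq _ | i <- _].
have pcs : all (all zpos) cs.
  apply/allP => c /mapP[i _ ->]; apply/allP => r /mapP[j _ ->]; by have [] := zval_of (cen i 0 j).
have [pc ->] := fval_fcost d ps pcs; split=> //.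
have dE p i : fval (fdist d p [seq zrat_of (cen i 0 j) | j <- enum 'I_d]) = sqdist (prow d p) (cen i).
  have pi : all zpos [seq zrat_of (cen i 0 j) | j <- enum 'I_d].
    by apply/allP => r /mapP[j _ ->]; have [] := zval_of (cen i 0 j).
  have [_ ->] := fval_fdist d p pi; apply: eq_bigr => j _; rewrite mxE.
  by rewrite (nth_map j) ?size_enum_ord // nth_ord_enum; have [_ ->] := zval_of (cen i 0 j).
rewrite /kmeans_cost big_map; apply: eq_bigr => p _.
have [_ ->] := fval_fmindist d p pcs; rewrite /cs big_map -big_enum /=.
rewrite (eq_bigr (fun i => sqdist (prow d p) (cen i))); last by move=> i _; rewrite dE.
have -> : head [::] [seq [seq zrat_of (cen i 0 j) | j <- enum 'I_d] | i <- enum 'I_k.+1] =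
   [seq zrat_of (cen ord0 0 j) | j <- enum 'I_d] by rewrite enum_ordSl.
by rewrite dE.
Qed.

End FractionValues.
Import FractionValues.

Module Averages.

Import Order.TTheory GRing.Theory Num.Theory.
Local Open Scope ring_scope.

(** * Averages *)

Section Avg.

Variable R : realFieldType.

Definition avg (T : finType) (F : T -> R) : R := (\sum_x F x) / #|T|%:R.

Implicit Types T S : finType.

Lemma eq_avg T (F G : T -> R) : F =1 G -> avg F = avg G.
Proof. by move=> e; rewrite /avg (eq_bigr G). Qed.

Lemma avgD T (F G : T -> R) : avg (fun x => F x + G x) = avg F + avg G.
Proof. by rewrite /avg big_split /= mulrDl. Qed.

Lemma avgZ T c (F : T -> R) : avg (fun x => c * F x) = c * avg F.
Proof. by rewrite /avg -mulr_sumr mulrA. Qed.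

Lemma avg_cst T c : (0 < #|T|)%N -> avg (fun _ : T => c) = c.
Proof. by move=> T0; rewrite /avg sumr_const -[c *+ _]mulr_natr mulfK // pnatr_eq0 -lt0n. Qed.

Lemma ler_avg T (F G : T -> R) : (forall x, F x <= G x) -> avg F <= avg G.
Proof. by move=> le; rewrite /avg ler_wpM2r ?invr_ge0 ?ler0n // ler_sum. Qed.

Lemma avg_ge0 T (F : T -> R) : (forall x, 0 <= F x) -> 0 <= avg F.
Proof. by move=> le; rewrite /avg divr_ge0 ?ler0n // sumr_ge0. Qed.

Lemma avg_reindex T S (h : T -> S) (F : S -> R) :
  bijective h -> avg F = avg (fun x => F (h x)).
Proof.
move=> bh; rewrite /avg (bij_eq_card bh); congr (_ / _).
by rewrite (reindex h) //; apply: onW_bij.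
Qed.

Lemma avg_pair T S (F : T -> S -> R) :
  avg (fun p : T * S => F p.1 p.2) = avg (fun x => avg (F x)).
Proof.
rewrite /avg -mulr_suml card_prod natrM invfM mulrA -pair_bigA /=; ring.
Qed.

Lemma exchange_avg T S (F : T -> S -> R) :
  avg (fun x => avg (F x)) = avg (fun y => avg (F^~ y)).
Proof.
rewrite /avg -!mulr_suml exchange_big /=; ring.
Qed.

Lemma avg_lt1_ex T (P : pred T) : (0 < #|T|)%N ->
  avg (fun x => (P x)%:R) < 1 -> exists x, ~~ P x.
Proof.
move=> T0 lt1; apply/existsP; apply: contraTT lt1; rewrite negb_exists => /forallP h.
rewrite -leNgt -[X in X <= _](avg_cst (T := T)) //; apply: ler_avg => x.
by have := h x; rewrite negbK => ->.
Qed.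

End Avg.

End Averages.
Import Averages.

Module CubeExpanders.

Import Order.TTheory GRing.Theory Num.Theory.
Local Open Scope ring_scope.

(** * Fourier analysis on cubes *)

Section Fourier.

Variables (R : realFieldType) (I : finType).

Notation cube := {ffun I -> bool}.

Definition xorf (x y : cube) : cube := [ffun i => x i (+) y i].

Definition sgn (b : bool) : R := (-1) ^+ b.

Lemma sgnD a b : sgn (a (+) b) = sgn a * sgn b.
Proof. by rewrite /sgn signr_addb. Qed.

Lemma sgnK a : sgn a * sgn a = 1.
Proof. by rewrite -sgnD addbb. Qed.

(** The Walsh character with frequency [u]. *)
Definition chi (u x : cube) : R := \prod_i sgn (u i && x i).

Lemma chiC u x : chi u x = chi x u.
Proof. by apply: eq_bigr => i _; rewrite andbC. Qed.

Lemma chiD u x y : chi u (xorf x y) = chi u x * chi u y.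
Proof.
by rewrite -big_split; apply: eq_bigr => i _ /=; rewrite ffunE -sgnD -andb_addr.
Qed.

Lemma chi_sum u v : \sum_x chi u x * chi v x = (2 ^ #|I|)%:R * (u == v)%:R.
Proof.
under eq_bigr => x _.
  rewrite -big_split /=; over.
rewrite -(bigA_distr_bigA (fun i b => sgn (u i && b) * sgn (v i && b))).
have [->|ne] := eqVneq u v.
  rewrite mulr1 natrX -prodr_const; apply: eq_bigr => i _.
  by rewrite big_bool /= !sgnK.
have /existsP[i ui] : [exists i, u i != v i].
  by rewrite -negb_forall; apply: contraNN ne => /forallP e; apply/eqP/ffunP => i; apply/eqP.
rewrite mulr0 (bigD1 i) //= big_bool /= !andbT !andbF.
by case: (u i) (v i) ui => [] [] //= _; rewrite /sgn !expr0 !expr1 ?mulN1r ?mulrN1 ?mulr1 addNr mul0r.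
Qed.

Definition fourier (f : cube -> R) (u : cube) : R := \sum_x f x * chi u x.

Lemma parseval f : \sum_u fourier f u ^+ 2 = (2 ^ #|I|)%:R * \sum_x f x ^+ 2.
Proof.
have e u : fourier f u ^+ 2 = \sum_x \sum_y f x * f y * (chi x u * chi y u).
  rewrite expr2 /fourier mulr_suml; apply: eq_bigr => x _.
  rewrite mulr_sumr; apply: eq_bigr => y _.
  by rewrite [chi x u]chiC [chi y u]chiC; ring.
under eq_bigr => u _ do rewrite e.
rewrite exchange_big mulr_sumr; apply: eq_bigr => x _ /=.
rewrite exchange_big /= (bigD1 x) //= -mulr_sumr chi_sum eqxx mulr1 big1 ?addr0.
  by rewrite expr2; ring.
by move=> y ne; rewrite -mulr_sumr chi_sum eq_sym (negPf ne) mulr0 mulr0.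
Qed.

Lemma fourierB f g u : fourier (fun x => f x - g x) u = fourier f u - fourier g u.
Proof. by rewrite /fourier -sumrB; apply: eq_bigr => x _; rewrite mulrBl. Qed.

Lemma fourier_perm f (s s' : cube -> cube) u :
  involutive s -> (forall u x, chi u (s x) = chi (s' u) x) ->
  fourier (fun x => f (s x)) u = fourier f (s' u).
Proof.
move=> sK sT; rewrite /fourier (reindex_inj (inv_inj sK)) /=.
by apply: eq_bigr => x _; rewrite sK sT.
Qed.

Lemma fourier_shift f a u :
  fourier (fun x => f (xorf x a)) u = chi u a * fourier f u.
Proof.
have aK : involutive (xorf^~ a).
  by move=> x; apply/ffunP => i; rewrite !ffunE -addbA addbb addbF.
rewrite /fourier (reindex_inj (inv_inj aK)) /= mulr_sumr.
by apply: eq_bigr => x _; rewrite aK chiD; ring.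
Qed.

End Fourier.

(** * A family of expanders *)

Section PingPong.

Variables (R : realFieldType) (k : nat).

Notation I := (bool * 'I_k.+1)%type.
Notation cube := {ffun I -> bool}.

(* The two halves of a vector are polynomials over F_2 of degree at most [k]. *)
Definition mulX (x : 'I_k.+1 -> bool) (i : 'I_k.+1) : bool :=
  if i == 0 :> nat then false else x (inord i.-1).
Definition divX (x : 'I_k.+1 -> bool) (i : 'I_k.+1) : bool :=
  if i == k :> nat then false else x (inord i.+1).

Definition coef (h : bool) (c : 'I_3) (m : ('I_k.+1 -> bool) -> 'I_k.+1 -> bool)
    (x : cube) (i : 'I_k.+1) : bool :=
  ((c != 1 :> nat) && x (h, i)) (+) ((c != 0 :> nat) && m (fun j => x (h, j)) i).

(* Adds 1, X or 1 + X times the half [~~ h] (or its transpose) to the half [h]. *)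
Definition shear (h : bool) (c : 'I_3) m (x : cube) : cube :=
  [ffun p => x p (+) ((p.1 == h) && coef (~~ h) c m x p.2)].

Lemma shearK h c m : involutive (shear h c m).
Proof.
move=> x; apply/ffunP => -[h' i]; rewrite !ffunE /=.
case: eqP => [->|_]; rewrite ?addbF //= -addbA.
suff -> : coef (~~ h) c m (shear h c m x) i = coef (~~ h) c m x i by rewrite addbb addbF.
have e j : shear h c m x (~~ h, j) = x (~~ h, j).
  by rewrite ffunE /=; case: (h); rewrite addbF.
rewrite /coef e; congr (_ (+) (_ && _)).
by congr (m _ i); apply/funext.
Qed.

Lemma coef_ext h c m (x y : cube) i : (forall j, x (h, j) = y (h, j)) ->
  coef h c m x i = coef h c m y i.
Proof.
move=> e; rewrite /coef e; congr (_ (+) (_ && _)).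
by congr (m _ i); apply/funext.
Qed.

Lemma shear_src h c m x j : shear h c m x (~~ h, j) = x (~~ h, j).
Proof. by rewrite ffunE /=; case: (h); rewrite addbF. Qed.

Lemma shear_tgt h c m x j : shear h c m x (h, j) = x (h, j) (+) coef (~~ h) c m x j.
Proof. by rewrite ffunE /= eqxx. Qed.

Lemma chi_half (u x y : cube) h :
  \prod_(p : I) sgn R (u p && ((p.1 == h) && y p)) = \prod_i sgn R (u (h, i) && y (h, i)).
Proof.
pose F a b := sgn R (u (a, b) && ((a == h) && y (a, b))).
rewrite (eq_bigr (fun p : I => F p.1 p.2)); last by case.
rewrite -(pair_bigA _ F) /= {}/F.
rewrite (bigD1 h) //= eqxx /= [X in _ * X]big1 ?mulr1 //.
by move=> h' /negPf->; rewrite big1 // => i _; rewrite andbF.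
Qed.

(** [divX] is the transpose of [mulX], and transposing a shear interchanges its source and target
    halves. In frequency space the labels therefore multiply polynomials, and degrees can be
    followed. *)
Lemma chi_shear h c u x :
  chi R u (shear h c divX x) = chi R (shear (~~ h) c mulX u) x.
Proof.
pose y : cube := [ffun p => coef (~~ h) c divX x p.2].
pose v : cube := [ffun p => coef h c mulX u p.2].
have -> : chi R u (shear h c divX x) =
    chi R u x * \prod_(p : I) sgn R (u p && ((p.1 == h) && y p)).
  by rewrite -big_split; apply: eq_bigr => p _ /=; rewrite !ffunE -sgnD -andb_addr.
have -> : chi R (shear (~~ h) c mulX u) x =
    chi R u x * \prod_(p : I) sgn R (x p && ((p.1 == ~~ h) && v p)).
  rewrite -big_split; apply: eq_bigr => p _ /=; rewrite !ffunE -sgnD negbK.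
  by rewrite [x p && _]andbC -andb_addl.
rewrite !chi_half //; congr (_ * _).
have e1 : \prod_i sgn R (u (h, i) && divX (fun j => x (~~ h, j)) i) =
          \prod_i sgn R (x (~~ h, i) && mulX (fun j => u (h, j)) i).
  rewrite big_ord_recr /= {2}/divX eqxx andbF mulr1.
  rewrite [RHS]big_ord_recl /mulX eqxx andbF mul1r; apply: eq_bigr => i _.
  rewrite /divX /=; have lt_i := ltn_ord i.
  rewrite ifN; last by rewrite neq_ltn lt_i.
  rewrite andbC; congr (sgn R (x (_, _) && u (_, _))); apply: val_inj => /=.
    by rewrite inordK.
  by rewrite add0n inordK // ltnW.
under eq_bigr => i _ do rewrite /y ffunE /coef andb_addr sgnD.
under [RHS]eq_bigr => i _ do rewrite /v ffunE /coef andb_addr sgnD.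
rewrite !big_split /=; congr (_ * _).
  by apply: eq_bigr => i _; case: (nat_of_ord c != 1%N); rewrite ?andbF //= andbC.
case: (c != 0 :> nat); first exact: e1.
by rewrite !big1 // => i _; rewrite andbF.
Qed.

(** The degree plus one, so that the zero polynomial has value 0. *)
Definition deg (h : bool) (u : cube) : nat := \max_(i < k.+1 | u (h, i)) i.+1.

Lemma deg_le h (u : cube) n : (forall i : 'I_k.+1, (n <= i)%N -> u (h, i) = false) -> (deg h u <= n)%N.
Proof.
move=> ub; apply/bigmax_leqP => i ui; rewrite ltnNge; apply/negP => le.
by rewrite ub in ui.
Qed.

Lemma deg_ge h (u : cube) (i : 'I_k.+1) : u (h, i) -> (i < deg h u)%N.
Proof. by move=> ui; apply: (@leq_bigmax_cond _ (fun i => u (h, i)) (fun i => i.+1) i). Qed.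

Lemma deg_lt h (u : cube) (i : 'I_k.+1) : (deg h u <= i)%N -> u (h, i) = false.
Proof. by move=> le; apply/negP => /deg_ge; lia. Qed.

Lemma deg_top h (u : cube) n : deg h u = n.+1 -> (n < k.+1)%N /\ u (h, inord n).
Proof.
move=> dn; have [i0 ui0] : exists i : 'I_k.+1, u (h, i).
  apply/existsP; apply: contraPT dn; rewrite negb_exists => /forallP nu.
  by rewrite /deg big_pred0 // => i; apply/negbTE.
have [i ui di] := eq_bigmax_cond (fun i : 'I_k.+1 => i.+1) (A := [pred i | u (h, i)])
  (ltac:(by apply/card_gt0P; exists i0)).
have : deg h u = i.+1 by [].
by rewrite dn => -[->]; rewrite inord_val.
Qed.

Definition c1 : 'I_3 := inord 0.
Definition cX : 'I_3 := inord 1.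
Definition c1X : 'I_3 := inord 2.

Notation shr h c := (shear (~~ h) c mulX).

Lemma deg_src h c (u : cube) : deg h (shr h c u) = deg h u.
Proof.
apply: eq_bigl => i; have := shear_src (~~ h) c mulX u i; by rewrite negbK.
Qed.

(** Adding [X] or [1 + X] times the half of larger degree makes the other half the larger one,
    unless the shift pushes the leading coefficient out of range. *)
Lemma deg_shrX h c (u : cube) : c != c1 -> (deg (~~ h) u < deg h u)%N ->
  u (h, ord_max) = false -> deg (~~ h) (shr h c u) = (deg h u).+1.
Proof.
move=> nc lt_d top.
have nc0 : (c != 0 :> nat) by apply: contraNneq nc => e; apply/eqP/val_inj; rewrite /= inordK.
case dn: (deg h u) lt_d => [//|n] lt_d.
have [lt_n un] := deg_top dn.
have {}lt_n : (n < k)%N.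
  rewrite ltn_neqAle -ltnS lt_n andbT; apply/eqP => nk.
  suff e : inord n = ord_max :> 'I_k.+1 by rewrite e top in un.
  by apply: val_inj; rewrite /= inordK ?nk.
apply/eqP; rewrite eqn_leq; apply/andP; split.
  apply: deg_le => i le_i; rewrite shear_tgt negbK /coef nc0 /=.
  rewrite (deg_lt (_ : deg (~~ h) u <= i)%N); last by lia.
  rewrite (deg_lt (_ : deg h u <= i)%N); last by lia.
  rewrite andbF /= /mulX ifN; last by lia.
  by apply: deg_lt; rewrite /= inordK; have := ltn_ord i; lia.
have -> : n.+2 = (inord n.+1 : 'I_k.+1).+1 by rewrite inordK.
apply: deg_ge; rewrite shear_tgt negbK /coef nc0 /=.
rewrite (deg_lt (_ : deg (~~ h) u <= _)%N); last by rewrite inordK; lia.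
rewrite (deg_lt (_ : deg h u <= _)%N); last by rewrite inordK; lia.
by rewrite andbF /= /mulX !inordK.
Qed.

Lemma deg_shr1 h (u : cube) : (deg (~~ h) u < deg h u)%N -> deg (~~ h) (shr h c1 u) = deg h u.
Proof.
move=> lt_d; case dn: (deg h u) lt_d => [//|n] lt_d.
have [lt_n un] := deg_top dn.
have E i : shr h c1 u (~~ h, i) = u (~~ h, i) (+) u (h, i).
  by rewrite shear_tgt negbK /coef /= inordK //= addbF.
apply/eqP; rewrite eqn_leq; apply/andP; split.
  by apply: deg_le => i le_i; rewrite E !deg_lt //; lia.
have -> : n.+1 = (inord n : 'I_k.+1).+1 by rewrite inordK.
by apply: deg_ge; rewrite E un deg_lt // inordK.
Qed.

Lemma deg_shr_eq h (u : cube) : deg (~~ h) u = deg h u -> (0 < deg h u)%N ->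
  (deg (~~ h) (shr h c1 u) < deg h u)%N.
Proof.
case dn: (deg h u) => [//|n] dn' _; have [lt_n un] := deg_top dn.
have [_ un'] := deg_top dn'.
apply: deg_le => i le_i; rewrite shear_tgt negbK /coef /= inordK //= addbF.
have [e|ne] := eqVneq (i : nat) n.
  by have -> : i = inord n; [apply: val_inj; rewrite /= inordK | rewrite un un'].
by rewrite !deg_lt //; lia.
Qed.

Lemma shr_comp h (u : cube) : shr h c1X (shr h cX u) = shr h c1 u.
Proof.
apply/ffunP => -[h' i]; rewrite !ffunE /=.
case: eqP => [->|_] /=; rewrite ?addbF // negbK -addbA; congr (_ (+) _).
have e j : shr h cX u (h, j) = u (h, j).
  by have := shear_src (~~ h) cX mulX u j; rewrite negbK.
rewrite (coef_ext c1X mulX i e) /coef /= !inordK //=.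
by case: (u (h, i)); case: (mulX _ _).
Qed.

Section Mass.

Variables (w : cube -> R).
Hypothesis w_ge0 : forall u, 0 <= w u.
Hypothesis w0 : w [ffun=> false] = 0.

Definition vary (S : cube -> cube) : R := \sum_u `|w u - w (S u)|.
Definition mass (P : pred cube) : R := \sum_(u | P u) w u.

Lemma mass_move (P : pred cube) S : involutive S ->
  mass P <= \sum_(u | P (S u)) w u + vary S.
Proof.
move=> SK; rewrite [X in _ <= X + _](reindex_inj (inv_inj SK)) /=.
under [X in _ <= X + _]eq_bigl => u do rewrite SK.
rewrite -lerBlDl -sumrB /vary [X in _ <= X](bigID P) /=.
apply: le_trans (_ : \sum_(u | P u) `|w u - w (S u)| <= _).
  by apply: ler_sum => u _; apply: ler_norm.
by rewrite lerDl sumr_ge0.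
Qed.

Definition dom h (u : cube) := (deg (~~ h) u < deg h u)%N.
Definition high (u : cube) := u (true, ord_max) || u (false, ord_max).

(** Ping-pong: the shears by [X] and by [1 + X] carry the part of [dom h] without top coefficients
    into two disjoint parts of [dom (~~ h)], which therefore weighs about twice as much. *)
Lemma mass_dom h : 2 * (mass (dom h) - mass high) <=
  mass (dom (~~ h)) + vary (shr h cX) + vary (shr h c1X).
Proof.
pose P u := dom h u && ~~ high u.
have leP : mass (dom h) - mass high <= mass P.
  rewrite lerBlDr /mass (bigID high) /= addrC lerD2l.
  rewrite [X in _ <= X](bigID (dom h)) /= [X in _ <= X + _](eq_bigl (fun u => dom h u && high u)).
    by rewrite lerDl sumr_ge0.
  by move=> u; rewrite andbC.
have sK c : involutive (shr h c) by exact: shearK.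
have l1 := mass_move P (sK cX); have l2 := mass_move P (sK c1X).
have Pdom c u : c != c1 -> P (shr h c u) -> dom (~~ h) u.
  move=> nc /andP[dS]; rewrite negb_or => /andP[t1 t2].
  have t : shr h c u (h, ord_max) = false by case: (h) t1 t2 => /negPf t1 /negPf t2.
  have := deg_shrX nc dS t; rewrite sK deg_src /dom negbK => ->.
  exact: ltnSn.
have n1 : cX != c1 by rewrite -val_eqE /= !inordK.
have n2 : c1X != c1 by rewrite -val_eqE /= !inordK.
suff : \sum_(u | P (shr h cX u)) w u + \sum_(u | P (shr h c1X u)) w u <= mass (dom (~~ h)).
  by lra.
rewrite /mass big_mkcond [X in _ + X]big_mkcond [X in _ <= X]big_mkcond -big_split /=.
apply: ler_sum => u _; case: ifP => [P1|_]; case: ifP => [P2|_]; rewrite ?addr0 ?add0r.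
(* Disjointness: over F_2 the two shears differ by the shear by 1, which takes an element of [dom h]
   to a pair of equal degrees. *)
- exfalso; have /andP[d1 _] := P1; have /andP[d2 _] := P2.
  have e : shr h c1X u = shr h c1 (shr h cX u) by rewrite -shr_comp sK.
  by move: d2; rewrite /dom e (deg_shr1 d1) !deg_src ltnn.
- by rewrite (Pdom _ _ n1 P1).
- by rewrite (Pdom _ _ n2 P2).
by case: ifP.
Qed.

Lemma mass_total : \sum_u w u <= 8 * mass high +
  2 * (\sum_(h : bool) (vary (shr h cX) + vary (shr h c1X) + vary (shr h c1))).
Proof.
pose eqd (u : cube) := (deg true u == deg false u) && (0 < deg true u)%N.
have tot : \sum_u w u = mass (dom true) + mass (dom false) + mass eqd.
  rewrite /mass (bigID (dom true)) /= -addrA; congr (_ + _).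
  rewrite (bigID (dom false)) /=; congr (_ + _).
    by apply: eq_bigl => u; rewrite /dom /=; lia.
  rewrite (bigD1 [ffun=> false]) /=; last first.
    have d0 h : deg h [ffun=> false] = 0%N.
      by rewrite /deg big_pred0 // => i; rewrite ffunE.
    by rewrite /dom !d0.
  rewrite w0 add0r; apply: eq_bigl => u; rewrite /dom /eqd /=.
  case: eqVneq => [->|ne]; rewrite /= ?andbT.
    have d0 h : deg h [ffun=> false] = 0%N.
      by rewrite /deg big_pred0 // => i; rewrite ffunE.
    by rewrite !d0 /= ?andbF.
  have /existsP[[h i] ui] : [exists p, u p].
    apply: contraNT ne; rewrite negb_exists => /forallP nu.
    by apply/eqP/ffunP => p; rewrite ffunE; apply/negbTE.
  have := deg_ge ui; case: (h) => {ui}; lia.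
have e1 : mass eqd <= mass (dom true) + vary (shr true c1).
  have sK : involutive (shr true c1) by exact: shearK.
  apply: le_trans (mass_move eqd sK) _; rewrite lerD2r /mass.
  rewrite big_mkcond [X in _ <= X]big_mkcond /=; apply: ler_sum => u _.
  case: ifP => [/andP[/eqP d1 d2]|_]; last by case: ifP.
  have := deg_shr_eq (h := true) (esym d1) d2.
  by rewrite sK deg_src /dom /= => ->.
have d1 := mass_dom true; have d2 := mass_dom false.
have vg S : 0 <= vary S by rewrite sumr_ge0.
have := vg (shr false c1); have := vg (shr true c1).
have := vg (shr true cX); have := vg (shr true c1X).
have := vg (shr false cX); have := vg (shr false c1X).
rewrite big_bool /= in d1 d2 *.
have hg : 0 <= mass high by rewrite sumr_ge0.
rewrite tot; lra.
Qed.

End Mass.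

Definition elabel : finType := (bool * option 'I_3)%type.

Definition flip (h : bool) : cube := [ffun p => p == (h, ord_max)].

(** The two flips account for the frequencies with a top coefficient, where the degree argument for
    the shears breaks down. *)
Definition enb (x : cube) (l : elabel) : cube :=
  if l.2 is Some c then shear l.1 c divX x else xorf x (flip l.1).

Lemma enbK l x : enb (enb x l) l = x.
Proof.
case: l => h [c|]; rewrite /enb /=; first exact: shearK.
by apply/ffunP => p; rewrite !ffunE -addbA addbb addbF.
Qed.

Lemma chi_flip h u : chi R u (flip h) = sgn R (u (h, ord_max)).
Proof.
rewrite /chi (bigD1 (h, ord_max)) //= ffunE eqxx andbT big1 ?mulr1 //.
by move=> p ne; rewrite ffunE (negPf ne) andbF.
Qed.

Definition energy (f : cube -> R) (l : elabel) := \sum_x (f x - f (enb x l)) ^+ 2.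

(** In the manner of Gabber and Galil, in frequency space: a function of mean zero has no weight at
    frequency 0, the energy of a flip is 4 times the weight of the frequencies with that top
    coefficient, and the energy of a shear controls the variation of the weight under the transposed
    shear. *)
Lemma cube_poincare0 (f : cube -> R) : \sum_x f x = 0 ->
  \sum_x f x ^+ 2 <= 96 * \sum_l energy f l.
Proof.
move=> f0; pose F := fourier f; pose w u := F u ^+ 2.
pose c : R := (2 ^ #|{: bool * 'I_k.+1}|)%:R; have c_gt0 : 0 < c by rewrite ltr0n expn_gt0.
rewrite -(ler_pM2l c_gt0) -parseval [X in _ <= X](_ : _ = 96 * (c * \sum_l energy f l)); last by ring.
have en l : c * energy f l = \sum_u (F u - fourier (fun x => f (enb x l)) u) ^+ 2.
  by rewrite /energy -parseval; apply: eq_bigr => u _; rewrite fourierB.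
have enS h b : c * energy f (h, Some b) = \sum_u (F u - F (shr h b u)) ^+ 2.
  rewrite en; apply: eq_bigr => u _; congr ((_ - _) ^+ 2).
  rewrite (@fourier_perm _ _ f (shear h b divX) (shr h b)) //; first exact: shearK.
  by move=> v x; rewrite chi_shear.
have enF h : c * energy f (h, None) = 4 * \sum_(u : cube | u (h, ord_max)) w u.
  rewrite en mulr_sumr [RHS]big_mkcond; apply: eq_bigr => u _.
  rewrite fourier_shift chi_flip -/F /sgn; case: (u _); rewrite ?expr1 ?expr0 /w; ring.
have w_ge0 u : 0 <= w u by exact: sqr_ge0.
have w0 : w [ffun=> false] = 0.
  rewrite /w /F /fourier (eq_bigr f) ?f0 ?expr0n // => x _.
  by rewrite /chi big1 ?mulr1 // => p _; rewrite ffunE.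
(* The six variations enter [mass_total] with factor 2, so with weight 24 they return half of the
   total weight. Moving it to the left gives [96 = 2 * 2 * 24]. *)
have var h b : vary w (shr h b) <= 24 * (c * energy f (h, Some b)) + (\sum_u w u) / 24.
  rewrite enS; set S := shr h b; have SK : involutive S by exact: shearK.
  have e2 : \sum_u w u = \sum_u w (S u) by rewrite (reindex_inj (inv_inj SK)).
  have -> : (\sum_u w u) / 24 = \sum_u (w u + w (S u)) / 48.
    by rewrite -mulr_suml big_split /= -e2; lra.
  rewrite mulr_sumr -big_split /=; apply: ler_sum => u _.
  rewrite /w subr_sqr normrM.
  have := sqr_ge0 (48 * `|F u - F (S u)| - `|F u + F (S u)|).
  have := sqr_ge0 (F u - F (S u)).
  have := real_normK (num_real (F u - F (S u))).
  have := real_normK (num_real (F u + F (S u))).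
  set a := `| _ |; set b' := `| _ |; nra.
have high_le : mass w high <= \sum_h (c * energy f (h, None)) / 4.
  rewrite big_bool /= !enF /mass big_mkcond /= ![4 * _]mulrC !mulfK ?pnatr_eq0 //.
  rewrite [X in _ <= X + _]big_mkcond [X in _ <= _ + X]big_mkcond -big_split /=.
  apply: ler_sum => u _; rewrite /high; have := w_ge0 u.
  by case: (u (true, _)); case: (u (false, _)) => /=; lra.
pose G h o := c * energy f (h, o).
have Esum : c * \sum_l energy f l = \sum_h \sum_o G h o.
  rewrite mulr_sumr (eq_bigr (fun p : elabel => G p.1 p.2)); last by case.
  by rewrite -(pair_bigA _ G).
have := mass_total w_ge0 w0.
have en0 l : 0 <= c * energy f l.
  by rewrite mulr_ge0 ?(ltW c_gt0) // /energy sumr_ge0 // => x _; apply: sqr_ge0.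
have -> : \sum_u fourier f u ^+ 2 = \sum_u w u by [].
rewrite Esum.
have bo (Q : option 'I_3 -> R) : \sum_o Q o = Q None + (Q (Some c1) + Q (Some cX) + Q (Some c1X)).
  rewrite (bigD1 None) //=; congr (_ + _).
  rewrite (reindex_omap Some id) /=; last by case.
  rewrite (eq_bigl predT); last by move=> i; rewrite eqxx.
  rewrite !big_ord_recr big_ord0 /= add0r.
  by congr (Q (Some _) + Q (Some _) + Q (Some _)); apply: val_inj; rewrite /= inordK.
rewrite !big_bool /= !bo /G in high_le *.
have := var true c1; have := var true cX; have := var true c1X.
have := var false c1; have := var false cX; have := var false c1X.
have := en0 (true, None); have := en0 (true, Some c1); have := en0 (true, Some cX).
have := en0 (true, Some c1X); have := en0 (false, None); have := en0 (false, Some c1).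
have := en0 (false, Some cX); have := en0 (false, Some c1X).
by move=> *; lra.
Qed.

End PingPong.

End CubeExpanders.
Import CubeExpanders.

Module EvaluationTests.

Import Order.TTheory GRing.Theory Num.Theory.
Local Open Scope ring_scope.

(** * Testing evaluations *)

Section Cube.

Variables (R : realFieldType) (U : finType).

Notation X := {ffun U -> bool}.

Lemma xorfC (x y : X) : xorf x y = xorf y x.
Proof. by apply/ffunP => i; rewrite !ffunE addbC. Qed.

Lemma xorfA (x y z : X) : xorf x (xorf y z) = xorf (xorf x y) z.
Proof. by apply/ffunP => i; rewrite !ffunE addbA. Qed.

Lemma xorKf (x y : X) : xorf x (xorf x y) = y.
Proof. by apply/ffunP => i; rewrite !ffunE addbA addbb. Qed.

Lemma xorf_bij (x : X) : bijective (xorf x).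
Proof. by exists (xorf x) => y; apply: xorKf. Qed.

Lemma X_gt0 : (0 < #|{: X}|)%N.
Proof. by apply/card_gt0P; exists [ffun=> false]. Qed.

Definition additive (f : X -> bool) := forall x y, f (xorf x y) = f x (+) f y.

Lemma additive0 f : additive f -> f [ffun=> false] = false.
Proof.
move=> fD; have := fD [ffun=> false] [ffun=> false].
have -> : xorf [ffun=> false] [ffun=> false] = [ffun=> false] :> X.
  by apply/ffunP => i; rewrite !ffunE.
by rewrite addbb.
Qed.

Lemma additive_half f x0 : additive f -> f x0 -> avg (fun x => (f x)%:R : R) = 1 / 2.
Proof.
move=> fD fx0.
have e1 : avg (fun x => (f x)%:R : R) = avg (fun x => (~~ f x)%:R).
  rewrite (avg_reindex _ (xorf_bij x0)); apply: eq_avg => x.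
  by rewrite fD fx0.
have : avg (fun x => (f x)%:R : R) + avg (fun x => (~~ f x)%:R) = 1.
  rewrite -avgD -[RHS](avg_cst (T := {: X})) ?X_gt0 //; apply: eq_avg => x.
  by case: (f x); rewrite ?addr0 ?add0r.
by rewrite -e1; lra.
Qed.

(** A nonzero additive function is true on exactly half of the cube; this is used once in each
    argument. *)
Lemma biadditive_quarter (D : X -> X -> bool) x0 y0 :
  (forall x, additive (D x)) -> (forall y, additive (D^~ y)) -> D x0 y0 ->
  1 / 4 <= avg (fun x => avg (fun y => (D x y)%:R : R)).
Proof.
move=> D1 D2 D0.
apply: le_trans (_ : avg (fun x => (1 / 2) * (D x y0)%:R) <= _).
  by rewrite avgZ (@additive_half (D^~ y0) x0) //; lra.
apply: ler_avg => x; case Dx: (D x y0); rewrite ?mulr1 ?mulr0.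
  by rewrite (additive_half (D1 x) Dx).
by apply: avg_ge0 => y; rewrite ler0n.
Qed.

(** * The linearity test of Blum, Luby and Rubinfeld *)

Section BLR.

Variables (f : X -> bool) (d : R).

Hypothesis lin : avg (fun x => avg (fun y => (f x (+) f y (+) f (xorf x y))%:R)) <= d.
Hypothesis d_small : d <= 1 / 100.

Definition vote x y := f (xorf x y) (+) f y.
(** Self-correction of [f]: the majority of the votes at [x]. *)
Definition corr x := 1 / 2 <= avg (fun y => (vote x y)%:R : R).

Definition miss x := avg (fun y => (vote x y (+) corr x)%:R : R).

Lemma avg_neg (g : X -> bool) : avg (fun y => (~~ g y)%:R : R) = 1 - avg (fun y => (g y)%:R).
Proof.
have e : avg (fun y : X => 1 : R) = 1 by rewrite avg_cst ?X_gt0.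
suff : avg (fun y => (~~ g y)%:R : R) + avg (fun y => (g y)%:R) = 1 by lra.
rewrite -avgD -[RHS]e; apply: eq_avg => y.
by case: (g y); rewrite /= ?addr0 ?add0r.
Qed.

Lemma miss_half x : 0 <= miss x <= 1 / 2.
Proof.
rewrite /miss avg_ge0 /=; last by move=> y; rewrite ler0n.
case c: (corr x); last first.
  under eq_avg do rewrite addbF.
  by move/negbT: c; rewrite /corr -ltNge => /ltW.
under eq_avg do rewrite addbT.
by rewrite avg_neg; move: c; rewrite /corr; lra.
Qed.

(** Two independent votes differ with probability [2 m (1 - m)] for [m = miss x <= 1 / 2], which is
    at least [m]. They differ only if one of two instances of the linearity test fails. *)
Lemma miss_le x : miss x <= 2 * d.
Proof.
have two : avg (fun y => avg (fun z => (vote x y (+) vote x z)%:R : R)) <= 2 * d.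
  pose t y z := f y (+) f z (+) f (xorf y z).
  apply: le_trans (_ : avg (fun y => avg (fun z => (t (xorf x y) z)%:R + (t (xorf x z) y)%:R)) <= _).
    apply: ler_avg => y; apply: ler_avg => z; rewrite /t /vote.
    have -> : xorf (xorf x z) y = xorf (xorf x y) z by rewrite -!xorfA [xorf z y]xorfC.
    by do 5!case: (f _); rewrite /= -?natrD ler_nat.
  under eq_avg do rewrite avgD; rewrite avgD.
  rewrite [X in _ + X]exchange_avg.
  rewrite -(avg_reindex (fun y => avg (fun z => (t y z)%:R)) (xorf_bij x)).
  by move: lin; rewrite -/t; lra.
have e : avg (fun y => avg (fun z => (vote x y (+) vote x z)%:R : R)) =
   2 * miss x * (1 - miss x).
  pose g y := vote x y (+) corr x.
  have -> : avg (fun y => avg (fun z => (vote x y (+) vote x z)%:R : R)) =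
    avg (fun y => (g y)%:R * (1 - miss x) + (~~ g y)%:R * miss x).
    apply: eq_avg => y; rewrite -avg_neg -/g.
    have -> : avg (fun z => (vote x y (+) vote x z)%:R) = avg (fun z => (g y (+) g z)%:R) :> R.
      by apply: eq_avg => z; rewrite /g; case: (vote x y); case: (vote x z); case: (corr x).
    case: (g y); rewrite ?mul1r ?mul0r ?add0r ?addr0.
      by apply: eq_avg => z; rewrite addTb.
    by rewrite /miss; apply: eq_avg => z; rewrite addFb.
  rewrite avgD; under eq_avg do rewrite mulrC; rewrite avgZ.
  under [X in _ + X]eq_avg do rewrite mulrC; rewrite avgZ avg_neg -/(miss x); ring.
have /andP[] := miss_half x; rewrite e in two; nra.
Qed.

(** The majorities at [x], [y] and their sum fail with total probability at most [6 * d < 1], so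
    some [z] makes three votes correct at once, and these votes add up exactly. *)
Lemma corr_additive : additive corr.
Proof.
move=> x y.
have [||z nz] := @avg_lt1_ex R _ (fun z => [|| vote x z (+) corr x,
  vote y (xorf x z) (+) corr y | vote (xorf x y) z (+) corr (xorf x y)]).
- exact: X_gt0.
- apply: le_lt_trans (_ : miss x + miss y + miss (xorf x y) < 1); last first.
    have ds := d_small; have := miss_le x; have := miss_le y; have := miss_le (xorf x y).
    by move=> *; lra.
  have -> : miss y = avg (fun z => (vote y (xorf x z) (+) corr y)%:R).
    by rewrite /miss (avg_reindex _ (xorf_bij x)).
  rewrite /miss -!avgD; apply: ler_avg => z.
  by do 3!case: (_ (+) _); rewrite /= -?natrD ler_nat.
move: nz; rewrite !negb_or !negb_add => /and3P[/eqP<- /eqP<- /eqP<-].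
rewrite /vote xorfA [xorf y x]xorfC.
by case: (f z); case: (f (xorf x z)); case: (f _).
Qed.

(** Where [f] departs from the majority vote, at least half of the tests through that point fail. *)
Lemma corr_close : avg (fun x => (f x (+) corr x)%:R : R) <= 2 * d.
Proof.
have le x : (f x (+) corr x)%:R <= 2 * avg (fun y => (f x (+) f y (+) f (xorf x y))%:R : R).
  have /andP[m0 m1] := miss_half x.
  case ne: (f x (+) corr x); last by rewrite mulr_ge0 // avg_ge0 // => y; rewrite ler0n.
  have -> : avg (fun y => (f x (+) f y (+) f (xorf x y))%:R : R) = 1 - miss x.
    rewrite -avg_neg; apply: eq_avg => y; move: ne; rewrite /vote.
    by case: (f x); case: (corr x); case: (f y); case: (f _).
  by rewrite mulr1n; lra.
by apply: le_trans (ler_avg le) _; rewrite avgZ ler_pM2l ?ltr0n.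
Qed.

End BLR.

Definition andf (x y : X) : X := [ffun i => x i && y i].
Definition ind (W : pred U) : X := [ffun i => W i].

Lemma additive_mult_eval f (W : pred U) : additive f ->
  (forall x y, f (andf x y) = f x && f y) -> f (ind W) ->
  exists2 u, W u & forall x, f x = x u.
Proof.
move=> fD fM fW.
have fsum (s : seq U) : uniq s -> f (ind (mem s)) ->
    exists2 u, u \in s & f (ind (pred1 u)).
  elim: s => [_ |u s IHs /= /andP[us uns]].
    have -> : ind (mem [::]) = [ffun=> false] by apply/ffunP => i; rewrite !ffunE.
    by rewrite additive0.
  have -> : ind (mem (u :: s)) = xorf (ind (pred1 u)) (ind (mem s)).
    apply/ffunP => i; rewrite !ffunE /= inE; case: eqP => [->|//].
    by rewrite (negPf us).
  rewrite fD; case e: (f (ind (pred1 u))) => /=.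
    by exists u; rewrite ?inE ?eqxx.
  by move=> /(IHs uns)[v vs fv]; exists v; rewrite // inE vs orbT.
have [||u] := fsum (enum W); first exact: enum_uniq.
  by have -> : ind (mem (enum W)) = ind W by apply/ffunP => i; rewrite !ffunE; exact: mem_enum.
rewrite mem_enum => Wu fu; exists u => // x.
rewrite -[LHS]andbT -fu -fM.
case xu: (x u).
  suff -> : andf x (ind (pred1 u)) = ind (pred1 u) by [].
  by apply/ffunP => i; rewrite !ffunE /=; case: eqP => [->|]; rewrite ?xu ?andbF.
suff -> : andf x (ind (pred1 u)) = [ffun=> false] by rewrite additive0.
by apply/ffunP => i; rewrite !ffunE /=; case: eqP => [->|]; rewrite ?xu ?andbF.
Qed.

Definition pull (Y : finType) (g : {ffun Y -> bool}) (p : U -> Y) : X := [ffun u => g (p u)].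

End Cube.

Section Decode.

Variables (R : realFieldType) (U Y : finType) (W : pred U) (kap : U -> Y) (k0 : Y).

Notation X := {ffun U -> bool}.

Variables (f : X -> bool) (d : R).

Definition dist_eval (f : X -> bool) (u : U) : R := avg (fun x => (f x (+) x u)%:R).

Lemma avg_union3 (T : finType) (a b c e : T -> bool) :
  (forall x, a x -> [|| b x, c x | e x]) ->
  avg (fun x => (a x)%:R : R) <=
  avg (fun x => (b x)%:R) + avg (fun x => (c x)%:R) + avg (fun x => (e x)%:R).
Proof.
move=> h; rewrite -!avgD; apply: ler_avg => x; have := h x.
by case: (a x); case: (b x); case: (c x); case: (e x); rewrite -!natrD ler_nat //= => /(_ isT).
Qed.

(** The corrected function [p] is additive and [2 * d]-close to [f]. The product test makes it an
    evaluation, the third test puts the point into [W], and the last one determines its image under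
    [kap]. *)
Lemma long_code_decode : d <= 1 / 100 ->
  avg (fun x => avg (fun y => (f x (+) f y (+) f (xorf x y))%:R)) <= d ->
  avg (fun x => avg (fun y => avg (fun z =>
    ((f x && f y) (+) f z (+) f (xorf (andf x y) z))%:R))) <= d ->
  avg (fun x => (~~ (f (xorf (ind W) x) (+) f x))%:R) <= d ->
  avg (fun g : {ffun Y -> bool} => avg (fun x =>
    (f (xorf (pull g kap) x) (+) f x (+) g k0)%:R)) <= d ->
  exists u, [/\ W u, kap u = k0 & dist_eval f u <= 2 * d].
Proof.
move=> d_small lin mult wt info.
pose p := corr R f; have pD : additive p by apply: corr_additive lin d_small.
have pc : avg (fun x => (f x (+) p x)%:R : R) <= 2 * d by apply: corr_close lin.
have pM x y : p (andf x y) = p x && p y.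
  pose D x y := (p x && p y) (+) p (andf x y).
  (* The defect of multiplicativity is biadditive, hence zero once it is rarer than a quarter. The
     test contributes [d] and the four replacements of [f] by [p] contribute [8 * d]. *)
  suff Dz : avg (fun x => avg (fun y => (D x y)%:R : R)) < 1 / 4.
    apply/eqP; rewrite eq_sym -negb_add -/(D x y); apply/negP => Dxy.
    suff : 1 / 4 <= avg (fun x => avg (fun y => (D x y)%:R : R)) by lra.
    apply: (@biadditive_quarter _ _ D x y) => // [u|u] a b; rewrite /D.
      have -> : andf u (xorf a b) = xorf (andf u a) (andf u b).
        by apply/ffunP => i; rewrite !ffunE andb_addr.
      by rewrite !pD; case: (p u); case: (p a); case: (p b); do 2!case: (p _).
    have -> : andf (xorf a b) u = xorf (andf a u) (andf b u).
      by apply/ffunP => i; rewrite !ffunE andb_addl.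
    by rewrite !pD; case: (p u); case: (p a); case: (p b); do 2!case: (p _).
  have dpos : 0 <= d.
    by apply: le_trans lin; apply: avg_ge0 => a; apply: avg_ge0 => b; rewrite ler0n.
  pose e x : R := (f x (+) p x)%:R.
  pose t x y z : R := ((f x && f y) (+) f z (+) f (xorf (andf x y) z))%:R.
  have X0 := X_gt0 U.
  have le1 a b : (D a b)%:R <= avg (fun z => t a b z + (e a + (e b + (e z + e (xorf (andf a b) z))))).
    rewrite -[X in X <= _](avg_cst (T := {: X})) //; apply: ler_avg => z.
    rewrite /D /t /e; have := pD (andf a b) z.
    by case: (f a); case: (f b); case: (f z); case: (f _); case: (p a); case: (p b); case: (p z); case: (p (xorf _ _)); case: (p _) => //= _; rewrite -?natrD ler_nat.
  apply: le_lt_trans (_ : avg (fun a => avg (fun b => avg (fun z =>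
     t a b z + (e a + (e b + (e z + e (xorf (andf a b) z))))))) < _).
    by apply: ler_avg => a; apply: ler_avg => b.
  have -> : avg (fun a => avg (fun b => avg (fun z =>
     t a b z + (e a + (e b + (e z + e (xorf (andf a b) z))))))) =
     avg (fun a => avg (fun b => avg (fun z => t a b z))) + (avg e + (avg e + (avg e + avg e))).
    have c4 : avg (fun a : X => avg (fun b : X => avg (fun z => e (xorf (andf a b) z)))) = avg e.
      rewrite -[RHS](avg_cst (T := {: X})) //; apply: eq_avg => a.
      rewrite -[RHS](avg_cst (T := {: X})) //; apply: eq_avg => b.
      by rewrite [RHS](avg_reindex _ (xorf_bij (andf a b))).
    under eq_avg => a do under eq_avg => b do rewrite !avgD !avg_cst //.
    under eq_avg => a do rewrite !avgD !avg_cst //.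
    by rewrite !avgD !avg_cst // c4.
  by move: mult pc; rewrite -/t -/e; lra.
have pW : p (ind W).
  apply/negPn/negP => npW.
  have [||x] := @avg_lt1_ex R _ (fun x => [|| ~~ (f (xorf (ind W) x) (+) f x),
     f (xorf (ind W) x) (+) p (xorf (ind W) x) | f x (+) p x]).
  - exact: X_gt0.
  - apply: le_lt_trans (avg_union3 (fun x h => h)) _.
    by rewrite -(avg_reindex (fun x => (f x (+) p x)%:R) (xorf_bij (ind W))); lra.
  rewrite !negb_or negbK !negb_add => /and3P[a /eqP b /eqP c].
  by move: a; rewrite b c pD (negPf npW) addbb.
have [u Wu pu] := additive_mult_eval pD pM pW.
exists u; split=> //; last by rewrite /dist_eval; under eq_avg do rewrite -pu.
apply/eqP/negPn/negP => ne.
(* A random [g] separates two distinct points half of the time, while the test and two replacements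
   of [f] by [p] allow only [5 * d]. *)
pose h (g : {ffun Y -> bool}) := g (kap u) (+) g k0.
have hD : additive h.
  move=> g g'; rewrite /h !ffunE.
  by case: (g (kap u)); case: (g k0); case: (g' (kap u)); case: (g' k0).
have h1 : h (ind (pred1 k0)) by rewrite /h !ffunE /= eqxx (negPf ne).
have := additive_half R hD h1; suff : avg (fun g => (h g)%:R : R) <= 5 * d by lra.
have X0 := X_gt0 U.
apply: le_trans (_ : avg (fun g => avg (fun x =>
  (f (xorf (pull g kap) x) (+) f x (+) g k0)%:R + ((f (xorf (pull g kap) x) (+) p (xorf (pull g kap) x))%:R + (f x (+) p x)%:R))) <= _).
  apply: ler_avg => g; rewrite -[X in X <= _](avg_cst (T := {: X})) //; apply: ler_avg => x.
  have := pD (pull g kap) x; rewrite [p (pull g kap)]pu ffunE /h.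
  by case: (g _); case: (g _); case: (f _); case: (f x); case: (p x); case: (p _) => //= _; rewrite -?natrD ler_nat.
under eq_avg => g do rewrite !avgD -(avg_reindex (fun x => (f x (+) p x)%:R) (xorf_bij (pull g kap))).
rewrite !avgD !avg_cst ?X_gt0 //; lra.
Qed.

End Decode.

Section Consistency.

Variables (R : realFieldType) (U U' Y : finType) (p : U -> Y) (p' : U' -> Y).

(** A random [g] separates [p u] from [p' u'] half of the time, and each of the four queried values
    is wrong with probability at most [d]. *)
Lemma consistency_reject (f : {ffun U -> bool} -> bool) (f' : {ffun U' -> bool} -> bool)
    u u' (d : R) : dist_eval R f u <= d -> dist_eval R f' u' <= d -> p u != p' u' ->
  1 / 2 - 4 * d <= avg (fun g : {ffun Y -> bool} => avg (fun x => avg (fun y =>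
    (f x (+) f (xorf (pull g p) x) (+) (f' y (+) f' (xorf (pull g p') y)))%:R))).
Proof.
move=> du du' ne.
pose h (g : {ffun Y -> bool}) := g (p u) (+) g (p' u').
have hD : additive h.
  move=> g g'; rewrite /h !ffunE.
  by case: (g (p u)); case: (g (p' u')); case: (g' (p u)); case: (g' (p' u')).
have h1 : h (ind (pred1 (p u))) by rewrite /h !ffunE /= eqxx eq_sym (negPf ne).
rewrite lerBlDr -(additive_half R hD h1).
have X0 := X_gt0 U; have X0' := X_gt0 U'; have Y0 := X_gt0 Y.
pose e x : R := (f x (+) x u)%:R; pose e' y : R := (f' y (+) y u')%:R.
apply: le_trans (_ : avg (fun g => avg (fun x => avg (fun y =>
    (f x (+) f (xorf (pull g p) x) (+) (f' y (+) f' (xorf (pull g p') y)))%:R +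
    (e x + (e (xorf (pull g p) x) + (e' y + e' (xorf (pull g p') y))))))) <= _).
  apply: ler_avg => g; rewrite -[X in X <= _](avg_cst (T := {: {ffun U -> bool}})) //.
  apply: ler_avg => x; rewrite -[X in X <= _](avg_cst (T := {: {ffun U' -> bool}})) //.
  apply: ler_avg => y; rewrite /e /e' !ffunE /h.
  by case: (g (p u)); case: (g (p' u')); case: (f x); case: (f _); case: (f' y); case: (f' _); case: (x u); case: (y u'); rewrite /= -?natrD ler_nat.
under eq_avg => g do under eq_avg => x do
  rewrite !avgD !avg_cst // -(avg_reindex e' (xorf_bij (pull g p'))).
under eq_avg => g do rewrite !avgD !avg_cst // -(avg_reindex e (xorf_bij (pull g p))).
rewrite !avgD !avg_cst // lerD2l.
have : avg e <= d by []; have : avg e' <= d by []; lra.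
Qed.

End Consistency.

End EvaluationTests.
Import EvaluationTests.

Module RandomWalks.

Import Order.TTheory GRing.Theory Num.Theory.
Local Open Scope ring_scope.

(** * Random walks *)

Section Walk.

Variables (R : realFieldType) (V L : finType) (mv : V -> L -> V).
Hypothesis mvK : forall v l, mv (mv v l) l = v.
Hypothesis L_gt0 : (0 < #|L|)%N.

Implicit Types (f g : V -> R) (F : seq L -> R).

Lemma sum_mv l f : \sum_v f (mv v l) = \sum_v f v.
Proof.
have mvI : involutive (mv^~ l) by move=> v; apply: mvK.
by rewrite [RHS](reindex_inj (inv_inj mvI)).
Qed.

Lemma sum_avg (I T : finType) (G : I -> T -> R) :
  \sum_v avg (G v) = avg (fun x => \sum_v G v x).
Proof. by rewrite /avg -mulr_suml exchange_big. Qed.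

Definition walk (v : V) (w : seq L) : V := foldl mv v w.

Lemma walk_rev v p : walk (walk v p) (rev p) = v.
Proof.
elim: p v => [//|l p IHp] v; rewrite rev_cons /walk -cats1 foldl_cat /=.
by rewrite -/(walk _ _) -/(walk _ _) IHp mvK.
Qed.

(** The expectation over a uniform word of length [n], in the recursive form suited to an analysis
    by the first step. *)
Fixpoint ew (n : nat) F : R :=
  if n is n'.+1 then avg (fun l => ew n' (fun w => F (l :: w))) else F [::].

Lemma eq_ew n F G : (forall w, size w = n -> F w = G w) -> ew n F = ew n G.
Proof.
elim: n F G => [|n IHn] F G e /=; first exact: e.
by apply: eq_avg => l; apply: IHn => w sw; apply: e; rewrite /= sw.
Qed.

Lemma ler_ew n F G : (forall w, size w = n -> F w <= G w) -> ew n F <= ew n G.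
Proof.
elim: n F G => [|n IHn] F G e /=; first exact: e.
by apply: ler_avg => l; apply: IHn => w sw; apply: e; rewrite /= sw.
Qed.

Lemma ewD n F G : ew n (fun w => F w + G w) = ew n F + ew n G.
Proof.
elim: n F G => [//|n IHn] F G /=; rewrite -avgD; apply: eq_avg => l.
exact: IHn.
Qed.

Lemma ewZ n c F : ew n (fun w => c * F w) = c * ew n F.
Proof.
elim: n F => [//|n IHn] F /=; rewrite -avgZ; apply: eq_avg => l.
exact: IHn.
Qed.

Lemma ew_cst n c : ew n (fun=> c) = c.
Proof. by elim: n => //= n ->; rewrite avg_cst. Qed.

Lemma ew_ge0 n F : (forall w, 0 <= F w) -> 0 <= ew n F.
Proof. by move=> h; rewrite -(ew_cst n 0); apply: ler_ew. Qed.

Lemma ew_sum (T : Type) (r : seq T) (P : pred T) n (F : T -> seq L -> R) :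
  ew n (fun w => \sum_(i <- r | P i) F i w) = \sum_(i <- r | P i) ew n (F i).
Proof.
elim: r => [|i r IHr].
  by rewrite big_nil -{2}(ew_cst n 0); apply: eq_ew => w _; rewrite big_nil.
under eq_ew => w _ do rewrite big_cons; rewrite big_cons.
by case: (P i); rewrite ?ewD IHr.
Qed.

Lemma avg_ew (T : finType) n (F : T -> seq L -> R) :
  avg (fun x => ew n (F x)) = ew n (fun w => avg (fun x => F x w)).
Proof.
elim: n F => [//|n IHn] F /=; rewrite exchange_avg.
by apply: eq_avg => l; rewrite IHn.
Qed.

Lemma ew_cat a b F : ew (a + b) F = ew a (fun p => ew b (fun q => F (p ++ q))).
Proof. by elim: a F => [//|a IHa] F /=; apply: eq_avg => l; rewrite IHa. Qed.

(** Reversibility: every letter acts as an involution, so from a uniform starting vertex the walk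
    and its reversal have the same law. *)
Lemma ew_rev n (H : V -> seq L -> R) :
  \sum_v ew n (H v) = \sum_v ew n (fun w => H (walk v w) (rev w)).
Proof.
elim: n H => [//|n IHn] H.
transitivity (\sum_v ew (n + 1) (fun w => H (walk v w) (rev w))); last by rewrite addn1.
under [RHS]eq_bigr => v _ do rewrite ew_cat /= -avg_ew.
rewrite /= !sum_avg; apply: eq_avg => l.
under [RHS]eq_bigr => v _.
  rewrite (@eq_ew _ _ (fun w => H (mv (walk v w) l) (l :: rev w))); last first.
    by move=> w _; rewrite cats1 rev_rcons /walk -cats1 foldl_cat.
  over.
rewrite -(IHn (fun v w => H (mv v l) (l :: w))).
by rewrite (sum_mv l (fun v => ew n (fun w => H v (l :: w)))).
Qed.

Lemma ew_tuple n F : avg (fun w : n.-tuple L => F w) = ew n F.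
Proof.
elim: n F => [|n IHn] F /=.
  rewrite /avg (big_pred1 [tuple]) ?card_tuple ?expn0 ?divr1 //.
  by move=> w; apply/esym/eqP; apply: tuple0.
under [RHS]eq_avg => l do rewrite -IHn.
rewrite -(avg_pair (fun l (w : n.-tuple L) => F (l :: w))).
rewrite (@avg_reindex _ _ _ (fun p : L * n.-tuple L => [tuple of p.1 :: p.2])) //.
exists (fun w : n.+1.-tuple L => (thead w, [tuple of behead w])).
  by case=> l w /=; congr (_, _); rewrite ?theadE //; apply: val_inj.
by move=> w /=; rewrite [RHS]tuple_eta; apply: val_inj.
Qed.

Definition avop f v : R := avg (fun l => f (mv v l)).
Definition dot f g : R := \sum_v f v * g v.

Lemma dot_avop f g : dot f (avop g) = dot (avop f) g.
Proof.
rewrite /dot /avop; under eq_bigr => v _ do rewrite -avgZ.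
under [RHS]eq_bigr => v _ do rewrite mulrC -avgZ.
rewrite !sum_avg; apply: eq_avg => l.
rewrite -(sum_mv l (fun v => f v * g (mv v l))); apply: eq_bigr => v _.
by rewrite mvK mulrC.
Qed.

Lemma dotC f g : dot f g = dot g f.
Proof. by apply: eq_bigr => v _; rewrite mulrC. Qed.

Lemma iter_avop n f v : iter n avop f v = ew n (fun w => f (walk v w)).
Proof.
elim: n v => // n IHn v; rewrite iterS /avop /=.
apply: eq_avg => l; exact: IHn.
Qed.

Lemma sum_avop f : \sum_v avop f v = \sum_v f v.
Proof.
rewrite sum_avg (eq_avg (G := fun=> \sum_v f v)) ?avg_cst // => l.
exact: sum_mv.
Qed.

Lemma dot_ge0 f : 0 <= dot f f.
Proof. by apply: sumr_ge0 => v _; rewrite -expr2 sqr_ge0. Qed.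

Variable lam : R.
Hypothesis lam_gt0 : 0 < lam.
Hypothesis lam_lt1 : lam < 1.
Hypothesis psd : forall f, 0 <= dot f (avop f).
Hypothesis gap : forall f, \sum_v f v = 0 -> dot f (avop f) <= lam * dot f f.

Lemma dot_lin f g c : dot (fun v => f v - c * g v) (avop (fun v => f v - c * g v)) =
  dot f (avop f) - 2 * c * dot g (avop f) + c ^+ 2 * dot g (avop g).
Proof.
have -> : avop (fun v => f v - c * g v) = fun v => avop f v - c * avop g v.
  apply/funext => v; rewrite /avop -avgZ -mulN1r -avgZ -avgD.
  by apply: eq_avg => l; ring.
have e : dot f (avop g) = dot g (avop f) by rewrite dot_avop dotC.
transitivity (dot f (avop f) - c * dot f (avop g) - c * dot g (avop f) + c ^+ 2 * dot g (avop g)).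
  rewrite /dot !mulr_sumr -!sumrB -big_split /=; apply: eq_bigr => v _; ring.
by rewrite e; ring.
Qed.

(** Nonnegativity of the form at [f - lam^-1 * avop f], with [gap] at [avop f] for the term of third
    order. It takes the place of a spectral decomposition. *)
Lemma decay2 f : \sum_v f v = 0 -> dot (avop f) (avop f) <= lam * dot f (avop f).
Proof.
move=> f0; have := psd (fun v => f v - lam^-1 * avop f v); rewrite dot_lin.
have := gap (f := avop f); rewrite sum_avop => /(_ f0).
set a := dot f _; set b := dot (avop f) (avop f); set c := dot _ _ => le1.
have : lam^-1 ^+ 2 * c <= lam^-1 * b.
  rewrite expr2 -mulrA ler_pM2l ?invr_gt0 // -(ler_pM2l lam_gt0) mulrA divff ?gt_eqF //.
  by rewrite mul1r.
move=> le2 le3; rewrite -(ler_pM2l (_ : 0 < lam^-1)) ?invr_gt0 // mulrA mulVf ?gt_eqF //.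
by rewrite mul1r; lra.
Qed.

Lemma decay n f : \sum_v f v = 0 -> dot f (iter n avop f) <= lam ^+ n * dot f f.
Proof.
have shift i g h : dot (iter i avop g) h = dot g (iter i avop h).
  by elim: i g h => //= i IHi g h; rewrite -dot_avop IHi -iterSr.
have sum0 i g : \sum_v g v = 0 -> \sum_v iter i avop g v = 0.
  by move=> g0; elim: i => //= i IHi; rewrite sum_avop.
move=> f0; elim: n => [|n IHn]; first by rewrite expr0 mul1r.
suff : dot f (iter n.+1 avop f) <= lam * dot f (iter n avop f).
  move/le_trans; apply; rewrite exprS -mulrA ler_pM2l //.
(* Half of the iterations go to each side of the product: an odd [n] then reduces to [decay2] and an
   even one to [gap], both at the [m]-th iterate. *)
have := odd_double_half n; rewrite -addnn; set m := n./2.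
case: (odd n) => <-.
  have -> : (true + (m + m)).+1 = (m.+1 + m.+1)%N by lia.
  have -> : (true + (m + m) = m + m.+1)%N by lia.
  by rewrite !iterD -(shift m.+1 f) -(shift m f) !iterS; apply: decay2; apply: sum0.
have -> : (false + (m + m)).+1 = (m + m.+1)%N by lia.
by rewrite add0n !iterD -!(shift m f) !iterS; apply: gap; apply: sum0.
Qed.

(** * The number of bad steps of a walk *)

Section Bad.

Variable bad : V -> L -> bool.
Hypothesis badC : forall v l, bad (mv v l) l = bad v l.

Definition phi v : R := avg (fun l => (bad v l)%:R).
Definition mu : R := avg phi.

Lemma phi01 v : 0 <= phi v <= 1.
Proof.
rewrite avg_ge0 => [|l]; last exact: ler0n.
by rewrite -(avg_cst (R := R) (T := L) 1) //; apply: ler_avg => l; case: bad; rewrite ?ler01.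
Qed.

Lemma mu_ge0 : 0 <= mu.
Proof. by apply: avg_ge0 => v; case/andP: (phi01 v). Qed.

Hypothesis V_gt0 : (0 < #|V|)%N.

Lemma sum_phi : \sum_v phi v = #|V|%:R * mu.
Proof. by rewrite /mu /avg mulrCA divff ?mulr1 // pnatr_eq0 -lt0n. Qed.

(** Bad steps far apart are almost independent: the constant part of [phi] gives [mu ^+ 2], and the
    part of mean zero decays by [lam] at each step between them. *)
Lemma dot_phi j : dot phi (iter j avop phi) <= #|V|%:R * (mu ^+ 2 + lam ^+ j * mu).
Proof.
pose f v := phi v - mu.
have f0 : \sum_v f v = 0.
  by rewrite /f sumrB sum_phi sumr_const -[mu *+ _]mulr_natl subrr.
have e1 : iter j avop phi = fun v => mu + iter j avop f v.
  elim: j => [|j IHj] /=; first by apply/funext => v; rewrite /f; ring.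
  by rewrite IHj; apply/funext => v; rewrite /avop avgD avg_cst.
have s0 : \sum_v iter j avop f v = 0.
  by elim: (j) => //= i IHi; rewrite sum_avop.
have -> : dot phi (iter j avop phi) = #|V|%:R * mu ^+ 2 + dot f (iter j avop f).
  rewrite e1 /dot.
  transitivity (\sum_v (phi v * mu + (f v + mu) * iter j avop f v)).
    by apply: eq_bigr => v _; rewrite /f; ring.
  rewrite big_split /= -mulr_suml sum_phi; congr (_ + _); first by ring.
  under eq_bigr => v _ do rewrite mulrDl.
  by rewrite big_split /= -mulr_sumr s0 mulr0 addr0.
rewrite mulrDr lerD2l; apply: le_trans (decay j f0) _.
rewrite mulrCA ler_wpM2l ?exprn_ge0 ?(ltW lam_gt0) // -sum_phi.
have -> : dot f f = \sum_v phi v ^+ 2 - #|V|%:R * mu ^+ 2.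
  rewrite /dot; transitivity (\sum_v (phi v ^+ 2 - (2 * mu) * phi v + mu ^+ 2)).
    by apply: eq_bigr => v _; rewrite /f; ring.
  rewrite big_split /= sumrB -mulr_sumr sum_phi sumr_const -[_ *+ #|V|]mulr_natl; ring.
apply: le_trans (_ : \sum_v phi v ^+ 2 <= _).
  by rewrite lerBlDr lerDl mulr_ge0 ?ler0n ?sqr_ge0.
apply: ler_sum => v _; case/andP: (phi01 v) => p0 p1.
by rewrite expr2 ler_piMl.
Qed.

Fixpoint cnt (v : V) (w : seq L) : R :=
  if w is l :: w' then (bad v l)%:R + cnt (mv v l) w' else 0.

Lemma ew_cnt n u : ew n (cnt u) = \sum_(j < n) iter j avop phi u.
Proof.
elim: n u => [|n IHn] u /=; first by rewrite big_ord0.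
under eq_avg => l do rewrite ewD ew_cst IHn.
rewrite avgD big_ord_recl /= -/(phi u); congr (_ + _).
rewrite /avg exchange_big /= mulr_suml; apply: eq_bigr => j _ //.
Qed.

Lemma geom_le n : (1 - lam) * \sum_(j < n) lam ^+ j <= 1.
Proof.
suff -> : (1 - lam) * \sum_(j < n) lam ^+ j = 1 - lam ^+ n.
  by rewrite lerBlDr lerDl exprn_ge0 // ltW.
elim: n => [|n IHn]; first by rewrite big_ord0 expr0 mulr0 subrr.
by rewrite big_ord_recr /= mulrDr IHn exprS; ring.
Qed.

Let B := 1 + 2 / (1 - lam).

(** Expanding the square at the first step leaves its correlations with all later ones, which
    [dot_phi] bounds by a geometric series; hence the [2 / (1 - lam)] in [B]. *)
Lemma cnt2_le n : \sum_v ew n (fun w => cnt v w ^+ 2) <=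
  #|V|%:R * (n%:R * (mu * B) + 2 * n%:R ^+ 2 * mu ^+ 2).
Proof.
have m0 := mu_ge0; have V0 : 0 <= #|V|%:R :> R by rewrite ler0n.
elim: n => [|n IHn] /=; first by rewrite big1 ?mul0r ?expr0n /= ?mulr0 ?mul0r ?addr0 ?mulr0 // => v _; rewrite expr0n.
have -> : \sum_v avg (fun l => ew n (fun w => ((bad v l)%:R + cnt (mv v l) w) ^+ 2)) =
  \sum_v phi v + 2 * dot phi (fun v => ew n (cnt v)) + \sum_v ew n (fun w => cnt v w ^+ 2).
  transitivity (\sum_v (phi v + 2 * avg (fun l => (bad v l)%:R * ew n (cnt (mv v l))) +
     avg (fun l => ew n (fun w => cnt (mv v l) w ^+ 2)))).
    apply: eq_bigr => v _; rewrite -avgZ -!avgD; apply: eq_avg => l.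
    rewrite -ewZ -ewZ -[X in _ = X + _ + _](ew_cst n) -!ewD; apply: eq_ew => w _.
    by case: bad; rewrite /= ?mulr1n ?mulr0n; ring.
  rewrite !big_split /= -mulr_sumr; congr (_ + 2 * _ + _).
    rewrite /dot sum_avg; under [RHS]eq_bigr => v _ do rewrite /phi mulrC -avgZ.
    rewrite sum_avg; apply: eq_avg => l; rewrite -[RHS](sum_mv l).
    by apply: eq_bigr => v _; rewrite badC mulrC.
  rewrite sum_avg -[RHS](avg_cst (R := R) (T := L)) //; apply: eq_avg => l.
  by rewrite (sum_mv l (fun v => ew n (fun w => cnt v w ^+ 2))).
rewrite sum_phi.
have cr : dot phi (fun v => ew n (cnt v)) <= #|V|%:R * (n%:R * mu ^+ 2 + mu / (1 - lam)).
  have -> : dot phi (fun v => ew n (cnt v)) = \sum_(j < n) dot phi (iter j avop phi).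
    rewrite /dot exchange_big; apply: eq_bigr => v _ /=.
    by rewrite ew_cnt mulr_sumr.
  apply: le_trans (ler_sum _ (fun (j : 'I_n) _ => dot_phi j)) _.
  rewrite -mulr_sumr ler_wpM2l // big_split /= sumr_const card_ord -[mu ^+ 2 *+ n]mulr_natl.
  rewrite lerD2l -mulr_suml mulrC ler_wpM2l // -[X in _ <= X]mul1r ler_pdivlMr ?subr_gt0 // mulrC.
  exact: geom_le.
have -> : #|V|%:R * (n.+1%:R * (mu * B) + 2 * n.+1%:R ^+ 2 * mu ^+ 2) =
  #|V|%:R * (n%:R * (mu * B) + 2 * n%:R ^+ 2 * mu ^+ 2) + #|V|%:R * mu +
  2 * (#|V|%:R * (n%:R * mu ^+ 2 + mu / (1 - lam))) + #|V|%:R * mu ^+ 2 * (2 * n%:R + 2).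
  by rewrite /B -natr1; ring.
have : 0 <= #|V|%:R * mu ^+ 2 * (2 * n%:R + 2).
  apply: mulr_ge0; first by rewrite mulr_ge0 ?sqr_ge0.
  by have : 0 <= n%:R :> R := ler0n _ _; lra.
by move: IHn cr; lra.
Qed.


(** * Powering along walks *)

Section Power.

Variables (A : finType) (op : V -> seq L -> A) (ast : V -> A) (t : nat) (l0 : L).
Hypothesis t_gt0 : (0 < t)%N.

(* [op x p] is the opinion of [x] on the endpoint of the walk [p] from [x]. *)
Definition agree (u : V) : R :=
  (\sum_(a < t) ew a (fun p => (op (walk u p) (rev p) == ast u)%:R)) / t%:R.

Hypothesis ast_plural : forall u, #|A|%:R^-1 <= agree u.

(** The walk [p], [l], [q] crosses a bad edge by [l]; its start holds the popular opinion [ast] on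
    the near end of that edge, and its final vertex, looking back along [q], the one on the far
    end. *)
Definition event (v : V) (p : seq L) (l : L) (q : seq L) : bool :=
  [&& bad (walk v p) l, op v p == ast (walk v p) &
      op (walk v (p ++ l :: q)) (rev q) == ast (walk v (rcons p l))].

(** Both halves must be shorter than [t], the range over which [agree] averages opinions. *)
Definition hit (v : V) (w : seq L) (i : nat) : bool :=
  [&& i < t, size w - i.+1 < t & event v (take i w) (nth l0 w i) (drop i.+1 w)]%N.

Definition nhit (v : V) (w : seq L) : R := \sum_(i < size w) (hit v w i)%:R.

Lemma A_gt0 : (0 < #|V|)%N -> (0 < #|A|)%N.
Proof. by case/card_gt0P=> v _; apply/card_gt0P; exists (ast v). Qed.

(** Reversing the first half makes the near end [u] of the edge the uniform vertex; the two halves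
    then leave the edge independently, which gives the product. *)
Lemma sum_hit a b : (a < t)%N -> (b < t)%N ->
  \sum_v ew (a + b).+1 (fun w => (hit v w a)%:R) =
  \sum_u avg (fun l => (bad u l)%:R *
     (ew a (fun p => (op (walk u p) (rev p) == ast u)%:R) *
      ew b (fun q => (op (walk (mv u l) q) (rev q) == ast (mv u l))%:R))).
Proof.
move=> lt_a lt_b; rewrite -addnS.
pose H u p := avg (fun l => ew b (fun q =>
  ([&& bad u l, op (walk u p) (rev p) == ast u &
     op (walk u (l :: q)) (rev q) == ast (mv u l)])%:R) : R).
transitivity (\sum_v ew a (fun p => H (walk v p) (rev p))).
  apply: eq_bigr => v _; rewrite ew_cat; apply: eq_ew => p sp /=.
  apply: eq_avg => l; apply: eq_ew => q sq; congr (nat_of_bool _)%:R.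
  rewrite /hit /event lt_a size_cat /= sp sq addnS subSS addKn lt_b /=.
  rewrite take_size_cat // nth_cat sp ltnn subnn /= drop_cat sp ltnNge leqnSn /= subSnn /= drop0.
  by rewrite revK walk_rev /walk foldl_cat foldl_rcons.
rewrite -(ew_rev a H); apply: eq_bigr => u _; rewrite /H -avg_ew.
apply: eq_avg => l; set Y := ew b _.
transitivity (ew a (fun p => ((bad u l)%:R * Y) * (op (walk u p) (rev p) == ast u)%:R)).
  apply: eq_ew => p _; rewrite mulrAC /Y -ewZ; apply: eq_ew => q _ /=.
  by case: bad; case: eqP; case: eqP; rewrite /= ?mulr1n ?mulr0n ?mulr1 ?mulr0 ?mul0r.
by rewrite ewZ; ring.
Qed.

(** Two halves of lengths [a, b < t] are the position [a] in a word of [a + b + 1] letters, so every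
    pair of lengths occurs on the right. *)
Lemma triangle_sum (G : nat -> nat -> R) : (forall n i, 0 <= G n i) ->
  \sum_(a < t) \sum_(b < t) G (a + b)%N a <= \sum_(n < 2 * t) \sum_(i < n.+1) G n i.
Proof.
move=> G0.
have -> : \sum_(n < 2 * t) \sum_(i < n.+1) G n i =
          \sum_(i < 2 * t) \sum_(n < 2 * t | (i <= n)%N) G n i.
  under eq_bigr => n _ do rewrite (big_ord_widen (2 * t) (fun i => G n i)) ?ltn_ord //.
  by rewrite (exchange_big_dep xpredT).
rewrite (big_ord_widen (2 * t) (fun a => \sum_(b < t) G (a + b)%N a)) ?leq_pmull //.
rewrite big_mkcond; apply: ler_sum => i _; case: ifP => [lt_i|_]; last exact: sumr_ge0.
rewrite -(big_mkord (fun n => (i <= n)%N) (fun n => G n i)).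
rewrite (big_cat_nat (leq0n i)) /=; last by lia.
rewrite [X in _ <= X + _]big1_seq ?add0r; last first.
  by move=> n; rewrite mem_index_iota => /andP[]; lia.
rewrite -[X in index_iota X _]add0n big_addn (eq_bigl xpredT); last by move=> n; lia.
rewrite (big_cat_nat (leq0n t)) /=; last by lia.
rewrite -[X in X <= _](big_mkord xpredT (fun b => G (i + b)%N i)).
rewrite (eq_bigr (fun b => G (b + i)%N i)) => [|b _]; last by rewrite addnC.
rewrite [X in _ <= X + _](eq_bigl xpredT) => [|n]; last by rewrite leq_addl.
by rewrite lerDl sumr_ge0.
Qed.

Lemma first_moment :
  t%:R ^+ 2 * (#|V|%:R * mu) / #|A|%:R ^+ 2 <=
  \sum_(n < 2 * t) \sum_v ew n.+1 (nhit v).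
Proof.
have -> : \sum_(n < 2 * t) \sum_v ew n.+1 (nhit v) =
    \sum_(n < 2 * t) \sum_(i < n.+1) \sum_v ew n.+1 (fun w => (hit v w i)%:R).
  apply: eq_bigr => n _; rewrite exchange_big; apply: eq_bigr => v _ /=.
  rewrite -(ew_sum _ _ n.+1 (fun (i : 'I_n.+1) w => (hit v w i)%:R)).
  by apply: (@eq_ew n.+1 (nhit v)) => w sw; rewrite /nhit sw.
pose G n i := \sum_v ew n.+1 (fun w => (hit v w i)%:R).
have G0 n i : 0 <= G n i.
  by apply: sumr_ge0 => v _; apply: ew_ge0 => w; rewrite ler0n.
apply: le_trans (triangle_sum G0).
pose x a u := ew a (fun p => (op (walk u p) (rev p) == ast u)%:R) : R.
have xt u : \sum_(a < t) x a u = t%:R * agree u.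
  by rewrite /agree mulrCA divff ?mulr1 // pnatr_eq0 -lt0n.
have -> : \sum_(a < t) \sum_(b < t) G (a + b)%N a =
    \sum_u avg (fun l => (bad u l)%:R * ((t%:R * agree u) * (t%:R * agree (mv u l)))).
  transitivity (\sum_(a < t) \sum_(b < t) \sum_u avg (fun l =>
      (bad u l)%:R * (x a u * x b (mv u l)))).
    by apply: eq_bigr => a _; apply: eq_bigr => b _; apply: sum_hit.
  under eq_bigr => a _ do rewrite exchange_big /=.
  rewrite exchange_big; apply: eq_bigr => u _ /=.
  under eq_bigr => a _ do rewrite sum_avg.
  rewrite sum_avg; apply: eq_avg => l; rewrite -!xt.
  rewrite big_distrlr /= mulr_sumr; apply: eq_bigr => a _.
  by rewrite mulr_sumr.
have A0 := A_gt0 V_gt0.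
rewrite -sum_phi mulr_sumr mulr_suml; apply: ler_sum => u _.
rewrite /phi -avgZ mulrC -avgZ; apply: ler_avg => l.
have -> : (#|A|%:R ^+ 2)^-1 * (t%:R ^+ 2 * (bad u l)%:R) =
   (bad u l)%:R * ((t%:R * #|A|%:R^-1) * (t%:R * #|A|%:R^-1)) :> R.
  by rewrite -exprVn; ring.
rewrite ler_wpM2l ?ler0n // ler_pM ?mulr_ge0 ?invr_ge0 ?ler0n //.
  by rewrite ler_wpM2l ?ler0n.
by rewrite ler_wpM2l ?ler0n.
Qed.

Lemma nhit_ge0 v w : 0 <= nhit v w.
Proof. by apply: sumr_ge0 => i _; rewrite ler0n. Qed.

Lemma nhit_le v w : nhit v w <= cnt v w.
Proof.
apply: le_trans (_ : \sum_(i < size w) (bad (walk v (take i w)) (nth l0 w i))%:R <= _).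
  by apply: ler_sum => i _; rewrite /hit /event; case: bad; rewrite ?andbF //; case: [&& _, _ & _].
elim: w v => [|l w IHw] v /=; first by rewrite big_ord0.
by rewrite big_ord_recl /= lerD2l; apply: IHw.
Qed.

(** The second moment method: the expected number of hits grows like [t * mu], and its second
    moment, bounded by that of all bad steps, is not much larger than needed for an often nonzero
    count. *)
Lemma power_reject :
  (4 * #|A|%:R ^+ 4 * (2 * B + 8))^-1 * (t%:R * mu / (1 + t%:R * mu)) * ((2 * t)%:R * #|V|%:R)
  <= \sum_(n < 2 * t) \sum_v ew n.+1 (fun w => [exists i : 'I_(size w), hit v w i]%:R).
Proof.
set y := t%:R * mu; have A0 := A_gt0 V_gt0.
have m0 := mu_ge0; have y0 : 0 <= y by rewrite mulr_ge0 ?ler0n.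
have a0 : 0 < #|A|%:R :> R by rewrite ltr0n.
have B0 : 0 < 2 * B + 8.
  have : 0 < 2 / (1 - lam) by rewrite divr_gt0 ?subr_gt0.
  by rewrite /B; lra.
set a := #|A|%:R in a0 *; set b := 2 * B + 8 in B0 *.
(* An indicator of [n > 0] is at least [2 * c * n - c ^+ 2 * n ^+ 2]; this [c], the quotient of the
   two moment bounds, maximizes the result. *)
pose c := (2 * a ^+ 2 * b)^-1 / (1 + y).
have low v w : 2 * c * nhit v w + (- c ^+ 2) * nhit v w ^+ 2 <=
    [exists i : 'I_(size w), hit v w i]%:R.
  case: existsP => [_|no].
    have := sqr_ge0 (1 - c * nhit v w); rewrite mulr1n; nra.
  have -> : nhit v w = 0; last by rewrite expr0n /= !mulr0 addr0.
  by rewrite /nhit big1 // => i _; case h: (hit v w i) => //; case: no; exists i.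
apply: le_trans (_ : \sum_(n < 2 * t) \sum_v ew n.+1 (fun w =>
   2 * c * nhit v w + (- c ^+ 2) * nhit v w ^+ 2) <= _); last first.
  apply: ler_sum => n _; apply: ler_sum => v _.
  exact: (@ler_ew n.+1 _ _ (fun w _ => low v w)).
under eq_bigr => n _ do under eq_bigr => v _ do rewrite ewD !ewZ.
under eq_bigr => n _ do rewrite big_split /= -!mulr_sumr.
rewrite big_split /= -!mulr_sumr.
have fm := first_moment; set N1 := \sum_(n < _) _ in fm *.
set N2 := \sum_(n < _) _.
have sm : N2 <= (2 * t)%:R * (#|V|%:R * ((2 * t)%:R * (mu * B) + 2 * (2 * t)%:R ^+ 2 * mu ^+ 2)).
  apply: le_trans (_ : \sum_(n < 2 * t) (#|V|%:R * ((2 * t)%:R * (mu * B) + 2 * (2 * t)%:R ^+ 2 * mu ^+ 2)) <= _).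
    apply: ler_sum => n _.
    apply: le_trans (_ : \sum_v ew n.+1 (fun w => cnt v w ^+ 2) <= _).
      apply: ler_sum => v _.
      apply: (@ler_ew n.+1 (fun w => nhit v w ^+ 2) (fun w => cnt v w ^+ 2)) => w _.
      by rewrite ler_sqr ?nnegrE ?nhit_ge0 ?nhit_le // (le_trans (nhit_ge0 v w)) ?nhit_le.
    apply: le_trans (cnt2_le _) _; rewrite ler_wpM2l ?ler0n //.
    have n2t : n.+1%:R <= (2 * t)%:R :> R by rewrite ler_nat.
    have Bg : 0 <= mu * B.
      rewrite mulr_ge0 // /B addr_ge0 // divr_ge0 // ltW // subr_gt0 //.
    rewrite lerD // ?ler_wpM2r // ?sqr_ge0 // ler_wpM2l // ler_sqr ?nnegrE ?ler0n //.
  by rewrite sumr_const card_ord -[_ *+ (2 * t)]mulr_natl.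
have V0 : 0 < #|V|%:R :> R by rewrite ltr0n.
have t0 : 0 < t%:R :> R by rewrite ltr0n.
have y1 : 0 < 1 + y by lra.
have c0 : 0 < c by rewrite divr_gt0 // invr_gt0 !mulr_gt0 // exprn_gt0.
have {fm} fm : t%:R * #|V|%:R * y / a ^+ 2 <= N1.
  by apply: le_trans fm; rewrite /y le_eqVlt; apply/orP; left; apply/eqP; ring.
have {sm} sm : N2 <= 2 * t%:R * #|V|%:R * (b * y * (1 + y)).
  apply: le_trans sm _; rewrite natrM.
  have -> : 2 * t%:R * (#|V|%:R * (2 * t%:R * (mu * B) + 2 * (2 * t%:R) ^+ 2 * mu ^+ 2)) =
    2 * t%:R * #|V|%:R * (2 * B * y + 8 * y ^+ 2) by rewrite /y; ring.
  rewrite ler_wpM2l ?mulr_ge0 ?ler0n //.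
  have B1 : 0 <= 2 * B by rewrite mulr_ge0 // /B addr_ge0 // divr_ge0 // ltW // subr_gt0.
  rewrite /b; have := mulr_ge0 y0 y0; have := mulr_ge0 B1 y0.
  have := mulr_ge0 B1 (mulr_ge0 y0 y0); nra.
have -> : (4 * a ^+ 4 * b)^-1 * (y / (1 + y)) * ((2 * t)%:R * #|V|%:R) =
  2 * c * (t%:R * #|V|%:R * y / a ^+ 2) + (- c ^+ 2) * (2 * t%:R * #|V|%:R * (b * y * (1 + y))).
  rewrite /c natrM; field; rewrite ?gt_eqF //=.
apply: lerD; first by rewrite ler_pM2l // mulr_gt0.
by rewrite ler_nM2l // oppr_lt0 exprn_gt0.
Qed.

End Power.

End Bad.

End Walk.

End RandomWalks.
Import RandomWalks.

Module PoincareInequalities.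

Import Order.TTheory GRing.Theory Num.Theory.
Local Open Scope ring_scope.

(** * Poincare inequalities *)

Definition poincare (R : realFieldType) (T L : finType) (nb : T -> L -> T) (c : R) :=
  forall f : T -> R, \sum_x f x = 0 ->
  \sum_x f x ^+ 2 <= c * \sum_l \sum_x (f x - f (nb x l)) ^+ 2.

Section Transport.

Variables (R : realFieldType) (T : finType) (k : nat).
Hypothesis cardT : #|T| = #|{: {ffun bool * 'I_k.+1 -> bool}}|.

Definition to_cube (x : T) : {ffun bool * 'I_k.+1 -> bool} :=
  enum_val (cast_ord cardT (enum_rank x)).
Definition of_cube (y : {ffun bool * 'I_k.+1 -> bool}) : T :=
  enum_val (cast_ord (esym cardT) (enum_rank y)).

Lemma to_cubeK : cancel to_cube of_cube.
Proof. by move=> x; rewrite /of_cube enum_valK cast_ordK enum_rankK. Qed.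

Lemma of_cubeK : cancel of_cube to_cube.
Proof. by move=> y; rewrite /to_cube enum_valK cast_ordKV enum_rankK. Qed.

(** Only the cardinality has to match, so the set of positions of a long code table can carry the
    expander too. *)
Definition enbT (x : T) (l : elabel) : T := of_cube (enb (to_cube x) l).

Lemma enbTK l x : enbT (enbT x l) l = x.
Proof. by rewrite /enbT of_cubeK enbK to_cubeK. Qed.

Lemma enbT_poincare : poincare enbT (96 : R).
Proof.
move=> f f0.
have bij : {on xpredT, bijective of_cube}.
  by apply: onW_bij; exists to_cube; [exact: of_cubeK | exact: to_cubeK].
rewrite (reindex _ bij) /=; apply: le_trans (cube_poincare0 (f := f \o of_cube) _) _.
  by rewrite -[RHS]f0 [RHS](reindex _ bij); apply: eq_bigr.
rewrite ler_pM2l //; apply: ler_sum => l _; rewrite /energy [X in _ <= X](reindex _ bij) /=.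
by apply: ler_sum => y _; rewrite /enbT of_cubeK.
Qed.

End Transport.

Lemma xor0f (U : finType) (x : {ffun U -> bool}) : xorf [ffun=> false] x = x.
Proof. by apply/ffunP => i; rewrite !ffunE. Qed.

Section Poincare.

Variable R : realFieldType.

Lemma jensen (T : finType) (d : T -> R) : (\sum_c d c) ^+ 2 <= #|T|%:R * \sum_c d c ^+ 2.
Proof.
have -> : #|T|%:R * \sum_c d c ^+ 2 = \sum_(c : T) \sum_(c' : T) d c ^+ 2.
  by rewrite mulr_sumr; apply: eq_bigr => c _; rewrite sumr_const mulr_natl.
have e : \sum_(c : T) \sum_(c' : T) d c ^+ 2 = \sum_(c : T) \sum_(c' : T) (d c ^+ 2 + d c' ^+ 2) / 2.
  transitivity ((\sum_(c : T) \sum_(c' : T) d c ^+ 2 + \sum_(c : T) \sum_(c' : T) d c' ^+ 2) / 2).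
    by rewrite [X in (_ + X) / 2]exchange_big /=; lra.
  rewrite -big_split mulr_suml /=; apply: eq_bigr => c _.
  by rewrite -big_split mulr_suml.
rewrite e expr2 big_distrlr /=; apply: ler_sum => c _; apply: ler_sum => c' _.
have := sqr_ge0 (d c - d c'); lra.
Qed.

Definition mean (T : finType) (f : T -> R) : R := avg f.

Lemma sum_sub_mean (T : finType) (f : T -> R) : \sum_x (f x - mean f) = 0.
Proof.
rewrite sumrB sumr_const -[mean f *+ _]mulr_natl /mean /avg.
have [T0|T0] := posnP #|T|.
  by rewrite T0 mul0r subr0 big1 // => x _; have := card0_eq T0 x; rewrite inE.
by rewrite mulrCA divff ?mulr1 ?subrr // pnatr_eq0 -lt0n.
Qed.

Lemma sum_sqr_split (T : finType) (f : T -> R) m : \sum_x (f x - mean f) = 0 ->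
  \sum_x (f x - m) ^+ 2 = \sum_x (f x - mean f) ^+ 2 + #|T|%:R * (mean f - m) ^+ 2.
Proof.
move=> s0; transitivity (\sum_x ((f x - mean f) ^+ 2 + 2 * (mean f - m) * (f x - mean f) + (mean f - m) ^+ 2)).
  by apply: eq_bigr => x _; ring.
rewrite !big_split /= -mulr_sumr s0 mulr0 addr0 sumr_const; congr (_ + _); by rewrite mulr_natl.
Qed.

Lemma poincare_mean (T L : finType) (nb : T -> L -> T) c : poincare nb c ->
  forall f, \sum_x (f x - mean f) ^+ 2 <= c * \sum_l \sum_x (f x - f (nb x l)) ^+ 2.
Proof.
move=> P f; apply: le_trans (P _ (sum_sub_mean f)) _.
rewrite (eq_bigr (fun l => \sum_x (f x - f (nb x l)) ^+ 2)) // => l _.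
by apply: eq_bigr => x _; congr (_ ^+ 2); ring.
Qed.

(** The variance splits into that inside the fibres and that of the fibre means; by Jensen, the
    energy of the means is at most the average energy in the other direction. *)
Lemma tensor (X C LX LC : finType) (nX : X -> LX -> X) (nC : C -> LC -> C) c :
  0 <= c -> poincare nX c -> poincare nC c -> forall f : X * C -> R,
  \sum_k (f k - mean f) ^+ 2 <=
  c * (\sum_l \sum_k (f k - f (k.1, nC k.2 l)) ^+ 2 +
       \sum_l \sum_k (f k - f (nX k.1 l, k.2)) ^+ 2).
Proof.
move=> c0 PX PC f; pose h x := mean (fun c => f (x, c)).
have pairE (F : X * C -> R) : \sum_k F k = \sum_x \sum_c F (x, c).
  by rewrite pair_bigA; apply: eq_bigr => -[].
have mh : mean f = mean h.
  by rewrite /mean /h -avg_pair; apply: eq_avg => -[].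
have -> : \sum_k (f k - mean f) ^+ 2 =
   \sum_x \sum_c (f (x, c) - h x) ^+ 2 + #|C|%:R * \sum_x (h x - mean h) ^+ 2.
  rewrite pairE mulr_sumr -big_split; apply: eq_bigr => x _ /=.
  by rewrite (@sum_sqr_split _ (fun c => f (x, c))) ?sum_sub_mean // mh.
rewrite mulrDr; apply: lerD.
  apply: le_trans (ler_sum _ (fun x _ => poincare_mean PC (fun c => f (x, c)))) _.
  rewrite -mulr_sumr exchange_big /= ler_wpM2l //; apply: ler_sum => l _.
  by rewrite pairE.
apply: le_trans (ler_wpM2l (ler0n _ _) (poincare_mean PX h)) _.
rewrite mulrCA ler_wpM2l // mulr_sumr; apply: ler_sum => l _.
rewrite mulr_sumr pairE; apply: ler_sum => x _ /=.
have [C0|C0] := posnP #|C|; first by rewrite C0 mul0r sumr_ge0 // => i _; exact: sqr_ge0.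
have -> : h x - h (nX x l) = (\sum_c (f (x, c) - f (nX x l, c))) / #|C|%:R.
  by rewrite /h /mean /avg -mulrBl sumrB.
have Cp : 0 < #|C|%:R :> R by rewrite ltr0n.
rewrite expr_div_n.
set S := \sum_c (f (x, c) - f (nX x l, c)).
have -> : #|C|%:R * (S ^+ 2 / #|C|%:R ^+ 2) = S ^+ 2 / #|C|%:R.
  by field; rewrite gt_eqF.
by rewrite ler_pdivrMr // mulrC; exact: jensen.
Qed.

End Poincare.

End PoincareInequalities.
Import PoincareInequalities.

Module ConstraintGraphs.

Import Order.TTheory GRing.Theory Num.Theory.
Local Open Scope ring_scope.

(** * Constraint graphs *)

Definition cdat (Sg Lb : finType) : finType := {ffun Lb -> {ffun Sg * Sg -> bool}}.

(** Each label acts as an involution, so the graph is regular and a walk is undone by its reversed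
    word. The constraint read from one end of an edge may differ from the one read from the
    other. *)
Record cgraph (Sg Lb : finType) := CGraph {
  vert : finType;
  nb : vert -> Lb -> vert;
  nbK : forall v l, nb (nb v l) l = v;
  dat : vert -> cdat Sg Lb
}.

Definition sat_at Sg Lb (G : cgraph Sg Lb) (a : vert G -> Sg) v l : bool :=
  dat v l (a v, a (nb v l)).

Definition unsat (R : realFieldType) Sg Lb (G : cgraph Sg Lb) (a : vert G -> Sg) : R :=
  avg (fun v => avg (fun l => (~~ sat_at a v l)%:R)).

(** Loops may exist, but their constraints accept equal values; this is what keeps loops out of the
    conflict graph. *)
Definition loopless Sg Lb (G : cgraph Sg Lb) :=
  forall (v : vert G) l s, nb v l = v -> dat v l (s, s).

(** [J] indexes the four queries of a test, and a letter of [Sg1] records their four answers. *)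
Definition J : finType := (bool * bool)%type.
Definition Sg1 : finType := {ffun J -> bool}.
Definition Lb1 : finType := (elabel + J + elabel)%type.

Definition xorJ (i j : J) : J := (i.1 (+) j.1, i.2 (+) j.2).

Lemma xorJK i j : xorJ (xorJ i j) j = i.
Proof. by case: i j => [[] []] [[] []]. Qed.

(** * Composition with the long code test *)

Section Gadget.

Variables (U Y info wlk : finType) (okU : pred U) (kap : U -> info).
Variables (outv inv_ : wlk -> U -> Y).

Definition X : finType := {ffun U -> bool}.
(** The five kinds of tests: 0 additivity, 1 products, 2 membership in [okU], 3 the value of [kap],
    4 agreement of the two views along a walk. *)
Definition seed : finType :=
  ('I_5 * (wlk * ({ffun info -> bool} * {ffun Y -> bool})))%type.
Definition test : finType := (seed * (X * (X * X)))%type.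
Definition rest : finType := (seed * J * (X * X))%type.
Definition slot : finType := (test * J)%type.

Definition x0 : X := [ffun=> false].

(* Query [j] of a test of seed [s] reads the table at [offset] plus one of the
   three random points, the two others being [p] and [q]. *)
Definition which (s : seed) (j : J) : nat :=
  match nat_of_ord s.1, j with
  | 0, (false, true) => 1
  | 0, (true, false) => 1
  | 1, (false, true) => 1
  | 1, (true, _) => 2
  | 4, (true, _) => 1
  | _, _ => 0
  end.

Definition offset (s : seed) (j : J) (p q : X) : X :=
  match nat_of_ord s.1, j with
  | 0, (true, false) => p
  | 1, (true, true) => andf p q
  | 2, (false, true) => ind okU
  | 3, (false, true) => pull s.2.2.1 kap
  | 4, (false, true) => pull s.2.2.2 (outv s.2.1)
  | 4, (true, true) => pull s.2.2.2 (inv_ s.2.1)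
  | _, _ => x0
  end.

Definition pt_of (n : nat) (xs : X * (X * X)) : X :=
  match n with 0 => xs.1 | 1 => xs.2.1 | _ => xs.2.2 end.
Definition others (n : nat) (xs : X * (X * X)) : X * X :=
  match n with 0 => xs.2 | 1 => (xs.1, xs.2.2) | _ => (xs.1, xs.2.1) end.

Definition pos (s : slot) : X :=
  let o := others (which s.1.1 s.2) s.1.2 in
  xorf (offset s.1.1 s.2 o.1 o.2) (pt_of (which s.1.1 s.2) s.1.2).

Definition rest_of (s : slot) : rest :=
  (s.1.1, s.2, others (which s.1.1 s.2) s.1.2).

(** The offset of a query depends only on the rest, so subtracting it recovers the omitted random
    point. Thus each query falls uniformly on the table. *)
Lemma pos_rest_inj : injective (fun s => (pos s, rest_of s)).
Proof.
case=> [[s xs] j] [[s' xs'] j'] [] /=; rewrite /pos /= => e ? ? o; subst s' j'.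
suff -> : xs = xs' by [].
have {e} e : pt_of (which s j) xs = pt_of (which s j) xs'.
  by rewrite -[LHS](xorKf (offset s j (others (which s j) xs).1 (others (which s j) xs).2)) e o xorKf.
case: xs xs' o e => a [b c] [a' [b' c']].
by case: (which s j) => [|[|n]]; rewrite /others /pt_of /= => -[-> ->] ->.
Qed.

Lemma ex_dim : exists k, (#|rest| <= 4 ^ k.+1)%N.
Proof. by exists #|rest|; apply: ltnW; apply: (leq_trans (ltn_expl _ (isT : 1 < 4)%N)); rewrite leq_exp2l. Qed.

(** Minimality gives [C_le_rest]: the cube of copies is at most four times larger than needed, so
    slots fill a constant fraction of [K]. *)
Definition dim : nat := ex_minn ex_dim.

Definition C : finType := {ffun bool * 'I_dim.+1 -> bool}.

Lemma card_C : #|C| = (4 ^ dim.+1)%N.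
Proof. by rewrite card_ffun card_bool card_prod card_bool card_ord expnM. Qed.

Lemma rest_le_C : (#|rest| <= #|C|)%N.
Proof. by rewrite card_C /dim; case: ex_minnP. Qed.

Lemma C_le_rest : (0 < #|rest|)%N -> (#|C| <= 4 * #|rest|)%N.
Proof.
rewrite card_C /dim; case: ex_minnP => -[|k] _ mk r0; first by rewrite expn1; lia.
have : ~~ (#|rest| <= 4 ^ k.+1)%N by apply/negP => /mk; rewrite ltnn.
by rewrite -ltnNge => lt; rewrite [X in (X <= _)%N]expnS leq_mul2l /= ltnW.
Qed.

Definition emb (r : rest) : C := enum_val (widen_ord rest_le_C (enum_rank r)).

Lemma emb_inj : injective emb.
Proof.
move=> r r' /enum_val_inj /(congr1 val) /= /val_inj /enum_rank_inj; exact.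
Qed.

(** Each table position [x] has a cube of copies [(x, c)], one for each query that may read it, and
    the expander on [C] makes the copies agree. *)
Definition K : finType := (X * C)%type.

Definition iota_ (s : slot) : K := (pos s, emb (rest_of s)).

Lemma iota_inj : injective iota_.
Proof. by move=> s s' [e1 /emb_inj e2]; apply: pos_rest_inj; rewrite e1 e2. Qed.

Definition dec (k : K) : option slot := [pick s | iota_ s == k].

Lemma iotaK s : dec (iota_ s) = Some s.
Proof.
rewrite /dec; case: pickP => [s' /eqP/iota_inj-> //|/(_ s)].
by rewrite eqxx.
Qed.

Lemma decK k s : dec k = Some s -> k = iota_ s.
Proof. by rewrite /dec; case: pickP => // s' /eqP<- [->]. Qed.

(** The two queries of test 4 that read the table at the other end of the walk. *)
Definition far (s : slot) : bool := (s.1.1.1 == 4 :> nat) && s.2.1.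

Definition pred_ok (s : seed) (k : info) (a : Sg1) : bool :=
  let b i j := a (i, j) in
  match nat_of_ord s.1 with
  | 0 => b false false (+) b false true == b true false
  | 1 => (b false false && b false true) (+) b true false == b true true
  | 2 => b false false (+) b false true
  | 3 => b false false (+) b false true == s.2.2.1 k
  | _ => b false false (+) b false true == b true false (+) b true true
  end.

Definition moved (s : slot) (e : J) : slot := (s.1, xorJ s.2 e).

Definition bit (k : K) (a : Sg1) : bool := a (if dec k is Some s then s.2 else (false, false)).

Variables (dX : nat) (cardX : #|X| = #|{: {ffun bool * 'I_dX.+1 -> bool}}|).
Variables (V : finType) (go bk : V -> wlk -> V) (kapb : V -> info).
Hypothesis goK : forall v r, bk (go v r) r = v.
Hypothesis bkK : forall v r, go (bk v r) r = v.

Definition enbX : X -> elabel -> X := enbT cardX.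

(** A test belongs to the vertex where its walk starts, its anchor; a slot sits in the cloud of the
    vertex whose table it reads. *)
Definition anchor (v : V) (s : slot) : V := if far s then bk v s.1.1.2.1 else v.
Definition cloud (v : V) (s : slot) : V := if far s then go v s.1.1.2.1 else v.

Lemma cloudK v s : cloud (anchor v s) s = v.
Proof. by rewrite /cloud /anchor; case: far. Qed.

Lemma anchorK v s : anchor (cloud v s) s = v.
Proof. by rewrite /cloud /anchor; case: far. Qed.

Lemma moved_slot s e : moved (moved s e) e = s.
Proof. by rewrite /moved /= xorJK; case: s. Qed.

Definition hop (v : V * K) (e : J) : V * K :=
  if dec v.2 is Some s then (cloud (anchor v.1 s) (moved s e), iota_ (moved s e)) else v.

Definition nb1 (v : V * K) (l : Lb1) : V * K :=
  match l with
  | inl (inl l) => (v.1, (v.2.1, enb v.2.2 l))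
  | inl (inr e) => hop v e
  | inr l => (v.1, (enbX v.2.1 l, v.2.2))
  end.

Lemma hop_slot v s e :
  hop (cloud v s, iota_ s) e = (cloud v (moved s e), iota_ (moved s e)).
Proof. by rewrite /hop iotaK anchorK. Qed.

Lemma hopK v e : hop (hop v e) e = v.
Proof.
case: v => v k; rewrite {2}/hop; case ds: (dec (v, k).2) => [s|].
  by rewrite hop_slot moved_slot cloudK -(decK ds).
by rewrite /hop ds.
Qed.

(** Edges between copies ask for the same table bit. Edges between the slots of one test ask for the
    same accepting record of answers; the shift by [(false, false)] is a loop and must accept. Edges
    between positions are there for expansion and carry no constraint. *)
Definition cst1 (v : V * K) (l : Lb1) (ab : Sg1 * Sg1) : bool :=
  match l with
  | inl (inl l) => bit v.2 ab.1 == bit (v.2.1, enb v.2.2 l) ab.2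
  | inl (inr e) => if dec v.2 is Some s then
      (e == (false, false)) ||
      ((ab.1 == ab.2) && pred_ok s.1.1 (kapb (anchor v.1 s)) ab.1) else true
  | inr _ => true
  end.

Definition dat1 (v : V * K) : cdat Sg1 Lb1 := [ffun l => [ffun ab => cst1 v l ab]].

Lemma nb1K v l : nb1 (nb1 v l) l = v.
Proof.
case: l => [[l|e]|l]; [|exact: hopK|]; case: v => v [x c]; rewrite /nb1 ?enbK //.
by rewrite /enbX enbTK.
Qed.

Definition gadget_graph : cgraph Sg1 Lb1 := CGraph nb1K dat1.

Lemma gadget_loopless : loopless gadget_graph.
Proof.
move=> v l a; rewrite [nb _ _]/(nb1 v l) [dat _]/(dat1 v) !ffunE.
case: l => [[l|e]|l] //; rewrite /nb1 /cst1.
  by case: v => v [x c] [->].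
rewrite /hop; case ds: (dec v.2) => [s|] // e1.
suff -> : e = (false, false) by rewrite eqxx.
have /iota_inj/(congr1 snd) : iota_ (moved s e) = iota_ s.
  by rewrite -(decK ds) -[in RHS]e1.
by rewrite /moved; case: (s.2) (e) => [[] []] [[] []].
Qed.

Section Complete.

Variable honest : V -> U.
Hypothesis ok_honest : forall v, okU (honest v).
Hypothesis kap_honest : forall v, kap (honest v) = kapb v.
Hypothesis view_honest : forall v r, outv r (honest v) = inv_ r (honest (go v r)).

Definition answers (v : V) (th : test) : Sg1 :=
  [ffun j : J => pos (th, j) (honest (cloud v (th, j)))].

Definition proof (v : V * K) : Sg1 :=
  if dec v.2 is Some s then answers (anchor v.1 s) s.1 else [ffun=> v.2.1 (honest v.1)].

Lemma bit_proof v k : bit k (proof (v, k)) = k.1 (honest v).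
Proof.
rewrite /bit /proof /=; case ds: (dec k) => [s|]; rewrite ffunE //.
have -> : (s.1, s.2) = s by case: (s).
by rewrite cloudK (decK ds).
Qed.

Lemma pred_honest v th : pred_ok th.1 (kapb v) (answers v th).
Proof.
case: th => -[[ty lt_ty] [r [g1 g2]]] [x [y z]].
rewrite /pred_ok /answers !ffunE /cloud /far.
case: ty lt_ty => [|[|[|[|[|//]]]]] lt_ty;
  rewrite /which /offset /others /pt_of /x0 /= !ffunE ?eqxx //=.
- by rewrite ok_honest; case: (x _).
- by rewrite kap_honest; case: (x _); case: (g1 _).
by rewrite view_honest; case: (x _); case: (y _); case: (g2 _).
Qed.

Lemma proof_sat v l : sat_at (proof : vert gadget_graph -> Sg1) v l.
Proof.
rewrite /sat_at [nb _ _]/(nb1 v l) [dat _]/(dat1 v) !ffunE.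
case: v => v k; case: l => [[l|e]|l] //; rewrite /nb1 /cst1.
  by rewrite !bit_proof eqxx.
rewrite /hop /=; case ds: (dec k) => [s|] //; apply/orP; right.
rewrite /proof /= iotaK anchorK ds.
by rewrite /moved eqxx pred_honest.
Qed.

End Complete.

(** * Expansion and soundness of the composed graph *)

Section Spread.

Variable R : realFieldType.

Lemma sum_inj_le (S T : finType) (g : S -> T) (F : T -> R) : injective g ->
  (forall x, 0 <= F x) -> \sum_s F (g s) <= \sum_x F x.
Proof.
move=> gI F0; have <- : \sum_(x in g @: [set: S]) F x = \sum_s F (g s).
  rewrite big_imset /=; last by move=> x y _ _ /gI.
  by apply: eq_bigl => s; rewrite inE.
by rewrite big_mkcond; apply: ler_sum => x _; case: ifP.
Qed.

Lemma sum_vk (F : V * K -> R) : \sum_p F p = \sum_v \sum_k F (v, k).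
Proof. by rewrite pair_bigA; apply: eq_bigr => -[]. Qed.

Lemma sum_go r (F : V -> R) : \sum_v F (go v r) = \sum_v F v.
Proof.
have b : bijective (go^~ r) by exists (bk^~ r) => v; rewrite ?goK ?bkK.
by rewrite [RHS](reindex (go^~ r)) //; apply: onW_bij.
Qed.

Lemma sum_cloud s (F : V -> R) : \sum_v F (cloud v s) = \sum_v F v.
Proof. by rewrite /cloud; case: far => //; apply: sum_go. Qed.

Definition test4 : finType := (wlk * ({ffun info -> bool} * {ffun Y -> bool}) * (X * (X * X)))%type.

Definition mk4 (i : 'I_5) (p : test4) : test := ((i, p.1), p.2).

Lemma card_test : #|test| = (5 * #|test4|)%N.
Proof. by rewrite /test /seed /test4 !card_prod card_ord -!mulnA. Qed.

Hypothesis wlk_gt0 : (0 < #|wlk|)%N.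

Lemma test4_gt0 : (0 < #|test4|)%N.
Proof. by rewrite /test4 !card_prod !muln_gt0 wlk_gt0 !X_gt0. Qed.

Lemma card_K_test : (#|K| <= 16 * #|test|)%N.
Proof.
have r0 : (0 < #|rest|)%N.
  by rewrite /rest /seed !card_prod !muln_gt0 card_ord wlk_gt0 !X_gt0 !card_bool.
have -> : #|K| = (#|X| * #|C|)%N by exact: card_prod.
apply: leq_trans (_ : #|X| * (4 * #|rest|) <= _)%N; first by rewrite leq_mul2l C_le_rest ?orbT.
have -> : #|rest| = (#|seed| * 4 * (#|X| * #|X|))%N by rewrite /rest !card_prod !card_bool.
have -> : #|test| = (#|seed| * (#|X| * (#|X| * #|X|)))%N by rewrite /test !card_prod.
by rewrite leq_eqVlt; apply/orP; left; apply/eqP; ring.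
Qed.

Definition i4 : 'I_5 := inord 4.

Lemma sum_test4 (F : wlk -> R) : \sum_(p : test4) F p.1.1 = #|test4|%:R * avg F.
Proof.
have n0 : #|test4|%:R != 0 :> R by rewrite pnatr_eq0 -lt0n test4_gt0.
transitivity (#|test4|%:R * avg (fun p : test4 => F p.1.1)).
  by rewrite /avg mulrCA divff ?mulr1.
rewrite (avg_pair (fun q (z : X * (X * X)) => F q.1)).
under eq_avg do rewrite avg_cst ?card_prod ?muln_gt0 ?X_gt0 //.
rewrite (avg_pair (fun r (z : {ffun info -> bool} * {ffun Y -> bool}) => F r)).
by under eq_avg do rewrite avg_cst ?card_prod ?muln_gt0 ?X_gt0 //.
Qed.

Lemma sum_Lb1 (F : Lb1 -> R) : \sum_l F l =
  \sum_l F (inl (inl l)) + \sum_e F (inl (inr e)) + \sum_l F (inr l).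
Proof. by rewrite big_sumType big_sumType. Qed.

Section Expand.

Hypothesis vgap : forall h : V -> R, \sum_v h v = 0 ->
  \sum_v h v ^+ 2 <= \sum_v avg (fun r => (h v - h (go v r)) ^+ 2).

(** Inside a cloud, positions and copies form a product of two cubes. The cloud means are compared
    through test 4, one of whose edges joins the cloud of [v] to that of [go v r], so that [vgap]
    applies to the means. *)
Lemma gadget_poincare : poincare nb1 ((300 * 300) : R).
Proof.
move=> f f0; pose h v := mean (fun k => f (v, k)).
pose D := \sum_v \sum_k (f (v, k) - h v) ^+ 2.
have K0 : #|K|%:R != 0 :> R.
  by rewrite pnatr_eq0 -lt0n card_prod muln_gt0 X_gt0 X_gt0.
have fE : \sum_p f p ^+ 2 = D + #|K|%:R * \sum_v h v ^+ 2.
  rewrite sum_vk mulr_sumr -big_split; apply: eq_bigr => v _ /=.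
  transitivity (\sum_k (f (v, k) - 0) ^+ 2); first by apply: eq_bigr => k _; rewrite subr0.
  by rewrite (sum_sqr_split (f := fun k => f (v, k))) ?sum_sub_mean // subr0.
have h0 : \sum_v h v = 0.
  rewrite /h /mean /avg -mulr_suml -(sum_vk f) f0 mul0r //.
rewrite sum_Lb1; set EC := \sum_l \sum_x (f x - f (nb1 x (inl (inl l)))) ^+ 2.
set EJ := \sum_e \sum_x (f x - f (nb1 x (inl (inr e)))) ^+ 2.
set EX := \sum_l \sum_x (f x - f (nb1 x (inr l))) ^+ 2.
have DE : D <= 96 * (EC + EX).
  have PC : poincare (@enb dim) (96 : R) by move=> g g0; apply: cube_poincare0.
  have PX : poincare enbX (96 : R) by exact: enbT_poincare.
  apply: le_trans (ler_sum _ (fun v _ => tensor _ PX PC (fun k => f (v, k)))) _ => //.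
  rewrite -mulr_sumr ler_pM2l // big_split /=; apply: lerD.
    rewrite exchange_big /=; apply: ler_sum => l _; by rewrite sum_vk.
  rewrite exchange_big /=; apply: ler_sum => l _; by rewrite sum_vk.
have cross : #|test4|%:R * \sum_v h v ^+ 2 <= 3 * (D + EJ + D).
  apply: le_trans (ler_wpM2l (ler0n _ _) (vgap h0)) _.
  rewrite mulr_sumr; under eq_bigr => v _ do rewrite -(sum_test4 (fun r => (h v - h (go v r)) ^+ 2)).
  pose s0 (p : test4) : slot := (mk4 i4 p, (false, false)).
  pose s2 (p : test4) : slot := (mk4 i4 p, (true, false)).
  have f0' p : far (s0 p) = false by rewrite /far andbF.
  have f2 p : far (s2 p) = true by rewrite /far /= inordK.
  have sI0 : injective (fun p => iota_ (s0 p)).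
    by move=> [p x] [q y] /iota_inj [] /= -> ->.
  have sI2 : injective (fun p => iota_ (s2 p)).
    by move=> [p x] [q y] /iota_inj [] /= -> ->.
  (* From one mean to its near slot, across the edge of the test, and from the far slot to the other
     mean. *)
  have tri v p : (h v - h (go v p.1.1)) ^+ 2 <= 3 * ((f (v, iota_ (s0 p)) - h v) ^+ 2 +
     (f (v, iota_ (s0 p)) - f (hop (v, iota_ (s0 p)) (true, false))) ^+ 2 +
     (f (go v p.1.1, iota_ (s2 p)) - h (go v p.1.1)) ^+ 2).
    have -> : hop (v, iota_ (s0 p)) (true, false) = (go v p.1.1, iota_ (s2 p)).
      have := hop_slot v (s0 p) (true, false); rewrite {1}/cloud f0' => ->.
      have -> : moved (s0 p) (true, false) = s2 p by [].
      by rewrite /cloud f2.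
    set a := f _; set b := f _; set x := h v; set y := h _.
    have := sqr_ge0 ((x - a) - (a - b)); have := sqr_ge0 ((x - a) - (b - y)).
    have := sqr_ge0 ((a - b) - (b - y)); nra.
  apply: le_trans (ler_sum _ (fun v _ => ler_sum _ (fun p _ => tri v p))) _.
  under eq_bigr => v _ do rewrite -mulr_sumr !big_split /=.
  rewrite -mulr_sumr ler_pM2l // !big_split /=; apply: lerD; first apply: lerD.
  - apply: ler_sum => v _.
    by apply: (sum_inj_le (F := fun k => (f (v, k) - h v) ^+ 2) sI0) => k; apply: sqr_ge0.
  - apply: le_trans (_ : \sum_v \sum_k (f (v, k) - f (hop (v, k) (true, false))) ^+ 2 <= _).
      apply: ler_sum => v _.
      by apply: (sum_inj_le (F := fun k => (f (v, k) - f (hop (v, k) (true, false))) ^+ 2) sI0) => k; apply: sqr_ge0.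
    rewrite -(sum_vk (fun p => (f p - f (hop p (true, false))) ^+ 2)) /EJ.
    rewrite [X in _ <= X](bigD1 (true, false)) //= lerDl sumr_ge0 // => e _.
    by apply: sumr_ge0 => p _; apply: sqr_ge0.
  - rewrite exchange_big /=.
    under eq_bigr => p _ do rewrite (sum_go p.1.1 (fun v => (f (v, iota_ (s2 p)) - h v) ^+ 2)).
    rewrite exchange_big /=; apply: ler_sum => v _.
    by apply: (sum_inj_le (F := fun k => (f (v, k) - h v) ^+ 2) sI2) => k; apply: sqr_ge0.
(* The factor 16 of [card_K_test] and the five kinds of tests. *)
have KT : #|K|%:R <= 80 * #|test4|%:R :> R.
  have -> : 80 * #|test4|%:R = (16 * #|test|)%:R :> R by rewrite card_test !natrM; ring.
  by rewrite ler_nat card_K_test.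
have H0 : 0 <= \sum_v h v ^+ 2 by apply: sumr_ge0 => v _; apply: sqr_ge0.
have KH := ler_wpM2r H0 KT.
have J0 : 0 <= EJ by apply: sumr_ge0 => e _; apply: sumr_ge0 => p _; apply: sqr_ge0.
have C0 : 0 <= EC by apply: sumr_ge0 => e _; apply: sumr_ge0 => p _; apply: sqr_ge0.
have X0 : 0 <= EX by apply: sumr_ge0 => e _; apply: sumr_ge0 => p _; apply: sqr_ge0.
have KH' : #|K|%:R * \sum_v h v ^+ 2 <= 80 * (#|test4|%:R * \sum_v h v ^+ 2) by rewrite mulrA.
rewrite fE; move: KH' DE cross J0 C0 X0.
move: (#|K|%:R * \sum_v h v ^+ 2) (#|test4|%:R * \sum_v h v ^+ 2) => a b.
by move=> *; lra.
Qed.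

End Expand.

Section Sound.

Variable a : V * K -> Sg1.

Definition rd (v : V) (k : K) : bool := bit k (a (v, k)).
Definition tabF (v : V) (x : X) : bool := 1 / 2 <= avg (fun c : C => (rd v (x, c))%:R : R).
Definition dis (v : V) (k : K) : bool := rd v k (+) tabF v k.1.
Definition vio (v : V * K) (l : Lb1) : R := (~~ cst1 v l (a v, a (nb1 v l)))%:R.

(** The minority has density [m <= 1 / 2] among the copies, hence variance [m (1 - m) >= m / 2], and
    the Poincare inequality of the cube bounds the variance by 96 times the violated edges. *)
Lemma dis_le v x : \sum_c (dis v (x, c))%:R <= 192 * \sum_c \sum_l vio (v, (x, c)) (inl (inl l)).
Proof.
pose f (c : C) : R := (dis v (x, c))%:R.
have C0 : (0 < #|C|)%N by exact: X_gt0.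
have Cp : 0 < #|C|%:R :> R by rewrite ltr0n.
have mf : mean f <= 1 / 2.
  rewrite /mean /f /dis /=; case tf: (tabF v x); last first.
    under eq_avg do rewrite addbF.
    by move/negbT: tf; rewrite /tabF -ltNge => /ltW.
  under eq_avg do rewrite addbT.
  have : avg (fun c : C => (~~ rd v (x, c))%:R : R) + avg (fun c : C => (rd v (x, c))%:R) = 1.
    rewrite -avgD -[RHS](avg_cst (T := C)) //; apply: eq_avg => c.
    by case: rd; rewrite /= ?addr0 ?add0r.
  by move: tf; rewrite /tabF; lra.
have PC : poincare (@enb dim) (96 : R) by move=> g g0; apply: cube_poincare0.
have := poincare_mean PC f.
have -> : \sum_l \sum_c (f c - f (enb c l)) ^+ 2 = \sum_c \sum_l vio (v, (x, c)) (inl (inl l)).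
  rewrite exchange_big; apply: eq_bigr => c _; apply: eq_bigr => l _ /=.
  rewrite /f /dis /vio /cst1 /nb1 /= -!/(rd _ _).
  by case: (rd v (x, c)); case: (rd _ _); case: tabF; rewrite /= ?mulr1n ?mulr0n; ring.
have := sum_sqr_split 0 (sum_sub_mean f).
have -> : \sum_c (f c - 0) ^+ 2 = \sum_c f c.
  by apply: eq_bigr => c _; rewrite subr0 /f; case: dis; rewrite /= ?mulr1n ?mulr0n ?expr1n ?expr0n.
have sf : \sum_c f c = #|C|%:R * mean f by rewrite /mean /avg mulrCA divff ?mulr1 ?gt_eqF.
have m0 : 0 <= mean f by apply: avg_ge0 => c; rewrite ler0n.
have -> : \sum_c (dis v (x, c))%:R = \sum_c f c by [].
rewrite subr0 sf; move: (\sum_x0 (f x0 - mean f) ^+ 2) (\sum_c \sum_l vio (v, (x, c)) (inl (inl l))) => q z e1 e2.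
move: (mean f) mf m0 e1 => m mf m0 e1.
by have := mulr_ge0 (ltW Cp) m0; nra.
Qed.

Definition rej (v : V) (th : test) : bool :=
  ~~ pred_ok th.1 (kapb v) [ffun j : J => tabF (cloud v (th, j)) (pos (th, j))].

(** If the majority tables fail a test, either one of the four copies read is in the minority, or
    the four slots cannot hold one and the same accepting record, and an edge at the first slot is
    violated. *)
Lemma rej_le v th : (rej v th)%:R <=
  \sum_j (dis (cloud v (th, j)) (iota_ (th, j)))%:R +
  \sum_e vio (v, iota_ (th, (false, false))) (inl (inr e)).
Proof.
have S1 : 0 <= \sum_j (dis (cloud v (th, j)) (iota_ (th, j)))%:R :> R by apply: sumr_ge0 => j _; rewrite ler0n.
have S2 : 0 <= \sum_e vio (v, iota_ (th, (false, false))) (inl (inr e)).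
  by apply: sumr_ge0 => j _; rewrite ler0n.
case r: (rej v th); last by rewrite /= addr_ge0.
have [/existsP[j dj]|nd] := boolP [exists j, dis (cloud v (th, j)) (iota_ (th, j))].
  apply: le_trans (_ : \sum_j (dis (cloud v (th, j)) (iota_ (th, j)))%:R <= _); last by rewrite lerDl.
  by rewrite (bigD1 j) //= dj lerDl; apply: sumr_ge0 => i _; rewrite ler0n.
apply: le_trans (_ : \sum_e vio (v, iota_ (th, (false, false))) (inl (inr e)) <= _); last by rewrite lerDr.
suff [e ve] : exists e, vio (v, iota_ (th, (false, false))) (inl (inr e)) = 1.
  by rewrite (bigD1 e) //= ve lerDl; apply: sumr_ge0 => i _; rewrite ler0n.
have [/existsP[e /eqP ve]|] := boolP [exists e, vio (v, iota_ (th, (false, false))) (inl (inr e)) == 1].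
  by exists e.
rewrite negb_exists => /forallP nv; exfalso.
suff p' : pred_ok th.1 (kapb v) [ffun j : J => tabF (cloud v (th, j)) (pos (th, j))].
  by move: r; rewrite /rej p'.
have c0 : cloud v (th, (false, false)) = v by rewrite /cloud /far andbF.
have ok e : e != (false, false) -> a (cloud v (th, e), iota_ (th, e)) = a (v, iota_ (th, (false, false))) /\
   pred_ok th.1 (kapb v) (a (v, iota_ (th, (false, false)))).
  move=> ne; have := nv e; rewrite /vio /cst1 /nb1 iotaK (negPf ne) /=.
  have := hop_slot v (th, (false, false)) e; rewrite c0 => ->.
  have -> : moved (th, (false, false)) e = (th, e) by case: (e).
  have -> : anchor v (th, (false, false)) = v by rewrite /anchor /far andbF.
  case: (eqVneq (a (v, iota_ (th, (false, false)))) _) => [e1|_] /=; case: pred_ok; rewrite /= ?eqxx //.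
have [_ p] := ok (true, false) isT.
suff -> : [ffun j : J => tabF (cloud v (th, j)) (pos (th, j))] = a (v, iota_ (th, (false, false))) by [].
apply/ffunP => j; rewrite ffunE.
have : ~~ dis (cloud v (th, j)) (iota_ (th, j)).
  by move: nd; rewrite negb_exists => /forallP.
rewrite /dis /rd /bit iotaK negb_add => /eqP /= <-.
by have [->|/ok[-> _]] := eqVneq j (false, false); rewrite ?c0.
Qed.

Lemma sum_rej_le : \sum_v \sum_th (rej v th)%:R <= 192 * \sum_p \sum_l vio p l.
Proof.
apply: le_trans (ler_sum _ (fun v _ => ler_sum _ (fun th _ => rej_le v th))) _.
under eq_bigr => v _ do rewrite big_split /=; rewrite big_split /=.
have vge p l : 0 <= vio p l by rewrite ler0n.
have l1 : \sum_v \sum_th \sum_j (dis (cloud v (th, j)) (iota_ (th, j)))%:R <=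
    192 * \sum_p \sum_l vio p (inl (inl l)).
  apply: le_trans (_ : \sum_v \sum_k (dis v k)%:R <= _).
    rewrite exchange_big /=; under eq_bigr => th _ do rewrite exchange_big /=.
    under eq_bigr => th _ do under eq_bigr => j _ do rewrite (sum_cloud (th, j) (fun v => (dis v (iota_ (th, j)))%:R)).
    rewrite (pair_bigA _ (fun th j => \sum_v (dis v (iota_ (th, j)))%:R)) exchange_big /=.
    apply: ler_sum => v _.
    rewrite (eq_bigr (fun s : slot => (dis v (iota_ s))%:R : R)); last by case.
    by apply: (sum_inj_le (F := fun k => (dis v k)%:R) iota_inj) => k; rewrite ler0n.
  rewrite sum_vk mulr_sumr; apply: ler_sum => v _.
  rewrite (eq_bigr (fun p : K => (fun x c => (dis v (x, c))%:R : R) p.1 p.2)); last by case.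
  rewrite -(pair_bigA _ (fun x c => (dis v (x, c))%:R)) /=.
  rewrite (eq_bigr (fun p : K => (fun x c => \sum_l vio (v, (x, c)) (inl (inl l))) p.1 p.2)); last by case.
  rewrite -(pair_bigA _ (fun x c => \sum_l vio (v, (x, c)) (inl (inl l)))) /= mulr_sumr.
  by apply: ler_sum => x _; apply: dis_le.
have l2 : \sum_v \sum_th \sum_e vio (v, iota_ (th, (false, false))) (inl (inr e)) <=
    \sum_p \sum_e vio p (inl (inr e)).
  rewrite sum_vk; apply: ler_sum => v _.
  apply: (sum_inj_le (g := fun th => iota_ (th, (false, false))) (F := fun k => \sum_e vio (v, k) (inl (inr e)))).
    by move=> x y /iota_inj [].
  by move=> k; apply: sumr_ge0.
have -> : \sum_p \sum_l vio p l = \sum_p \sum_l vio p (inl (inl l)) +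
    \sum_p \sum_e vio p (inl (inr e)) + \sum_p \sum_l vio p (inr l).
  by rewrite -!big_split; apply: eq_bigr => p _; rewrite sum_Lb1.
have p0 (L : finType) (F : V * K -> L -> R) : (forall p l, 0 <= F p l) -> 0 <= \sum_p \sum_l F p l.
  by move=> h; apply: sumr_ge0 => p _; apply: sumr_ge0.
have := p0 _ (fun p l => vio p (inl (inr l))) (fun p l => vge p _).
have := p0 _ (fun p l => vio p (inr l)) (fun p l => vge p _).
move: l1 l2; lra.
Qed.

Hypothesis V_gt0 : (0 < #|V|)%N.
Variable udef : U.

Definition goodp (v : V) (u : U) : bool :=
  [&& okU u, kap u == kapb v & dist_eval R (tabF v) u <= 1 / 50].
Definition good (v : V) : bool := [exists u, goodp v u].
Definition uv (v : V) : U := odflt udef [pick u | goodp v u].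

Lemma uvP v : good v -> goodp v (uv v).
Proof. by case/existsP=> u gu; rewrite /uv; case: pickP => [//|/(_ u)]; rewrite gu. Qed.

Definition rejq (v : V) (i : 'I_5) r g1 g2 x y z : R :=
  (rej v ((i, (r, (g1, g2))), (x, (y, z))))%:R.

Definition rho (v : V) (i : 'I_5) : R :=
  avg (fun r => avg (fun g1 => avg (fun g2 => avg (fun x => avg (fun y => avg (fun z =>
    rejq v i r g1 g2 x y z)))))).

Definition rate (v : V) : R := avg (fun th => (rej v th)%:R).

Lemma rate_rho v : rate v = avg (rho v).
Proof.
rewrite /rate.
rewrite (eq_avg (G := fun p : test => (fun s q => (rej v (s, q))%:R : R) p.1 p.2)); last by case.
rewrite (avg_pair (fun s q => (rej v (s, q))%:R : R)).
rewrite (eq_avg (G := fun p : seed => (fun i q => avg (fun x => (rej v ((i, q), x))%:R : R)) p.1 p.2)); last by case.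
rewrite (avg_pair (fun i q => avg (fun x => (rej v ((i, q), x))%:R : R))); apply: eq_avg => i.
rewrite (eq_avg (G := fun p => (fun r q => avg (fun x => (rej v ((i, (r, q)), x))%:R : R)) p.1 p.2)); last by case.
rewrite (avg_pair (fun r q => avg (fun x => (rej v ((i, (r, q)), x))%:R : R))); apply: eq_avg => r.
rewrite (eq_avg (G := fun p => (fun g1 g2 => avg (fun x => (rej v ((i, (r, (g1, g2))), x))%:R : R)) p.1 p.2)); last by case.
rewrite (avg_pair (fun g1 g2 => avg (fun x => (rej v ((i, (r, (g1, g2))), x))%:R : R))); apply: eq_avg => g1; apply: eq_avg => g2.
rewrite (eq_avg (G := fun p => (fun x q => (rej v ((i, (r, (g1, g2))), (x, q)))%:R : R) p.1 p.2)); last by case.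
rewrite (avg_pair (fun x q => (rej v ((i, (r, (g1, g2))), (x, q)))%:R : R)); apply: eq_avg => x.
rewrite (eq_avg (G := fun p => (fun y z => (rej v ((i, (r, (g1, g2))), (x, (y, z))))%:R : R) p.1 p.2)); last by case.
by rewrite (avg_pair (fun y z => (rej v ((i, (r, (g1, g2))), (x, (y, z))))%:R : R)).
Qed.

Lemma rho_ge0 v i : 0 <= rho v i.
Proof. by do 6!(apply: avg_ge0 => ?); rewrite ler0n. Qed.

Lemma rho_le v i : rho v i <= 5 * rate v.
Proof.
rewrite rate_rho /avg card_ord mulrCA divff ?mulr1 ?pnatr_eq0 //.
by rewrite (bigD1 i) //= lerDl; apply: sumr_ge0 => j _; exact: rho_ge0.
Qed.

Lemma avg_cst6 (F : R) : avg (fun _ : wlk => avg (fun _ : {ffun info -> bool} => avg (fun _ : {ffun Y -> bool} => F))) = F.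
Proof.
under eq_avg do under eq_avg do rewrite avg_cst ?X_gt0 //.
under eq_avg do rewrite avg_cst ?X_gt0 //.
by rewrite avg_cst.
Qed.

Lemma rej0 v r g1 g2 x y z : rejq v (inord 0) r g1 g2 x y z =
  (tabF v x (+) tabF v y (+) tabF v (xorf x y))%:R.
Proof.
rewrite /rejq /rej /pred_ok /= inordK // !ffunE /cloud /far /= !inordK //= /pos /which /offset /others /pt_of /= !inordK //=.
by rewrite !xor0f negb_eqb.
Qed.

Lemma rej1 v r g1 g2 x y z : rejq v (inord 1) r g1 g2 x y z =
  ((tabF v x && tabF v y) (+) tabF v z (+) tabF v (xorf (andf x y) z))%:R.
Proof.
rewrite /rejq /rej /pred_ok /= inordK // !ffunE /cloud /far /= !inordK //= /pos /which /offset /others /pt_of /= !inordK //=.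
by rewrite !xor0f negb_eqb.
Qed.

Lemma rej2 v r g1 g2 x y z : rejq v (inord 2) r g1 g2 x y z =
  (~~ (tabF v (xorf (ind okU) x) (+) tabF v x))%:R.
Proof.
rewrite /rejq /rej /pred_ok /= inordK // !ffunE /cloud /far /= !inordK //= /pos /which /offset /others /pt_of /= !inordK //=.
by rewrite !xor0f addbC.
Qed.

Lemma rej3 v r g1 g2 x y z : rejq v (inord 3) r g1 g2 x y z =
  (tabF v (xorf (pull g1 kap) x) (+) tabF v x (+) g1 (kapb v))%:R.
Proof.
rewrite /rejq /rej /pred_ok /= inordK // !ffunE /cloud /far /= !inordK //= /pos /which /offset /others /pt_of /= !inordK //=.
by rewrite !xor0f negb_eqb [tabF v x (+) _]addbC.
Qed.

Lemma rej4 v r g1 g2 x y z : rejq v (inord 4) r g1 g2 x y z =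
  (tabF v x (+) tabF v (xorf (pull g2 (outv r)) x) (+)
   (tabF (go v r) y (+) tabF (go v r) (xorf (pull g2 (inv_ r)) y)))%:R.
Proof.
rewrite /rejq /rej /pred_ok /= inordK // !ffunE /cloud /far /= !inordK //= /pos /which /offset /others /pt_of /= !inordK //=.
by rewrite !xor0f negb_eqb.
Qed.

(** A rejection rate below [1 / 500] leaves each of the five kinds below [1 / 100], the threshold of
    [long_code_decode]. *)
Lemma not_good v : ~~ good v -> 1 / 500 <= rate v.
Proof.
rewrite leNgt; apply: contraNN => lt.
have d1 i : rho v i <= 1 / 100 by apply: le_trans (rho_le v i) _; lra.
have [|||||u [u1 u2 u3]] := @long_code_decode R U info okU kap (kapb v) (tabF v) (1 / 100).
- by [].
- apply: le_trans (d1 (inord 0)); rewrite /rho.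
  under [X in _ <= X]eq_avg do under eq_avg do under eq_avg do under eq_avg do under eq_avg do
    (under eq_avg do rewrite rej0; rewrite avg_cst ?X_gt0 //).
  by rewrite avg_cst6.
- apply: le_trans (d1 (inord 1)); rewrite /rho.
  under [X in _ <= X]eq_avg do under eq_avg do under eq_avg do under eq_avg do under eq_avg do under eq_avg do rewrite rej1.
  by rewrite avg_cst6.
- apply: le_trans (d1 (inord 2)); rewrite /rho.
  under [X in _ <= X]eq_avg do under eq_avg do under eq_avg do under eq_avg do
    (under eq_avg do (under eq_avg do rewrite rej2; rewrite avg_cst ?X_gt0 //); rewrite avg_cst ?X_gt0 //).
  by rewrite avg_cst6.
- apply: le_trans (d1 (inord 3)); rewrite /rho.
  under [X in _ <= X]eq_avg do (under eq_avg do
    (under eq_avg do under eq_avg do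
    (under eq_avg do (under eq_avg do rewrite rej3; rewrite avg_cst ?X_gt0 //); rewrite avg_cst ?X_gt0 //); rewrite avg_cst ?X_gt0 //)).
  by rewrite avg_cst.
apply/existsP; exists u; rewrite /goodp u1 u2 eqxx /=.
by apply: le_trans u3 _; lra.
Qed.

Lemma sum_good_go r (F : V -> R) : avg (fun v => F (go v r)) = avg F.
Proof. by rewrite /avg sum_go. Qed.

(** A hit walk has an undecodable end, paid for by [not_good], or two decoded views that disagree,
    on which test 4 rejects. *)
Lemma hits_rate (hit : V -> wlk -> bool) :
  (forall v r, hit v r -> good v -> good (go v r) -> outv r (uv v) != inv_ r (uv (go v r))) ->
  avg (fun v => avg (fun r => (hit v r)%:R)) <= 2000 * avg rate.
Proof.
move=> hitP; pose b v : R := (~~ good v)%:R.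
have r0 v : 0 <= rate v by apply: avg_ge0 => th; rewrite ler0n.
have bl : avg b <= 500 * avg rate.
  rewrite -avgZ; apply: ler_avg => v; rewrite /b.
  by have [g|/not_good] := boolP (good v); [rewrite /= mulr_ge0 | rewrite /= mulr1n; lra].
(* [42 / 100 = 1 / 2 - 4 * (1 / 50)] comes from [consistency_reject] with the decoding radius
   [1 / 50]. *)
have s4 v : avg (fun r => (42 / 100) * ((hit v r)%:R - b v - b (go v r))) <= rho v (inord 4).
  apply: ler_avg => r; set sg := avg _.
  have sE : sg = avg (fun g2 : {ffun Y -> bool} => avg (fun x => avg (fun y =>
     (tabF v x (+) tabF v (xorf (pull g2 (outv r)) x) (+)
     (tabF (go v r) y (+) tabF (go v r) (xorf (pull g2 (inv_ r)) y)))%:R))).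
    rewrite /sg -[RHS](avg_cst (T := {: {ffun info -> bool}})) ?X_gt0 //.
    apply: eq_avg => g1; apply: eq_avg => g2; apply: eq_avg => x; apply: eq_avg => y.
    by under eq_avg do rewrite rej4; rewrite avg_cst ?X_gt0.
  have s0 : 0 <= sg by do 5!(apply: avg_ge0 => ?); rewrite ler0n.
  have b0 w : 0 <= b w by rewrite ler0n.
  have [h|h] := boolP (hit v r); last by have := b0 v; have := b0 (go v r); rewrite /= mulr0n; lra.
  have [g1|ng1] := boolP (good v); last first.
    by have := b0 (go v r); have -> : b v = 1 by [rewrite /b ng1]; rewrite /= ?mulr1n; lra.
  have [g2|ng2] := boolP (good (go v r)); last first.
    by have := b0 v; have -> : b (go v r) = 1 by [rewrite /b ng2]; rewrite /= ?mulr1n; lra.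
  have /and3P[_ _ d1] := uvP g1; have /and3P[_ _ d2] := uvP g2.
  have := @consistency_reject R U U Y (outv r) (inv_ r) _ _ _ _ _ d1 d2 (hitP _ _ h g1 g2).
  have -> : b v = 0 by rewrite /b g1.
  have -> : b (go v r) = 0 by rewrite /b g2.
  by rewrite -sE /= ?mulr1n; lra.
have : avg (fun v => avg (fun r => (42 / 100) * ((hit v r)%:R - b v - b (go v r)))) <= 5 * avg rate.
  rewrite -avgZ; apply: ler_avg => v; apply: le_trans (s4 v) (rho_le _ _).
have -> : avg (fun v => avg (fun r => (42 / 100) * ((hit v r)%:R - b v - b (go v r)))) =
  (42 / 100) * (avg (fun v => avg (fun r => (hit v r)%:R)) - avg b - avg b).
  transitivity (avg (fun v => avg (fun r => (42 / 100) * (hit v r)%:R + ((- (42 / 100)) * b v + (- (42 / 100)) * b (go v r))))).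
    by apply: eq_avg => v; apply: eq_avg => r; ring.
  under eq_avg do rewrite !avgD !avgZ avg_cst //.
  rewrite !avgD !avgZ.
  have -> : avg (fun v => avg (fun r => b (go v r))) = avg b.
    by rewrite exchange_avg; under eq_avg do rewrite sum_good_go; rewrite avg_cst.
  ring.
have : 0 <= avg rate by exact: avg_ge0.
move: bl; set h := avg (fun v => avg _); lra.
Qed.

Lemma gadget_sound (hit : V -> wlk -> bool) :
  (forall v r, hit v r -> good v -> good (go v r) -> outv r (uv v) != inv_ r (uv (go v r))) ->
  avg (fun v => avg (fun r => (hit v r)%:R)) <=
  (200 * (800 * 800)) * unsat R (a : vert gadget_graph -> Sg1).
Proof.
move/hits_rate => le1; apply: le_trans le1 _.
have V0 : 0 < #|V|%:R :> R by rewrite ltr0n.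
have T0 : 0 < #|test|%:R :> R by rewrite ltr0n card_test muln_gt0 test4_gt0.
have K0 : 0 < #|K|%:R :> R by rewrite ltr0n card_prod muln_gt0 X_gt0 X_gt0.
have -> : unsat R (a : vert gadget_graph -> Sg1) =
    (\sum_p \sum_l vio p l) / (#|V|%:R * #|K|%:R * 20).
  rewrite /unsat /avg -mulr_suml.
  have -> : #|Lb1|%:R = 20 :> R.
    by rewrite !card_sum !card_prod !card_option !card_bool card_ord.
  have -> : #|vert gadget_graph|%:R = #|V|%:R * #|K|%:R :> R by rewrite card_prod natrM.
  rewrite -mulrA -invfM [20 * _]mulrC; congr (_ / _).
  by apply: eq_bigr => p _; apply: eq_bigr => l _; rewrite /sat_at /dat /= !ffunE.
have -> : avg rate = (\sum_v \sum_th (rej v th)%:R) / (#|V|%:R * #|test|%:R).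
  by rewrite /avg /rate /avg -mulr_suml -mulrA -invfM [#|test|%:R * _]mulrC.
have := sum_rej_le; set S1 := \sum_v _; set S2 := \sum_p _ => le.
have S20 : 0 <= S2 by apply: sumr_ge0 => p _; apply: sumr_ge0 => l _; rewrite ler0n.
have KT : #|K|%:R <= 16 * #|test|%:R :> R by rewrite -natrM ler_nat card_K_test.
have VT : 0 < #|V|%:R * #|test|%:R :> R by rewrite mulr_gt0.
(* [320] is 16 vertices of a cloud per test times the 20 labels of [Lb1]; the final constant
   dominates [2000 * 192 * 320]. *)
have le2 : S1 / (#|V|%:R * #|test|%:R) <= 192 * 320 * (S2 / (#|V|%:R * #|K|%:R * 20)).
  rewrite ler_pdivrMr //; apply: le_trans le _.
  have -> : 192 * 320 * (S2 / (#|V|%:R * #|K|%:R * 20)) * (#|V|%:R * #|test|%:R) =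
     192 * (S2 * (16 * #|test|%:R / #|K|%:R)) by field; rewrite !gt_eqF.
  rewrite ler_pM2l // ler_peMr // ler_pdivlMr // mul1r //.
apply: le_trans (ler_wpM2l _ le2) _; first by rewrite ler0n.
have q0 : 0 <= S2 / (#|V|%:R * #|K|%:R * 20) by rewrite divr_ge0 // !mulr_ge0 // ltW.
by move: q0; set q := S2 / _; lra.
Qed.
(** The decoded views come before [hit] in the quantifiers, because the assignment that determines
    the hits is read off from these views. *)
Lemma gadget_sound_ex : exists (g : pred V) (u : V -> U),
  (forall v, g v -> okU (u v) /\ kap (u v) = kapb v) /\
  forall hit : V -> wlk -> bool,
    (forall v r, hit v r -> g v -> g (go v r) -> outv r (u v) != inv_ r (u (go v r))) ->
    avg (fun v => avg (fun r => (hit v r)%:R)) <=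
    (200 * (800 * 800)) * unsat R (a : vert gadget_graph -> Sg1).
Proof.
exists good, uv; split; last exact: gadget_sound.
by move=> v /uvP/and3P[ok /eqP].
Qed.

End Sound.

End Spread.

End Gadget.

End ConstraintGraphs.
Import ConstraintGraphs.

Module AmplificationStep.

Import Order.TTheory GRing.Theory Num.Theory.
Local Open Scope ring_scope.

(** * One amplification step *)

Section Step.

Variables (Sg Lb : finType) (s0 : Sg) (t : nat).

(** Letters of the lazy walk: [(false, l)] stays in place. Laziness makes the averaging operator
    positive semidefinite. *)
Definition LL : finType := (bool * Lb)%type.
Definition lpath : finType := {: (2 * t).-bseq LL}.
(** The constraints seen from a vertex are part of its view. The condition [okU] on a view is then
    the same at all vertices, and test 3 compares this part with the actual constraints. *)
Definition info : finType := {ffun lpath -> cdat Sg Lb}.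
Definition U0 : finType := ({ffun lpath -> Sg} * info)%type.
(** The extra bit doubles the type, so that the tables over it are as many as a cube over
    [bool * 'I_n] ([cardX]). *)
Definition U : finType := (bool * U0)%type.
Definition Yv : finType := {ffun 'I_(2 * t).+1 -> Sg}.
Definition wlk : finType := ('I_(2 * t) * {: (2 * t).-tuple LL})%type.

Definition asp (p : seq LL) : lpath := insubd ([bseq] : (2 * t).-bseq LL) p.

Lemma aspK p : (size p <= 2 * t)%N -> val (asp p) = p.
Proof. by move=> le; rewrite /asp val_insubd le. Qed.

Definition opin (u : U) (p : seq LL) : Sg := u.2.1 (asp p).
Definition kapU (u : U) : info := u.2.2.

Definition okU (u : U) : bool := [forall p : lpath, forall l : LL,
  (size (val p) < 2 * t)%N && l.1 ==>
  (kapU u p l.2 (u.2.1 p, opin u (rcons (val p) l)) &&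
   kapU u (asp (rcons (val p) l)) l.2 (opin u (rcons (val p) l), u.2.1 p))].

(** A uniform length between 1 and [2 * t] is obtained from a word of full length of which a prefix
    is walked. *)
Definition lword (r : wlk) : seq LL := take r.1.+1 (val r.2).

Lemma size_lword r : size (lword r) = r.1.+1.
Proof. by rewrite /lword size_takel // size_tuple; exact: ltn_ord. Qed.

(** The opinions on the successive vertices of the walk, as held at its start; [inv_] gives those
    held at its end, looking back. *)
Definition outv (r : wlk) (u : U) : Yv := [ffun i : 'I_(2 * t).+1 => opin u (take i (lword r))].
Definition inv_ (r : wlk) (u : U) : Yv := [ffun i : 'I_(2 * t).+1 => opin u (rev (drop i (lword r)))].

Definition udef : U := (false, ([ffun=> s0], [ffun=> [ffun=> [ffun=> true]]])).

Lemma U0_gt0 : (0 < #|U0|)%N.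
Proof. by apply/card_gt0P; exists udef.2. Qed.

Lemma cardX : #|X U| = #|{: {ffun bool * 'I_(#|U0|.-1).+1 -> bool}}|.
Proof.
have h (T : finType) : #|{: {ffun T -> bool}}| = (2 ^ #|T|)%N by rewrite card_ffun card_bool.
have -> : #|X U| = #|{: {ffun U -> bool}}| by [].
rewrite !h; congr (2 ^ _)%N.
have -> : #|U| = (2 * #|U0|)%N by rewrite card_prod card_bool.
have h2 (n : nat) : #|{: bool * 'I_n}| = (2 * n)%N by rewrite card_prod card_bool card_ord.
by etransitivity; last exact: (esym (h2 _)); rewrite prednK // U0_gt0.
Qed.

Definition KK : finType := K U Yv info wlk.
Definition dc : KK -> option (slot U Yv info wlk) := dec okU kapU outv inv_.
Definition unl (w : seq LL) : seq Lb := [seq l.2 | l <- w & l.1].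
Definition anc (s : slot U Yv info wlk) : seq LL := if far s then rev (lword s.1.1.2.1) else [::].
Definition clo (s : slot U Yv info wlk) : seq LL := if far s then lword s.1.1.2.1 else [::].

(** With [kpT], [WT] and [DlT], this puts the step into the form of the local transformation
    [stepT]. *)
Definition omT (k : KK) (l : Lb1) : seq Lb :=
  match l with
  | inl (inr e) => if dc k is Some s then unl (anc s ++ clo (moved s e)) else [::]
  | _ => [::]
  end.

Definition kpT (k : KK) (l : Lb1) : KK :=
  match l with
  | inl (inl l) => (k.1, enb k.2 l)
  | inl (inr e) => if dc k is Some s then iota_ okU kapU outv inv_ (moved s e) else k
  | inr l => (enbX cardX k.1 l, k.2)
  end.

Definition WT (k : KK) : seq (seq Lb) :=
  if dc k is Some s then [seq unl (anc s ++ val p) | p : lpath <- enum lpath] else [::].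

Definition dflt : cdat Sg Lb := [ffun=> [ffun=> true]].

Definition DlT (k : KK) (ds : seq (cdat Sg Lb)) : cdat Sg1 Lb1 :=
  [ffun l => [ffun ab =>
    match l with
    | inl (inl l) => bit okU kapU outv inv_ k ab.1 == bit okU kapU outv inv_ (k.1, enb k.2 l) ab.2
    | inl (inr e) => if dc k is Some s then (e == (false, false)) ||
        ((ab.1 == ab.2) &&
          pred_ok s.1.1 [ffun p : lpath => nth dflt ds (enum_rank p)] ab.1) else true
    | inr _ => true
    end]].

Section Graph.

Variable G : cgraph Sg Lb.

Definition lmv (v : vert G) (l : LL) : vert G := if l.1 then nb v l.2 else v.

Lemma lmvK v l : lmv (lmv v l) l = v.
Proof. by rewrite /lmv; case: (l.1) => //; rewrite nbK. Qed.

Notation lwalk := (walk lmv).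

Lemma lwalk_cat v p q : lwalk v (p ++ q) = lwalk (lwalk v p) q.
Proof. exact: foldl_cat. Qed.

Lemma lwalk_rcons v p l : lwalk v (rcons p l) = lmv (lwalk v p) l.
Proof. by rewrite /walk foldl_rcons. Qed.

Definition go (v : vert G) (r : wlk) := lwalk v (lword r).
Definition bk (v : vert G) (r : wlk) := lwalk v (rev (lword r)).

Lemma goK v r : bk (go v r) r = v.
Proof. exact: (walk_rev lmvK). Qed.

Lemma bkK v r : go (bk v r) r = v.
Proof. by have := walk_rev lmvK v (rev (lword r)); rewrite revK. Qed.

Definition kapb (v : vert G) : info := [ffun p : lpath => dat (lwalk v (val p))].

Definition stepG : cgraph Sg1 Lb1 := gadget_graph okU kapU outv inv_ cardX kapb goK bkK.

Lemma unlE v w : lwalk v w = foldl (@nb _ _ G) v (unl w).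
Proof. by elim: w v => // -[[] l] w IHw v; rewrite /walk /= -IHw. Qed.

Lemma step_nbE (v : vert G) (k : KK) l :
  @nb _ _ stepG (v, k) l = (foldl (@nb _ _ G) v (omT k l), kpT k l).
Proof.
case: l => [[l|e]|l] //; rewrite /omT /kpT.
rewrite [LHS]/(hop okU kapU outv inv_ go bk (v, k) e) /hop.
have -> : dec okU kapU outv inv_ (v, k).2 = dc k by [].
case: (dc k) => [s|] //; congr (_, _); rewrite -unlE lwalk_cat /anchor /cloud /anc /clo.
by case: (far (moved s e)); case: (far s).
Qed.

Lemma step_datE (v : vert G) (k : KK) :
  @dat _ _ stepG (v, k) = DlT k [seq dat (foldl (@nb _ _ G) v w) | w <- WT k].
Proof.
apply/ffunP => l; apply/ffunP => ab.
rewrite [dat _]/(dat1 okU kapU outv inv_ bk kapb (v, k)) /dat1 /DlT.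
rewrite [in LHS]ffunE [in LHS]ffunE [in RHS]ffunE [in RHS]ffunE.
case: l => [[l|e]|l] //; rewrite /cst1.
have -> : dec okU kapU outv inv_ (v, k).2 = dc k by [].
rewrite /WT; case: (dc k) => [s|] //; congr (_ || (_ && pred_ok _ _ _)).
apply/ffunP => p; rewrite [RHS]ffunE [LHS]ffunE -map_comp (nth_map p) -?cardE ?ltn_ord //.
rewrite nth_enum_rank /= -unlE lwalk_cat; congr (dat (lwalk _ _)).
by rewrite /anchor /anc; case: (far s).
Qed.

Lemma step_loopless : loopless stepG.
Proof. exact: gadget_loopless. Qed.

Section Complete.

Variable a : vert G -> Sg.
Hypothesis sat_a : forall v l, sat_at a v l.

Definition honest (v : vert G) : U := (false, ([ffun p : lpath => a (lwalk v (val p))], kapb v)).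

Lemma opin_honest v p : (size p <= 2 * t)%N -> opin (honest v) p = a (lwalk v p).
Proof. by move=> le; rewrite /opin ffunE aspK. Qed.

Lemma okU_honest v : okU (honest v).
Proof.
apply/forallP => p; apply/forallP => l; apply/implyP => /andP[lt_p l1].
rewrite opin_honest ?size_rcons // /kapU /= !ffunE aspK ?size_rcons //.
rewrite lwalk_rcons /lmv l1; have := sat_a (lwalk v (val p)) l.2.
have := sat_a (nb (lwalk v (val p)) l.2) l.2; rewrite /sat_at nbK => -> ->.
by [].
Qed.

Lemma view_honest v r : outv r (honest v) = inv_ r (honest (go v r)).
Proof.
apply/ffunP => i; rewrite !ffunE.
have sz : (size (lword r) <= 2 * t)%N by rewrite size_lword.
have s1 : (size (take i (lword r)) <= 2 * t)%N by apply: leq_trans sz; rewrite size_take_min geq_minr.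
have s2 : (size (rev (drop i (lword r))) <= 2 * t)%N.
  by rewrite size_rev size_drop; apply: leq_trans (leq_subr _ _) sz.
rewrite !opin_honest //.
have -> : go v r = lwalk (lwalk v (take i (lword r))) (drop i (lword r)).
  by rewrite -lwalk_cat cat_take_drop.
by rewrite (walk_rev lmvK).
Qed.

Lemma step_complete : exists a' : vert stepG -> Sg1, forall v l, sat_at a' v l.
Proof.
by eexists; apply: (proof_sat (honest := honest)) => // [v|v r]; [exact: okU_honest | exact: view_honest].
Qed.

End Complete.

Section Spectral.

Variables (R : realFieldType) (c : R).
Hypothesis Lb_gt0 : (0 < #|Lb|)%N.
Hypothesis c_large : 1 <= c.
Hypothesis P : poincare (@nb _ _ G) c.

(** The Poincare inequality bounds the square norm by [2 * c * #|Lb|] times the Dirichlet form, of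
    which the lazy walk sees half. *)
Definition lam : R := 1 - (4 * c * #|Lb|%:R)^-1.

Lemma LL_gt0 : (0 < #|LL|)%N.
Proof. by rewrite card_prod card_bool muln_gt0. Qed.

Lemma k_gt0 : 0 < 4 * c * #|Lb|%:R.
Proof. by rewrite !mulr_gt0 ?ltr0n //; apply: lt_le_trans c_large. Qed.

Lemma inv_small : 0 < (4 * c * #|Lb|%:R)^-1 <= 1 / 4.
Proof.
have L1 : 1 <= #|Lb|%:R :> R by rewrite ler1n.
have h : 4 <= 4 * c * #|Lb|%:R.
  by have := mulr_ege1 c_large L1; rewrite -mulrA; lra.
have h0 : 0 < 4 * c * #|Lb|%:R by lra.
by rewrite invr_gt0 h0 /= div1r lef_pV2 ?posrE.
Qed.

Lemma lam_gt0 : 0 < lam. Proof. by have /andP[] := inv_small; rewrite /lam; lra. Qed.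
Lemma lam_lt1 : lam < 1. Proof. by have /andP[] := inv_small; rewrite /lam; lra. Qed.

Lemma avop_lm (f : vert G -> R) v :
  avop lmv f v = (f v + avg (fun l => f (nb v l))) / 2.
Proof.
rewrite /avop /avg (eq_bigr (fun p : LL => (fun b l => f (if b then nb v l else v)) p.1 p.2)) //.
rewrite -(pair_bigA _ (fun b l => f (if b then nb v l else v))) /= big_bool /= sumr_const.
rewrite card_prod card_bool natrM -[f v *+ _]mulr_natl.
have L1 : #|Lb|%:R != 0 :> R by rewrite pnatr_eq0 -lt0n.
by field.
Qed.

Lemma energy_nb (f : vert G -> R) (s : R) : s ^+ 2 = 1 ->
  \sum_l \sum_v (f v + s * f (nb v l)) ^+ 2 =
  2 * #|Lb|%:R * (dot f f + s * \sum_v f v * avg (fun l => f (nb v l))).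
Proof.
move=> s2; have L1 : #|Lb|%:R != 0 :> R by rewrite pnatr_eq0 -lt0n.
have -> : \sum_v f v * avg (fun l => f (nb v l)) =
    (\sum_l \sum_v f v * f (nb v l)) / #|Lb|%:R.
  rewrite exchange_big mulr_suml; apply: eq_bigr => v _.
  by rewrite /avg mulrA mulr_sumr.
have -> : 2 * #|Lb|%:R * (dot f f + s * ((\sum_l \sum_v f v * f (nb v l)) / #|Lb|%:R)) =
   \sum_(l : Lb) (2 * dot f f) + 2 * s * \sum_l \sum_v f v * f (nb v l).
  by rewrite sumr_const -[_ *+ #|Lb|]mulr_natl; field.
rewrite [2 * s * _]mulr_sumr -big_split; apply: eq_bigr => l _ /=.
have e : \sum_v f (nb v l) ^+ 2 = dot f f.
  rewrite (sum_mv (@nbK _ _ G) l (fun v => f v ^+ 2)); apply: eq_bigr => v _.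
  exact: expr2.
transitivity (dot f f + 2 * s * \sum_v f v * f (nb v l) + s ^+ 2 * \sum_v f (nb v l) ^+ 2).
  by rewrite /dot !mulr_sumr -!big_split; apply: eq_bigr => v _ /=; ring.
by rewrite s2 e; ring.
Qed.

Lemma lm_psd (f : vert G -> R) : 0 <= dot f (avop lmv f).
Proof.
have := energy_nb f (s := 1); rewrite expr1n => /(_ erefl) e.
have : 0 <= \sum_l \sum_v (f v + 1 * f (nb v l)) ^+ 2.
  by apply: sumr_ge0 => l _; apply: sumr_ge0 => v _; exact: sqr_ge0.
rewrite e pmulr_rge0 ?mulr_gt0 ?ltr0n // mul1r.
have -> : dot f (avop lmv f) = (dot f f + \sum_v f v * avg (fun l => f (nb v l))) / 2.
  rewrite /dot -big_split mulr_suml; apply: eq_bigr => v _ /=.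
  by rewrite avop_lm; ring.
lra.
Qed.

Lemma lm_gap (f : vert G -> R) : \sum_v f v = 0 ->
  dot f (avop lmv f) <= lam * dot f f.
Proof.
move/P; have := energy_nb f (s := -1); rewrite sqrrN expr1n => /(_ erefl).
have -> : \sum_l \sum_v (f v + -1 * f (nb v l)) ^+ 2 = \sum_l \sum_v (f v - f (nb v l)) ^+ 2.
  by apply: eq_bigr => l _; apply: eq_bigr => v _; rewrite mulN1r.
move=> ->; have -> : \sum_v f v ^+ 2 = dot f f by apply: eq_bigr => v _; rewrite expr2.
have -> : dot f (avop lmv f) = (dot f f + \sum_v f v * avg (fun l => f (nb v l))) / 2.
  rewrite /dot -big_split mulr_suml; apply: eq_bigr => v _ /=.
  by rewrite avop_lm; ring.
set D := dot f f; set S := \sum_v _ => le.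
have L0 : 0 < #|Lb|%:R :> R by rewrite ltr0n.
have k0 := k_gt0.
rewrite -(ler_pM2l k0).
have -> : 4 * c * #|Lb|%:R * (lam * D) = 4 * c * #|Lb|%:R * D - D.
  have c0 : c != 0 by rewrite gt_eqF // (lt_le_trans _ c_large).
  have q0 : #|Lb|%:R != 0 :> R by rewrite gt_eqF.
  by rewrite /lam; field; rewrite ?c0 ?q0.
by move: le; set q := #|Lb|%:R; nra.
Qed.

Hypothesis t_gt0 : (0 < t)%N.

Lemma wlk_gt0 : (0 < #|wlk|)%N.
Proof. by rewrite card_prod card_ord card_tuple muln_gt0 muln_gt0 t_gt0 expn_gt0 LL_gt0. Qed.

Lemma avg_wlk (F : seq LL -> R) :
  avg (fun r : wlk => F (lword r)) = (\sum_(n < 2 * t) ew n.+1 F) / (2 * t)%:R.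
Proof.
rewrite (eq_avg (G := fun r : wlk => (fun n (w : (2 * t).-tuple LL) => F (take n.+1 (val w))) r.1 r.2)) //.
rewrite (avg_pair (fun (n : 'I_(2 * t)) (w : (2 * t).-tuple LL) => F (take n.+1 (val w)))).
rewrite {1}/avg card_ord; congr (_ / _); apply: eq_bigr => n _.
rewrite (ew_tuple (2 * t) (fun w => F (take n.+1 w))).
have := ew_cat n.+1 (2 * t - n.+1) (fun w => F (take n.+1 w)); rewrite subnKC ?ltn_ord // => ->.
apply: eq_ew => p sp.
by rewrite -[RHS](ew_cst LL_gt0 (2 * t - n.+1)); apply: eq_ew => q _; rewrite take_size_cat.
Qed.

Hypothesis t_large : 4 * c * #|Lb|%:R <= t%:R.

(** Since [t >= (1 - lam)^-1], the correlation between the ends of a walk, averaged over [2 * t]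
    lengths, is at most one half. The constant [c] has disappeared, hence the fixed constant of the
    composed graph. *)
Lemma vgap (h : vert G -> R) : \sum_v h v = 0 ->
  \sum_v h v ^+ 2 <= \sum_v avg (fun r => (h v - h (go v r)) ^+ 2).
Proof.
move=> h0; pose D := dot h h.
have DE : \sum_v h v ^+ 2 = D by apply: eq_bigr => v _; rewrite expr2.
have D0 : 0 <= D by exact: dot_ge0.
pose Cr := avg (fun r : wlk => \sum_v h v * h (go v r)).
have RE : \sum_v avg (fun r => (h v - h (go v r)) ^+ 2) = 2 * D - 2 * Cr.
  rewrite sum_avg.
  transitivity (avg (fun r : wlk => 2 * D + (-2) * \sum_v h v * h (go v r))).
    apply: eq_avg => r.
    have e : \sum_v h (go v r) ^+ 2 = D by rewrite (sum_go goK bkK r (fun v => h v ^+ 2)).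
    transitivity (D + D + (-2) * \sum_v h v * h (go v r)); last by ring.
    rewrite -{1}DE -{1}e mulr_sumr -!big_split; apply: eq_bigr => v _ /=; ring.
  by rewrite avgD avg_cst ?wlk_gt0 // (avgZ _ (fun r : wlk => \sum_v h v * h (go v r))) -/Cr; ring.
have CE : Cr = (\sum_(n < 2 * t) dot h (iter n.+1 (avop lmv) h)) / (2 * t)%:R.
  rewrite /Cr -sum_avg.
  transitivity (\sum_v h v * ((\sum_(n < 2 * t) ew n.+1 (fun w => h (lwalk v w))) / (2 * t)%:R)).
    by apply: eq_bigr => v _; rewrite avgZ (avg_wlk (fun w => h (lwalk v w))).
  rewrite exchange_big mulr_suml; apply: eq_bigr => v _.
  rewrite mulrA; congr (_ / _); rewrite mulr_sumr; apply: eq_bigr => n _.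
  by rewrite [in RHS]iter_avop.
have lg0 := lam_gt0; have lg1 := lam_lt1.
have le1 : \sum_(n < 2 * t) dot h (iter n.+1 (avop lmv) h) <= t%:R * D.
  apply: le_trans (_ : \sum_(n < 2 * t) lam ^+ n * D <= _).
    apply: ler_sum => n _; apply: le_trans (_ : lam ^+ n.+1 * D <= _).
      by apply: decay => //; try exact: lmvK; try exact: LL_gt0; try exact: lm_psd; try exact: lm_gap.
    by rewrite ler_wpM2r // exprS ler_piMl ?exprn_ge0 // ltW.
  rewrite -mulr_suml ler_wpM2r //; apply: le_trans t_large.
  have gl : (1 - lam) * \sum_(j < 2 * t) lam ^+ j <= 1 by apply: geom_le.
  have e1 : 1 - lam = (4 * c * #|Lb|%:R)^-1 by rewrite /lam opprB addrC subrK.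
  by move: gl; rewrite e1 mulrC ler_pdivrMr ?k_gt0 // mul1r.
have tp : 0 < t%:R :> R by rewrite ltr0n.
have : Cr <= D / 2.
  rewrite CE natrM invfM mulrA ler_pdivrMr // mulrAC ler_pdivrMr ?ltr0n //.
  by rewrite divfK ?pnatr_eq0 // [D * _]mulrC.
rewrite DE RE; lra.
Qed.

Lemma step_poincare : poincare (@nb _ _ stepG) ((300 * 300) : R).
Proof. by apply: gadget_poincare; [exact: goK | exact: bkK | exact: wlk_gt0 | exact: vgap]. Qed.

Hypothesis V_gt0 : (0 < #|vert G|)%N.

(** At each vertex the agreements with the letters of [Sg] sum to 1, so some letter reaches the
    average. *)
Lemma plural_ex (op : vert G -> seq LL -> Sg) : exists ast : vert G -> Sg,
  forall u, #|Sg|%:R^-1 <= agree R lmv op ast t u.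
Proof.
have A0 : 0 < #|Sg|%:R :> R by rewrite ltr0n; apply/card_gt0P; exists s0.
have tp : 0 < t%:R :> R by rewrite ltr0n.
have ex u : exists s, #|Sg|%:R^-1 <= agree R lmv op (fun=> s) t u.
  apply/not_existsP => no.
  have : \sum_s agree R lmv op (fun=> s) t u < \sum_(s : Sg) #|Sg|%:R^-1.
    have := @ltr_sum R Sg (index_enum Sg) xpredT (fun s => agree R lmv op (fun=> s) t u) (fun=> #|Sg|%:R^-1).
    apply; first by apply/hasP; exists s0; rewrite ?mem_index_enum.
    by move=> s _; rewrite ltNge; apply/negP/no.
  rewrite sumr_const -[_ *+ _]mulr_natl divff ?gt_eqF //.
  rewrite /agree -mulr_suml exchange_big /=.
  have -> : \sum_(j < t) \sum_s ew j (fun p => (op (lwalk u p) (rev p) == s)%:R) = t%:R :> R.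
    rewrite -[t in RHS]card_ord -sumr_const /=; apply: eq_bigr => j _.
    transitivity (ew (L := LL) (R := R) j (fun=> 1)); last by rewrite ew_cst // LL_gt0.
    have -> : \sum_s ew (L := LL) j (fun p => (op (lwalk u p) (rev p) == s)%:R : R) =
        ew (L := LL) j (fun p => \sum_s (op (lwalk u p) (rev p) == s)%:R : R) by apply: esym; apply: ew_sum; try exact: LL_gt0.
    apply: (@eq_ew R LL) => p _.
    rewrite (bigD1 (op (lwalk u p) (rev p))) //= eqxx big1 ?addr0 // => s ne.
    by rewrite eq_sym (negPf ne).
  by rewrite divff ?gt_eqF // ltxx.
by have [ast h] := choice ex; exists ast.
Qed.

Lemma frac_mono (x y : R) : 0 <= x -> x <= y -> x / (1 + x) <= y / (1 + y).
Proof.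
move=> x0 xy; have x1 : 0 < 1 + x by lra.
have y1 : 0 < 1 + y by lra.
by rewrite ler_pdivrMr // mulrAC ler_pdivlMr // !mulrDr !mulr1 [y * x]mulrC lerD2r.
Qed.

(** Violation is counted from both ends of the edge, which makes badness invariant under
    reversal. *)
Definition badl (ast : vert G -> Sg) (v : vert G) (l : LL) : bool :=
  l.1 && (~~ sat_at ast v l.2 || ~~ sat_at ast (nb v l.2) l.2).

Lemma badlC ast v l : badl ast (lmv v l) l = badl ast v l.
Proof. by rewrite /badl /lmv; case: (l.1) => //=; rewrite nbK orbC. Qed.

Lemma okUP (u : U) p (l : LL) : okU u -> (size p < 2 * t)%N -> l.1 ->
  kapU u (asp p) l.2 (opin u p, opin u (rcons p l)) &&
  kapU u (asp (rcons p l)) l.2 (opin u (rcons p l), opin u p).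
Proof.
move=> /forallP/(_ (asp p))/forallP/(_ l) + sp l1; rewrite aspK; last exact: ltnW.
by rewrite sp l1.
Qed.

Lemma kapb_asp v p : (size p <= 2 * t)%N -> kapb v (asp p) = dat (lwalk v p).
Proof. by move=> sp; rewrite ffunE aspK. Qed.

(** If the two views agreed along the walk, the view at its start would hold the values of [ast] at
    both ends of a violated edge, against [okU] and its knowledge of the true constraints. *)
Lemma hit_views (u : vert G -> U) ast v r i l1 :
  okU (u v) -> kapU (u v) = kapb v -> (i < size (lword r))%N ->
  hit lmv (badl ast) (fun v p => opin (u v) p) ast t l1 v (lword r) i ->
  outv r (u v) != inv_ r (u (go v r)).
Proof.
move=> ok kE iw /and3P[lt_i _ /and3P[]]; set p := take i _; set l := nth _ _ _; set q := drop _ _.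
move=> /andP[l1' bd] /eqP e1 /eqP e2; apply/eqP => ev.
have sw : (size (lword r) <= 2 * t)%N by rewrite size_lword.
have sp : size p = i by rewrite size_take iw.
have i1 : (i.+1 < (2 * t).+1)%N by exact: leq_trans iw sw.
have e3 : opin (u v) (rcons p l) = ast (lwalk v (rcons p l)).
  have := congr1 (fun f : Yv => f (Ordinal i1)) ev; rewrite [LHS]ffunE [RHS]ffunE /=.
  rewrite (take_nth l1) // -/p -/l -/q => ->; rewrite -e2; congr (opin (u _) _).
  by rewrite /go -[in LHS](cat_take_drop i (lword r)) (drop_nth l1).
have sp2 : (size p < 2 * t)%N by rewrite sp; exact: leq_trans iw sw.
have := okUP ok sp2 l1'; rewrite kE !kapb_asp ?size_rcons //; last exact: ltnW.
rewrite e1 e3 lwalk_rcons /lmv l1'.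
by move: bd; rewrite /sat_at nbK => /orP[] /negPf-> //; rewrite andbF.
Qed.

Lemma step_views (a' : vert stepG -> Sg1) : exists (g : pred (vert G)) (u : vert G -> U),
  (forall v, g v -> okU (u v) /\ kapU (u v) = kapb v) /\
  forall hit : vert G -> wlk -> bool,
    (forall v r, hit v r -> g v -> g (go v r) -> outv r (u v) != inv_ r (u (go v r))) ->
    avg (fun v => avg (fun r => (hit v r)%:R)) <= (200 * (800 * 800)) * unsat R a'.
Proof.
exact: (@gadget_sound_ex _ _ _ _ okU kapU outv inv_ _ cardX _ go bk kapb goK bkK R wlk_gt0 a' V_gt0 udef).
Qed.

Lemma avg_go_word (F : vert G -> seq LL -> R) : avg (fun v => avg (fun r : wlk => F v (lword r))) =
  (\sum_(n < 2 * t) \sum_v ew n.+1 (F v)) / (2 * t)%:R / #|vert G|%:R.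
Proof.
rewrite exchange_big {1}/avg; congr (_ / _); rewrite mulr_suml; apply: eq_bigr => v _.
exact: avg_wlk.
Qed.

Lemma mu_badl ast : unsat R ast / 2 <= mu R (badl ast).
Proof.
rewrite /unsat mulrC -avgZ; apply: ler_avg => v; rewrite -avgZ /phi.
have -> : avg (fun l : LL => (badl ast v l)%:R) = avg (fun l => (badl ast v (true, l))%:R) / 2 :> R.
  rewrite /avg (eq_bigr (fun p : LL => (fun b l => (badl ast v (b, l))%:R) p.1 p.2)); last by case.
  rewrite -(pair_bigA _ (fun b l => (badl ast v (b, l))%:R)) /= big_bool /= [X in _ + X]big1 ?addr0 //.
  by rewrite card_prod card_bool natrM invfM mulrA mulrAC.
rewrite [_ / 2]mulrC -avgZ; apply: ler_avg => l; rewrite ler_pM2l ?invr_gt0 //.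
by rewrite ler_nat /badl /=; case: sat_at.
Qed.

Definition A4 : R := 4 * #|Sg|%:R ^+ 4 * (2 * (1 + 2 / (1 - lam)) + 8).

Lemma A4_gt0 : 0 < A4.
Proof.
have : 0 < 2 / (1 - lam) by rewrite divr_gt0 ?subr_gt0 ?lam_lt1.
move=> h; rewrite /A4; apply: mulr_gt0; last by lra.
by apply: mulr_gt0 => //; apply: exprn_gt0; rewrite ltr0n; apply/card_gt0P; exists s0.
Qed.

Lemma hit_rate_low (op : vert G -> seq LL -> Sg) ast (l1 : LL) :
  (forall u, #|Sg|%:R^-1 <= agree R lmv op ast t u) ->
  A4^-1 * (t%:R * mu R (badl ast) / (1 + t%:R * mu R (badl ast))) <= avg (fun v => avg (fun r : wlk =>
    [exists i : 'I_(size (lword r)), hit lmv (badl ast) op ast t l1 v (lword r) i]%:R)).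
Proof.
move=> astP; pose y := t%:R * mu R (badl ast); rewrite -/y.
have := power_reject lmvK LL_gt0 lam_gt0 lam_lt1 lm_psd lm_gap (badlC ast) V_gt0 l1 t_gt0 astP.
rewrite -/A4 -/y (avg_go_word (fun v w => [exists i : 'I_(size w), hit lmv (badl ast) op ast t l1 v w i]%:R)).
move=> pw; rewrite ler_pdivlMr ?ltr0n // ler_pdivlMr ?ltr0n ?muln_gt0 ?t_gt0 //.
by apply: le_trans pw; rewrite -mulrA [#|_|%:R * _]mulrC.
Qed.

(** The views decoded from [a'] define opinions, their plurality an assignment of the old graph, and
    the edges it violates are hit often by long walks; hit walks with decodable ends carry
    disagreeing views. *)
Lemma step_sound (a' : vert stepG -> Sg1) (dl : R) : 0 <= dl ->
  (forall a : vert G -> Sg, dl <= unsat R a) ->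
  (A4 * (200 * (800 * 800)))^-1 * ((t%:R * (dl / 2)) / (1 + t%:R * (dl / 2))) <= unsat R a'.
Proof.
move=> dl0 dlP.
have [g [u [uP sound]]] := step_views a'.
have [ast astP] := plural_ex (fun v p => opin (u v) p).
have [l1 _] := card_gt0P LL_gt0.
have tp : 0 < t%:R :> R by rewrite ltr0n.
have {}sound := sound (fun v r => [exists i : 'I_(size (lword r)),
   hit lmv (badl ast) (fun v p => opin (u v) p) ast t l1 v (lword r) i]).
have hv : forall v r, [exists i : 'I_(size (lword r)),
     hit lmv (badl ast) (fun v p => opin (u v) p) ast t l1 v (lword r) i] ->
   g v -> g (go v r) -> outv r (u v) != inv_ r (u (go v r)).
  move=> v r /existsP[i hi] gv _.
  by have [ok kE] := uP v gv; exact: hit_views ok kE (ltn_ord i) hi.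
have {hv}sound := sound hv.
have low := hit_rate_low l1 astP.
have mu_ge : dl / 2 <= mu R (badl ast).
  by apply: le_trans (mu_badl ast); rewrite ler_pM2r ?invr_gt0.
have le1 := frac_mono (mulr_ge0 (ltW tp) (divr_ge0 dl0 (ler0n R 2))) (ler_wpM2l (ltW tp) mu_ge).
have Q0 : 0 < 200 * (800 * 800) :> R by rewrite !mulr_gt0.
rewrite invfM mulrAC ler_pdivrMr // [unsat _ _ * _]mulrC.
apply: le_trans sound; apply: le_trans low.
by rewrite ler_pM2l ?invr_gt0 ?A4_gt0.
Qed.

End Spectral.

End Graph.

End Step.

End AmplificationStep.
Import AmplificationStep.

Module GapAmplification.

Import Order.TTheory GRing.Theory Num.Theory.
Local Open Scope ring_scope.

(** * Amplification to a constant gap *)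

Definition satG Sg Lb (G : cgraph Sg Lb) := exists a : vert G -> Sg, forall v l, sat_at a v l.
Definition gapG (R : realFieldType) Sg Lb (G : cgraph Sg Lb) (dl : R) := forall a : vert G -> Sg, dl <= unsat R a.

Definition s1 : Sg1 := [ffun=> false].

Lemma Lb1_gt0 : (0 < #|Lb1|)%N.
Proof. by apply/card_gt0P; exists (inl (inr (false, false))). Qed.

Lemma vert_step_gt0 (Sg Lb : finType) (s0 : Sg) t (G : cgraph Sg Lb) :
  (0 < #|vert G|)%N -> (0 < #|vert (stepG s0 t G)|)%N.
Proof.
move=> V0; have -> : #|vert (stepG s0 t G)| = (#|vert G| * #|KK Sg Lb t|)%N by exact: card_prod.
rewrite muln_gt0 V0; have -> : #|KK Sg Lb t| = (#|X (U Sg Lb t)| * #|C (U Sg Lb t) (Yv Sg t) (info Sg Lb t) (wlk Lb t)|)%N by exact: card_prod.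
by rewrite muln_gt0 !X_gt0.
Qed.

Section Arch.

Variable R : realFieldType.
Hypothesis nat_above : forall x : R, exists2 n : nat, (0 < n)%N & x <= n%:R.

Section First.

Variables (Sg Lb : finType) (s0 : Sg) (c : R).
Hypothesis Lb_gt0 : (0 < #|Lb|)%N.
Hypothesis c_large : 1 <= c.

Definition et : R := (A4 Sg Lb c * (200 * (800 * 800)))^-1.

Lemma et_gt0 : 0 < et.
Proof. by rewrite invr_gt0; apply: mulr_gt0; [exact: A4_gt0 | rewrite !mulr_gt0]. Qed.

Lemma step_gap t : (0 < t)%N -> 4 * c * #|Lb|%:R <= t%:R ->
  forall G : cgraph Sg Lb, poincare (@nb _ _ G) c -> (0 < #|vert G|)%N ->
  forall dl, 0 <= dl -> gapG G dl ->
  gapG (stepG s0 t G) (et * (t%:R * (dl / 2) / (1 + t%:R * (dl / 2)))).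
Proof. by move=> t0 tl G P V0 dl dl0 h a; exact: step_sound. Qed.

(** This step is for changing the alphabet and the labels into [Sg1] and [Lb1]; it may lose a
    constant factor of the gap. *)
Lemma first_step : exists t C : nat, [/\ (0 < C)%N &
  forall G : cgraph Sg Lb, poincare (@nb _ _ G) c -> (0 < #|vert G|)%N ->
  [/\ poincare (@nb _ _ (stepG s0 t G)) ((300 * 300) : R),
    satG G -> satG (stepG s0 t G) &
    forall n : nat, (0 < n)%N -> gapG G (n%:R^-1 : R) -> gapG (stepG s0 t G) ((C * n)%:R^-1 : R)]].
Proof.
have [t t0 tl] := nat_above (4 * c * #|Lb|%:R).
have [C C0 Cl] := nat_above (3 * et^-1).
exists t, C; split=> // G P V0; split.
- exact: step_poincare tl.
- by case=> a sa; exact: step_complete sa.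
move=> n n0 gap; have np : 0 < n%:R :> R by rewrite ltr0n.
have n1 : 1 <= n%:R :> R by rewrite ler1n.
have tp : 1 <= t%:R :> R by rewrite ler1n.
have h : 0 <= n%:R^-1 :> R by rewrite invr_ge0 ltW.
move=> a; apply: le_trans (step_gap t0 tl P V0 h gap a).
have e0 := et_gt0; have Cp : 0 < C%:R :> R by rewrite ltr0n.
have nt : 0 < 2 * n%:R + t%:R :> R by lra.
have -> : t%:R * (n%:R^-1 / 2) / (1 + t%:R * (n%:R^-1 / 2)) = t%:R / (2 * n%:R + t%:R) :> R.
  by field; rewrite !gt_eqF //; lra.
apply: le_trans (_ : et * (3 * n%:R)^-1 <= _).
  rewrite natrM !invfM mulrA ler_pM2r ?invr_gt0 //.
  have -> : et * 3^-1 = (3 * et^-1)^-1 by rewrite invfM invrK mulrC.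
  by rewrite lef_pV2 ?posrE ?divr_gt0.
rewrite ler_pM2l // ler_pdivlMr // mulrC ler_pdivrMr ?mulr_gt0 //.
have h1 : 0 <= t%:R * (n%:R - 1) :> R by apply: mulr_ge0; lra.
have h2 : 0 <= n%:R * (t%:R - 1) :> R by apply: mulr_ge0; lra.
by move: h1 h2; rewrite !mulrBr !mulr1 [n%:R * t%:R]mulrC mulrCA; lra.
Qed.

Lemma loop_step : exists t q : nat, [/\ (0 < q)%N &
  forall G : cgraph Sg Lb, poincare (@nb _ _ G) c -> (0 < #|vert G|)%N ->
  [/\ poincare (@nb _ _ (stepG s0 t G)) ((300 * 300) : R),
    satG G -> satG (stepG s0 t G) &
    forall dl : R, 0 <= dl -> gapG G dl -> gapG (stepG s0 t G) (Num.min (2 * dl) q%:R^-1)]].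
Proof.
have [ta ta0 tal] := nat_above (4 * c * #|Lb|%:R).
(* With [et * t >= 8] a small gap at least doubles, since [et * (y / 2) = et * t * dl / 4]. Once
   [y >= 1], the new gap is at least [et / 2], which [q] bounds from below. *)
have [tb tb0 tbl] := nat_above (8 * et^-1).
have [q q0 ql] := nat_above (2 * et^-1).
pose t := (ta + tb)%N; have tE : t%:R = ta%:R + tb%:R :> R by rewrite natrD.
have t0 : (0 < t)%N by rewrite addn_gt0 ta0.
have tl : 4 * c * #|Lb|%:R <= t%:R by rewrite tE; apply: le_trans tal _; rewrite lerDl.
have tl2 : 8 * et^-1 <= t%:R by rewrite tE; apply: le_trans tbl _; rewrite lerDr.
exists t, q; split=> // G P V0; split.
- exact: step_poincare tl.
- by case=> a sa; exact: step_complete sa.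
move=> dl dl0 gap a; apply: le_trans (step_gap t0 tl P V0 dl0 gap a).
have e0 := et_gt0; have qp : 0 < q%:R :> R by rewrite ltr0n.
have tp : 0 < t%:R :> R by rewrite ltr0n.
set y := t%:R * (dl / 2); have y0 : 0 <= y by rewrite mulr_ge0 ?divr_ge0 // ltW.
have y1 : 0 < 1 + y by lra.
have eV : et * et^-1 = 1 by rewrite divff // gt_eqF.
rewrite ge_min; apply/orP; have [le1|/ltW ge1] := lerP y 1; [left|right].
  apply: le_trans (_ : et * (y / 2) <= _); last first.
    by rewrite ler_pM2l // ler_wpM2l // lef_pV2 ?posrE //; lra.
  have h1 : 8 <= et * t%:R by have := ler_wpM2l (ltW e0) tl2; rewrite mulrCA eV mulr1.
  have -> : et * (y / 2) = (et * t%:R) * dl / 4 by rewrite /y; field.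
  by have := ler_wpM2r dl0 h1; lra.
apply: le_trans (_ : et * 2^-1 <= _).
  have -> : et * 2^-1 = (2 * et^-1)^-1 by rewrite invfM invrK mulrC.
  by rewrite lef_pV2 ?posrE ?divr_gt0.
by rewrite ler_pM2l // ler_pdivlMr //; lra.
Qed.

End First.

Lemma gap_unsat (Sg Lb : finType) (G : cgraph Sg Lb) : (0 < #|vert G|)%N -> (0 < #|Lb|)%N ->
  ~ satG G -> gapG G ((#|vert G| * #|Lb|)%:R^-1 : R).
Proof.
move=> V0 L0 ns a.
have /existsP[v /existsP[l vl]] : [exists v, exists l, ~~ sat_at a v l].
  apply: contra_notT ns; rewrite negb_exists => /forallP h; exists a => v l.
  by have := h v; rewrite negb_exists => /forallP/(_ l); rewrite negbK.
have Vp : 0 < #|vert G|%:R :> R by rewrite ltr0n.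
have Lp : 0 < #|Lb|%:R :> R by rewrite ltr0n.
rewrite /unsat {1}/avg natrM invfM mulrC ler_pM2r ?invr_gt0 //.
rewrite (bigD1 v) //= -[X in X <= _]addr0; apply: lerD; last first.
  by apply: sumr_ge0 => w _; apply: avg_ge0 => ?; rewrite ler0n.
rewrite /avg -[X in X <= _]mul1r ler_pM2r ?invr_gt0 // (bigD1 l) //= vl lerDl.
by apply: sumr_ge0 => ? _; rewrite ler0n.
Qed.

(** [t1] and [q] precede the alphabet, so the final gap does not depend on the language; [t0] and
    [C] may. *)
Theorem amplification : exists t1 q : nat, (0 < q)%N /\
  forall (Sg Lb : finType) (s0 : Sg), (0 < #|Lb|)%N -> exists t0 C : nat,
  forall (G : cgraph Sg Lb) (m : nat), poincare (@nb _ _ G) (96 : R) -> (0 < #|vert G|)%N ->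
  (C * (#|vert G| * #|Lb|) <= 2 ^ m)%N ->
  let H := iter m (stepG s1 t1) (stepG s0 t0 G) in
  [/\ satG G -> satG H, ~ satG G -> gapG H (q%:R^-1 : R), loopless H & (0 < #|vert H|)%N].
Proof.
have c1 : 1 <= 300 * 300 :> R by lra.
have [t1 [q [q0 loop]]] := loop_step s1 Lb1_gt0 c1.
exists t1, q; split=> // Sg Lb s0 L0.
have c96 : 1 <= 96 :> R by lra.
have [t0 [C [C0 first]]] := first_step s0 L0 c96.
exists t0, C => G m P V0 le_m H.
have [P1 sat1 gap1] := first G P V0.
pose G1 := stepG s0 t0 G; pose Gi i := iter i (stepG s1 t1) G1.
have inv i : poincare (@nb _ _ (Gi i)) ((300 * 300) : R) /\ (0 < #|vert (Gi i)|)%N.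
  elim: i => [|i [Pi Vi]]; first by split=> //; exact: vert_step_gt0.
  by have [P' _ _] := loop _ Pi Vi; split; [exact: P' | exact: vert_step_gt0].
split.
- move=> /sat1 sg; rewrite /H -/G1; elim: m {le_m H} => //= i IHi.
  by have [Pi Vi] := inv i; have [_ h _] := loop _ Pi Vi; exact: h.
- move=> ns; have n0 : (0 < #|vert G| * #|Lb|)%N by rewrite muln_gt0 V0.
  have := gap1 _ n0 (gap_unsat V0 L0 ns); set e := (C * _)%:R^-1 => ge.
  have e0 : 0 <= e by rewrite invr_ge0.
  have gi i : gapG (Gi i) (Num.min (2 ^+ i * e) q%:R^-1).
    elim: i => [|i IHi]; first by move=> a; rewrite expr0 mul1r; apply: le_trans (ge a); rewrite ge_min lexx.
    have [Pi Vi] := inv i; have [_ _ h] := loop _ Pi Vi.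
    have q1 : 0 <= q%:R^-1 :> R by rewrite invr_ge0.
    have m0 : 0 <= Num.min (2 ^+ i * e) q%:R^-1 by rewrite le_min q1 mulr_ge0 // exprn_ge0.
    move=> a; apply: le_trans (h _ m0 IHi a); rewrite le_min; apply/andP; split; last by rewrite ge_min lexx orbT.
    rewrite exprS -mulrA ge_min; case: (lerP (2 ^+ i * e) q%:R^-1) => [le|lt]; rewrite ?lexx //.
    by apply/orP; right; lra.
  move=> a; apply: le_trans (gi m a); rewrite le_min lexx andbT.
  have Ce : 0 < (C * (#|vert G| * #|Lb|))%:R :> R by rewrite ltr0n muln_gt0 C0.
  apply: le_trans (_ : 1 <= _); first by rewrite invf_le1 ?ltr0n // ler1n.
  by rewrite /e ler_pdivlMr // mul1r -natrX ler_nat.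
- by rewrite /H; case: m {le_m H} => [|i]; exact: step_loopless.
by have [_] := inv m.
Qed.

End Arch.

End GapAmplification.
Import GapAmplification.

Module ConflictGraphs.

Import Order.TTheory GRing.Theory Num.Theory.
Local Open Scope ring_scope.

(** * The conflict graph of a constraint graph *)

Section Conflict.

Variables (Sg Lb : finType) (G : cgraph Sg Lb) (ix : vert G -> nat).
Hypothesis ixI : injective ix.
Hypothesis ix_lt : forall v, (ix v < #|vert G|)%N.
Hypothesis G_loopless : loopless G.

(** The vertices of the conflict graph are pairs of a variable and a value, as in the graph of
    Feige, Goldwasser, Lovasz, Safra and Szegedy. [None] yields the conflicts between two values of
    one variable, [Some l] those between the ends of an edge. *)
Definition ctype : finType := (Sg * (option Lb * Sg))%type.
Definition codev (v : vert G) (a : Sg) : nat := (ix v * #|Sg| + enum_rank a)%N.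
Definition nbo (v : vert G) (ol : option Lb) : vert G := if ol is Some l then nb v l else v.
Definition confl (v : vert G) (x : ctype) : bool :=
  if x.2.1 is Some l then ~~ dat v l (x.1, x.2.2) else x.1 != x.2.2.
Definition edge (v : vert G) (x : ctype) : nat * nat := (codev v x.1, codev (nbo v x.2.1) x.2.2).

Lemma codev_lt v a : (codev v a < #|vert G| * #|Sg|)%N.
Proof.
apply: leq_trans (_ : (ix v).+1 * #|Sg| <= _)%N; last by rewrite leq_mul2r ix_lt orbT.
by rewrite mulSn /codev addnC ltn_add2r ltn_ord.
Qed.

Lemma codev_inj v a w b : codev v a = codev w b -> v = w /\ a = b.
Proof.
rewrite /codev => e; have S0 : (0 < #|Sg|)%N by apply/card_gt0P; exists a.
have := congr1 (fun n => n %/ #|Sg|)%N e; rewrite !divnMDl // !divn_small // !addn0 => /ixI ->.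
by have := congr1 (fun n => n %% #|Sg|)%N e; rewrite !modnMDl !modn_small // => /val_inj/enum_rank_inj ->.
Qed.

Lemma edge_neq v x : confl v x -> (edge v x).1 <> (edge v x).2.
Proof.
case: x => a [[l|] b]; rewrite /confl /edge /= => c /codev_inj[ev eb]; rewrite eb in c.
  by rewrite (G_loopless b (esym ev)) in c.
by rewrite eqxx in c.
Qed.

Lemma sum_codev (F : nat -> nat) :
  (\sum_(x < #|vert G| * #|Sg|) F x = \sum_v \sum_a F (codev v a))%N.
Proof.
pose h (p : vert G * Sg) : 'I_(#|vert G| * #|Sg|) := Ordinal (codev_lt p.1 p.2).
have hI : injective h by move=> [v a] [w b] /(congr1 val) /= /codev_inj[-> ->].
have [g gK hK] : bijective h by apply: inj_card_bij; rewrite ?card_ord ?card_prod.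
rewrite pair_bigA (reindex h) //=; exact: onW_bij (Bijective gK hK).
Qed.

Section Cover.

Variable cv : nat -> bool.
Hypothesis cvP : forall v x, confl v x -> cv (edge v x).1 || cv (edge v x).2.

Definition dead (v : vert G) : bool := [forall a, cv (codev v a)].

(** The values of one variable are pairwise in conflict, so at most one of them is left
    uncovered. *)
Lemma sum_cv_vertex v : (\sum_a cv (codev v a) + 1 = #|Sg| + dead v)%N.
Proof.
have [/forallP dv|] := boolP (dead v).
  by rewrite (eq_bigr (fun=> 1%N)) ?sum1_card // => a _; rewrite dv.
rewrite negb_forall => /existsP[a na]; rewrite addn0.
rewrite (bigD1 a) //= (negPf na) add0n (eq_bigr (fun=> 1%N)) ?sum1_card; last first.
  move=> b nb; have := @cvP v (b, (None, a)) nb; rewrite /edge /= (negPf na) orbF.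
  by move->.
by rewrite cardC1 addn1 prednK //; apply/card_gt0P; exists a.
Qed.

(** Uncovered values define an assignment, and each constraint it violates has a dead end. A gap of
    [1 / q] thus forces at least [#|vert G| / (2 * q)] dead vertices, each of which costs one more
    cover vertex. *)
Lemma cover_gap (R : realFieldType) (s0 : Sg) (q : nat) : (0 < #|vert G|)%N -> (0 < #|Lb|)%N -> (0 < q)%N ->
  gapG G (q%:R^-1 : R) ->
  (#|vert G| + 2 * q * (#|vert G| * #|Sg|) <=
     2 * q * (\sum_(x < #|vert G| * #|Sg|) cv x + #|vert G|))%N.
Proof.
move=> V0 L0 q0 gap.
have -> : (\sum_(x < #|vert G| * #|Sg|) cv x + #|vert G| = #|vert G| * #|Sg| + \sum_v dead v)%N.
  rewrite (sum_codev (fun x => cv x)) -[X in (_ + X = _)%N]sum1_card -big_split /=.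
  rewrite (eq_bigr (fun v => #|Sg| + dead v)%N); last by move=> v _; exact: sum_cv_vertex.
  by rewrite big_split sum_nat_const.
rewrite mulnDr addnC leq_add2l.
pose a v := odflt s0 [pick b | ~~ cv (codev v b)].
have aP v : ~~ dead v -> ~~ cv (codev v (a v)).
  rewrite negb_forall => /existsP[b nb]; rewrite /a; case: pickP => [//|/(_ b)].
  by rewrite nb.
have vio v l : (~~ sat_at a v l <= dead v + dead (nb v l))%N.
  have [dv|ndv] := boolP (dead v); first by case: sat_at.
  have [dw|ndw] := boolP (dead (nb v l)); first by case: sat_at.
  have [//|ns] := boolP (sat_at a v l).
  by have := @cvP v (a v, (Some l, a (nb v l))) ns; rewrite /edge /= (negPf (aP _ ndv)) (negPf (aP _ ndw)).
have := gap a; rewrite /unsat.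
have -> : avg (fun v => avg (fun l => (~~ sat_at a v l)%:R)) =
   (\sum_v \sum_l (~~ sat_at a v l))%N%:R / #|Lb|%:R / #|vert G|%:R :> R.
  rewrite {1}/avg; congr (_ / _); rewrite natr_sum mulr_suml; apply: eq_bigr => v _.
  by rewrite /avg natr_sum.
have le2 : (\sum_v \sum_l (~~ sat_at a v l) <= 2 * #|Lb| * \sum_v dead v)%N.
  apply: leq_trans (_ : \sum_v \sum_l (dead v + dead (nb v l)) <= _)%N.
    by apply: leq_sum => v _; apply: leq_sum => l _; exact: vio.
  have e2 : (\sum_v \sum_l dead (nb v l) = #|Lb| * \sum_v dead v)%N.
    rewrite exchange_big (eq_bigr (fun=> \sum_v dead v)%N) ?sum_nat_const // => l _.
    have nI : involutive (fun v : vert G => nb v l) by move=> v; exact: nbK.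
    by rewrite [RHS](reindex_inj (inv_inj nI)).
  have e1 : (\sum_v \sum_(l : Lb) dead v = #|Lb| * \sum_v dead v)%N.
    by rewrite big_distrr /=; apply: eq_bigr => v _; rewrite sum_nat_const.
  rewrite (eq_bigr (fun v => \sum_(l : Lb) dead v + \sum_(l : Lb) dead (nb v l))%N); last first.
    by move=> v _; rewrite big_split.
  by rewrite big_split /= e2 e1 -mulnA mulSn mul1n.
rewrite ler_pdivlMr ?ltr0n // ler_pdivlMr ?ltr0n // => le1.
have {le1}le1 : #|vert G|%:R * #|Lb|%:R <= q%:R * (\sum_v \sum_l (~~ sat_at a v l))%N%:R :> R.
  have qp : 0 < q%:R :> R by rewrite ltr0n.
  by have := ler_wpM2l (ltW qp) le1; rewrite !mulrA divff ?gt_eqF // mul1r.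
move: le1; rewrite -!natrM ler_nat => le1.
rewrite -(leq_pmul2r L0); apply: leq_trans le1 _.
apply: leq_trans (leq_mul (leqnn q) le2) _; lia.
Qed.

End Cover.

Lemma sat_cover : satG G -> exists cv : nat -> bool,
  [/\ forall v x, confl v x -> cv (edge v x).1 || cv (edge v x).2,
     (\sum_(x < #|vert G| * #|Sg|) cv x + #|vert G| = #|vert G| * #|Sg|)%N &
     forall x, (x < #|vert G| * #|Sg|)%N -> cv x -> exists v y, confl v y /\ (edge v y).1 = x].
Proof.
case=> f sf; pose cv x := [exists v, exists a, (a != f v) && (codev v a == x)].
have cvE v a : cv (codev v a) = (a != f v).
  apply/existsP/idP => [[w /existsP[b /andP[nb /eqP/codev_inj[<- <-]]]] //|ne].
  by exists v; apply/existsP; exists a; rewrite ne eqxx.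
exists cv; split.
- move=> v [a [[l|] b]] /=; rewrite /confl /edge /= !cvE.
    by have [->|] //= := eqVneq a (f v); have [->|] //= := eqVneq b (f (nb v l)); rewrite -/(sat_at f v l) sf.
  by have [->|] //= := eqVneq a (f v); rewrite eq_sym.
- rewrite (sum_codev (fun x => cv x)) -[X in (_ + X = _)%N]sum1_card -big_split /=.
  rewrite (eq_bigr (fun=> #|Sg|)) ?sum_nat_const // => v _.
  rewrite (bigD1 (f v)) //= cvE eqxx add0n (eq_bigr (fun=> 1%N)); last by move=> a ne; rewrite cvE ne.
  by rewrite sum1_card cardC1 addn1 prednK //; apply/card_gt0P; exists (f v).
move=> x _ /existsP[v /existsP[a /andP[ne /eqP<-]]].
by exists v, (a, (None, f v)).
Qed.

End Conflict.

End ConflictGraphs.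
Import ConflictGraphs.

Module Tableaux.

(** * Computation tableaux *)

Section Tableau.

Variable M : turing_machine.

Definition cell : finType := (symbol (tm_aux M) * option (tm_state M))%type.
Definition blank : cell := (None, None).

Definition act (y : cell) := if y.2 is Some q then tm_trans q y.1 else None.

Definition arrive (x z : cell) : option (tm_state M) :=
  match act x with
  | Some (q, _, MoveRight) => Some q
  | _ => if act z is Some (q, _, MoveLeft) then Some q else None
  end.

Definition rule (x y z : cell) : cell :=
  match act y with
  | Some (q, a, Stay) => (a, Some q)
  | Some (_, a, _) => (a, arrive x z)
  | None => (y.1, if y.2 is Some q then Some q else arrive x z)
  end.

(** The cell at absolute position [j] when the head is at [h]; the head position is tracked
    separately by [newh]. *)
Definition rowc (c : config M) (h j : nat) : cell :=
  let: (q, (l, a, r)) := c in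
  if j == h then (a, Some q) else
  if j < h then (nth None l (h - j.+1), None) else (nth None r (j - h.+1), None).

Arguments rowc : simpl never.

Definition newh (c : config M) (h : nat) : nat :=
  let: (q, (l, a, r)) := c in
  if tm_trans q a is Some (_, _, d) then
    match d with MoveLeft => h.-1 | Stay => h | MoveRight => h.+1 end
  else h.

Lemma row_at q l a r h : rowc (q, (l, a, r)) h h = (a, Some q).
Proof. by rewrite /rowc eqxx. Qed.

Lemma row_lt q l a r h j : j < h -> rowc (q, (l, a, r)) h j = (nth None l (h - j.+1), None).
Proof. by move=> lt; rewrite /rowc lt ltn_eqF. Qed.

Lemma row_gt q l a r h j : h < j -> rowc (q, (l, a, r)) h j = (nth None r (j - h.+1), None).
Proof. by move=> lt; rewrite /rowc gtn_eqF // ltnNge ltnW. Qed.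

Lemma row_step c h j : 0 < h ->
  rowc (step c) (newh c h) j =
  rule (if j is j'.+1 then rowc c h j' else blank) (rowc c h j) (rowc c h j.+1).
Proof.
case: c => q [[l a] r] h0; set x := (X in rule X _ _).
have xnon : j <= h -> act x = None.
  rewrite /x; case: (j) => // j' lt; by rewrite row_lt.
have xat : j = h.+1 -> x = (a, Some q) by rewrite /x => ->; rewrite row_at.
have xgt : h.+1 < j -> act x = None by rewrite /x; case: (j) => // j' lt; rewrite row_gt.
have arr0 (z : cell) : act x = None -> act z = None -> arrive x z = None by rewrite /arrive => -> ->.
have non (s : symbol (tm_aux M)) : act (s, None) = None by [].
rewrite /step /newh; case E: (tm_trans q a) => [[[q' a'] d]|]; last first.
  have acth : act (a, Some q) = None by rewrite /act /= E.
  case: (ltngtP j h) => [lt|gt|eq].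
  - rewrite (row_lt _ _ _ _ lt) /rule non /= arr0 ?xnon //; first by rewrite ltnW.
    have [e|lt2] : j.+1 = h \/ j.+1 < h by lia.
      by rewrite e row_at.
    by rewrite row_lt.
  - rewrite (row_gt _ _ _ _ gt) /rule non /= arr0 //; last by rewrite row_gt //; lia.
    have [e|lt2] : j = h.+1 \/ h.+1 < j by lia.
      by rewrite xat.
    exact: xgt.
  by rewrite eq row_at /rule acth.
have acth : act (a, Some q) = Some (q', a', d) by rewrite /act /= E.
case: (ltngtP j h) => [lt|gt|eq].
- rewrite [rowc _ h j](row_lt _ _ _ _ lt) /rule non /= /arrive xnon; last exact: ltnW.
  have [e|lt2] : j.+1 = h \/ j.+1 < h by lia.
    rewrite e row_at acth -e subnn; case: d {acth E} => /=.
    + by rewrite row_at -nth0.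
    + by rewrite row_lt // subnn.
    + by rewrite row_lt ?subSnn //; lia.
  rewrite [rowc _ h j.+1]row_lt // non; case: d {acth E} => /=.
  + rewrite row_lt; last by lia.
    by rewrite nth_behead; congr (nth _ _ _, _); lia.
  + by rewrite row_lt.
  + by rewrite row_lt; [have -> : h.+1 - j.+1 = (h - j.+1).+1 by lia|lia].
- rewrite [rowc _ h j](row_gt _ _ _ _ gt) /rule non /= /arrive.
  have az : act (rowc (q, (l, a, r)) h j.+1) = None by rewrite row_gt //; lia.
  have [e|gt2] : j = h.+1 \/ h.+1 < j by lia.
    rewrite xat // acth az e subnn; case: d {acth E} => /=.
    + by rewrite row_gt; [have -> : h.+1 - h.-1.+1 = 1 by lia|lia].
    + by rewrite row_gt // subnn.
    + by rewrite row_at -nth0.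
  rewrite xgt // az; case: d {acth E} => /=.
  + by rewrite row_gt; [have -> : j - h.-1.+1 = (j - h.+1).+1 by lia|lia].
  + by rewrite row_gt.
  + by rewrite row_gt // nth_behead; congr (nth _ _ _, _); lia.
rewrite eq row_at /rule acth; have xn : act x = None by apply: xnon; rewrite eq.
have az : act (rowc (q, (l, a, r)) h h.+1) = None by rewrite row_gt.
case: d {acth E} => /=; rewrite ?arr0 //.
- by rewrite row_gt; [have -> : h - h.-1.+1 = 0 by lia|lia].
- by rewrite row_at.
- by rewrite row_lt // subnn.
Qed.

Section Run.

Variables (w : word) (B : nat).

Definition cs (i : nat) : config M := iter i (@step M) (initial M w).
Fixpoint hs (i : nat) : nat := if i is i'.+1 then newh (cs i') (hs i') else B.
(** Ample room for [B] steps of a head that starts at [B]. With [B = 2 ^ b] the whole tableau has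
    [2 ^ (2 * b + 4)] cells, the size of a cube of even dimension. *)
Definition W : nat := 16 * B.

Lemma cs_inv i : i <= B -> let: (_, (l, _, r)) := cs i in
  B + size l <= hs i + i /\ hs i + size r <= B + size w + i.
Proof.
elim: i => [|i IHi] lt_i.
  rewrite /cs /= size_behead size_map; lia.
have := IHi (ltnW lt_i); rewrite /cs iterS -/(cs i) /=.
case: (cs i) => q [[l a] r]; rewrite /step /newh.
case: (tm_trans q a) => [[[q' a'] []]|] /=; rewrite ?size_behead; lia.
Qed.

Hypothesis w_le : size w <= B.
Hypothesis B_gt0 : 0 < B.

Lemma row0 i : i < B -> rowc (cs i) (hs i) 0 = blank.
Proof.
move=> lt; have := cs_inv (ltnW lt); case: (cs i) => q [[l a] r] [h1 _].
have f1 sl : B + sl <= hs i + i -> sl <= hs i - 1 by lia.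
have f2 sl : B + sl <= hs i + i -> 0 < hs i by lia.
have e : nth None l (hs i - 1) = None by apply: nth_default; exact: f1 h1.
by rewrite row_lt ?e //; exact: f2 h1.
Qed.

Lemma rowW i j : i < B -> W.-1 <= j -> rowc (cs i) (hs i) j = blank.
Proof.
move=> lt; have := cs_inv (ltnW lt); case: (cs i) => q [[l a] r] [h1 h2]; rewrite /W => le.
have f1 sr sw : sw <= B -> hs i + sr <= B + sw + i -> sr <= j - (hs i).+1 by lia.
have f2 sr sw : sw <= B -> hs i + sr <= B + sw + i -> hs i < j by lia.
have e : nth None r (j - (hs i).+1) = None by apply: nth_default; exact: f1 w_le h2.
by rewrite row_gt ?e //; exact: f2 w_le h2.
Qed.

Definition tau (n : nat) : cell := rowc (cs (n %/ W)) (hs (n %/ W)) (n %% W).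

Lemma tauE i j : j < W -> tau (i * W + j) = rowc (cs i) (hs i) j.
Proof. by move=> lt; rewrite /tau divnMDl ?(leq_trans _ lt) // divn_small // addn0 modnMDl modn_small. Qed.

(** The rows are laid end to end. At the end of a row, the next cell in this order belongs to
    another row, but the blank margins make it the blank that the rule expects there. *)
Lemma tau_rule n : n + W < B * W ->
  tau (n + W) = rule (if n is n'.+1 then tau n' else blank) (tau n) (tau n.+1).
Proof.
have W0 : 0 < W by rewrite /W; lia.
have lj : n %% W < W by rewrite ltn_mod.
rewrite (divn_eq n W); move: (n %/ W) (n %% W) lj => i j lj.
have -> : i * W + j + W = i.+1 * W + j by rewrite mulSn; lia.
move=> lt; have li : i.+1 < B.
  by rewrite -(ltn_pmul2r W0); apply: leq_ltn_trans lt; rewrite leq_addr.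
have hp : 0 < hs i.
  by have := cs_inv (ltnW (ltnW li)); case: (cs i) => q [[l a] r] [h1 _]; lia.
rewrite tauE // [cs _]iterS -/(cs i) [hs _]/= (row_step _ _ hp) -tauE //; congr rule.
  clear lt; case: j lj => [|j] lj.
    rewrite addn0; case: i li {hp} => [|i] li //.
    rewrite mulSn; have -> : W + i * W = (i * W + W.-1).+1 by lia.
    by rewrite tauE ?rowW //; lia.
  by rewrite addnS tauE // ltnW.
have [e|ne] : j.+1 = W \/ j.+1 < W by lia.
  by rewrite -addnS e addnC -mulSn -[i.+1 * W]addn0 tauE // row0 // rowW //; lia.
by rewrite -addnS tauE.
Qed.

Lemma tau_unique (s : nat -> cell) : 1 < W ->
  (forall n, n < W -> s n = tau n) ->
  (forall n, n + W < B * W -> s (n + W) = rule (if n is n'.+1 then s n' else blank) (s n) (s n.+1)) ->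
  forall n, n < B * W -> s n = tau n.
Proof.
move=> W1 s0 sr; elim/ltn_ind => n IHn lt_n.
have [lt|ge] := ltnP n W; first exact: s0.
rewrite -(subnK ge) in lt_n *; set m := n - W in lt_n *.
rewrite sr // tau_rule //; have lm : m < n by rewrite /m; lia.
congr rule; last by apply: IHn; rewrite /m in lt_n *; lia.
  by case: (m) lm lt_n => // m' lm lt'; apply: IHn; lia.
by apply: IHn; lia.
Qed.

Definition isbit (a : symbol (tm_aux M)) : bool := if a is Some (inl _) then true else false.

(** The output is the single bit [true] when the scanned cell holds it and the next cell holds no
    bit, a condition on two adjacent cells. *)
Definition accept (y z : cell) : bool :=
  (y.2 != None) ==> (y.1 == Some (inl true)) && ~~ isbit z.1.

Lemma accept_row : (output (cs B.-1) == [:: true]) =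
  [forall j : 'I_W, accept (tau (B.-1 * W + j)) (tau (B.-1 * W + j).+1)].
Proof.
have lB : B.-1 < B by lia.
have := cs_inv (ltnW lB); case Ec: (cs B.-1) => [q [[l a] r]] [h1 h2].
have hW : (hs B.-1).+1 < W by rewrite /W; lia.
have out : (output (cs B.-1) == [:: true]) = (a == Some (inl true)) && ~~ isbit (nth None r 0).
  have lb (r0 : seq (symbol (tm_aux M))) : (leading_bits r0 == [::]) = ~~ isbit (nth None r0 0).
    by case: r0 => [|[[c|c]|] r0].
  by rewrite Ec /output /=; case: a {Ec} => [[c|c]|] //=; rewrite eqseq_cons lb; case: c.
rewrite -Ec out; apply/idP/forallP => [h j|/(_ (Ordinal (ltnW hW)))]; last first.
  by rewrite /= -addnS !tauE ?(ltnW hW) // Ec row_at row_gt // subnn.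
rewrite tauE // Ec; have [e|ne] := eqVneq (nat_of_ord j) (hs B.-1).
  by rewrite e row_at -addnS tauE // Ec row_gt // subnn /accept /= h.
by rewrite /accept /rowc (negPf ne); case: ifP.
Qed.

Lemma tau_first n : n < W -> tau n =
  if n < B then blank else (nth None [seq Some (inl b) | b <- w] (n - B), if n == B then Some (tm_start M) else None).
Proof.
move=> lt; rewrite -[n]add0n -(mul0n W) tauE // mul0n add0n /cs /= /initial.
case: (ltngtP n B) => [l|g|->].
- by rewrite row_lt // nth_default.
- by rewrite row_gt // nth_behead; congr (nth _ _ _, _); lia.
by rewrite row_at subnn nth0.
Qed.

End Run.

End Tableau.

End Tableaux.
Import Tableaux.

Module TableauGraphs.

Import Order.TTheory GRing.Theory Num.Theory.


(** * The constraint graph of a computation *)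

Fixpoint words (n : nat) : seq (seq bool) :=
  if n is n'.+1 then [seq true :: w | w <- words n'] ++ [seq false :: w | w <- words n'] else [:: [::]].

Lemma mem_words n w : (w \in words n) = (size w == n).
Proof.
elim: n w => [|n IHn] [|b w] //=; rewrite mem_cat.
  by apply/negbTE; rewrite negb_or; apply/andP; split; apply/mapP => -[].
have h c : (b :: w \in [seq c :: w | w <- words n]) = (b == c) && (w \in words n).
  apply/mapP/andP => [[u uw [-> ->]] //|[/eqP-> ww]]; by exists w.
by rewrite !h IHn eqSS; case: (b); rewrite /= ?orbF.
Qed.

Lemma uniq_words n : uniq (words n).
Proof.
elim: n => //= n IHn; rewrite cat_uniq !map_inj_uniq ?IHn //=; try by move=> u v [].
by rewrite andbT; apply/hasPn => w /mapP[u _ ->]; apply/mapP => -[].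
Qed.

Lemma size_words n : size (words n) = 2 ^ n.
Proof. by elim: n => //= n IHn; rewrite size_cat !size_map IHn expnS; lia. Qed.

Arguments words : simpl never.

Section Cube.

Variable k : nat.
Notation cube := {ffun bool * 'I_k.+1 -> bool}.

Definition wordof (v : cube) : seq bool :=
  [seq v (true, i) | i <- enum 'I_k.+1] ++ [seq v (false, i) | i <- enum 'I_k.+1].
Definition cubeof (w : seq bool) : cube :=
  [ffun p : bool * 'I_k.+1 => nth false w (if p.1 then p.2 : nat else k.+1 + p.2)].
Definition dim2 : nat := k.+1 + k.+1.

Lemma size_wordof v : size (wordof v) = dim2.
Proof. by rewrite /wordof size_cat 2!size_map size_enum_ord. Qed.

Lemma wordofK : cancel wordof cubeof.
Proof.
move=> v; apply/ffunP => -[b i]; rewrite ffunE /wordof nth_cat size_map size_enum_ord /=.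
case: b; first by rewrite ltn_ord (nth_map ord0) ?size_enum_ord // nth_ord_enum.
by rewrite ltnNge leq_addr /= addKn (nth_map ord0) ?size_enum_ord // nth_ord_enum.
Qed.

Lemma cubeofK w : size w = dim2 -> wordof (cubeof w) = w.
Proof.
move=> sw; apply: (@eq_from_nth _ false); rewrite size_wordof ?sw // => i lt_i.
rewrite /wordof nth_cat size_map size_enum_ord; case: ltnP => [lt|ge].
  by rewrite (nth_map ord0) ?size_enum_ord // ffunE /= nth_enum_ord.
have l2 : i - k.+1 < k.+1 by rewrite /dim2 in lt_i; lia.
by rewrite (nth_map ord0) ?size_enum_ord // ffunE /= nth_enum_ord // subnKC.
Qed.

Definition ixv (v : cube) : nat := index (wordof v) (words dim2).
Definition vof (n : nat) : cube := cubeof (nth [::] (words dim2) n).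
Definition card_cube : nat := 2 ^ dim2.

Lemma ixv_lt v : ixv v < card_cube.
Proof. by rewrite /card_cube -size_words index_mem mem_words size_wordof. Qed.

Lemma vofK n : n < card_cube -> ixv (vof n) = n.
Proof.
rewrite /card_cube -size_words => lt; rewrite /ixv /vof cubeofK ?index_uniq ?uniq_words //.
by apply/eqP; rewrite -mem_words mem_nth.
Qed.

Lemma ixvK v : vof (ixv v) = v.
Proof. by rewrite /vof /ixv nth_index ?wordofK // mem_words size_wordof. Qed.

Lemma card_cubeE : #|{: cube}| = card_cube.
Proof. by rewrite card_ffun card_bool card_prod card_bool card_ord /card_cube /dim2; congr (2 ^ _); lia. Qed.

End Cube.

(** The edges between [n] and [n + s] are split by the parity of [n %/ s] into two matchings, so
    that each label is an involution. The value is 1 at the lower end, 2 at the upper end and 0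
    without a partner. *)
Definition dirn (N s : nat) (bt : bool) (n : nat) : nat :=
  if odd (n %/ s) == bt then (if n + s < N then 1 else 0) else (if s <= n then 2 else 0).

Definition swap (N s : nat) (bt : bool) (n : nat) : nat :=
  match dirn N s bt n with 1 => n + s | 2 => n - s | _ => n end.

Lemma swap_lt N s bt n : n < N -> swap N s bt n < N.
Proof. by move=> lt; rewrite /swap /dirn; case: eqP => _; case: ifP => //; lia. Qed.

Lemma swapK N s bt n : 0 < s -> n < N -> swap N s bt (swap N s bt n) = n.
Proof.
move=> s0 lt; rewrite /swap.
have h1 : dirn N s bt n = 1 -> dirn N s bt (n + s) = 2.
  rewrite /dirn; case: eqP => [e|_]; last by case: ifP.
  by case: ifP => // _ _; rewrite divnDr ?dvdnn // divnn s0 addn1 /= e; case: (bt); rewrite /= leq_addl.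
have h2 : dirn N s bt n = 2 -> dirn N s bt (n - s) = 1.
  rewrite /dirn; case: eqP => [_|e]; first by case: ifP.
  case: ifP => // le _; have : odd ((n - s + s) %/ s) <> bt by rewrite subnK.
  rewrite divnDr ?dvdnn // divnn s0 addn1 /= => e2.
  have -> : odd ((n - s) %/ s) == bt by move: e2; case: odd; case: (bt).
  by rewrite subnK // lt.
case d: (dirn N s bt n) => [|[|[|d']]] /=; rewrite ?d ?(h1 d) ?(h2 d) /=; try lia; try by [].
move: d; rewrite /dirn; case: eqP => _; case: ifP => // le _; by rewrite subnK.
Qed.

Section Graph.

Variables (M : turing_machine) (e : word) (P b : nat).

Definition B : nat := 2 ^ b.
Definition k : nat := b.+1.
Definition N : nat := card_cube k.
Definition V : finType := {ffun bool * 'I_k.+1 -> bool}.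
(** A letter guesses a cell together with its left and right neighbours, which turns the ternary
    rule of the tableau into a binary constraint. *)
Definition Sg0 : finType := (cell M * (cell M * cell M))%type.
Definition Lb0 : finType := (elabel + (bool * bool) + unit)%type.

Lemma B_gt0 : 0 < B. Proof. by rewrite /B expn_gt0. Qed.

Lemma N_BW : N = B * W B.
Proof. rewrite /N /card_cube /dim2 /k /W /B; have -> : b.+2 + b.+2 = b + (4 + b) by lia. by rewrite !expnD. Qed.

Definition stride (sw : bool) : nat := if sw then W B else 1.

Definition nb0 (v : V) (l : Lb0) : V :=
  match l with
  | inl (inl l) => enb v l
  | inl (inr sb) => vof k (swap N (stride sb.1) sb.2 (ixv v))
  | inr _ => v
  end.

Lemma stride_gt0 sw : 0 < stride sw.
Proof. by case: sw => //=; rewrite /W; have := B_gt0; lia. Qed.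

Lemma nb0K v l : nb0 (nb0 v l) l = v.
Proof.
case: l => [[l|[sw bt]]|//] /=; first exact: enbK.
by rewrite vofK ?swap_lt ?ixv_lt // swapK ?stride_gt0 ?ixv_lt // ixvK.
Qed.

(** The first row consists of [B] blanks, the word [e], room for a witness of length at most [P],
    and blanks. Kinds 4 and 5 are the first input cell with the start state; kind 6 is a witness
    cell, a bit or a blank with only a blank to its right. *)
Definition kind (n : nat) : nat :=
  if W B <= n then 0 else if n < B then 1 else
  if n < B + size e then
    (if nth false e (n - B) then 1 else 0) + (if n == B then 4 else 2)
  else if n < B + size e + P then 6 else 1.

Definition kindok (kd : nat) (s : Sg0) : bool :=
  match kd with
  | 0 => true
  | 1 => s.2.1 == blank M
  | 2 => s.2.1 == (Some (inl false), None)
  | 3 => s.2.1 == (Some (inl true), None)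
  | 4 => s.2.1 == (Some (inl false), Some (tm_start M))
  | 5 => s.2.1 == (Some (inl true), Some (tm_start M))
  | _ => [&& s.2.1.2 == None, (s.2.1.1 == None) || isbit s.2.1.1 &
          (s.2.1.1 == None) ==> (s.2.2.1 == None)]
  end.

Definition rel (sw : bool) (x y : Sg0) : bool :=
  if sw then y.2.1 == rule x.1 x.2.1 x.2.2 else (x.2.2 == y.2.1) && (y.1 == x.2.1).

(** The constraints at a cell depend on its number only through these parameters of bounded range,
    so a program can find them by case distinction. *)
Definition datP (kd : nat) (z f : bool) (d : bool -> bool -> nat) : cdat Sg0 Lb0 :=
  [ffun l => [ffun ab =>
    match l with
    | inl (inl _) => true
    | inl (inr sb) => match d sb.1 sb.2 with
        1 => rel sb.1 ab.1 ab.2 | 2 => rel sb.1 ab.2 ab.1 | _ => true end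
    | inr _ => [&& kindok kd ab.1, z ==> (ab.1.1 == blank M) & f ==> accept ab.1.2.1 ab.1.2.2]
    end]].

Definition datn (n : nat) : cdat Sg0 Lb0 :=
  datP (kind n) (n == 0) (B.-1 * W B <= n) (fun sw bt => dirn N (stride sw) bt n).

Definition G0 : cgraph Sg0 Lb0 := @CGraph Sg0 Lb0 V nb0 nb0K (fun v => datn (ixv v)).

Hypothesis room : size e + P <= B.
Hypothesis e_gt0 : 0 < size e.

Lemma guess_split (s : seq (symbol (tm_aux M))) :
  all (fun a => (a == None) || isbit a) s ->
  (forall i, i.+1 < size s -> nth None s i = None -> nth None s i.+1 = None) ->
  exists2 y : word, size y <= size s & forall i, nth None s i = nth None [seq Some (inl c) | c <- y] i.
Proof.
elim: s => [|a s IHs] /=; first by exists [::].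
case/andP=> a_ok s_ok chain.
have [y sy yE] := IHs s_ok (fun i lt => chain i.+1 lt).
case: a a_ok chain => [[c|c] //|] _ chain.
  by exists (c :: y) => // -[|i] /=.
have s0 i : nth None s i = None.
  elim: i => [|i IHi]; first by case: (s) chain => // a s' chain; exact: (chain 0).
  have [lt|ge] := ltnP i.+1 (size s); last by rewrite nth_default.
  exact: (chain i.+1).
by exists [::] => // -[|i] //=; rewrite s0 nth_nil.
Qed.

Lemma guess_room n : n < B + size e + P -> n.+1 < W B.
Proof. by rewrite /W; have := room; have := B_gt0; lia. Qed.

Lemma sat_tableau : satG G0 <->
  exists2 y : word, size y <= P & output (cs M (e ++ y) B.-1) = [:: true].
Proof.
have B0 := B_gt0; have W1 : 1 < W B by rewrite /W; lia.
have NBW := N_BW.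
have lastW : B.-1 * W B + W B = N by rewrite NBW -mulSnr prednK.
split=> [[a sa]|[y sy acc]].
  pose t n := a (vof k n); pose s n := (t n).2.1.
  have sat n l : n < N -> datn n l (t n, a (nb0 (vof k n) l)).
    by move=> lt; have := sa (vof k n) l; rewrite /sat_at /= vofK.
  have sg sw n : n + stride sw < N -> rel sw (t n) (t (n + stride sw)).
    move=> lt; have ln : n < N by lia.
    (* This is the parity for which [n] is the lower end of its pair. *)
    have := sat n (inl (inr (sw, odd (n %/ stride sw)))) ln.
    rewrite /nb0 vofK // /datn /datP !ffunE /= /swap.
    by rewrite /dirn eqxx lt.
  have un n : n < N -> [&& kindok (kind n) (t n), (n == 0) ==> ((t n).1 == blank M) &
     (B.-1 * W B <= n) ==> accept (t n).2.1 (t n).2.2].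
    by move=> lt; have := sat n (inr tt) lt; rewrite /datn /datP !ffunE.
  have right n : n.+1 < N -> (t n).2.2 = s n.+1 /\ (t n.+1).1 = s n.
    by move=> lt; have := sg false n; rewrite /= addn1 => /(_ lt)/andP[/eqP-> /eqP->].
  have left n : n < N -> (t n).1 = if n is n'.+1 then s n' else blank M.
    case: n => [|n] lt; first by have /and3P[_ /eqP] := un _ lt.
    by have [] := right n lt.
  have kd n : n < N -> kindok (kind n) (t n) by move=> /un/and3P[].
  have WN : W B <= N by rewrite NBW leq_pmull.
  pose gs := [seq (s (B + size e + i)).1 | i <- iota 0 P].
  have gsE i : i < P -> nth None gs i = (s (B + size e + i)).1.
    by move=> lt; rewrite (nth_map 0) ?size_iota // nth_iota.
  have gk i : i < P -> kindok 6 (t (B + size e + i)).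
    move=> lt; have h := @guess_room (B + size e + i) (ltac:(lia)).
    have := kd (B + size e + i) (leq_trans (ltnW h) WN); rewrite /kind leqNgt (ltnW h) /=.
    have -> : (B + size e + i < B) = false by lia.
    have -> : (B + size e + i < B + size e) = false by lia.
    by rewrite ltn_add2l lt.
  have [y sy yE] : exists2 y : word, size y <= size gs & forall i, nth None gs i = nth None [seq Some (inl c) | c <- y] i.
    apply: guess_split.
      apply/(all_nthP None) => i; rewrite size_map size_iota => lt; rewrite gsE //.
      by have /and3P[] := gk i lt.
    move=> i; rewrite size_map size_iota => lt; rewrite !gsE ?(ltnW lt) // => e0.
    have /and3P[_ _ /implyP h] := gk i (ltnW lt).
    have h2 := @guess_room (B + size e + i) (ltac:(lia)).
    have [r1 _] := right (B + size e + i) (leq_trans h2 WN).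
    by rewrite addnS -r1; apply/eqP/h; rewrite -/(s _) e0.
  rewrite size_map size_iota in sy; exists y => //.
  have sw : size (e ++ y) <= B by rewrite size_cat; have := room; lia.
  have st n : n < B * W B -> s n = tau M (e ++ y) B n.
    apply: tau_unique => // {}n.
      move=> lt; rewrite tau_first //; have := kd n (leq_trans lt WN); rewrite /kind leqNgt lt /=.
      case: ltnP => [_ /eqP h|leB]; first exact: h.
      case: ltnP => [lte|lee].
        rewrite map_cat nth_cat size_map ltn_subLR // lte (nth_map false) ?ltn_subLR // /s.
        by case: (nth false e (n - B)); case: (n == B) => /= /eqP->.
      have ne : (n == B) = false by lia.
      have d : n = B + size e + (n - B - size e) by lia.
      have le1 : (n - B < size e) = false by lia.
      rewrite ne map_cat nth_cat size_map le1 -yE; case: ltnP => [ltP|leP] /=.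
        case/and3P=> /eqP h1 _ _; rewrite gsE; last by lia.
        by rewrite -d; move: h1; rewrite -/(s n); case: (s n) => ? ? /= ->.
      by rewrite /s => /eqP->; rewrite nth_default // size_map size_iota; lia.
    rewrite -NBW => lt; have l1 : n.+1 < N by lia.
    have /eqP := sg true n lt; rewrite -/(s _) left; last by lia.
    by have [-> _] := right n l1.
  apply/eqP; rewrite accept_row //; apply/forallP => j.
  have lj := ltn_ord j; pose n := B.-1 * W B + j; rewrite -/n.
  have ln : n < N by rewrite /n; lia.
  have [e1|l1] : n.+1 = N \/ n.+1 < N by lia.
    have -> : tau M (e ++ y) B n = blank M; last by [].
    by rewrite /n tauE ?rowW //; lia.
  have /and3P[_ _ /implyP] := un n ln; rewrite leq_addr => /(_ isT).
  have [-> _] := right n l1.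
  by rewrite -/(s n) !st // -NBW.
have sw : size (e ++ y) <= B by rewrite size_cat; have := room; lia.
pose T := tau M (e ++ y) B.
pose tr n : Sg0 := (if n is n'.+1 then T n' else blank M, (T n, T n.+1)).
exists (fun v => tr (ixv v)) => v l; rewrite /sat_at /= /datn /datP !ffunE.
have ln : ixv v < N by exact: ixv_lt.
case: l => [[l|[sb bt]]|[]] //=.
  rewrite vofK ?swap_lt // /swap; set n := ixv v in ln *.
  have relT m : m + stride sb < N -> rel sb (tr m) (tr (m + stride sb)).
    rewrite /rel; case: sb => /= lt; last by rewrite addn1 /= !eqxx.
    by rewrite NBW in lt; apply/eqP; apply: tau_rule.
  case d: (dirn N (stride sb) bt n) => [|[|[|d']]] //.
    by move: d; rewrite /dirn; case: eqP => _; case: ifP => // lt _; exact: relT.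
  move: d; rewrite /dirn; case: eqP => _; case: ifP => // le _.
  by have := relT (n - stride sb); rewrite subnK // => /(_ ln).
set n := ixv v in ln *; apply/and3P; split; last 2 first.
- by case: (n).
- apply/implyP => le; have /eqP := acc; rewrite accept_row // => /forallP h.
  have lj : n - B.-1 * W B < W B by lia.
  by have := h (Ordinal lj); rewrite /= subnKC.
rewrite /kind; have [//|lt] := leqP (W B) n; have tF n0 : n0 < W B -> T n0 = if n0 < B then blank M else
    (nth None [seq Some (inl b0) | b0 <- e ++ y] (n0 - B), if n0 == B then Some (tm_start M) else None).
  by move=> h; apply: tau_first.
have tE := tF n lt.
case: ltnP => leB; first by rewrite /= tE leB.
rewrite ltnNge leB /= in tE.
case: ltnP => lte.
  move: tE; rewrite map_cat nth_cat size_map ltn_subLR // lte (nth_map false) ?ltn_subLR // => tE.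
  by case: (nth false e (n - B)) tE; case: (n == B) => /= tE; rewrite tE.
have ne : (n == B) = false by lia.
rewrite ne map_cat nth_cat size_map [n - B < _]ltnNge in tE.
have le2 : size e <= n - B by lia.
rewrite le2 /= in tE.
case: ltnP => leP /=; last first.
  by rewrite tE nth_default // size_map; lia.
have l1 := guess_room leP; have tE1 := tF _ l1.
have f1 : (n.+1 < B) = false by lia.
have f2 : (n.+1 == B) = false by lia.
rewrite f1 f2 map_cat nth_cat size_map [n.+1 - B < _]ltnNge in tE1.
have le3 : size e <= n.+1 - B by lia.
rewrite le3 /= in tE1; rewrite tE tE1 /=.
have -> : n.+1 - B - size e = (n - B - size e).+1 by lia.
have [lt2|ge2] := ltnP (n - B - size e) (size y).
  by rewrite (nth_map false).
by rewrite !nth_default ?size_map //; lia.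
Qed.

(** The tableau edges and the loops only add energy to that of the cube. *)
Lemma G0_poincare (R : realFieldType) : poincare (@nb _ _ G0) (96 : R)%R.
Proof.
move=> f f0; apply: le_trans (cube_poincare0 f0) _.
rewrite ler_pM2l // big_sumType big_sumType /= -addrA lerDl addr_ge0 //.
  by apply: sumr_ge0 => l _; apply: sumr_ge0 => v _; exact: sqr_ge0.
by apply: sumr_ge0 => l _; apply: sumr_ge0 => v _; exact: sqr_ge0.
Qed.

End Graph.

End TableauGraphs.
Import TableauGraphs.

(** * Computing the table of a tableau graph *)

Module TableauTables.

Section Tools.

Context {X : Type} {eX : Enc X}.

Lemma pt_caseN {Y : Type} {eY : Enc Y} n (f : nat -> X -> Y) (g : X -> nat) :
  (forall i, pt (f i)) -> pt g -> (forall x, g x < n) -> pt (fun x => f (g x) x).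
Proof.
move=> ptf ptg g_lt.
have h m : pt (fun x => if g x < m then f (g x) x else f 0 x).
  elim: m => [|m IHm]; first by apply: pt_ext (ptf 0) _.
  apply: pt_ext (pt_if (pt_eqn ptg (pt_cst m)) (ptf m) IHm) _ => x.
  have [->|ne] := eqVneq (g x) m; first by rewrite ltnSn.
  by rewrite [g x < m.+1]ltnS [g x <= m]leq_eqVlt (negPf ne).
by apply: pt_ext (h n) _ => x; rewrite g_lt.
Qed.

Lemma pt_caseb {Y : Type} {eY : Enc Y} (f : bool -> X -> Y) (g : X -> bool) :
  (forall i, pt (f i)) -> pt g -> pt (fun x => f (g x) x).
Proof.
by move=> ptf ptg; apply: pt_ext (pt_if ptg (ptf true) (ptf false)) _ => x; case: (g x).
Qed.

Lemma pt_eqw (u v : X -> seq bool) : pt u -> pt v -> pt (fun x => u x == v x).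
Proof.
move=> ptu ptv.
have pth : pt (fun x => has (fun i => nth false (u x) i != nth false (v x) i) (iota 0 (size (u x)))).
  apply: (pt_has (f := fun x i => nth false (u x) i != nth false (v x) i)); last by apply: pt_iota; exact: pt_size.
  have p1 : pt (fun p : X * nat => p.1) by exact: pt_fst pt_id.
  have p2 : pt (fun p : X * nat => p.2) by exact: pt_snd pt_id.
  apply: pt_neg; apply: pt_eqb; apply: pt_nth => //; exact: (pt_comp _ p1).
apply: pt_ext (pt_and (pt_eqn (pt_size ptu) (pt_size ptv)) (pt_neg pth)) _ => x.
apply/andP/eqP => [[/eqP es /hasPn h]|->]; last first.
  by split=> //; apply/hasPn => i _; rewrite eqxx.
apply: (@eq_from_nth _ false) => // i lt.
by have := h i; rewrite mem_iota lt => /(_ isT); rewrite negbK => /eqP.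
Qed.

End Tools.

Section Tools2.

Context {X : Type} {eX : Enc X}.

Lemma pt_index (w : X -> seq bool) (l : X -> seq (seq bool)) :
  pt w -> pt l -> pt (fun x => index (w x) (l x)).
Proof.
move=> ptw ptl; have [e le_e] := pt_esize ptl.
pose st x (p : bool * nat) (a : seq bool) := if p.1 then p else if a == w x then (true, p.2) else (false, p.2.+1).
have stT x c s : foldl (st x) (true, c) s = (true, c) by elim: s.
have stE x c s : (foldl (st x) (false, c) s).2 = c + index (w x) s.
  elim: s c => [|a s IHs] c /=; first by rewrite addn0.
  rewrite /st /=; case: eqP => _; first by rewrite stT addn0.
  by rewrite IHs addnS.
have ptf : pt (fun x => foldl (st x) (false, 0) (l x)).
  apply: (pt_foldl (N := fun m => 2 * (m + 2) ^ e + 5) (step := st) [::]) => //.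
  - have p1 : pt (fun p : X * ((bool * nat) * seq bool) => p.1) by exact: pt_fst pt_id.
    have p21 : pt (fun p : X * ((bool * nat) * seq bool) => p.2.1) by exact: pt_fst (pt_snd pt_id).
    have p22 : pt (fun p : X * ((bool * nat) * seq bool) => p.2.2) by exact: pt_snd (pt_snd pt_id).
    apply: pt_if; [exact: pt_fst p21 | by [] |].
    apply: pt_if; first by apply: pt_eqw p22 (pt_comp ptw p1).
      by apply: pt_pair; [exact: pt_cst | exact: pt_snd p21].
    by apply: pt_pair; [exact: pt_cst | apply: pt_S; exact: pt_snd p21].
  - exact: pt_cst.
  - by pb.
  move=> x i; case E: (foldl _ _ _) => [fb c]; rewrite esize_pair esize_nat.
  have := stE x 0 (take i (l x)); rewrite E /= => ->; rewrite add0n.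
  have h1 := index_size (w x) (take i (l x)); pose proof (size_esize (l x)) as h2.
  have h3 := le_e x; pose proof (esize_bool fb) as h4.
  have h5 : size (take i (l x)) <= size (l x) by rewrite size_take_min geq_minr.
  have h6 : size (l x) < (esize x + 2) ^ e by exact: leq_trans h2 h3.
  have fin (I S0 S1 E0 F : nat) : I <= S0 -> S0 <= S1 -> S1 < E0 -> F <= 3 -> (F + (2 * I + 1)).+1 <= 2 * E0 + 5 by lia.
  exact: fin h1 h5 h6 h4.
by apply: pt_ext (pt_snd ptf) _ => x; rewrite stE.
Qed.

Lemma pt_odddiv (n s : X -> nat) : (forall x, 0 < s x) -> pt n -> pt s -> pt (fun x => odd (n x %/ s x)).
Proof.
move=> s0 ptn pts; have [e le_e] := pt_esize pts.
pose st x (p : nat * bool) := if p.1.+1 == s x then (0, ~~ p.2) else (p.1.+1, p.2).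
have stE x i : iter i (st x) (0, false) = (i %% s x, odd (i %/ s x)).
  elim: i => [|i IHi]; first by rewrite mod0n div0n.
  rewrite iterS IHi /st /=; have sx := s0 x; have lt := ltn_pmod i sx.
  have d := divn_eq i (s x); case: eqP => [es|ne].
    have e1 : i.+1 = (i %/ s x).+1 * s x by rewrite mulSn -[X in _ = X + _]es {1}d; lia.
    by rewrite e1 modnMl mulnK.
  have e1 : i.+1 = i %/ s x * s x + (i %% s x).+1 by rewrite addnS -d.
  have l2 : (i %% s x).+1 < s x by rewrite ltn_neqAle lt andbT; apply/eqP.
  by rewrite e1 modnMDl divnMDl // (modn_small l2) (divn_small l2) addn0.
have pti : pt (fun x => iter (n x) (st x) (0, false)).
  apply: (pt_iter (N := fun m => (m + 2) ^ e + 10) (step := st)) => //.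
  - have p1 : pt (fun p : X * (nat * bool) => p.2.1.+1) by apply: pt_S; exact: pt_fst (pt_snd pt_id).
    have p2 : pt (fun p : X * (nat * bool) => p.2.2) by exact: pt_snd (pt_snd pt_id).
    apply: pt_if.
    + by apply: pt_eqn => //; apply: (pt_comp pts); exact: pt_fst pt_id.
    + by apply: pt_pair; [exact: pt_cst | exact: pt_neg].
    + exact: pt_pair.
  - exact: pt_cst.
  - by pb.
  move=> x i _; rewrite stE esize_pair esize_nat; pose proof (esize_bool (odd (i %/ s x))) as h1.
  have := le_e x; rewrite esize_nat => h2; have h3 := ltn_pmod i (s0 x).
  have fin (a b c d : nat) : a < b -> 2 * b + 1 <= c -> d <= 3 -> (2 * a + 1 + d).+1 <= c + 10 by lia.
  exact: fin h3 h2 h1.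
by apply: pt_ext (pt_snd pti) _ => x; rewrite stE.
Qed.

End Tools2.

Definition bitw (k : nat) (l : elabel) (w : seq bool) (j : nat) : bool :=
  let hj := j < k.+1 in let i := if hj then j else j - k.+1 in
  let at_ h i := nth false w (if h then i else k.+1 + i) in
  nth false w j (+) ((hj == l.1) &&
    (if l.2 is Some c then
      ((c != 1 :> nat) && at_ (~~ l.1) i) (+) ((c != 0 :> nat) && (if i == k then false else at_ (~~ l.1) i.+1))
     else i == k)).

Definition enbw (k : nat) (l : elabel) (w : seq bool) : seq bool :=
  [seq bitw k l w j | j <- iota 0 (dim2 k)].

Lemma nth_wordof k (v : {ffun bool * 'I_k.+1 -> bool}) h (i : 'I_k.+1) :
  nth false (wordof v) (if h then i : nat else k.+1 + i) = v (h, i).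
Proof. by have := congr1 (fun f : {ffun bool * 'I_k.+1 -> bool} => f (h, i)) (wordofK v); rewrite /= ffunE. Qed.

Lemma enbw_spec k (v : {ffun bool * 'I_k.+1 -> bool}) l : wordof (enb v l) = enbw k l (wordof v).
Proof.
rewrite -[RHS](@cubeofK k); last by rewrite size_map size_iota.
congr wordof; apply/ffunP => -[h i]; rewrite ffunE /enbw.
set j := (if _ then _ else _).
have lj : j < dim2 k by rewrite /j /dim2 /=; have := ltn_ord i; case: (h); lia.
rewrite (nth_map 0) ?size_iota // nth_iota // add0n /bitw.
have hj : (j < k.+1) = h by rewrite /j /=; case: (h); [exact: ltn_ord | rewrite ltnNge leq_addr].
have ji : (if j < k.+1 then j else j - k.+1) = i by rewrite hj /j /=; case: (h); rewrite // addKn.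
rewrite ji hj {1}/j /= nth_wordof; case: l => h' [c|]; rewrite /enb /= !ffunE /=; last first.
  congr (_ (+) _); rewrite /flip xpair_eqE; congr (_ && _).
congr (_ (+) (_ && _)); rewrite /coef nth_wordof; congr ((_ && _) (+) (_ && _)).
rewrite /divX; case: eqP => // ne.
have lt : i.+1 < k.+1 by have := ltn_ord i; lia.
by rewrite -(nth_wordof v) inordK.
Qed.

Section Table.

Variable M : turing_machine.

Definition nbidx (b n : nat) (l : Lb0) : nat :=
  match l with
  | inl (inl l) => index (enbw (k b) l (nth [::] (words (dim2 (k b))) n)) (words (dim2 (k b)))
  | inl (inr sb) => swap (N b) (stride b sb.1) sb.2 n
  | inr _ => n
  end.

Definition table0 (e : word) (P b : nat) : table (cdat (Sg0 M) Lb0) :=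
  [seq (datn M e P b n, [seq nbidx b n l | l <- enum Lb0]) | n <- iota 0 (N b)].

Lemma rep_table0 e P b : rep (dflt (Sg0 M) Lb0) (@nb _ _ (G0 M e P b)) (@dat _ _ (G0 M e P b)) (table0 e P b).
Proof.
exists (@ixv (k b)); split.
- exact: can_inj (@ixvK _).
- by move=> v; rewrite size_map size_iota ixv_lt.
- by rewrite size_map size_iota /= card_cubeE.
move=> v; rewrite (nth_map 0) ?size_iota ?ixv_lt // nth_iota ?ixv_lt // add0n.
congr (_, _); apply: eq_map => -[[l|[sw bt]]|[]] //=.
  by rewrite -/(vof (k b) _) /ixv enbw_spec nth_index // mem_words size_wordof.
by rewrite vofK // swap_lt // ixv_lt.
Qed.

Context {X : Type} {eX : Enc X}.
Variables (ee : X -> seq bool) (PP bb : X -> nat).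
Hypothesis (pte : pt ee) (ptP : pt PP) (ptb : pt bb) (ptB : pt (fun x => B (bb x))).

Lemma ptW : pt (fun x => W (B (bb x))).
Proof. by apply: pt_mul ptB; exact: pt_cst. Qed.

Lemma ptN : pt (fun x => N (bb x)).
Proof. by apply: pt_ext (pt_mul ptB ptW) _ => x; rewrite N_BW. Qed.

Lemma ptwords : pt (fun x => words (dim2 (k (bb x)))).
Proof.
have ptd : pt (fun x => dim2 (k (bb x))) by apply: pt_add; do 2!apply: pt_S.
have [e le_e] := pt_esize ptN; have [e' le_e'] := pt_esize ptd.
pose st (s : seq (seq bool)) := [seq true :: w | w <- s] ++ [seq false :: w | w <- s].
have stE i : iter i st [:: [::]] = words i by elim: i => //= i ->.
have pti : pt (fun x => iter (dim2 (k (bb x))) st [:: [::]]).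
  apply: (pt_iter (N := fun m => (m + 2) ^ e * (4 * (m + 2) ^ e' + 2) + 1) (step := fun _ => st)) => //.
  - have p2 : pt (fun p : X * seq (seq bool) => p.2) by exact: pt_snd pt_id.
    by apply: pt_cat; (apply: (pt_map (f := fun _ w => _ :: w)) p2; apply: pt_cons; [exact: pt_cst | exact: pt_snd pt_id]).
  - exact: pt_cst.
  - by pb.
  move=> x i le_i; rewrite stE.
  have szw j : j < size (words i) -> forall w0, esize (nth w0 (words i) j) <= 4 * i + 1.
    move=> lt w0; have /eqP sw : size (nth w0 (words i) j) == i by rewrite -mem_words mem_nth.
    by rewrite -{2}sw; exact: esize_word.
  apply: leq_trans (esize_seq_le szw) _; rewrite leq_add2r size_words.
  have h1 : 2 ^ i <= (esize x + 2) ^ e.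
    apply: leq_trans (_ : N (bb x) <= _); first by rewrite leq_exp2l.
    by have := le_e x; rewrite esize_nat; lia.
  have h2 : i <= (esize x + 2) ^ e' by have := le_e' x; rewrite esize_nat; lia.
  apply: leq_mul => //; lia.
by apply: pt_ext pti _ => x; rewrite stE.
Qed.

Section Entry.

Notation XN := (X * nat)%type.

Let p1 : pt (fun p : XN => p.1) := pt_fst pt_id.
Let p2 : pt (fun p : XN => p.2) := pt_snd pt_id.
Let qB : pt (fun p : XN => B (bb p.1)) := pt_comp ptB p1.
Let qW : pt (fun p : XN => W (B (bb p.1))) := pt_comp ptW p1.
Let qN : pt (fun p : XN => N (bb p.1)) := pt_comp ptN p1.
Let qe : pt (fun p : XN => ee p.1) := pt_comp pte p1.
Let qP : pt (fun p : XN => PP p.1) := pt_comp ptP p1.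

Lemma pt_stride sw : pt (fun p : XN => stride (bb p.1) sw).
Proof. by case: sw => //; exact: pt_cst. Qed.

Lemma pt_dirn sw bt : pt (fun p : XN => dirn (N (bb p.1)) (stride (bb p.1) sw) bt p.2).
Proof.
have ps := pt_stride sw.
apply: pt_if; first apply: pt_eqb (pt_cst _).
- by apply: pt_odddiv => // p; exact: stride_gt0.
- by apply: pt_if; [apply: pt_leq => //; apply: pt_S; exact: pt_add | exact: pt_cst | exact: pt_cst].
- by apply: pt_if; [apply: pt_leq | exact: pt_cst | exact: pt_cst].
Qed.

Lemma pt_kind : pt (fun p : XN => kind (ee p.1) (PP p.1) (bb p.1) p.2).
Proof.
have qBe : pt (fun p : XN => B (bb p.1) + size (ee p.1)) by apply: pt_add => //; exact: pt_size.
apply: pt_if; [exact: pt_leq | exact: pt_cst |].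
apply: pt_if; [by apply: pt_leq => //; exact: pt_S | exact: pt_cst |].
apply: pt_if; first by apply: pt_leq => //; exact: pt_S.
  apply: pt_add; apply: pt_if; try exact: pt_cst; last exact: pt_eqn.
  by apply: pt_nth => //; exact: pt_sub.
by apply: pt_if; [apply: pt_leq; [exact: pt_S | exact: pt_add] | exact: pt_cst | exact: pt_cst].
Qed.

Lemma kind_lt e P b n : kind e P b n < 7.
Proof. by rewrite /kind; do ?case: ifP. Qed.

Lemma dirn_lt N0 s bt n : dirn N0 s bt n < 3.
Proof. by rewrite /dirn; do ?case: ifP. Qed.

Lemma datP_ext kd z f d d' : (forall a b, d a b = d' a b) -> datP M kd z f d = datP M kd z f d'.
Proof. by move=> e; congr datP; apply: funext => a; apply: funext => b. Qed.

(** Case distinctions on the kind, the two flags and the four directions reduce the entry to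
    constants. *)
Lemma pt_datn : pt (fun p : XN => datn M (ee p.1) (PP p.1) (bb p.1) p.2).
Proof.
pose dd a0 a1 a2 a3 (x y : bool) : nat := if x then (if y then a0 else a1) else (if y then a2 else a3).
have h : pt (fun p : XN => datP M (kind (ee p.1) (PP p.1) (bb p.1) p.2) (p.2 == 0) ((B (bb p.1)).-1 * W (B (bb p.1)) <= p.2)
   (dd (dirn (N (bb p.1)) (stride (bb p.1) true) true p.2) (dirn (N (bb p.1)) (stride (bb p.1) true) false p.2)
       (dirn (N (bb p.1)) (stride (bb p.1) false) true p.2) (dirn (N (bb p.1)) (stride (bb p.1) false) false p.2))).
  apply: (pt_caseN (n := 7) (f := fun kd (p : XN) => datP M kd (p.2 == 0) ((B (bb p.1)).-1 * W (B (bb p.1)) <= p.2)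
     (dd (dirn (N (bb p.1)) (stride (bb p.1) true) true p.2) (dirn (N (bb p.1)) (stride (bb p.1) true) false p.2)
       (dirn (N (bb p.1)) (stride (bb p.1) false) true p.2) (dirn (N (bb p.1)) (stride (bb p.1) false) false p.2)))) pt_kind _; last by move=> p; exact: kind_lt.
  move=> kd.
  apply: (pt_caseb (f := fun z (p : XN) => datP M kd z ((B (bb p.1)).-1 * W (B (bb p.1)) <= p.2) (dd _ _ _ _)) _ (pt_eq0 p2)) => z.
  have pf : pt (fun p : XN => (B (bb p.1)).-1 * W (B (bb p.1)) <= p.2).
    by apply: pt_leq => //; apply: pt_mul => //; exact: pt_P.
  apply: (pt_caseb (f := fun f (p : XN) => datP M kd z f (dd _ _ _ _)) _ pf) => f.
  apply: (pt_caseN (n := 3) (f := fun a0 (p : XN) => datP M kd z f (dd a0 _ _ _)) _ (pt_dirn true true)); last by move=> p; exact: dirn_lt.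
  move=> a0.
  apply: (pt_caseN (n := 3) (f := fun a1 (p : XN) => datP M kd z f (dd a0 a1 _ _)) _ (pt_dirn true false)); last by move=> p; exact: dirn_lt.
  move=> a1.
  apply: (pt_caseN (n := 3) (f := fun a2 (p : XN) => datP M kd z f (dd a0 a1 a2 _)) _ (pt_dirn false true)); last by move=> p; exact: dirn_lt.
  move=> a2.
  apply: (pt_caseN (n := 3) (f := fun a3 (p : XN) => datP M kd z f (dd a0 a1 a2 a3)) _ (pt_dirn false false)); last by move=> p; exact: dirn_lt.
  by move=> a3; exact: pt_cst.
by apply: pt_ext h _ => p; apply: datP_ext => -[] [].
Qed.

Lemma pt_swap sw bt : pt (fun p : XN => swap (N (bb p.1)) (stride (bb p.1) sw) bt p.2).
Proof.
have ps := pt_stride sw.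
apply: pt_ext (pt_caseN (n := 3) (f := fun d (p : XN) => match d with 1 => p.2 + stride (bb p.1) sw | 2 => p.2 - stride (bb p.1) sw | _ => p.2 end) _ (pt_dirn sw bt) _) _ => //.
  by case=> [|[|[|i]]] //; [exact: pt_add | exact: pt_sub].
by move=> p; exact: dirn_lt.
Qed.

Lemma pt_enbw l (w : XN -> seq bool) : pt w -> pt (fun p : XN => enbw (k (bb p.1)) l (w p)).
Proof.
move=> ptw; have qk : pt (fun p : XN => k (bb p.1)) by apply: pt_S; exact: (pt_comp ptb p1).
apply: (pt_map (f := fun p j => bitw (k (bb p.1)) l (w p) j)); last first.
  by apply: pt_iota; apply: pt_add; exact: pt_S.
have r1 : pt (fun q : XN * nat => q.1) by exact: pt_fst pt_id.
have r2 : pt (fun q : XN * nat => q.2) by exact: pt_snd pt_id.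
have rk : pt (fun q : XN * nat => k (bb q.1.1)) := pt_comp qk r1.
have rw : pt (fun q : XN * nat => w q.1) := pt_comp ptw r1.
have rk1 := pt_S rk.
have rh : pt (fun q : XN * nat => q.2 < (k (bb q.1.1)).+1) by apply: pt_leq => //; exact: pt_S.
have ri : pt (fun q : XN * nat => if q.2 < (k (bb q.1.1)).+1 then q.2 else q.2 - (k (bb q.1.1)).+1).
  by apply: pt_if => //; exact: pt_sub.
have rat h (i : XN * nat -> nat) : pt i -> pt (fun q : XN * nat => nth false (w q.1) (if h then i q else (k (bb q.1.1)).+1 + i q)).
  by move=> pti; apply: pt_nth => //; case: h => //; exact: pt_add.
apply: pt_xor; first exact: pt_nth.
apply: pt_and; first by apply: pt_eqb => //; exact: pt_cst.
case: (l.2) => [c|]; last exact: pt_eqn.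
apply: pt_xor; apply: pt_and; try exact: pt_cst; first exact: rat.
apply: pt_if; [exact: pt_eqn | exact: pt_cst | apply: rat; exact: pt_S].
Qed.

Lemma pt_nbidx l : pt (fun p : XN => nbidx (bb p.1) p.2 l).
Proof.
have qw := pt_comp ptwords p1.
case: l => [[l|[sw bt]]|[]] //; last exact: pt_swap.
by apply: pt_index => //; apply: pt_enbw; exact: pt_nth.
Qed.

End Entry.

Lemma pt_table0 : pt (fun x => table0 (ee x) (PP x) (bb x)).
Proof.
apply: (pt_map (f := fun x n => (datn M (ee x) (PP x) (bb x) n, [seq nbidx (bb x) n l | l <- enum Lb0]))); last first.
  exact: pt_iota ptN.
apply: pt_pair; first exact: pt_datn.
by apply: (pt_cmap (f := fun l (p : X * nat) => nbidx (bb p.1) p.2 l)) => l; exact: pt_nbidx.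
Qed.

End Table.

End TableauTables.
Import TableauTables.

Module GraphInstances.

Import Order.TTheory GRing.Theory Num.Theory.

(** * From constraint tables to instances *)

Section Edges.

Variables (Sg Lb : finType).
Notation D := (cdat Sg Lb).
Notation e0 := (dflt Sg Lb, [::] : seq nat).

Definition confT (T : table D) (i : nat) (x : ctype Sg Lb) : bool :=
  if x.2.1 is Some l then ~~ (nth e0 T i).1 l (x.1, x.2.2) else x.1 != x.2.2.

Definition edgeT (T : table D) (i : nat) (x : ctype Sg Lb) : nat * nat :=
  (i * #|Sg| + enum_rank x.1,
   (if x.2.1 is Some l then nth 0 (nth e0 T i).2 (enum_rank l) else i) * #|Sg| + enum_rank x.2.2).

Definition EL (T : table D) : seq (nat * nat) :=
  flatten [seq flatten [seq (if confT T i x then [:: edgeT T i x] else [::]) | x <- enum (ctype Sg Lb)]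
          | i <- iota 0 (size T)].

Lemma pt_EL {X : Type} {eX : Enc X} (f : X -> table D) : pt f -> pt (fun x => EL (f x)).
Proof.
move=> ptf; apply: pt_flatten.
apply: (pt_map (f := fun x i => flatten [seq (if confT (f x) i y then [:: edgeT (f x) i y] else [::]) | y <- enum (ctype Sg Lb)])); last first.
  by apply: pt_iota; exact: pt_size.
apply: pt_flatten.
have p1 : pt (fun p : X * nat => f p.1) by apply: (pt_comp ptf); exact: pt_fst pt_id.
have p2 : pt (fun p : X * nat => p.2) by exact: pt_snd pt_id.
have pn : pt (fun p : X * nat => nth e0 (f p.1) p.2) by exact: pt_nth.
apply: (pt_cmap (f := fun y (p : X * nat) => if confT (f p.1) p.2 y then [:: edgeT (f p.1) p.2 y] else [::])) => -[a [ol b]].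
apply: pt_if; last exact: pt_cst.
  rewrite /confT /=; case: ol => [l|]; last exact: pt_cst.
  apply: pt_neg; apply: (pt_case (f := fun (dd : D) (p : X * nat) => dd l (a, b)) (dflt Sg Lb)) (pt_fst pn).
  by move=> dd; exact: pt_cst.
apply: pt_cons; last exact: pt_cst.
apply: pt_pair; (apply: pt_add; last exact: pt_cst); (apply: pt_mul; last exact: pt_cst) => //=.
by case: ol => [l|] //; apply: pt_nth; [exact: pt_snd | exact: pt_cst].
Qed.

Lemma size_EL (T : table D) : size (EL T) <= size T * #|ctype Sg Lb|.
Proof.
rewrite /EL; have h i : size (flatten [seq (if confT T i x then [:: edgeT T i x] else [::]) | x <- enum (ctype Sg Lb)]) <= #|ctype Sg Lb|.
  rewrite cardE; elim: (enum _) => //= x s IHs; rewrite size_cat; case: ifP => _ /=; lia.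
rewrite -{2}(size_iota 0 (size T)); elim: (iota _ _) => //= i s IHs.
by rewrite size_cat mulSn leq_add.
Qed.

Variables (G : cgraph Sg Lb) (T : table D) (ix : vert G -> nat).
Hypothesis ixI : injective ix.
Hypothesis ix_lt : forall v, ix v < size T.
Hypothesis szT : size T = #|vert G|.
Hypothesis nthT : forall v, nth e0 T (ix v) = (dat v, [seq ix (nb v l) | l <- enum Lb]).

Lemma ix_onto i : i < size T -> exists v, ix v = i.
Proof.
move=> lt; pose h v : 'I_(size T) := Ordinal (ix_lt v).
have hI : injective h by move=> v w /(congr1 val) /= /ixI.
have [g gK hK] : bijective h by apply: inj_card_bij; rewrite ?card_ord ?szT.
by exists (g (Ordinal lt)); have := congr1 val (hK (Ordinal lt)).
Qed.

Lemma confTE v x : confT T (ix v) x = confl v x.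
Proof. by rewrite /confT /confl nthT. Qed.

Lemma edgeTE v x : edgeT T (ix v) x = edge ix v x.
Proof.
rewrite /edgeT /edge /codev nthT; case: x => a [[l|] b] //=.
by rewrite (nth_map l) -?cardE // nth_enum_rank.
Qed.

Lemma mem_EL y : reflect (exists v x, confl v x /\ y = edge ix v x) (y \in EL T).
Proof.
apply: (iffP flatten_mapP) => [[i]|[v [x [cx ->]]]].
  rewrite mem_iota add0n => /andP[_ lt]; have [v <-] := ix_onto lt.
  case/flatten_mapP=> x _; rewrite confTE edgeTE; case: ifP => // cx.
  by rewrite inE => /eqP->; exists v, x.
exists (ix v); first by rewrite mem_iota ix_lt.
apply/flatten_mapP; exists x; first by rewrite mem_enum.
by rewrite confTE cx edgeTE inE eqxx.
Qed.

End Edges.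

Section Instance.

Variables (Sg Lb : finType) (s0 : Sg).

Definition icen (T : table (cdat Sg Lb)) : nat := size T * #|Sg|.
Definition im (T : table (cdat Sg Lb)) : nat := size (EL T).
Definition ip (T : table (cdat Sg Lb)) (j : nat) : nat := (nth (0, 0) (EL T) j).1.
Definition iq (T : table (cdat Sg Lb)) (j : nat) : nat := (nth (0, 0) (EL T) j).2.
Definition idim (T : table (cdat Sg Lb)) : nat := icen T + 2 * im T.
(** The size of a cover that leaves one value of each variable, plus one cluster for each subdivided
    edge. *)
Definition ik (T : table (cdat Sg Lb)) : nat := size T * #|Sg|.-1 + im T.
Definition ips (T : table (cdat Sg Lb)) : seq (nat * nat) := pairs (icen T) (im T) (ip T) (iq T).

Variables (G : cgraph Sg Lb) (T : table (cdat Sg Lb)).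
Hypothesis repT : rep (dflt Sg Lb) (@nb _ _ G) (@dat _ _ G) T.
Hypothesis lG : loopless G.
Hypothesis V0 : 0 < #|vert G|.
Hypothesis L0 : 0 < #|Lb|.

Lemma size_rep : size T = #|vert G|. Proof. by case: repT => ix []. Qed.

Lemma inst_ok : [/\ forall j, j < im T -> ip T j < icen T,
   forall j, j < im T -> iq T j < icen T & forall j, j < im T -> ip T j <> iq T j].
Proof.
case: repT => ix [ixI ix_lt szT nthT].
have ixl v : ix v < #|vert G| by rewrite -szT.
have h j : j < im T -> exists v x, confl v x /\ nth (0, 0) (EL T) j = edge ix v x.
  by move=> lt; apply/(mem_EL ixI ix_lt szT nthT)/mem_nth.
split=> j /h[v [x [cx e]]]; rewrite /ip /iq e /icen ?szT.
- exact: codev_lt.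
- exact: codev_lt.
- exact: edge_neq cx.
Qed.

Lemma S_gt0 : 0 < #|Sg|. Proof. by apply/card_gt0P; exists s0. Qed.

Lemma kE : (ik T + size T = size T * #|Sg| + im T).
Proof. by rewrite /ik -{2}(prednK S_gt0) mulnS; lia. Qed.

Lemma instance_sat (R : realFieldType) k : ik T = k.+1 -> satG G ->
  exists cen : 'I_k.+1 -> 'I_(idim T) -> R,
    (kcost (@EA (icen T) (im T) (ip T) (iq T)) cen <= (3 * im T)%:R - k.+1%:R)%R.
Proof.
move=> ek sG; case: repT => ix [ixI ix_lt szT nthT].
have ixl v : ix v < #|vert G| by rewrite -szT.
have [cv [cvP cvs cvo]] := sat_cover ixI ixl sG; have [h1 h2 h3] := inst_ok.
apply: (subdivision_upper h1 h2 R (cv := cv)).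
- move=> j lt; have /(mem_EL ixI ix_lt szT nthT)[v [x [cx e]]] := mem_nth (0, 0) lt.
  by rewrite /ip /iq e; exact: cvP.
- move=> x lt cx; rewrite /icen szT in lt; have [v [y [cy e]]] := cvo x lt cx.
  have my : edge ix v y \in EL T by apply/(mem_EL ixI ix_lt szT nthT); exists v, y.
  by exists (index (edge ix v y) (EL T)); rewrite ?index_mem // /ip nth_index.
by rewrite -ek /icen szT; have := kE; rewrite szT; lia.
Qed.

(** The cover exceeds its ideal size by at least [size T / (2 * q)], and the cost by a third of
    that. *)
Lemma instance_gap (R : realFieldType) (F : realFieldType) (q k : nat) : 0 < q -> ik T = k.+1 ->
  gapG G (q%:R^-1 : F)%R -> forall cen : 'I_k.+1 -> 'I_(idim T) -> R,
  ((3 * im T)%:R - k.+1%:R + (size T)%:R / (6 * q%:R) <=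
     kcost (@EA (icen T) (im T) (ip T) (iq T)) cen)%R.
Proof.
move=> q0 ek gG cen; case: (repT) => ix [ixI ix_lt szT nthT].
have ixl v : ix v < #|vert G| by rewrite -szT.
have [h1 h2 h3] := inst_ok; have [cv [cvP le]] := subdivision_lower h1 h2 h3 cen.
apply: le_trans le; rewrite lerD2l.
have cvP' v x : confl v x -> cv (edge ix v x).1 || cv (edge ix v x).2.
  move=> cx; have my : edge ix v x \in EL T by apply/(mem_EL ixI ix_lt szT nthT); exists v, x.
  by have := cvP (index (edge ix v x) (EL T)); rewrite /ip /iq nth_index // index_mem; apply.
have := cover_gap ixI ixl cvP' s0 V0 L0 q0 gG; rewrite -szT -/(icen T) -ek => cg.
have kk := kE; rewrite -/(icen T) in kk.
have qp : (0 < q%:R :> R)%R by rewrite ltr0n.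
rewrite ler_pdivrMr ?mulr_gt0 // mulrAC ler_pdivlMr //.
set X := \sum_(x < icen T) cv x in cg *.
have key : (size T + 2 * q * ik T <= 2 * q * (X + im T))%N.
  move: cg kk; move: (icen T) (ik T) (im T) (size T) X => a b c d e cg kk.
  have e1 : 2 * q * (b + d) = 2 * q * (a + c) by rewrite kk.
  by rewrite !mulnDr in cg e1 *; lia.
move: key; rewrite -(ler_nat R) !natrD !natrM !natrD; move: (X%:R : R)%R (q%:R : R)%R => x y.
lra.
Qed.

End Instance.

End GraphInstances.
Import GraphInstances.

(** * The reduction as a polynomial-time program *)

Module InstancePipeline.

Import Order.TTheory GRing.Theory Num.Theory.

Definition stepTab (Sg Lb : finType) (s0 : Sg) (t : nat) (T : table (cdat Sg Lb)) : table (cdat Sg1 Lb1) :=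
  stepT (dflt Sg Lb) (@omT Sg Lb t) (@kpT Sg Lb s0 t) (@WT Sg Lb t) (@DlT Sg Lb t) T.

Lemma rep_stepTab (Sg Lb : finType) (s0 : Sg) t (G : cgraph Sg Lb) T :
  rep (dflt Sg Lb) (@nb _ _ G) (@dat _ _ G) T ->
  rep (dflt Sg1 Lb1) (@nb _ _ (stepG s0 t G)) (@dat _ _ (stepG s0 t G)) (stepTab s0 t T).
Proof.
by move=> h; apply: (rep_stepT (dflt Sg1 Lb1) _ _ h) => [v k l|v k]; [exact: step_nbE | exact: step_datE].
Qed.

Lemma esize_rep (V Lb D : finType) (d0 : D) (nb : V -> Lb -> V) dat T : rep d0 nb dat T ->
  esize T <= size T * (2 * #|D| + #|Lb| * (2 * size T + 1) + 4) + 1.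
Proof.
case=> ix [ixI ix_lt szT nthT].
have onto i : i < size T -> exists v, ix v = i.
  move=> lt; pose h v : 'I_(size T) := Ordinal (ix_lt v).
  have hI : injective h by move=> v w /(congr1 val) /= /ixI.
  have [g gK hK] : bijective h by apply: inj_card_bij; rewrite ?card_ord ?szT.
  by exists (g (Ordinal lt)); have := congr1 val (hK (Ordinal lt)).
have le i : i < size T -> forall x0, esize (nth x0 T i) <= 2 * #|D| + #|Lb| * (2 * size T + 1) + 3.
  move=> lt x0; rewrite (set_nth_default (d0, [::])) //; have [v <-] := onto i lt.
  rewrite nthT esize_pair.
  have h1 : esize (dat v) <= 2 * #|D| + 1.
    have := esize_nat (enum_rank (dat v)); have := ltn_ord (enum_rank (dat v)).
    have fin (r n a : nat) : r < n -> a = 2 * r + 1 -> a <= 2 * n + 1 by lia.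
    exact: fin.
  have h2 : esize [seq ix (nb v l) | l <- enum Lb] <= #|Lb| * (2 * size T + 1) + 1.
    have h := @esize_seq_le nat Enc_nat [seq ix (nb v l) | l <- enum Lb] (2 * size T).
    rewrite size_map -cardE in h; rewrite [2 * size T + 1]addn1; apply: h => j ltj y0; rewrite cardE in ltj.
    have [l0 _] : exists l : Lb, true by case: (enum Lb) ltj => // l; exists l.
    by rewrite (nth_map l0) // esize_nat; have := ix_lt (nb v (nth l0 (enum Lb) j)); lia.
  lia.
apply: leq_trans (esize_seq_le le) _; rewrite leq_add2r leq_mul2l; apply/orP; right; lia.
Qed.

Lemma enc_seqE (T : Type) (e : T -> word) s : enc_seq e s = flatten [seq true :: e x | x <- s] ++ [:: false].
Proof. by elim: s => //= x s ->; rewrite -catA. Qed.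

Section Programs.

Context {X : Type} {eX : Enc X}.

Lemma pt_horner (s : seq nat) (n : X -> nat) : pt n -> pt (fun x => horner_rec s (n x)).
Proof.
move=> ptn; elim: s => [|a s IHs] /=; first exact: pt_cst.
by apply: pt_add; [exact: pt_mul | exact: pt_cst].
Qed.

Lemma pt_nseq (n : X -> nat) : pt n -> pt (fun x => enc_unary (n x)).
Proof.
move=> ptn; apply: pt_ext (pt_cat (pt_map (f := fun _ _ => true) (pt_cst true) (pt_iota ptn)) (pt_cst [:: false])) _ => x.
rewrite /enc_unary -cats1; congr (_ ++ _); elim: (n x) 0 => //= m IHm i; by rewrite IHm.
Qed.

(** Doubling stops as soon as [n] is reached, so the power of two, which is stored in unary, stays
    linear in [n]. *)
Definition lgst (n : nat) (p : nat * nat) : nat * nat := if n <= p.2 then p else (p.1.+1, p.2 + p.2).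
Definition lgf (n : nat) : nat * nat := iter n (lgst n) (0, 1).

Lemma lgf_inv n i : let r := iter i (lgst n) (0, 1) in
  [/\ r.2 = 2 ^ r.1, r.2 <= 2 * n + 1, r.1 <= i & (n <= r.2) || (i < r.2)].
Proof.
elim: i => [|i] /=; first by rewrite orbT; split=> //; lia.
case: (iter i _ _) => a b /= [e1 e2 e3 e4]; rewrite /lgst /=.
case: (leqP n b) => h /=; first by split=> //; rewrite ?h //; lia.
rewrite leqNgt h /= in e4; split=> /=; [by rewrite expnS -e1; lia | lia | lia | apply/orP; right; lia].
Qed.

Lemma lgfE n : (lgf n).2 = 2 ^ (lgf n).1 /\ n <= (lgf n).2.
Proof. by have [e1 _ _ /orP[h|h]] := lgf_inv n n; split=> //; exact: ltnW. Qed.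

Lemma pt_lgf (n : X -> nat) : pt n -> pt (fun x => lgf (n x)).
Proof.
move=> ptn; have [e le_e] := pt_esize ptn.
apply: (pt_iter (N := fun m => 10 * (m + 2) ^ e + 10) (step := fun x => lgst (n x))) => //.
- have p1 : pt (fun p : X * (nat * nat) => n p.1) by apply: (pt_comp ptn); exact: pt_fst pt_id.
  have p2 : pt (fun p : X * (nat * nat) => p.2) by exact: pt_snd pt_id.
  have p21 := pt_fst p2; have p22 := pt_snd p2.
  by apply: pt_if; [exact: pt_leq | by [] | apply: pt_pair; [exact: pt_S | exact: pt_add]].
- exact: pt_cst.
- by pb.
move=> x i le_i; have [_ h2 h3 _] := lgf_inv (n x) i; move: h2 h3.
case: (iter i _ _) => a b /= h2 h3; rewrite esize_pair !esize_nat.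
have := le_e x; rewrite esize_nat; move: ((esize x + 2) ^ e) => E h; lia.
Qed.

(** Conversion by repeated increment. The word may have linear length with leading zeros, which is
    affordable as [n] itself is in unary. *)
Definition tobin (n : nat) : seq bool := iter n (addw [:: true]) [::].

Lemma val_tobin n : val2 (tobin n) = n.
Proof. by elim: n => // n IHn; rewrite /tobin iterS val_addw IHn. Qed.

Lemma size_tobin n : size (tobin n) <= 2 * n.
Proof. by elim: n => // n IHn; rewrite /tobin iterS size_addw -/(tobin n) /=; lia. Qed.

Lemma pt_tobin (n : X -> nat) : pt n -> pt (fun x => tobin (n x)).
Proof.
move=> ptn; have [e le_e] := pt_esize ptn.
apply: (pt_iter (N := fun m => 8 * (m + 2) ^ e + 1) (step := fun _ => addw [:: true])) => //.
- by apply: pt_addw; [exact: pt_cst | exact: pt_snd pt_id].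
- exact: pt_cst.
- by pb.
move=> x i le_i; apply: leq_trans (esize_word _) _; have h1 := size_tobin i; rewrite -/(tobin i).
have := le_e x; rewrite esize_nat; move: ((esize x + 2) ^ e) => E h; lia.
Qed.

End Programs.

Section Programs2.

Context {X : Type} {eX : Enc X}.

Lemma pt_splitp (f : X -> seq bool) : pt f -> pt (fun x => splitp (f x) : seq bool * seq bool).
Proof.
move=> ptf.
have ptr : pt (fun x => foldl sst (0, ([::], [::])) (f x)).
  apply: (pt_foldl_mu (mu := fun s : sstate => esize s) (c := 1) (N := fun=> 20) false (step := fun _ => sst)) => //.
  - have p1 : pt (fun p : X * (sstate * bool) => p.2.1.1) by exact: pt_fst (pt_fst (pt_snd pt_id)).
    have p2 : pt (fun p : X * (sstate * bool) => p.2.1.2) by exact: pt_snd (pt_fst (pt_snd pt_id)).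
    have p3 : pt (fun p : X * (sstate * bool) => p.2.2) by exact: pt_snd (pt_snd pt_id).
    have p21 := pt_fst p2; have p22 := pt_snd p2.
    apply: pt_ext (pt_if (pt_eq0 p1) (pt_pair (pt_if p3 (pt_cst 1) (pt_cst 2)) p2)
      (pt_if (pt_eqn p1 (pt_cst 1)) (pt_pair (pt_cst 0) (pt_pair (pt_cons p3 p21) p22))
         (pt_pair (pt_cst 2) (pt_pair p21 (pt_cons p3 p22))))) _.
    by case=> x [[st [a b]] c]; rewrite /sst /=; case: st => [|[|st]].
  - exact: pt_cst.
  - by pb.
  - by move=> b; rewrite mul1n leq_addr.
  move=> x [st [a b]] c _; pose proof (esize_bool c) as hc; rewrite /sst /=.
  by case: st => [|[|st]]; rewrite !esize_pair ?esize_cons ?esize_nat; case: (c) hc; lia.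
by apply: pt_pair; apply: pt_rev; [exact: pt_fst (pt_snd ptr) | exact: pt_snd (pt_snd ptr)].
Qed.

Lemma pt_parse (f : X -> seq bool) : pt f -> pt (fun x => FractionValues.parse (f x) : seq (seq zrat)).
Proof.
move=> ptf.
have ptr : pt (fun x => foldl pst pinit (f x)).
  apply: (pt_foldl_mu (mu := fun s : pstate => esize s) (c := 1) (N := fun=> 60) false (step := fun _ => pst)) => //.
  - pose Q := (X * (pstate * bool))%type.
    have ps : pt (fun p : Q => p.2.1) by exact: pt_fst (pt_snd pt_id).
    have b1 : pt (fun p : Q => p.2.2) by exact: pt_snd (pt_snd pt_id).
    have st1 := pt_fst ps; have r1 := pt_snd ps; have sg1 := pt_fst r1; have r2 := pt_snd r1.
    have cur1 := pt_fst r2; have r3 := pt_snd r2; have num1 := pt_fst r3; have r4 := pt_snd r3.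
    have rats1 := pt_fst r4; have ptl1 := pt_snd r4.
    have nil1 : pt (fun _ : Q => [::] : seq bool) by exact: pt_cst.
    have num0 : pt (fun _ : Q => (false, [::]) : bool * seq bool) by exact: pt_cst.
    have nil2 : pt (fun _ : Q => [::] : seq zrat) by exact: pt_cst.
    have c n : pt (fun _ : Q => n : nat) by exact: pt_cst.
    apply: pt_ext (pt_if (pt_eqn st1 (c 0)) (pt_pair (pt_if b1 (c 1) (c 8)) r1)
      (pt_if (pt_eqn st1 (c 1)) (pt_if b1 (pt_pair (c 2) r1)
          (pt_pair (c 0) (pt_pair sg1 (pt_pair cur1 (pt_pair num1 (pt_pair nil2 (pt_cons (pt_rev rats1) ptl1)))))))
      (pt_if (pt_eqn st1 (c 2)) (pt_pair (c 3) (pt_pair b1 r2))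
      (pt_if (pt_eqn st1 (c 3)) (pt_if b1 (pt_pair (c 4) r1)
          (pt_pair (c 5) (pt_pair sg1 (pt_pair nil1 (pt_pair (pt_pair sg1 (pt_rev cur1)) r4)))))
      (pt_if (pt_eqn st1 (c 4)) (pt_pair (c 3) (pt_pair sg1 (pt_pair (pt_cons b1 cur1) r3)))
      (pt_if (pt_eqn st1 (c 5)) (pt_pair (c 6) (pt_pair b1 r2))
      (pt_if (pt_eqn st1 (c 6)) (pt_if b1 (pt_pair (c 7) r1)
          (pt_pair (c 1) (pt_pair sg1 (pt_pair nil1 (pt_pair num0 (pt_pair (pt_cons (pt_pair num1 (pt_pair sg1 (pt_rev cur1))) rats1) ptl1))))))
      (pt_if (pt_eqn st1 (c 7)) (pt_pair (c 6) (pt_pair sg1 (pt_pair (pt_cons b1 cur1) r3))) ps)))))))) _.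
    case=> x [[st [sg [cur [num [rats ptl]]]]] b]; rewrite /pst /=.
    by case: st => [|[|[|[|[|[|[|[|st]]]]]]]]; case: b.
  - exact: pt_cst.
  - by pb.
  - by move=> b; rewrite mul1n leq_addr.
  move=> x [st [sg [cur [num [rats ptl]]]]] b _; rewrite /pst.
  have n0 : esize ((false, [::]) : bool * seq bool) = 3 by []. have n1 : esize (@nil bool) = 1 by []. have n2 : esize (@nil zrat) = 1 by [].
  have b1 : esize true = 3 by []. have b0 : esize false = 1 by [].
  have g1 : 0 < esize num by exact: esize_gt0.
  case: st => [|[|[|[|[|[|[|[|st]]]]]]]]; case: b; rewrite ?leq_addr // !esize_pair ?esize_cons ?esize_pair ?esize_rev ?esize_nat ?n0 ?n1 ?n2 ?b1 ?b0.
  all: try by pose proof (esize_gt0 sg); pose proof (esize_bool sg); pose proof (esize_gt0 cur); lia.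
exact: pt_rev (pt_snd (pt_snd (pt_snd (pt_snd (pt_snd ptr))))).
Qed.

Lemma pt_pairs (c m : X -> nat) (E : X -> seq (nat * nat)) : pt c -> pt m -> pt E ->
  pt (fun x => pairs (c x) (m x) (fun j => (nth (0, 0) (E x) j).1) (fun j => (nth (0, 0) (E x) j).2)).
Proof.
move=> ptc ptm ptE; apply: pt_flatten.
apply: (pt_map (f := fun x j => [seq sub_ends (c x) (fun j => (nth (0, 0) (E x) j).1) (fun j => (nth (0, 0) (E x) j).2) j i | i <- iota 0 3])); last exact: pt_iota.
have p1 : pt (fun p : X * nat => p.1) by exact: pt_fst pt_id.
have p2 : pt (fun p : X * nat => p.2) by exact: pt_snd pt_id.
have pc : pt (fun p : X * nat => c p.1 + 2 * p.2).
  by apply: pt_add; [exact: (pt_comp ptc p1) | apply: pt_mul => //; exact: pt_cst].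
have pn : pt (fun p : X * nat => nth (0, 0) (E p.1) p.2) by apply: pt_nth => //; exact: (pt_comp ptE p1).
have pcS := pt_S pc.
rewrite /=; apply: pt_cons; first by apply: pt_pair => //; exact: pt_fst.
apply: pt_cons; first exact: pt_pair.
by apply: pt_cons; [apply: pt_pair => //; exact: pt_snd | exact: pt_cst].
Qed.

Lemma pt_inst_word (d k1 : X -> nat) (ps : X -> seq (nat * nat)) : pt d -> pt k1 -> pt ps ->
  pt (fun x => inst_word (d x) (k1 x) (ps x) : seq bool).
Proof.
move=> ptd ptk ptp; apply: pt_cat; first exact: pt_nseq.
apply: pt_cat; first exact: pt_nseq.
pose g d0 (p : nat * nat) := flatten [seq true :: enc_rat_bit (pind p j) | j <- iota 0 d0] ++ [:: false].
have h : pt (fun x => flatten [seq true :: g (d x) p | p <- ps x] ++ [:: false]).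
  apply: pt_cat; last exact: pt_cst.
  apply: pt_flatten; apply: (pt_map (f := fun x p => true :: g (d x) p)) => //.
  apply: pt_cons; first exact: pt_cst.
  apply: pt_cat; last exact: pt_cst.
  have q1 : pt (fun q : X * (nat * nat) => d q.1) by apply: (pt_comp ptd); exact: pt_fst pt_id.
  apply: pt_flatten; apply: (pt_map (f := fun (q : X * (nat * nat)) j => true :: enc_rat_bit (pind q.2 j))); last exact: pt_iota.
  apply: pt_cons; first exact: pt_cst.
  have qp : pt (fun q : (X * (nat * nat)) * nat => q.1.2) by exact: pt_snd (pt_fst pt_id).
  have qj : pt (fun q : (X * (nat * nat)) * nat => q.2) by exact: pt_snd pt_id.
  apply: pt_if; [|exact: pt_cst|exact: pt_cst].
  by apply: pt_or; apply: pt_eqn => //; [exact: pt_fst | exact: pt_snd].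
apply: pt_ext h _ => x; rewrite enc_seqE; congr (flatten _ ++ _); apply: eq_map => p.
by rewrite /g enc_seqE -map_comp.
Qed.

End Programs2.

Section Pipeline.

Variables (M : turing_machine) (sg0 : Sg0 M) (t0 t1 c0 : nat).

(** The tableau graph has [2 ^ dim2 (k b)] vertices, so [dim2 (k b)] doublings, plus a constant
    number for the other losses, bring its initial gap up to a constant. *)
Definition pipe (e : word) (P b : nat) : table (cdat Sg1 Lb1) :=
  iter (dim2 (k b) + c0) (stepTab s1 t1) (stepTab sg0 t0 (table0 M e P b)).

Definition pipeG (e : word) (P b i : nat) : cgraph Sg1 Lb1 :=
  iter i (stepG s1 t1) (stepG sg0 t0 (G0 M e P b)).

Lemma rep_pipe e P b i :
  rep (dflt Sg1 Lb1) (@nb _ _ (pipeG e P b i)) (@dat _ _ (pipeG e P b i))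
    (iter i (stepTab s1 t1) (stepTab sg0 t0 (table0 M e P b))).
Proof.
elim: i => [|i IHi]; first exact: rep_stepTab (rep_table0 M e P b).
exact: (rep_stepTab s1 t1 IHi).
Qed.

Lemma card_pipe e P b i : #|vert (pipeG e P b i)| =
  N b * #|KK (Sg0 M) Lb0 t0| * #|KK Sg1 Lb1 t1| ^ i.
Proof.
have cs (Sg Lb : finType) (s : Sg) t (G : cgraph Sg Lb) : #|vert (stepG s t G)| = #|vert G| * #|KK Sg Lb t|.
  exact: card_prod.
elim: i => [|i IHi]; first by rewrite [pipeG _ _ _ 0]/(stepG sg0 t0 (G0 M e P b)) cs expn0 muln1; congr (_ * _); exact: card_cubeE.
by rewrite [pipeG _ _ _ _]/(stepG s1 t1 (pipeG e P b i)) cs IHi expnS; lia.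
Qed.

Context {X : Type} {eX : Enc X}.
Variables (ee : X -> seq bool) (PP bb : X -> nat).
Hypothesis (pte : pt ee) (ptP : pt PP) (ptb : pt bb) (ptB : pt (fun x => B (bb x))).

Lemma pt_stepTab {Z : Type} {eZ : Enc Z} (Sg Lb : finType) (s : Sg) t (f : Z -> table (cdat Sg Lb)) :
  pt f -> pt (fun z => stepTab s t (f z)).
Proof. exact: pt_stepT. Qed.

Lemma pt_pipe : pt (fun x => pipe (ee x) (PP x) (bb x)).
Proof.
have [e le_e] := pt_esize (ptN ptB).
pose K0 := #|KK (Sg0 M) Lb0 t0|; pose K1 := #|KK Sg1 Lb1 t1|.
pose SS n := (n + 2) ^ e * K0 * (2 ^ c0 * (n + 2) ^ e) ^ K1.
apply: (pt_iter (N := fun n => SS n * (2 * #|cdat Sg1 Lb1| + #|Lb1| * (2 * SS n + 1) + 4) + 1) (step := fun _ => stepTab s1 t1)).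
- by apply: pt_stepTab; exact: pt_snd pt_id.
- by apply: pt_stepTab; exact: pt_table0.
- by apply: pt_add (pt_cst _); apply: pt_add; do 2!apply: pt_S.
- by rewrite /SS; pb.
move=> x i le_i; have rp := rep_pipe (ee x) (PP x) (bb x) i.
apply: leq_trans (esize_rep rp) _.
have sz : size (iter i (stepTab s1 t1) (stepTab sg0 t0 (table0 M (ee x) (PP x) (bb x)))) <= SS (esize x).
  case: rp => ix [_ _ -> _]; rewrite card_pipe.
  have NE : N (bb x) <= (esize x + 2) ^ e by have := le_e x; rewrite esize_nat; lia.
  apply: leq_mul; first exact: leq_mul.
  (* A round multiplies the number of rows by [K1 <= 2 ^ K1], and [2 ^ i] is at most a constant
     times the size of the tableau, so the growth is polynomial. *)
  apply: leq_trans (_ : (2 ^ i) ^ K1 <= _).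
    by rewrite -expnM mulnC expnM; apply: leq_expl; exact: ltnW (ltn_expl _ _).
  apply: leq_expl; apply: leq_trans (_ : 2 ^ (dim2 (k (bb x)) + c0) <= _); first by rewrite leq_exp2l.
  by rewrite expnD mulnC leq_mul2l NE orbT.
rewrite leq_add2r; apply: leq_mul => //; rewrite leq_add2r leq_add2l leq_mul2l; apply/orP; right; lia.
Qed.

End Pipeline.

End InstancePipeline.
Import InstancePipeline.

Import Order.TTheory GRing.Theory Num.Theory.
Local Open Scope ring_scope.

(** * The reduction *)

Lemma real_cost (R : realType) d k (S : seq 'rV[rat]_d) (c : 'I_k.+1 -> 'rV[rat]_d) :
  kmeans_cost [seq real_point R x | x <- S] (fun i => real_point R (c i)) =
  ratr (kmeans_cost S c).
Proof.
have sdE (x y : 'rV[rat]_d) : sqdist (real_point R x) (real_point R y) = ratr (sqdist x y).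
  by rewrite /sqdist rmorph_sum; apply: eq_bigr => i _; rewrite !mxE /= rmorphXn rmorphB.
have minE : {morph (ratr : rat -> R) : x y / Order.min x y >-> Order.min x y}.
  by move=> x y; rewrite !minElt ltr_rat; case: ifP.
rewrite /kmeans_cost big_map rmorph_sum; apply: eq_bigr => x _.
rewrite /= (big_morph (ratr : rat -> R) minE (erefl _)) -sdE.
by apply: eq_bigr => i _; rewrite sdE.
Qed.

Lemma horner_rec_mono (s : seq nat) (a b : nat) :
  (a <= b)%N -> (horner_rec s a <= horner_rec s b)%N.
Proof.
move=> ab; elim: s => //= c s IHs.
exact: leq_add (leq_mul IHs ab) (leqnn c).
Qed.

Lemma iter_halted M (c : config M) n : halted c -> iter n (@step M) c = c.
Proof.
move=> h; elim: n => //= n ->.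
by case: c h => q [[l a] r] /= ->.
Qed.

Lemma run_output (M : turing_machine) (qq : {poly nat}) (f : word -> word) (n : nat) (w : word) :
  (forall w : word, let c := iter qq.[size w] (@step M) (initial M w) in
     halted c /\ output c = f w) ->
  (qq.[size w] <= n)%N -> output (cs M w n) = f w.
Proof.
move=> h le; have [hc <-] := h w; rewrite /cs -(subnK le) iterD iter_halted //.
Qed.

Lemma pt_enc_word : pt (fun x : seq bool => enc_word x : seq bool).
Proof.
apply: pt_ext (pt_cat (pt_flatten (pt_map (f := fun (_ : seq bool) (b : bool) => [:: true; b]) _ pt_id)) (pt_cst [:: false])) _.
  by apply: pt_cons; [exact: pt_cst | apply: pt_cons; [exact: pt_snd pt_id | exact: pt_cst]].
by move=> x; rewrite /enc_word enc_seqE.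
Qed.

Lemma card_Sg1 : (1 < #|Sg1|)%N.
Proof.
pose j0 : J := (true, true).
rewrite cardT; have : uniq [:: s1; [ffun=> true] : Sg1].
  by rewrite /= inE andbT; apply/eqP => /ffunP /(_ j0); rewrite !ffunE.
by move=> u; apply: (@uniq_leq_size _ [:: s1; [ffun=> true] : Sg1]) => // y; rewrite mem_enum.
Qed.

Section Machine.

Variables (L V : word -> Prop) (p : {poly nat}) (fV : word -> word).
Variables (M : turing_machine) (qq : {poly nat}).
Hypothesis MP : forall w : word, let c := iter qq.[size w] (@step M) (initial M w) in
  halted c /\ output c = fV w.
Hypothesis VP : forall w, V w <-> fV w = [:: true].
Hypothesis LP : forall x, L x <->
  exists2 y : word, (size y <= p.[size x])%N & V (enc_pair x y).

Definition PP (x : seq bool) : nat := horner_rec p (size x).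
(** Room for the encoded input with a longest witness, and time for the verifier on it. *)
Definition Bd (x : seq bool) : nat :=
  (size (enc_word x) + PP x + horner_rec qq (size (enc_word x) + PP x) + 1)%N.
Definition bb (x : seq bool) : nat := (lgf (Bd x)).1.

Lemma B_bb x : (lgf (Bd x)).2 = B (bb x).
Proof. by case: (lgfE (Bd x)). Qed.

Lemma L_sat x : satG (G0 M (enc_word x) (PP x) (bb x)) <-> L x.
Proof.
have leB : (Bd x <= B (bb x))%N by rewrite -B_bb; case: (lgfE (Bd x)).
have room : (size (enc_word x) + PP x <= B (bb x))%N.
  have fin (a b c : nat) : (a + b + 1 <= c -> a <= c)%N by lia.
  exact: fin leB.
have e0 : (0 < size (enc_word x))%N by case: (x).
have st := sat_tableau M room e0.
have out (y : word) : (size y <= PP x)%N ->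
    output (cs M (enc_word x ++ y) (B (bb x)).-1) = fV (enc_pair x y).
  move=> sy; apply: (run_output MP).
  have h := horner_rec_mono qq (leq_add (leqnn (size (enc_word x))) sy).
  have fin (a b c d : nat) : (a <= c -> b + c + 1 <= d -> a <= d.-1)%N by lia.
  rewrite -size_cat in h; exact: fin h leB.
split=> [/st[y sy oy]|/LP[y sy /VP oy]]; last by apply/st; exists y => //; rewrite out.
by apply/LP; exists y => //; apply/VP; rewrite -out.
Qed.

Lemma pt_PP : pt PP. Proof. by apply: pt_horner; exact: pt_size pt_id. Qed.

Lemma pt_lgB : pt (fun x => lgf (Bd x)).
Proof.
have s : pt (fun x => size (enc_word x) + PP x)%N.
  by apply: pt_add pt_PP; exact: pt_size pt_enc_word.
by apply: pt_lgf; apply: pt_add (pt_cst 1%N); apply: pt_add s (pt_horner _ s).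
Qed.

Variables (R : realType) (t0 t1 C q : nat).
Hypothesis q0 : (0 < q)%N.

Definition sg0 : Sg0 M := (blank M, (blank M, blank M)).

Hypothesis amp : forall (G : cgraph (Sg0 M) Lb0) (m : nat), poincare (@nb _ _ G) (96 : R) ->
  (0 < #|vert G|)%N -> (C * (#|vert G| * #|Lb0|) <= 2 ^ m)%N ->
  let H := iter m (stepG s1 t1) (stepG sg0 t0 G) in
  [/\ satG G -> satG H, ~ satG G -> gapG H (q%:R^-1 : R), loopless H & (0 < #|vert H|)%N].

Definition TT (x : seq bool) : table (cdat Sg1 Lb1) :=
  pipe sg0 t0 t1 (C * #|Lb0|) (enc_word x) (PP x) (bb x).
Definition GG (x : seq bool) : cgraph Sg1 Lb1 :=
  pipeG sg0 t0 t1 (enc_word x) (PP x) (bb x) (dim2 (k (bb x)) + C * #|Lb0|).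

Lemma TT_ok x : [/\ rep (dflt Sg1 Lb1) (@nb _ _ (GG x)) (@dat _ _ (GG x)) (TT x),
  loopless (GG x), (0 < #|vert (GG x)|)%N, L x -> satG (GG x) &
  ~ L x -> gapG (GG x) (q%:R^-1 : R)].
Proof.
have cE : #|vert (G0 M (enc_word x) (PP x) (bb x))| = (2 ^ dim2 (k (bb x)))%N.
  exact: card_cubeE.
have [] := amp (G := G0 M (enc_word x) (PP x) (bb x)) (m := dim2 (k (bb x)) + C * #|Lb0|).
- exact: (@G0_poincare _ _ _ _ R).
- by rewrite cE expn_gt0.
- by rewrite cE expnD mulnCA leq_mul2l ltnW ?orbT // ltn_expl.
move=> hs hg hl hv; split=> //; first exact: rep_pipe.
- by move/L_sat.
by move=> nL; apply: hg => /L_sat.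
Qed.

Lemma pt_TT : pt TT.
Proof.
apply: pt_pipe; [exact: pt_enc_word | exact: pt_PP | exact: pt_fst pt_lgB |].
exact: pt_ext (pt_snd pt_lgB) B_bb.
Qed.

Definition reduction (x : word) : word := inst_word (idim (TT x)) (ik (TT x)) (ips (TT x)).

(** The lower bound of [instance_gap], over the common denominator [6 * q]. *)
Definition threshold (T : table (cdat Sg1 Lb1)) : tfrac :=
  (tobin (6 * q * (3 * im T) + size T), (tobin (6 * q * ik T), tobin (6 * q))).

Definition decision (w : word) : word :=
  [:: ~~ fle (threshold (TT (splitp w).1))
        (fcost (idim (TT (splitp w).1)) (ips (TT (splitp w).1)) (FractionValues.parse (splitp w).2))].

Lemma pt_parts {X : Type} {eX : Enc X} (T : X -> table (cdat Sg1 Lb1)) : pt T ->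
  [/\ pt (fun x => im (T x)), pt (fun x => idim (T x)), pt (fun x => ik (T x)) &
      pt (fun x => ips (T x))].
Proof.
move=> ptT; have pE := pt_EL ptT; have pm := pt_size pE; have ps := pt_size ptT.
have pc : pt (fun x => icen (T x)) by exact: pt_mul ps (pt_cst _).
split=> //.
- exact: pt_add pc (pt_mul (pt_cst 2%N) pm).
- exact: pt_add (pt_mul ps (pt_cst _)) pm.
exact: pt_pairs.
Qed.

Lemma poly_reduction : poly_time reduction.
Proof.
apply: pt_poly_time; have [_ h1 h2 h3] := pt_parts pt_TT.
exact: pt_inst_word.
Qed.

Lemma poly_decision : poly_time decision.
Proof.
apply: pt_poly_time; have sp : pt (fun w : seq bool => splitp w : seq bool * seq bool) by exact: pt_splitp pt_id.
have pT : pt (fun w : seq bool => TT (splitp w).1) by exact: pt_comp pt_TT (pt_fst sp).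
have [h0 h1 h2 h3] := pt_parts pT.
apply: pt_cons (pt_cst [::]); apply: pt_neg; apply: pt_fle; last first.
  by apply: pt_fcost => //; apply: pt_parse; exact: pt_snd sp.
apply: pt_pair.
  apply: pt_tobin; apply: pt_add (pt_size pT).
  exact: pt_mul (pt_cst _) (pt_mul (pt_cst 3%N) h0).
by apply: pt_pair; apply: pt_tobin; [exact: pt_mul (pt_cst _) h2 | exact: pt_cst].
Qed.

Lemma ik_TT x : exists j, ik (TT x) = j.+1.
Proof.
have [rp _ V0 _ _] := TT_ok x; exists (ik (TT x)).-1; rewrite prednK //.
rewrite /ik (size_rep rp) addn_gt0 muln_gt0 V0 /= -subn1 subn_gt0.
by rewrite card_Sg1.
Qed.

Lemma valid_reduction (alpha : R) x : valid_input (kmeans_approximation alpha) (reduction x).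
Proof.
have [rp lG V0 _ _] := TT_ok x; have [j ej] := ik_TT x.
have [h1 h2 h3] := inst_ok rp lG.
exists (idim (TT x)), j, (pts (icen (TT x)) (im (TT x)) (ip (TT x)) (iq (TT x))).
by split; [exact: pts_uniq | rewrite /reduction -inst_wordE ej].
Qed.

Lemma threshold_val T : fpos (threshold T) /\
  fval (threshold T) = (3 * im T)%:R - (ik T)%:R + (size T)%:R / (6 * q%:R).
Proof.
rewrite /fpos /fval /= !val_tobin; split; first by rewrite muln_gt0.
have qn : q%:R != 0 :> rat by rewrite pnatr_eq0 -lt0n.
rewrite natrD !natrM; move: qn; move: (q%:R : rat) ((ik T)%:R : rat) ((im T)%:R : rat) ((size T)%:R : rat) => a b c d an.
by field.
Qed.

Notation E := #|ctype Sg1 Lb1|.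

(** The origin of [eps]. There are at most [EE] edges per row, so the ideal cost is at most
    [3 * n * EE]; the approximation may add [a] times that, and [a * (18 * Q * EE) < 1] keeps it
    below the excess [n / (6 * Q)]. *)
Lemma gap_arith (a n m k1 X Q EE : R) : 0 <= a -> a < (18 * Q * EE + 1)^-1 -> 0 < Q -> 0 <= EE ->
  0 < n -> m <= n * EE -> 0 <= k1 -> X <= (1 + a) * (3 * m - k1) -> X < 3 * m - k1 + n / (6 * Q).
Proof.
move=> a0 al Q0 E0 n0 mn k0 lX.
have D0 : 0 < 18 * Q * EE + 1 by rewrite ltr_wpDl // !mulr_ge0 // ltW.
have h1 : a * (18 * Q * EE + 1) < 1 by rewrite -ltr_pdivlMr // div1r.
have h2 : a * (3 * m - k1) <= a * (3 * (n * EE)) by apply: ler_wpM2l => //; lra.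
have h3 : a * (3 * (n * EE)) < n / (6 * Q).
  rewrite ltr_pdivlMr ?mulr_gt0 //.
  have h4 : n * (a * (18 * Q * EE)) < n * 1 by rewrite ltr_pM2l //; lra.
  by rewrite mulr1 in h4; apply: le_lt_trans h4; rewrite le_eqVlt; apply/orP; left; apply/eqP; ring.
lra.
Qed.

(** On a yes instance the approximate solution stays strictly below the threshold by [gap_arith]; on
    a no instance every choice of centers, optimal or not, costs at least the threshold. *)
Lemma gap_decision (Lx : Prop) (G : cgraph Sg1 Lb1) (T : table (cdat Sg1 Lb1)) (alpha : R)
    (d k : nat) (S : seq 'rV[rat]_d) (c : 'I_k.+1 -> 'rV[rat]_d) :
  rep (dflt Sg1 Lb1) (@nb _ _ G) (@dat _ _ G) T -> loopless G -> (0 < #|vert G|)%N ->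
  (Lx -> satG G) -> (~ Lx -> gapG G (q%:R^-1 : R)) ->
  1 <= alpha -> alpha < 1 + (18 * q%:R * E%:R + 1)^-1 ->
  ik T = k.+1 -> existT (fun n => seq 'rV[rat]_n) (idim T)
    [seq prow (idim T) y | y <- ips T] = existT _ d S ->
  (forall c' : 'I_k.+1 -> 'rV[R]_d,
     kmeans_cost [seq real_point R y | y <- S] (fun i => real_point R (c i)) <=
     alpha * kmeans_cost [seq real_point R y | y <- S] c') ->
  (Lx <-> ~~ fle (threshold T) (fcost (idim T) (ips T) (FractionValues.parse (enc_centers c)))).
Proof.
move=> rp lG V0 sat gap a1 a2 ek eS app.
(* The dimension is part of the equation [eS], so the claim is generalized over dependent pairs
   before rewriting. *)
pose Q (t : {n : nat & seq 'rV[rat]_n}) := forall c : 'I_k.+1 -> 'rV[rat]_(projT1 t),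
  (forall c' : 'I_k.+1 -> 'rV[R]_(projT1 t),
     kmeans_cost [seq real_point R y | y <- projT2 t] (fun i => real_point R (c i)) <=
     alpha * kmeans_cost [seq real_point R y | y <- projT2 t] c') ->
  (Lx <-> ~~ fle (threshold T) (fcost (idim T) (ips T) (FractionValues.parse (enc_centers c)))).
suff QS : Q (existT _ d S) by exact: (QS c app).
rewrite -eS /Q /= {d S c app eS Q} => c app.
have szT := size_rep rp.
have [fp fv] := fcost_centers (ips T) c; have [tp tv] := threshold_val T.
have cE (cen : 'I_k.+1 -> 'rV[R]_(idim T)) :
    kmeans_cost [seq real_point R y | y <- [seq prow (idim T) y | y <- ips T]] cen =
    kcost (@EA (icen T) (im T) (ip T) (iq T)) (fun i n => cen i 0 n) by exact: pts_cost.
have fE : fle (threshold T) (fcost (idim T) (ips T) (FractionValues.parse (enc_centers c))) =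
    ((3 * im T)%:R - k.+1%:R + (size T)%:R / (6 * q%:R) <=
     kmeans_cost [seq real_point R y | y <- [seq prow (idim T) y | y <- ips T]] (fun i => real_point R (c i))).
  rewrite fleE // fv tv ek real_cost -(ler_rat R) rmorphD rmorphB fmorph_div rmorphM /= !ratr_nat.
  by [].
have n0 : 0 < (size T)%:R :> R by rewrite ltr0n szT.
rewrite fE; split=> [Lx1|].
  rewrite -ltNge.
  have [cen le] := instance_sat s1 rp lG V0 Lb1_gt0 R ek (sat Lx1).
  have lec := app (fun i => \row_n cen i n); rewrite [X in _ <= _ * X]cE in lec.
  have ce : (fun i n => (\row_j cen i j) 0 n) = cen.
    by apply/funext => i; apply/funext => n; rewrite mxE.
  rewrite ce in lec.
  have mE : (im T)%:R <= (size T)%:R * E%:R :> R by rewrite -natrM ler_nat; exact: size_EL.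
  rewrite natrM; apply: (@gap_arith (alpha - 1) _ _ _ _ _ E%:R) => //.
  - by rewrite subr_ge0.
  - by rewrite ltrBlDl.
  - by rewrite ltr0n.
  rewrite addrC subrK -natrM; apply: le_trans lec _.
  by apply: ler_wpM2l => //; apply: le_trans a1.
rewrite cE => nle; apply: contrapT => nL.
apply: (negP nle); exact: (instance_gap s1 rp lG V0 Lb1_gt0 q0 ek (gap nL)).
Qed.

Lemma decision_correct (alpha : R) x z : 1 <= alpha -> alpha < 1 + (18 * q%:R * E%:R + 1)^-1 ->
  valid_output (kmeans_approximation alpha) (reduction x) z ->
  (L x <-> decision (enc_pair x z) = [:: true]).
Proof.
move=> a1 a2 [d [k [S [c [_ e zE app]]]]].
have [ek eS] : ik (TT x) = k.+1 /\ existT (fun n => seq 'rV[rat]_n) (idim (TT x))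
    [seq prow (idim (TT x)) y | y <- ips (TT x)] = existT _ d S.
  by apply: enc_instance_inj; rewrite -e inst_wordE.
have [rp lG V0 sat gap] := TT_ok x.
have core := gap_decision rp lG V0 sat gap a1 a2 ek eS app; rewrite -zE in core.
have -> : decision (enc_pair x z) =
    [:: ~~ fle (threshold (TT x)) (fcost (idim (TT x)) (ips (TT x)) (FractionValues.parse z))].
  by rewrite /decision splitpE.
by move: core; move: (fle _ _) => b core; split=> [/core->|[/core]].
Qed.

End Machine.

Theorem theorem1 (R : realType) :
  exists eps : R, 0 < eps /\
    forall alpha : R, 1 <= alpha -> alpha < 1 + eps ->
      NP_hard (kmeans_approximation alpha).
Proof.
have nat_above (x : R) : exists2 n : nat, (0 < n)%N & x <= n%:R.
  exists (Num.bound `|x|).+1 => //; apply: le_trans (ler_norm x) _.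
  apply: le_trans (ltW (archi_boundP (normr_ge0 x))) _.
  by rewrite ler_nat.
have [t1 [q [q0 amp]]] := amplification nat_above.
exists (18 * q%:R * #|ctype Sg1 Lb1|%:R + 1)^-1; split.
  by rewrite invr_gt0 ltr_wpDl // !mulr_ge0.
move=> alpha a1 a2 L [V [p [[fV [M [qq MP]] VP] LP]]].
have L0 : (0 < #|Lb0|)%N by apply/card_gt0P; exists (inr tt).
(* The verifier enters only here, after [eps] has been fixed. *)
have [t0 [C ampM]] := amp (Sg0 M) Lb0 (sg0 M) L0.
exists (reduction p M qq t0 t1 C), (fun w => decision p M qq t0 t1 C q w = [:: true]); split.
- exact: poly_reduction.
- by exists (decision p M qq t0 t1 C q); first exact: poly_decision.
move=> x; split; first exact: (valid_reduction MP VP LP ampM).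
by move=> z; exact: (decision_correct MP VP LP q0 ampM).
Qed.
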